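(* Let $\tau$ be a conjugation on a JB$^*$-triple $X$, and let $E= X^{\tau}=\{x\in X:\tau(x)=x\}$. Then for each weak$^*$-closed proper face $F$ of $\mathcal{B}_{E^*}$ there exists a unique compact tripotent $u\in E^{**}$ satisfying $F =\{u\}_{\prime,E^*}$. Furthermore, the mapping $$ u \mapsto \{u\}_{\prime,E^*}$$ is an order isomorphism from $\tilde{\mathcal U}_c (E^{**})$ onto $\mathcal{F}_{w^*}(\mathcal{B}_{E^*})$.
   Context: A JB$^*$-triple is a complex Banach space $X$ with a continuous triple product $\{\cdot,\cdot,\cdot\}:X^3\to X$, symmetric and linear in the outer variables and conjugate linear in the middle one, such that, with $L(a,b)x=\{a,b,x\}$: (a) $L(a,b)L(x,y)=L(x,y)L(a,b)+L(L(a,b)x,y)-L(x,L(b,a)y)$; (b) each $L(a,a)$ is a hermitian operator with non-negative spectrum; (c) $\|\{a,a,a\}\|=\|a\|^3$. A conjugation on $X$ is a conjugate linear isometry $\tau:X\to X$ of period 2; then $E=X^\tau$ is a real JB$^*$-triple (a norm-closed real subtriple of $X$). The bidual $X^{**}$ is a JB$^*$-triple whose product is separately weak$^*$-continuous and extends that of $X$. With $\tau^{\sharp}(\varphi)(x)=\overline{\varphi(\tau(x))}$ on $X^*$ and $\tau^{\sharp\sharp}$ defined similarly on $X^{**}$, one identifies $E^*=(X^* )^{\tau^\sharp}$ and $E^{**}=(X^{**})^{\tau^{\sharp\sharp}}$; thus $E^{**}$ is a weak$^*$-closed real subtriple of $X^{**}$. $\mathcal{B}_Z$ denotes the closed unit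 ball of a normed space $Z$. A tripotent is an element $e$ with $\{e,e,e\}=e$. Elements $a,b$ are orthogonal ($a\perp b$) if $\{a,a,b\}=0$ (equivalently $L(a,b)=0$). Tripotents are partially ordered by $u\le e$ iff $e-u$ is a tripotent orthogonal to $u$. For a norm-one $a\in E$, put $a^{[1]}=a$, $a^{[2n+1]}=\{a,a,a^{[2n-1]}\}$; the sequence $(a^{[2n-1]})_n$ converges weak$^*$ in $E^{**}$ to a tripotent $u(a)$, the support tripotent of $a$. A tripotent $u\in E^{**}$ is compact-$G_\delta$ if $u=u(a)$ for some norm-one $a\in E$; it is compact if $u=0$ or $u$ is the infimum of a decreasing net of compact-$G_\delta$ tripotents in $E^{**}$. $\tilde{\mathcal U}_c(E^{**})$ is the set of compact tripotents in $E^{**}$ with a largest element $\omega$ adjoined. For $u\in E^{**}$, $\{u\}_{\prime,E^*}=\{\varphi\in\mathcal{B}_{E^*}:u(\varphi)=1\}$. A face of a convex set $L$ is a convex subset $F$ such that $x,y\in L$, $0<t<1$, $tx+(1-t)y\in F$ imply $x,y\in F$; $\emptyset$ and $L$ count as faces, and a proper face is a nonempty face different from $L$. $\mathcal{F}_{w^*}(\mathcal{B}_{E^*})$ is the complete lattice of weak$^*$-closed faces of $\mathcal{B}_{E^*}$ ordered by inclusion. By convention the adjoined element $\omega$ is mapped to $\mathcal{B}_{E^*}$. *)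

(* Defs.v *)
From HB Require Import structures.
From mathcomp Require Import all_boot all_order all_algebra.
From mathcomp Require Import complex.
From mathcomp Require Import all_classical all_reals all_analysis.
Set Implicit Arguments.
Unset Strict Implicit.
Unset Printing Implicit Defensive.
Import Order.TTheory GRing.Theory Num.Theory.
Import numFieldNormedType.Exports.
Local Open Scope classical_set_scope.
Local Open Scope complex_scope.
Local Open Scope ring_scope.

Section Dual.
Context {R : realType} (V : normedModType R[i]).

Definition dual_pred : {pred V -> R[i]^o} :=
  fun f => `[< linear f /\ continuous f >].

Record dual := Dual { dual_fun :> V -> R[i]^o ; _ : dual_fun \in dual_pred }.

HB.instance Definition _ := [isSub for dual_fun].
HB.instance Definition _ := gen_eqMixin dual.
HB.instance Definition _ := gen_choiceMixin dual.

Lemma dual_linear (f : dual) : linear f.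
Proof. by case: f => f /= /asboolP[]. Qed.

Lemma dual_continuous (f : dual) : continuous f.
Proof. by case: f => f /= /asboolP[]. Qed.

HB.instance Definition _ (f : dual) :=
  GRing.isLinear.Build R[i] V R[i]^o *:%R (dual_fun f) (dual_linear f).

Lemma dual_submod_closed : submod_closed dual_pred.
Proof.
split.
  apply/asboolP; split; first by move=> a x y; rewrite /= scaler0 addr0.
  exact: cst_continuous.
move=> a f g /asboolP[lf cf] /asboolP[lg cg]; apply/asboolP; split.
  move=> b x y /=.
  have -> : forall z, (a *: f + g) z = a *: f z + g z by [].
  rewrite lf lg !scalerDr !scalerA [b * a]mulrC -!addrA; congr (_ + _).
  by rewrite addrCA.
move=> x; apply: (@cvgD _ _ _ (nbhs x) _ (a \*: f) g) => //; last exact: cg.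
apply: cvgZl_tmp; exact: cf.
Qed.

HB.instance Definition _ :=
  GRing.isSubmodClosed.Build _ _ dual_pred dual_submod_closed.
HB.instance Definition _ := [SubChoice_isSubLmodule of dual by <:].

Lemma dualP (f g : dual) : (forall x, f x = g x) -> f = g.
Proof. by move=> fg; apply: val_inj; apply/funext. Qed.

Lemma dualDE (f g : dual) x : (f + g) x = f x + g x.
Proof. by []. Qed.

Lemma dualZE a (f : dual) x : (a *: f) x = a *: f x.
Proof. by []. Qed.

(* The operator norm, as a real number. *)
Definition dual_norm (f : dual) : R :=
  sup [set complex.Re `|f x| | x in [set x : V | `|x| <= 1]].

Lemma ReK (z : R[i]) : 0 <= z -> (complex.Re z)%:C = z.
Proof. by case: z => a b; rewrite lecE /= => /andP[/eqP -> _]. Qed.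

Lemma Re_ge0 (z : R[i]) : 0 <= z -> 0 <= complex.Re z.
Proof. by case: z => a b; rewrite lecE /= => /andP[_]. Qed.

Lemma le_Re (z : R[i]) (M : R) : z <= M%:C -> complex.Re z <= M.
Proof. by case: z => a b; rewrite lecE /= => /andP[_]. Qed.

Lemma Re_le (z : R[i]) (M : R) : 0 <= z -> complex.Re z <= M -> z <= M%:C.
Proof. by case: z => a b; rewrite !lecE /= => /andP[/eqP -> _] ->; rewrite eqxx. Qed.

Lemma ReM (z : R[i]) (N : R) : 0 <= z -> (complex.Re z * N)%:C = z * N%:C.
Proof. by move=> z0; rewrite -{2}(ReK z0) -rmorphM. Qed.

Lemma dual_bounded (f : dual) :
  exists2 M : R, 0 <= M & forall x, `|f x| <= M%:C * `|x|.
Proof.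
have [_ /(_ (@dual_continuous f))] := @linear_bounded_continuous _ _ _ f.
move=> /linear_boundedP/pinfty_ex_gt0[M M0 fM]; exists (complex.Re M).
  exact/Re_ge0/ltW.
by move=> x; rewrite (ReK (ltW M0)); exact: fM.
Qed.

Lemma dual_norm_has_sup (f : dual) :
  has_sup [set complex.Re `|f x| | x in [set x : V | `|x| <= 1]].
Proof.
split; first by exists (complex.Re `|f 0|); exists 0 => //=; rewrite normr0.
have [M M0 fM] := dual_bounded f; exists M => _ [x x1 <-].
apply: le_Re; apply: (le_trans (fM x)).
by rewrite -[leRHS]mulr1 ler_wpM2l // lecR.
Qed.

Lemma dual_norm_ge0 (f : dual) : 0 <= dual_norm f.
Proof.
apply: (@le_trans _ _ (complex.Re `|f 0|)); first exact: Re_ge0.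
apply: (sup_upper_bound (dual_norm_has_sup f)).
by exists 0 => //; rewrite /= normr0.
Qed.

Lemma dual_norm_ub (f : dual) x : `|f x| <= (dual_norm f)%:C * `|x|.
Proof.
have [->|x0] := eqVneq x 0; first by rewrite linear0 !normr0 mulr0.
have nx0 : 0 < `|x| by rewrite normr_gt0.
rewrite -ler_pdivrMr // -[`|x| in leLHS]normr_id mulrC -normfV -normrZ.
rewrite -(linearZ_LR f).
apply: Re_le => //; apply: (sup_upper_bound (dual_norm_has_sup f)).
exists (`|x|^-1 *: x) => //=.
by rewrite normrZ normfV normr_id mulVf // gt_eqF.
Qed.

Lemma dual_norm_le (f : dual) (M : R) : 0 <= M ->
  (forall x, `|f x| <= M%:C * `|x|) -> dual_norm f <= M.
Proof.
move=> M0 fM; apply: ge_sup; first by case: (dual_norm_has_sup f).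
move=> _ [x x1 <-]; apply: le_Re; apply: (le_trans (fM x)).
by rewrite -[leRHS]mulr1 ler_wpM2l // lecR.
Qed.

Let normD (f g : dual) :
  (dual_norm (f + g))%:C <= (dual_norm f)%:C + (dual_norm g)%:C.
Proof.
rewrite -rmorphD lecR; apply: dual_norm_le.
  by rewrite addr_ge0 // dual_norm_ge0.
move=> x; rewrite dualDE rmorphD mulrDl.
by apply: (le_trans (ler_normD _ _)); rewrite lerD // dual_norm_ub.
Qed.

Let normZ_le a (f : dual) : (dual_norm (a *: f))%:C <= `|a| * (dual_norm f)%:C.
Proof.
rewrite -ReM // lecR; apply: dual_norm_le.
  by rewrite mulr_ge0 ?dual_norm_ge0 // Re_ge0.
move=> x; rewrite dualZE normrZ ReM // -mulrA.
by rewrite ler_wpM2l // dual_norm_ub.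
Qed.

Let normZ a (f : dual) : (dual_norm (a *: f))%:C = `|a| * (dual_norm f)%:C.
Proof.
apply/eqP; rewrite eq_le normZ_le /=.
have [->|a0] := eqVneq a 0.
  by rewrite normr0 mul0r lecR dual_norm_ge0.
have := normZ_le a^-1 (a *: f).
by rewrite scalerA mulVf // scale1r normfV -ler_pdivrMl ?invrK // invr_gt0 normr_gt0.
Qed.

Let norm_eq0 (f : dual) : (dual_norm f)%:C = 0 -> f = 0.
Proof.
move=> f0; apply: dualP => x; apply/eqP; rewrite -normr_le0.
by have := dual_norm_ub f x; rewrite f0 mul0r.
Qed.

HB.instance Definition _ :=
  Lmodule_isNormed.Build R[i] dual normD normZ norm_eq0.

Lemma dual_normE (f : dual) : `|f| = (dual_norm f)%:C.
Proof. by []. Qed.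

Lemma dual_apply_le (f : dual) x : `|f x| <= `|f| * `|x|.
Proof. exact: dual_norm_ub. Qed.


Lemma dual_norm_leP (f : dual) (M : R[i]) : 0 <= M ->
  (forall x, `|f x| <= M * `|x|) -> `|f| <= M.
Proof.
move=> M0 fM; rewrite dual_normE -[M]ReK // lecR dual_norm_le ?Re_ge0 //.
by rewrite ReK.
Qed.

Lemma bounded_dual_pred (f : V -> R[i]^o) (M : R[i]) : linear f -> 0 <= M ->
  (forall x, `|f x| <= M * `|x|) -> f \in dual_pred.
Proof.
move=> lf M0 fM; apply/asboolP; split => //.
pose g : {linear V -> R[i]^o} :=
  HB.pack f (GRing.isLinear.Build R[i] V R[i]^o *:%R f lf).
apply: (@bounded_linear_continuous _ _ _ g); apply/linear_boundedP.
near=> r => x; apply: (le_trans (fM x)); rewrite ler_wpM2r //.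
by near: r; apply: nbhs_pinfty_ge; exact: ger0_real.
Unshelve. all: by end_near. Qed.

Lemma complex_complete (F : set_system R[i]^o) :
  ProperFilter F -> cauchy F -> cvg F.
Proof.
move=> FF /cauchy_ballP Fc.
have ReF (p : R[i]^o -> R) : (forall z w, `|p z - p w|%:C <= `|z - w|) ->
    cvg (p @ F).
  move=> pl; apply: R_complete; apply/cauchy_ballP => e e0.
  have /Fc : 0 < e%:C :> R[i] by rewrite ltcR.
  case=> -[A B] /= [FA FB] AB; exists (p @` A, p @` B) => /=.
    by split; [move: FA|move: FB]; apply: filterS => z zA; exists z.
  move=> [_ _] /= [[z zA <-] [w wB <-]].
  have := AB (z, w) (conj zA wB); rewrite -!ball_normE /= => zw.
  by rewrite -ltcR; exact: le_lt_trans (pl _ _) zw.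
have cRe : cvg ((@complex.Re R : R[i]^o -> R) @ F).
  apply: ReF => z w; rewrite -raddfB; exact: normc_ge_Re.
have cIm : cvg ((@complex.Im R : R[i]^o -> R) @ F).
  apply: ReF => z w; rewrite -raddfB normc_def lecR.
  by rewrite -sqrtr_sqr ler_wsqrtr // lerDr sqr_ge0.
apply/cvg_ex; exists (Complex (lim ((@complex.Re R : R[i]^o -> R) @ F))
                     (lim ((@complex.Im R : R[i]^o -> R) @ F)) : R[i]^o).
apply/fcvgrPdist_lt => e e0.
have e2 : 0 < complex.Re e / 2 by rewrite divr_gt0 // -ltcR ReK // ltW.
have /cvgrPdist_lt/(_ _ e2) nRe := cRe.
have /cvgrPdist_lt/(_ _ e2) nIm := cIm.
have nle (w : R[i]) : `|w| <= (`|complex.Re w| + `|complex.Im w|)%:C.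
  case: w => a b; rewrite normc_def lecR /=.
  rewrite -[leRHS]ger0_norm ?addr_ge0 // -sqrtr_sqr ler_wsqrtr //.
  by rewrite sqrrD !real_normK ?num_real // lerD2r lerDl mulrn_wge0 ?mulr_ge0.
have eE : e = (complex.Re e / 2 + complex.Re e / 2)%:C.
  by rewrite -splitr ReK // ltW.
near=> z; rewrite eE; apply: (le_lt_trans (nle _)); rewrite ltcR.
by apply: ltrD; rewrite raddfB; near: z.
Unshelve. all: by end_near. Qed.

Lemma dual_complete (F : set_system dual) : ProperFilter F -> cauchy F -> cvg F.
Proof.
move=> FF /cauchy_ballP Fc.
have close e : 0 < e -> exists2 A, F A &
    forall f g, A f -> A g -> forall x, `|f x - g x| <= e * `|x|.
  move=> e0.
  have e20 : 0 < e / 2 by rewrite divr_gt0.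
  have /cauchy_ballP/cauchyP := Fc.
  move=> /(_ (e / 2) e20)[h Fh]; exists (ball h (e / 2)) => // f g.
  rewrite -!ball_normE /= => hf hg x.
  have -> : f x - g x = (f - g) x by [].
  apply: le_trans (dual_apply_le _ _) _; rewrite ler_wpM2r //.
  have -> : f - g = (h - g) - (h - f) by rewrite opprB [RHS]addrC addrA subrK.
  by rewrite (le_trans (ler_normB _ _)) // [e]splitr lerD // ltW.
pose ev x := (fun f : dual => f x : R[i]^o).
have cev x : cvg (ev x @ F).
  apply: complex_complete; apply/cauchy_ballP => e e0.
  have p0 : 0 < `|x| + 1 by rewrite ltr_wpDl.
  have [|A FA AP] := close (e / (`|x| + 1)); first by rewrite divr_gt0.
  have FA' : F (ev x @^-1` (ev x @` A)) by apply: filterS FA => f Af; exists f.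
  exists (ev x @` A, ev x @` A) => //.
  move=> [_ _] /= [[f Af <-] [g Ag <-]]; rewrite -ball_normE /=.
  apply: le_lt_trans (AP _ _ Af Ag x) _.
  by rewrite -mulrA gtr_pMr // mulrC ltr_pdivrMr // mul1r ltrDl.
pose L x : R[i]^o := lim (ev x @ F).
have hC : hausdorff_space R[i]^o := @norm_hausdorff _ _.
have lL : linear L.
  move=> a x y.
  have evE : ev (a *: x + y) = (a \*: ev x) \+ ev y.
    by apply/funext => f; rewrite /ev linearP.
  have cD : (a \*: ev x) \+ ev y @ F --> (a *: L x + L y : R[i]^o).
    by apply: cvgD; [apply: cvgZl_tmp; exact: cev|exact: cev].
  by rewrite {1}/L evE; exact: (@cvg_lim _ hC).
have near_L e : 0 < e -> F [set f : dual | forall x, `|L x - f x| <= e * `|x|].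
  move=> e0; have [A FA AP] := close e e0; apply: filterS (FA) => f Af x.
  apply/ler_addgt0Pr => d d0.
  have /cvgrPdist_lt/(_ d d0) Fd := cev x.
  have [g [Ag gd]] := filter_ex (filterI FA Fd).
  have -> : L x - f x = (L x - g x) + (g x - f x) by rewrite addrA subrK.
  apply: (le_trans (ler_normD _ _)); rewrite addrC.
  by apply: lerD; [exact: AP|exact: ltW].
have [f fL] := filter_ex (near_L 1 ltr01).
have Lin : L \in dual_pred.
  apply: (bounded_dual_pred (M := 1 + `|f|)) lL _ _; first by rewrite addr_ge0.
  move=> x; have -> : L x = (L x - f x) + f x by rewrite subrK.
  by rewrite (le_trans (ler_normD _ _)) // mulrDl lerD ?dual_apply_le.
apply/cvg_ex; exists (Dual Lin); apply/fcvgrPdist_lt => e e0.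
have e20 : 0 < e / 2 by rewrite divr_gt0.
apply: filterS (near_L _ e20) => g gL; apply: (@le_lt_trans _ _ (e / 2)).
  by apply: dual_norm_leP; [exact: ltW|move=> x; exact: gL].
by rewrite gtr_pMr // invf_lt1 // ltr1n.
Qed.

HB.instance Definition _ := Uniform_isComplete.Build dual dual_complete.

(* The weak* topology: pointwise convergence on V. *)
Definition weakstar : Type :=
  initial_topology (dual_fun : dual -> {ptws V -> R[i]^o}).

HB.instance Definition _ := Topological.copy weakstar
  (initial_topology (dual_fun : dual -> {ptws V -> R[i]^o})).

End Dual.
Arguments dual_fun {R V} d _.

Notation bidual V := (dual (dual V)).

Section Bidual.
Context {R : realType} (V : normedModType R[i]).

Lemma eval_dual_pred (x : V) :
  (fun f : dual V => f x : R[i]^o) \in @dual_pred R (dual V).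
Proof.
apply: (bounded_dual_pred (M := `|x|)) => //.
by move=> f; rewrite mulrC dual_apply_le.
Qed.

Definition canonical_embedding (x : V) : bidual V := Dual (eval_dual_pred x).

End Bidual.

Section Conjugation.
Context {R : realType}.

Record conjugation (V : normedModType R[i]) := Conjugation {
  conj_fun :> V -> V ;
  conj_antilinear : forall (a : R[i]) x y,
    conj_fun (a *: x + y) = a^*%C *: conj_fun x + conj_fun y ;
  conj_isometry : forall x, `|conj_fun x| = `|x| ;
  conj_involutive : involutive conj_fun }.

(* The dual and the bidual of E = real_form tau are identified with
   real_form (sharp tau) and real_form (sharp (sharp tau)). *)
Definition real_form (V : normedModType R[i]) (tau : conjugation V) : set V :=
  [set x | tau x = x].

Variables (V : normedModType R[i]) (tau : conjugation V).

Lemma conjcD (z w : R[i]) : (z + w)^*%C = z^*%C + w^*%C.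
Proof. exact: raddfD. Qed.

Lemma conjcM (z w : R[i]) : (z * w)^*%C = z^*%C * w^*%C.
Proof. exact: rmorphM. Qed.

Lemma sharp_dual_pred (f : dual V) :
  (fun x => (f (tau x))^*%C : R[i]^o) \in @dual_pred R V.
Proof.
apply: (bounded_dual_pred (M := `|f|)) => //.
  move=> a x y; rewrite conj_antilinear linearP conjcD.
  congr (_ + _); rewrite -[LHS]/((a^*%C * f (tau x))^*%C).
  by rewrite conjcM conjcK.
by move=> x; rewrite normcJ (le_trans (dual_apply_le _ _)) // conj_isometry.
Qed.

Definition sharp_fun (f : dual V) : dual V := Dual (sharp_dual_pred f).

Lemma sharp_antilinear (a : R[i]) (f g : dual V) :
  sharp_fun (a *: f + g) = a^*%C *: sharp_fun f + sharp_fun g.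
Proof.
apply: dualP => x; rewrite dualDE dualZE.
rewrite -[LHS]/((a * f (tau x) + g (tau x))^*%C).
by rewrite conjcD conjcM.
Qed.

Lemma sharp_involutive : involutive sharp_fun.
Proof. by move=> f; apply: dualP => x; rewrite /= conjcK conj_involutive. Qed.

Lemma sharp_isometry (f : dual V) : `|sharp_fun f| = `|f|.
Proof.
have le g : `|sharp_fun g| <= `|g|.
  apply: dual_norm_leP => // x.
  by rewrite normcJ (le_trans (dual_apply_le _ _)) // conj_isometry.
by apply/eqP; rewrite eq_le le /= -[leLHS](congr1 _ (sharp_involutive f)) le.
Qed.

Definition sharp : conjugation (dual V) :=
  Conjugation sharp_antilinear sharp_isometry sharp_involutive.

End Conjugation.

Section JBStarTriple.
Context {R : realType}.

Section Operator.
Variables (V : normedModType R[i]) (T : V -> V).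

(* T is hermitian when its (spatial) numerical range is real. *)
Definition hermitian_operator :=
  forall (x : V) (f : dual V),
    `|x| = 1 -> `|f| = 1 -> f x = 1 -> f (T x) \is Num.real.

Definition spectrum : set R[i] :=
  [set l | ~ exists S : V -> V, [/\ linear S, continuous S,
     forall x, S (l *: x - T x) = x & forall x, l *: S x - T (S x) = x]].

End Operator.

(* In R[i], 0 <= l means that l is real and non-negative. *)
Record is_jbstar_triple (V : completeNormedModType R[i])
    (tp : V -> V -> V -> V) : Prop := IsJBStarTriple {
  triple_sym : forall x y z, tp x y z = tp z y x ;
  triple_linear : forall y z, linear (fun x => tp x y z) ;
  triple_antilinear : forall x z (a : R[i]) y y',
    tp x (a *: y + y') z = a^*%C *: tp x y z + tp x y' z ;
  triple_continuous : continuous (fun p : V * V * V => tp p.1.1 p.1.2 p.2) ;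
  triple_jordan : forall a b x y z,
    tp a b (tp x y z) =
      tp x y (tp a b z) + tp (tp a b x) y z - tp x (tp b a y) z ;
  triple_hermitian : forall a, hermitian_operator (tp a a) ;
  triple_positive : forall a l, spectrum (tp a a) l -> 0 <= l ;
  triple_norm : forall a, `|tp a a a| = `|a| ^+ 3 }.

(* These conditions determine tp2: V is weak*-dense in its bidual. *)
Record is_bidual_product (V : completeNormedModType R[i])
    (tp : V -> V -> V -> V)
    (tp2 : bidual V -> bidual V -> bidual V -> bidual V) : Prop :=
  IsBidualProduct {
  bidual_triple : is_jbstar_triple tp2 ;
  bidual_extends : forall x y z,
    tp2 (canonical_embedding x) (canonical_embedding y) (canonical_embedding z)
      = canonical_embedding (tp x y z) ;
  bidual_wcont1 : forall b c,
    continuous ((fun x => tp2 x b c) : weakstar (dual V) -> weakstar (dual V)) ;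
  bidual_wcont2 : forall a c,
    continuous ((fun x => tp2 a x c) : weakstar (dual V) -> weakstar (dual V)) ;
  bidual_wcont3 : forall a b,
    continuous ((fun x => tp2 a b x) : weakstar (dual V) -> weakstar (dual V)) }.

Section Tripotents.
Variables (V : normedModType R[i]) (tp : V -> V -> V -> V).

Definition tripotent (e : V) := tp e e e = e.

Definition triple_orthogonal (a b : V) := tp a a b = 0.

Definition tripotent_le (u e : V) :=
  tripotent (e - u) /\ triple_orthogonal (e - u) u.

(* a^[2n+1] *)
Definition odd_power (a : V) (n : nat) : V := iter n (tp a a) a.

End Tripotents.
End JBStarTriple.

Section Order.

Definition is_infimum (T : Type) (le : T -> T -> Prop) (P S : set T) (u : T) :=
  [/\ P u, forall s, S s -> le u s &
      forall v, P v -> (forall s, S s -> le v s) -> le v u].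

Record is_directed (I : Type) (r : I -> I -> Prop) : Prop := IsDirected {
  directed_nonempty : inhabited I ;
  directed_refl : forall i, r i i ;
  directed_trans : forall i j k, r i j -> r j k -> r i k ;
  directed_ub : forall i j, exists2 k, r i k & r j k }.

Definition order_isomorphism (S T : Type) (A : set S) (B : set T)
    (leA : S -> S -> Prop) (leB : T -> T -> Prop) (f : S -> T) :=
  set_bij A B f /\
  forall x y, A x -> A y -> (leA x y <-> leB (f x) (f y)).

End Order.

Section CompactTripotents.
Context {R : realType} (X : completeNormedModType R[i]).
Variables (tau : conjugation X) (tp : X -> X -> X -> X).
Variable (tp2 : bidual X -> bidual X -> bidual X -> bidual X).

Definition real_tripotents : set (bidual X) :=
  [set u | real_form (sharp (sharp tau)) u /\ tripotent tp2 u].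

(* u = u(a): the weak* limit of the a^[2n-1], unique when it exists. *)
Definition is_support_tripotent (a : X) (u : bidual X) :=
  ((fun n => canonical_embedding (odd_power tp a n) : weakstar (dual X))
     @ \oo --> (u : weakstar (dual X))).

Definition compact_Gdelta (u : bidual X) :=
  real_tripotents u /\
  exists a : X, [/\ real_form tau a, `|a| = 1 & is_support_tripotent a u].

(* The infimum is taken in the poset of all tripotents of the real bidual. *)
Definition compact_tripotent (u : bidual X) :=
  u = 0 \/
  exists (I : Type) (r : I -> I -> Prop) (e : I -> bidual X),
    [/\ is_directed r,
        forall i j, r i j -> tripotent_le tp2 (e j) (e i),
        forall i, compact_Gdelta (e i) &
        is_infimum (tripotent_le tp2) real_tripotents (range e) u].

(* None stands for the adjoined largest element. *)
Definition compact_tripotents_top : set (option (bidual X)) :=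
  [set v | if v is Some u then compact_tripotent u else True].

Definition tripotent_top_le (v w : option (bidual X)) : Prop :=
  match v, w with
  | _, None => True
  | None, Some _ => False
  | Some u, Some e => tripotent_le tp2 u e
  end.

End CompactTripotents.

Section Faces.
Context {R : realType}.

Definition is_face (W : lmodType R[i]) (L F : set W) :=
  [/\ F `<=` L, convex_set F &
      forall x y (t : R), L x -> L y -> 0 < t -> t < 1 ->
        F (t%:C *: x + (1 - t)%:C *: y) -> F x /\ F y].

Definition is_proper_face (W : lmodType R[i]) (L F : set W) :=
  [/\ is_face L F, F !=set0 & F <> L].

Variables (X : normedModType R[i]) (tau : conjugation X).

(* The closed unit ball of the dual of the real form of tau; the weak*
   topology of that dual is induced by the one of dual X. *)
Definition real_dual_ball : set (dual X) :=
  [set f | real_form (sharp tau) f /\ `|f| <= 1].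

Definition weakstar_closed_faces : set (set (dual X)) :=
  [set F | is_face real_dual_ball F /\ closed (F : set (weakstar X))].

Definition weakstar_closed_proper_faces : set (set (dual X)) :=
  [set F | is_proper_face real_dual_ball F /\ closed (F : set (weakstar X))].

Definition prime_face (u : bidual X) : set (dual X) :=
  [set f | real_dual_ball f /\ u f = 1].

Definition prime_face_top (v : option (bidual X)) : set (dual X) :=
  if v is Some u then prime_face u else real_dual_ball.

End Faces.

(* Main.v *)
(* A weak*-closed proper face F of the real dual ball is recovered in two steps.

   In the bidual, F is the intersection of the faces {phi | phi(w) = 1}, where w
   runs over the unit-ball elements w equal to 1 on F.  Given psi outside F,
   separate it from F by x with psi(x) > al >= phi(x) on F.  By weak*
   compactness, splitting phi = f1 + f2 inside the dual is eventually too
   expensive for the gauge la |f1| + (la + al) |f2| - Re f2(x), because cheap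
   splittings converge to a splitting inside the face.  A minimax argument turns
   this into b with |b| <= la, |b + x| <= la + al and phi(b) >= la - eta on F.
   If every such w were 1 at psi, a spectral projection of b / la relative to the
   support tripotent of one w would be close to 1 on F, hence at psi, and
   compressing b + x by it would give psi(x) <= al + o(1).

   Support tripotents of the w form a decreasing net with infimum e, so F is the
   state space of e.  Approximate elements x of X, with phi(x) >= 1 - eps on F,
   satisfy x ~ e + P_0(e) x; the right side is exactly 1 on F, so minimax
   improves x to a nearby x' with a smaller eps, and in the limit one gets a in X
   exactly 1 on F and different from 1 at a prescribed psi.  The support
   tripotents u(a) of these a decrease to the compact tripotent of F.  The order
   of tripotents is inclusion of their state spaces, which gives uniqueness and
   the order isomorphism.

   All triple-theoretic facts come directly from the axioms: odd powers, Peirce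
   projections and states are controlled by numerical ranges and by positivity of
   the moment functionals p |-> f(p(T) x), and real forms are handled without
   knowing that the conjugation preserves the triple product. *)
From HB Require Import structures.
Require Import Defs.
From mathcomp Require Import all_boot all_order all_algebra.
From mathcomp Require Import complex.
From mathcomp Require Import all_classical all_reals all_analysis.
From mathcomp Require Import ring lra.
Import Order.TTheory GRing.Theory Num.Theory.
Import numFieldNormedType.Exports.
Local Open Scope classical_set_scope.
Local Open Scope complex_scope.
Local Open Scope ring_scope.
Set Implicit Arguments.
Unset Strict Implicit.
Unset Printing Implicit Defensive.

(** Three devices recur. Polynomials are evaluated on odd powers of an element (or on powers of a
    self-adjoint element with respect to a unit tripotent), and an inequality between polynomials is
    certified algebraically by [ipos]. Supporting functionals turn such certificates into bounds of
    a numerical radius, hence of a norm, at the price of a factor 4. Where the constant must be 1,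
    the estimate is applied to all iterated cubes: as the norm of [{x, x, x}] is the cube of the
    norm of [x], any uniform bound on them forces norm at most 1.

    The product is only separately weak*-continuous, so limits are taken along ultrafilters in one
    variable at a time, always from an identity between products of members of the net.

    Elements of [X] with prescribed bounds come from a minimax over functionals. The existence claim
    then becomes an inequality for all splittings [f = f1 + f2] of the functionals of the face,
    checked either by evaluating one well-chosen element of the bidual or by weak*-compactness. *)

Definition nm {R : realType} {V : normedZmodType R[i]} (x : V) : R :=
  complex.Re `|x|.

(** * Norms and functionals *)

Section RealNorm.
Context {R : realType}.
Local Notation C := (R[i]).

(** Bridge from the [C]-valued norm to a real number, on which [lra] and [nra] can work. *)
Lemma nmE (V : normedZmodType C) (x : V) : `|x| = (nm x)%:C.
Proof. by rewrite /nm ReK. Qed.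

Lemma nm_ge0 (V : normedZmodType C) (x : V) : 0 <= nm x.
Proof. exact: Re_ge0. Qed.

Lemma nm_eq0 (V : normedZmodType C) (x : V) : nm x = 0 -> x = 0.
Proof. by move=> x0; apply/normr0_eq0; rewrite nmE x0. Qed.

Lemma nm0 (V : normedZmodType C) : nm (0 : V) = 0.
Proof. by rewrite /nm normr0. Qed.

Lemma nmD (V : normedZmodType C) (x y : V) : nm (x + y) <= nm x + nm y.
Proof. by rewrite -lecR rmorphD /= -!nmE ler_normD. Qed.

Lemma nmN (V : normedZmodType C) (x : V) : nm (- x) = nm x.
Proof. by rewrite /nm normrN. Qed.

Lemma nmB (V : normedZmodType C) (x y : V) : nm (x - y) <= nm x + nm y.
Proof. by rewrite -[nm y]nmN nmD. Qed.

Lemma nm_distC (V : normedZmodType C) (x y : V) : nm (x - y) = nm (y - x).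
Proof. by rewrite -nmN opprB. Qed.

Lemma nmBD (V : normedZmodType C) (x y : V) : nm x - nm y <= nm (x - y).
Proof. by have := nmD (x - y) y; rewrite subrK; lra. Qed.

Lemma nm_sum (V : normedZmodType C) (I : Type) (r : seq I) (P : pred I) (F : I -> V) :
  nm (\sum_(i <- r | P i) F i) <= \sum_(i <- r | P i) nm (F i).
Proof.
elim/big_rec2: _ => [|i y x _ xy]; first by rewrite nm0.
by apply: le_trans (nmD _ _) _; rewrite lerD2l.
Qed.

Lemma nmc (z : C) : nm z = Num.sqrt (complex.Re z ^+ 2 + complex.Im z ^+ 2).
Proof. by rewrite /nm normc_def. Qed.

Lemma nmM (z w : C) : nm (z * w) = nm z * nm w.
Proof. by apply: complexI; rewrite rmorphM /= -!nmE normrM. Qed.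

Lemma nmX (z : C) n : nm (z ^+ n) = nm z ^+ n.
Proof. by apply: complexI; rewrite rmorphXn /= -!nmE normrX. Qed.

Lemma nmV (z : C) : nm z^-1 = (nm z)^-1.
Proof. by apply: complexI; rewrite fmorphV /= -!nmE normfV. Qed.

Lemma nmR (t : R) : nm t%:C = `|t|.
Proof. by rewrite nmc /= expr0n /= addr0 sqrtr_sqr. Qed.

Lemma nmRp (t : R) : 0 <= t -> nm t%:C = t.
Proof. by move=> t0; rewrite nmR ger0_norm. Qed.

Lemma nmZ (V : normedModType C) (a : C) (x : V) : nm (a *: x) = nm a * nm x.
Proof. by apply: complexI; rewrite rmorphM /= -!nmE normrZ. Qed.

Lemma nmZR (V : normedModType C) (t : R) (x : V) : nm (t%:C *: x) = `|t| * nm x.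
Proof. by rewrite nmZ nmR. Qed.

Lemma nmZp (V : normedModType C) (t : R) (x : V) :
  0 <= t -> nm (t%:C *: x) = t * nm x.
Proof. by move=> t0; rewrite nmZR ger0_norm. Qed.

Lemma nmMn (V : normedModType C) (x : V) n : nm (x *+ n) = nm x *+ n.
Proof.
rewrite -scaler_nat -(rmorph_nat (real_complex R)) /= nmZp ?ler0n //.
by rewrite mulr_natl.
Qed.

Lemma Re_nm (z : C) : `|complex.Re z| <= nm z.
Proof. by rewrite -lecR -nmE normc_ge_Re. Qed.

Lemma Re_le_nm (z : C) : complex.Re z <= nm z.
Proof. exact: le_trans (ler_norm _) (Re_nm z). Qed.

Lemma Im_nm (z : C) : `|complex.Im z| <= nm z.
Proof. by rewrite nmc -sqrtr_sqr ler_wsqrtr // lerDr sqr_ge0. Qed.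

Lemma nm_le_ReIm (z : C) : nm z <= `|complex.Re z| + `|complex.Im z|.
Proof.
rewrite nmc -[leRHS]ger0_norm ?addr_ge0 // -sqrtr_sqr ler_wsqrtr //.
by rewrite sqrrD !real_normK ?num_real // lerD2r lerDl mulrn_wge0 ?mulr_ge0.
Qed.

Lemma nm_sq (z : C) : nm z ^+ 2 = complex.Re z ^+ 2 + complex.Im z ^+ 2.
Proof. by rewrite nmc sqr_sqrtr // addr_ge0 ?sqr_ge0. Qed.

Lemma nm1 : nm (1 : C) = 1.
Proof. by rewrite -(rmorph1 (real_complex R)) nmRp. Qed.

Lemma ReD (z w : C) : complex.Re (z + w) = complex.Re z + complex.Re w.
Proof. exact: raddfD. Qed.

Lemma ReN (z : C) : complex.Re (- z) = - complex.Re z.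
Proof. exact: raddfN. Qed.

Lemma ReB (z w : C) : complex.Re (z - w) = complex.Re z - complex.Re w.
Proof. exact: raddfB. Qed.

Lemma ImD (z w : C) : complex.Im (z + w) = complex.Im z + complex.Im w.
Proof. exact: raddfD. Qed.

Lemma ReMr (t : R) (z : C) : complex.Re (t%:C * z) = t * complex.Re z.
Proof. by case: z => a b /=; rewrite mul0r subr0. Qed.

Lemma ImMr (t : R) (z : C) : complex.Im (t%:C * z) = t * complex.Im z.
Proof. by case: z => a b /=; rewrite mul0r addr0. Qed.

Lemma RealE (z : C) : (z \is Num.real) = (complex.Im z == 0).
Proof. by case: z => a b; rewrite realE !lecE /= [b == 0]eq_sym; case: eqVneq => //= _; exact: le_total. Qed.

(** Reduces an equality [f x = 1] to a norm bound and a one-sided estimate of a real part. *)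
Lemma nm1_Re1 (z : C) : nm z <= 1 -> 1 <= complex.Re z -> z = 1.
Proof.
move=> z1 r1; have := nm_sq z; have := Re_le_nm z; have := nm_ge0 z => n0 rn sq.
have re : complex.Re z = 1 by apply/eqP; rewrite eq_le r1 andbT (le_trans rn).
have n1 : nm z = 1 by apply/eqP; rewrite eq_le z1 -re rn.
move: sq; rewrite n1 re expr1n => sq.
have im : complex.Im z = 0 by apply/eqP; rewrite -sqrf_eq0; apply/eqP; lra.
by apply/eqP; rewrite eq_complex re im /= !eqxx.
Qed.

End RealNorm.

Section Functionals.
Context {R : realType}.
Local Notation C := (R[i]).
Variable V : normedModType C.

Lemma dual_le (f : dual V) x : nm (f x : C) <= nm f * nm x.
Proof. by rewrite -lecR rmorphM /= -!nmE dual_apply_le. Qed.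

Lemma dual_le1 (f : dual V) x : nm f <= 1 -> nm (f x : C) <= nm x.
Proof.
by move=> f1; apply: le_trans (dual_le f x) _; rewrite ler_piMl ?nm_ge0.
Qed.

Lemma dual_nm_le (f : dual V) (M : R) : 0 <= M ->
  (forall x, nm (f x : C) <= M * nm x) -> nm f <= M.
Proof.
move=> M0 fM; rewrite -lecR -nmE; apply: dual_norm_leP; first by rewrite lecR.
by move=> x; rewrite !nmE -rmorphM lecR.
Qed.

Lemma dualD (f : dual V) x y : f (x + y) = f x + f y :> C.
Proof. exact: linearD. Qed.
Lemma dualB (f : dual V) x y : f (x - y) = f x - f y :> C.
Proof. exact: linearB. Qed.
Lemma dualN (f : dual V) x : f (- x) = - f x :> C.
Proof. exact: linearN. Qed.
Lemma dual0 (f : dual V) : f 0 = 0 :> C.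
Proof. exact: linear0. Qed.
Lemma dualcD (f g : dual V) x : (f + g) x = f x + g x :> C. Proof. by []. Qed.
Lemma dualcZ (f : dual V) a x : (a *: f) x = a * f x :> C. Proof. by []. Qed.
Lemma dualcN (f : dual V) x : (- f) x = - f x :> C. Proof. by []. Qed.
Lemma dualcB (f g : dual V) x : (f - g) x = f x - g x :> C. Proof. by []. Qed.
Lemma dualc0 x : (0 : dual V) x = 0 :> C. Proof. by []. Qed.
Lemma dualZ (f : dual V) a x : f (a *: x) = a * f x :> C.
Proof. by rewrite linearZ. Qed.

(** Transparent, so that applying the result reduces to [f] by conversion. *)
Definition dualmk (f : V -> C) (M : R) (lf : forall a x y, f (a *: x + y) = a * f x + f y)
    (M0 : 0 <= M) (fM : forall x, nm (f x) <= M * nm x) : dual V.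
Proof.
refine (@Dual _ _ f (@bounded_dual_pred R V f M%:C lf _ _)).
  by rewrite lecR.
by move=> x; rewrite !nmE -rmorphM lecR; exact: fM.
Defined.

(** A supporting functional without the normalisation [nm x = 1]: the relation survives scaling of
    [x] by non-negative reals, and [x = 0] is no exception. *)
Definition dualpair (x : V) (f : dual V) := nm f <= 1 /\ f x = (nm x)%:C :> C.

End Functionals.

(** * Norming functionals by Hahn-Banach *)

Section HahnBanach.
Context {R : realType}.
Local Notation C := (R[i]).
Variable V : normedModType C.

Definition sublinear (q : V -> R) :=
  (forall x y, q (x + y) <= q x + q y) /\
  (forall (t : R) x, 0 <= t -> q (t%:C *: x) = t * q x).

Lemma sublinear0 q : sublinear q -> q 0 = 0.
Proof. by move=> [_ qZ]; rewrite -(scale0r 0) -(rmorph0 (real_complex R)) qZ // mul0r. Qed.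

Lemma sublinear_lb q x : sublinear q -> - q (- x) <= q x.
Proof.
by move=> sq; have := sq.1 x (- x); rewrite subrr sublinear0 // => h; lra.
Qed.

(** The auxiliary functional of the Hahn-Banach proof through minimal sublinear functionals: it lies
    below [q] and is at most [- q y] at [- y], so a [q] that it cannot lower is additive. *)
Definition shave (q : V -> R) (y : V) (x : V) : R :=
  inf [set q (x + t%:C *: y) - t * q y | t in [set t : R | 0 <= t]].

Lemma shave_lb q y x : sublinear q ->
  forall t, 0 <= t -> - q (- x) <= q (x + t%:C *: y) - t * q y.
Proof.
move=> sq t t0; rewrite -(sq.2 t y t0).
have := sq.1 (x + t%:C *: y) (- x); rewrite addrAC subrr add0r; lra.
Qed.

Lemma shave_has_inf q y x : sublinear q ->
  has_inf [set q (x + t%:C *: y) - t * q y | t in [set t : R | 0 <= t]].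
Proof.
move=> sq; split; first by exists (q (x + 0%:C *: y) - 0 * q y); exists 0 => //=.
by exists (- q (- x)) => _ [t t0 <-]; exact: shave_lb.
Qed.

Lemma shave_le q y x t : sublinear q -> 0 <= t ->
  shave q y x <= q (x + t%:C *: y) - t * q y.
Proof.
move=> sq t0; apply: ge_inf; first exact: (shave_has_inf y x sq).2.
by exists t.
Qed.

Lemma shave_ge q y x m : sublinear q ->
  (forall t, 0 <= t -> m <= q (x + t%:C *: y) - t * q y) -> m <= shave q y x.
Proof.
move=> sq h; apply: lb_le_inf; first exact: (shave_has_inf y x sq).1.
by move=> _ [t t0 <-]; exact: h.
Qed.

Lemma shave_sublinear q y : sublinear q -> sublinear (shave q y).
Proof.
move=> sq; split=> [x z|t x].
  rewrite -lerBlDr; apply: shave_ge => // t t0; rewrite lerBlDr [leRHS]addrC -lerBlDr.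
  apply: shave_ge => // s s0; rewrite lerBlDr.
  have ts0 : 0 <= t + s by rewrite addr_ge0.
  apply: le_trans (shave_le y (x + z) sq ts0) _.
  rewrite rmorphD scalerDl addrACA.
  by have := sq.1 (x + t%:C *: y) (z + s%:C *: y); lra.
rewrite le_eqVlt => /predU1P[<-|t0].
  rewrite rmorph0 scale0r mul0r; apply/eqP; rewrite eq_le; apply/andP; split.
    have := shave_le y 0 sq (lexx 0).
    by rewrite rmorph0 scale0r addr0 mul0r subr0 (sublinear0 sq).
  by have := @shave_ge q y 0 0 sq; apply=> s s0; rewrite add0r sq.2 // subrr.
have tC : t%:C != 0 :> C by rewrite fmorph_eq0 gt_eqF.
apply/eqP; rewrite eq_le; apply/andP; split.
  rewrite -ler_pdivrMl //; apply: shave_ge => // s s0; rewrite ler_pdivrMl //.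
  have ts : 0 <= t * s by rewrite mulr_ge0 // ltW.
  apply: le_trans (shave_le y (t%:C *: x) sq ts) _.
  rewrite rmorphM -scalerA -scalerDr (sq.2 t _ (ltW t0)) mulrBr mulrA.
  exact: lexx.
apply: shave_ge => // s s0.
have ts : 0 <= t^-1 * s by rewrite mulr_ge0 // invr_ge0 ltW.
have := shave_le y x sq ts; rewrite -(ler_pM2l t0) => /le_trans; apply.
have E : t%:C *: (x + (t^-1 * s)%:C *: y) = t%:C *: x + s%:C *: y.
  by rewrite scalerDr scalerA -rmorphM mulVKf // gt_eqF.
by rewrite mulrBr -(sq.2 t _ (ltW t0)) E !mulrA mulfV ?gt_eqF // mul1r.
Qed.

Lemma shave_self q y x : sublinear q -> shave q y x <= q x.
Proof.
move=> sq; have := shave_le y x sq (lexx 0).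
by rewrite rmorph0 scale0r addr0 mul0r subr0.
Qed.

Record sublin_below (p : V -> R) := SublinBelow {
  sb_fun : V -> R ; sb_prop : sublinear sb_fun /\ forall x, sb_fun x <= p x }.

Lemma minimal_sublinear p : sublinear p ->
  exists q, [/\ sublinear q, (forall x, q x <= p x) &
    forall r, sublinear r -> (forall x, r x <= q x) -> r = q].
Proof.
move=> sp; pose T := sublin_below p.
pose Rl (a b : T) := `[< forall x, sb_fun b x <= sb_fun a x >].
have inj (a b : T) : sb_fun a = sb_fun b -> a = b.
  by case: a b => [f fp] [g gp] /= fg; subst g; congr SublinBelow; exact: Prop_irrelevance.
have [||||m mmax] := @Zorn T Rl.
- by move=> a; apply/asboolP.
- move=> a b c /asboolP ab /asboolP bc; apply/asboolP => x.
  exact: le_trans (bc x) (ab x).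
- move=> a b /asboolP ab /asboolP ba; apply: inj; apply/funext => x.
  by apply/eqP; rewrite eq_le ab ba.
- move=> A tA; have [[a0 Aa0]|nA] := pselect (exists a, A a); last first.
    have pp : sublinear p /\ forall x, p x <= p x by [].
    by exists (SublinBelow pp) => s As; case: nA; exists s.
  pose g x := inf [set sb_fun a x | a in A].
  have hi x : has_inf [set sb_fun a x | a in A].
    split; first by exists (sb_fun a0 x); exists a0.
    exists (- p (- x)) => _ [a Aa <-]; have := sublinear_lb x (sb_prop a).1.
    by have := (sb_prop a).2 (- x); lra.
  have gle x a : A a -> g x <= sb_fun a x.
    by move=> Aa; apply: ge_inf; [exact: (hi x).2|exists a].
  have gge x m : (forall a, A a -> m <= sb_fun a x) -> m <= g x.
    move=> h; apply: lb_le_inf; first exact: (hi x).1.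
    by move=> _ [a Aa <-]; exact: h.
  have sg : sublinear g.
    split=> [x y|t x t0].
      rewrite -lerBlDr; apply: (gge) => a Aa; rewrite lerBlDr [leRHS]addrC -lerBlDr.
      apply: (gge) => b Ab; rewrite lerBlDr.
      have [/asboolP ab|/asboolP ba] := tA a b Aa Ab.
        apply: le_trans (gle _ _ Ab) _; apply: le_trans ((sb_prop b).1.1 x y) _.
        by have := ab x; lra.
      apply: le_trans (gle _ _ Aa) _; apply: le_trans ((sb_prop a).1.1 x y) _.
      by have := ba y; lra.
    move: t0; rewrite le_eqVlt => /predU1P[<-|t0].
      rewrite rmorph0 scale0r mul0r; apply/eqP; rewrite eq_le; apply/andP; split.
        by have := gle 0 _ Aa0; rewrite (sublinear0 (sb_prop a0).1).
      by apply: (gge) => a Aa; rewrite (sublinear0 (sb_prop a).1).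
    apply/eqP; rewrite eq_le; apply/andP; split.
      rewrite -ler_pdivrMl //; apply: (gge) => a Aa; rewrite ler_pdivrMl //.
      by rewrite -((sb_prop a).1.2 t x (ltW t0)) gle.
    apply: (gge) => a Aa; rewrite ((sb_prop a).1.2 t x (ltW t0)) ler_pM2l //.
    exact: gle.
  have gp x : g x <= p x by apply: le_trans (gle x _ Aa0) _; exact: (sb_prop a0).2.
  exists (SublinBelow (conj sg gp)) => s As; apply/asboolP => x /=; exact: gle.
exists (sb_fun m); split; [exact: (sb_prop m).1|exact: (sb_prop m).2|].
move=> r sr rm.
have rp x : r x <= p x by apply: le_trans (rm x) _; exact: (sb_prop m).2.
by have /(congr1 (@sb_fun p)) := mmax (SublinBelow (conj sr rp)) (asboolT rm).
Qed.

(** A minimal sublinear functional is real-linear; starting from the norm shaved at [x0] instead of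
    the norm forces its value at [x0] to be [nm x0]. *)
Lemma norming (x0 : V) : exists f : dual V, dualpair x0 f.
Proof.
have sn : sublinear (@nm R V).
  by split=> [x y|t x t0]; [exact: nmD|rewrite nmZp].
have sp := @shave_sublinear _ x0 sn.
have [q [sq qp qmin]] := minimal_sublinear sp.
have qD x y : q (x + y) = q x + q y.
  apply/eqP; rewrite eq_le sq.1 /=.
  have := qmin _ (shave_sublinear y sq) (fun z => shave_self y z sq) => E.
  have := shave_le y x sq ler01; rewrite E scale1r mul1r; lra.
have qN x : q (- x) = - q x.
  by apply/eqP; rewrite -subr_eq0 opprK -qD addNr sublinear0.
have qZ (t : R) x : q (t%:C *: x) = t * q x.
  have [t0|t0] := leP 0 t; first exact: sq.2.
  rewrite -[t]opprK rmorphN scaleNr qN sq.2 ?oppr_ge0 ?ltW //; lra.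
have qn x : q x <= nm x by apply: le_trans (qp x) _; exact: shave_self.
have qx0 : q x0 = nm x0.
  apply/eqP; rewrite eq_le qn /=.
  have := qp (- x0); rewrite qN.
  have := shave_le x0 (- x0) sn ler01; rewrite scale1r addNr mul1r nm0; lra.
(* The usual complexification of a real functional; rotating [x] by the phase [u] below carries the
   bound from the real part over to the modulus. *)
pose f x : C := (q x +i* (- q ('i *: x)))%C.
have fl a x y : f (a *: x + y) = a * f x + f y.
  have qc (b : C) z : q (b *: z) = complex.Re b * q z + complex.Im b * q ('i *: z).
    rewrite {1}[b]complexE scalerDl qD qZ ['i%C * _]mulrC -scalerA qZ.
    by [].
  apply/eqP; rewrite eq_complex /=; apply/andP; split; apply/eqP.
    by rewrite qD qc; case: a => ar ai /=; ring.
  rewrite scalerDr qD scalerA [q ((_ * _) *: _)]qc; case: a => ar ai /=; ring.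
have fn x : nm (f x) <= 1 * nm x.
  rewrite mul1r; have [fx0|fx0] := eqVneq (f x) 0; first by rewrite fx0 nm0 nm_ge0.
  have nf0 : nm (f x) != 0 by apply: contra_neq fx0; exact: nm_eq0.
  pose u := (nm (f x))%:C / f x.
  have nu : nm u = 1 by rewrite nmM nmV nmRp ?nm_ge0 // mulfV.
  have : f (u *: x) = (nm (f x))%:C.
    have f0 : f 0 = 0.
      by apply/eqP; rewrite eq_complex /= scaler0 (sublinear0 sq) oppr0 eqxx.
    by have := fl u x 0; rewrite addr0 f0 addr0 => ->; rewrite /u divfK.
  move=> /(congr1 (@complex.Re R)) /= <-.
  by apply: le_trans (qn _) _; rewrite nmZ nu mul1r.
exists (dualmk fl ler01 fn); split.
  by apply: dual_nm_le => // x; exact: fn.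
have := fn x0; rewrite mul1r => h.
rewrite -[LHS]/(f x0); apply/eqP; rewrite eq_complex /= qx0 eqxx /=.
have := nm_sq (f x0); rewrite /= qx0.
have : nm (f x0) ^+ 2 <= nm x0 ^+ 2 by rewrite ler_pXn2r // nnegrE nm_ge0.
move=> h2 h3; rewrite h3 in h2.
by rewrite -sqrf_eq0 eq_le sqr_ge0 andbT; lra.
Qed.

End HahnBanach.

Section Separation.
Context {R : realType}.
Variable V : normedModType R[i].

Lemma dual_ext (x y : V) : (forall f : dual V, f x = f y :> R[i]) -> x = y.
Proof.
move=> fxy; have [f [_ fx]] := norming (x - y).
apply/eqP; rewrite -subr_eq0; apply/eqP; apply: nm_eq0.
have : f (x - y) = 0 :> R[i] by rewrite dualB fxy subrr.
by rewrite fx => /(congr1 (@complex.Re R)).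
Qed.

Lemma dualMn (f : dual V) (x : V) n : f (x *+ n) = (f x : R[i]) *+ n.
Proof. exact: raddfMn. Qed.

Lemma sqr_le (a b : R) : 0 <= a -> a <= b -> a ^+ 2 <= b ^+ 2.
Proof. by move=> a0 ab; rewrite ler_pXn2r ?nnegrE // (le_trans a0). Qed.

End Separation.

(** A vector identity is tested on an arbitrary functional, which leaves an identity of scalars for
    [ring]. *)
Ltac vec := apply: dual_ext => ?;
  rewrite ?(dualD, dualB, dualN, dualZ, dual0, dualMn); ring.
Ltac vecf := apply: dual_ext => ?;
  rewrite ?(dualD, dualB, dualN, dualZ, dual0, dualMn); field; rewrite ?pnatr_eq0 //.

Ltac nneg := repeat first [assumption | exact: nm_ge0 | exact: normr_ge0
  | exact: ler0n | exact: ler01 | exact: sqr_ge0 | (apply: ltW; assumption)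
  | apply: mulr_ge0 | apply: addr_ge0 | apply: exprn_ge0 | rewrite invr_ge0].

(** * Cauchy's estimate on roots of unity *)

Section Cauchy.
Context {R : realType}.
Local Notation C := (R[i]).

(** Iterated square roots of [-1], whose orders are the powers of two. *)
Lemma dyadic_root (m : nat) : exists2 z : C, nm z = 1 & (2 ^ m).-primitive_root z.
Proof.
have [m0|m0] := posnP m.
  by exists 1; [exact: nm1|rewrite m0; apply/andP; split=> //; apply/forallP => i; rewrite (ord1 i) /= eqxx unity_rootE expr1 eqxx].
pose s := fix s n : C := if n is n'.+1 then sqrtC (s n') else -1.
have sE n : s n ^+ (2 ^ n) = -1.
  by elim: n => [|n IH]; rewrite ?expr1 // expnS exprM sqrtCK.
pose z := s m.-1; exists z.
  have : nm z ^+ (2 ^ m.-1) = 1 by rewrite -nmX sE nmN nm1.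
  by move/eqP; rewrite pexpr_eq1 ?expn_gt0 ?nm_ge0 // => /eqP.
have z1 : z ^+ (2 ^ m) = 1 by rewrite -(prednK m0) expnS mulnC exprM sE sqrrN expr1n.
have [k kz] := prim_order_exists (expn_gt0 2 m : (0 < 2 ^ m)%N = true) z1.
move=> /(dvdn_pfactor _ _ (isT : prime 2))[j jm E]; rewrite E in kz.
have [jlt|] := ltnP j m; last first.
  by move=> mj; rewrite (_ : m = j) //; apply/eqP; rewrite eqn_leq mj jm.
have : z ^+ (2 ^ m.-1) = 1.
  have jm1 : (j <= m.-1)%N by rewrite -ltnS prednK.
  by rewrite -(subnK jm1) expnD mulnC exprM (prim_expr_order kz) expr1n.
rewrite sE => /eqP; rewrite -subr_eq0 -opprD oppr_eq0 -mulr2n pnatr_eq0.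
by [].
Qed.

Lemma prim_root_sum (n : nat) (z : C) k : n.-primitive_root z -> ~~ (n %| k)%N ->
  \sum_(j < n) (z ^+ k) ^+ j = 0.
Proof.
move=> zn nk; have zk1 : z ^+ k != 1 by rewrite -(prim_order_dvd zn).
have := subrX1 (z ^+ k) n.
rewrite -exprM mulnC exprM (prim_expr_order zn) expr1n subrr => /esym/eqP.
by rewrite mulf_eq0 subr_eq0 (negbTE zk1) => /eqP.
Qed.

Variable V : normedModType C.

Lemma opD (T : {linear V -> V}) x y : T (x + y) = T x + T y.
Proof. exact: linearD. Qed.
Lemma opB (T : {linear V -> V}) x y : T (x - y) = T x - T y.
Proof. exact: linearB. Qed.
Lemma opN (T : {linear V -> V}) x : T (- x) = - T x.
Proof. exact: linearN. Qed.
Lemma op0 (T : {linear V -> V}) : T 0 = 0.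
Proof. exact: linear0. Qed.
Lemma opZ (T : {linear V -> V}) a x : T (a *: x) = a *: T x.
Proof. exact: linearZ. Qed.
Lemma opMn (T : {linear V -> V}) x n : T (x *+ n) = T x *+ n.
Proof. exact: raddfMn. Qed.
Lemma op_sum (T : {linear V -> V}) (I : Type) (r : seq I) (P : pred I) (F : I -> V) :
  T (\sum_(i <- r | P i) F i) = \sum_(i <- r | P i) T (F i).
Proof. exact: linear_sum. Qed.

Lemma iter_comm (A B : V -> V) n x : (forall y, A (B y) = B (A y)) ->
  iter n A (B x) = B (iter n A x).
Proof. by move=> AB; elim: n => //= n ->. Qed.

Lemma iterD_comm (A B : {linear V -> V}) (w : C) n x :
  (forall y, A (B y) = B (A y)) ->
  iter n (fun y => A y + w *: B y) x =
    \sum_(k < n.+1) w ^+ k *: ((iter (n - k) A (iter k B x)) *+ 'C(n, k)).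
Proof.
move=> AB; elim: n => [|n IH]; first by rewrite big_ord1 expr0 scale1r.
rewrite iterS IH (op_sum A) (op_sum B) scaler_sumr.
have step k : (k <= n)%N -> A (iter (n - k) A (iter k B x)) = iter (n.+1 - k) A (iter k B x).
  by move=> kn; rewrite subSn.
have stepB k : B (iter (n - k) A (iter k B x)) = iter (n - k) A (iter k.+1 B x).
  by rewrite iterS [in RHS]iter_comm // .
under eq_bigr => k _ do rewrite (opZ A) (opMn A) step ?leq_ord //.
under [X in _ + X]eq_bigr => k _ do
  rewrite (opZ B) (opMn B) stepB scalerA -exprS.
rewrite big_ord_recl [in RHS]big_ord_recl /= ?bin0 ?subn0 -addrA; congr (_ + _).
rewrite [X in _ + X]big_ord_recr [in RHS]big_ord_recr /= addrA; congr (_ + _).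
  rewrite -big_split /=; apply: eq_bigr => k _.
  by rewrite /bump /= !add1n subSS -scalerDr -mulrnDr binS.
by rewrite /bump /= add1n !binn.
Qed.

(* Averaging over the roots of unity of order [2 ^ n] isolates the linear
   coefficient in [w] of [(A + w B) ^ n]. *)
Lemma cauchy_estimate (A B : {linear V -> V}) n x (M : R) :
  (0 < n)%N -> (forall y, A (B y) = B (A y)) ->
  (forall w : C, nm w = 1 -> nm (iter n (fun y => A y + w *: B y) x) <= M) ->
  nm (iter n.-1 A (B x)) *+ n <= M.
Proof.
move=> n0 AB bM; have [z nz pz] := dyadic_root n.+1.
set N := (2 ^ n.+1)%N in pz.
(* As [N] exceeds [n + 1], only [k = 1] makes the exponent [k - 1] a multiple of [N] when [k] runs
   from 0 to [n]. *)
have nN : (n.+1 < N)%N by apply: ltn_expl.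
have N0 : (0 < N)%N by apply: leq_trans nN.
pose G w := iter n (fun y => A y + w *: B y) x.
have key : \sum_(j < N) (z ^+ j) ^- 1 *: G (z ^+ j) =
    ((iter n.-1 A (B x)) *+ n) *+ N.
  under eq_bigr => j _ do rewrite /G iterD_comm // scaler_sumr.
  rewrite exchange_big /=.
  have n1 : (1 < n.+1)%N by [].
  rewrite (bigD1 (Ordinal n1)) //= [X in _ + X]big1 ?addr0 => [|k kn1].
    under eq_bigr => j _.
      rewrite expr1 scalerA mulVf ?scale1r; last first.
        rewrite expf_neq0 //; apply: contra_eq_neq nz => ->; rewrite nm0.
        by rewrite eq_sym oner_neq0.
      over.
    by rewrite sumr_const card_ord bin1 subn1.
  have zj j : z ^+ j != 0.
    by rewrite expf_neq0 //; apply: contra_eq_neq nz => ->; rewrite nm0 eq_sym oner_neq0.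
  under eq_bigr => j _ do rewrite scalerA.
  rewrite -scaler_suml; set S := \sum_(_ < _) _.
  suff -> : S = 0 by rewrite scale0r.
  have k1 : (nat_of_ord k != 1)%N by apply: contra_neq kn1 => k1; apply/val_inj.
  have E : S = \sum_(j < N) (z ^+ (k + N.-1)) ^+ j.
    apply: eq_bigr => j _; rewrite expr1 -[LHS]mul1r.
    apply: (mulfI (zj j)); rewrite mul1r mulrA mulfV // mul1r.
    rewrite [(z ^+ (_ + _)) ^+ _]exprAC -exprS -addnS prednK // exprD.
    by rewrite [_ ^+ N]exprAC (prim_expr_order pz) expr1n mulr1.
  rewrite E (prim_root_sum pz) //.
  case: (nat_of_ord k) k1 (ltn_ord k) => [|[|k']] //= _ kn.
    by rewrite add0n gtnNdvd // -ltnS ?prednK // ; apply: leq_trans nN.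
  rewrite addSn -addnS prednK // dvdn_addl ?dvdnn // gtnNdvd //.
  by apply: ltn_trans nN; rewrite ltnS; apply: ltnW.
have : nm (((iter n.-1 A (B x)) *+ n) *+ N) <= M *+ N.
  rewrite -key; apply: le_trans (nm_sum _ _ _) _.
  rewrite -[N in leRHS]card_ord -sumr_const; apply: ler_sum => j _.
  have nzj : nm (z ^+ j) = 1 by rewrite nmX nz expr1n.
  by rewrite nmZ expr1 nmV nzj invr1 mul1r bM.
by rewrite nmMn nmMn lerMn2r (gtn_eqF N0).
Qed.

End Cauchy.

(** * Numerical radius and operator norm *)

Section Operator.
Context {R : realType}.
Local Notation C := (R[i]).
Variable V : normedModType C.

Lemma bernoulliB (q : R) m : 0 <= q <= 1 -> 1 - m%:R * q <= (1 - q) ^+ m.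
Proof.
move=> /andP[q0 q1]; elim: m => [|m IH]; first by rewrite mul0r subr0.
rewrite exprS; apply: le_trans (ler_wpM2l _ IH); last by rewrite subr_ge0.
rewrite -natr1; have : 0 <= m%:R * q ^+ 2 by rewrite mulr_ge0 // sqr_ge0.
lra.
Qed.

(** Bernoulli's inequality for [1 - q] together with [(1 + q) (1 - q) <= 1]; it bounds the
    accumulated second-order errors. *)
Lemma pow_bound (q : R) (n : nat) : 0 <= q -> n%:R * q <= 1 ->
  (1 + q) ^+ n * (1 - n%:R * q) <= 1.
Proof.
case: n => [|n] q0 nq; first by rewrite mul0r subr0 mulr1.
have q1 : q <= 1.
  by apply: le_trans nq; rewrite ler_peMl // ler1n.
apply: (@le_trans _ _ ((1 + q) ^+ n.+1 * (1 - q) ^+ n.+1)).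
  by rewrite ler_wpM2l ?exprn_ge0 ?addr_ge0 // bernoulliB // q0.
rewrite -exprMn; apply: exprn_ile1.
  by apply: mulr_ge0; [rewrite addr_ge0|rewrite subr_ge0].
have -> : (1 + q) * (1 - q) = 1 - q ^+ 2 by ring.
by rewrite lerBlDr lerDl sqr_ge0.
Qed.

Lemma le_eps (a b c : R) : (forall e, 0 < e -> a <= b + e * c) -> a <= b.
Proof.
move=> h; apply/ler_addgt0Pr => e e0; have c1 : 0 < `|c| + 1 by rewrite ltr_wpDl.
apply: le_trans (h (e / (`|c| + 1)) _) _; first by rewrite divr_gt0.
rewrite lerD2l -mulrA ler_piMr ?(ltW e0) // [_^-1 * _]mulrC ler_pdivrMr // mul1r.
by have := ler_norm c; lra.
Qed.

Lemma archi_lt (a : R) : exists2 n : nat, (0 < n)%N & a < n%:R.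
Proof.
exists (Num.bound `|a|).+1 => //; have := archi_boundP (normr_ge0 a).
by rewrite -natr1; have := ler_norm a; lra.
Qed.

Definition opbound (T : V -> V) (K : R) := forall x, nm (T x) <= K * nm x.

(* Only one support functional per vector is needed, and only along the stable
   subspace [P]. *)
Lemma numerical_radius_bound (S : {linear V -> V}) (P : V -> Prop) (K v : R) :
  0 <= K -> 0 <= v -> opbound S K ->
  (forall a x y, P x -> P y -> P (a *: x + y)) -> (forall x, P x -> P (S x)) ->
  (forall x, P x -> exists2 f, dualpair x f & nm (f (S x) : C) <= v * nm x) ->
  forall x, P x -> nm (S x) <= 4 * v * nm x.
Proof.
move=> K0 v0 SK Plin PS num x Px.
apply: (@le_eps _ _ (4 * nm x)) => e e0.
rewrite (_ : 4 * v * nm x + e * (4 * nm x) = 4 * (v + e) * nm x); last by ring.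
set u := v + e; have u0 : 0 < u by rewrite ltr_wpDl.
(* With [c v < 1/2] the Euler products [(1 + w c S / n)^n] have norm at most 2 at unit vectors, for
   all [w] of modulus 1. Cauchy's estimate for the coefficient of [w] then reads [c |S x| <= 2 |x|],
   which is the constant 4. *)
pose c := (2 * u)^-1; have c0 : 0 < c by rewrite invr_gt0 mulr_gt0.
have step (w : C) (n : nat) y : P y -> nm w = 1 -> (0 < n)%N ->
    nm (y + (w * (c / n%:R)%:C) *: S y) * (1 - c * v / n%:R) <=
    (1 + (c * K) ^+ 2 / n%:R ^+ 2) * nm y.
  move=> Py nw n0; have nR : 0 < n%:R :> R by rewrite ltr0n.
  set a := w * _; have na : nm a = c / n%:R.
    by rewrite nmM nw mul1r nmRp // divr_ge0 // ltW.
  set z := y + _; have Pz : P z by rewrite /z addrC; apply: Plin => //; exact: PS.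
  have [f [f1 fz] fS] := num z Pz.
  (* Applying [1 - a S] to [z = (1 + a S) y] leaves a second-order error only, while the supporting
     functional of [z] shows that [1 - a S] shrinks [z] at most by the factor [1 - c v / n]. *)
  have E : z - a *: S z = y - (a * a) *: S (S y).
    by rewrite /z (opD S) (opZ S) scalerDr scalerA opprD addrA addrK.
  have lo : nm z * (1 - c * v / n%:R) <= nm (z - a *: S z).
    apply: le_trans (dual_le1 _ f1); rewrite dualB dualZ fz.
    apply: le_trans (nmBD _ _); rewrite nmRp ?nm_ge0 // nmM na mulrBr mulr1.
    rewrite lerD2l lerN2 (_ : nm z * (c * v / n%:R) = c / n%:R * (v * nm z)); last by ring.
    by rewrite ler_wpM2l // divr_ge0 // ltW.
  apply: le_trans lo _; rewrite E; apply: le_trans (nmB _ _) _.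
  rewrite mulrDl mul1r lerD2l nmZ nmM na.
  apply: (@le_trans _ _ (c / n%:R * (c / n%:R) * (K * (K * nm y)))).
    have cn0 : 0 <= c / n%:R by rewrite divr_ge0 // ltW.
    apply: ler_wpM2l; first exact: mulr_ge0.
    by apply: le_trans (SK _) _; rewrite ler_wpM2l.
  by rewrite le_eqVlt; apply/orP; left; apply/eqP; field; rewrite gt_eqF.
have cv : c * v < 2^-1.
  by rewrite /c invfM -mulrA gtr_pMr ?invr_gt0 // mulrC ltr_pdivrMr // mul1r ltrDl.
have cv0 : 0 <= c * v by rewrite mulr_ge0 // ltW.
suff main : c * nm (S x) <= 2 * nm x.
  rewrite -ler_pdivlMl // invrK in main.
  by apply: le_trans main _; rewrite -!mulrA; lra.
(* So many steps that the total error [(c K)^2 / n] fits into the gap [1/2 - c v]. *)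
have [n n0 nbig] := archi_lt ((c * K) ^+ 2 / (2^-1 - c * v) + (c * K) ^+ 2 + c * v).
have nR : 0 < n%:R :> R by rewrite ltr0n.
have cK2 : 0 <= (c * K) ^+ 2 by exact: sqr_ge0.
have gap : 0 < 2^-1 - c * v by rewrite subr_gt0.
have q1 : (c * K) ^+ 2 / (2^-1 - c * v) < n%:R.
  by apply: le_lt_trans nbig; rewrite -addrA lerDl addr_ge0.
have q2 : (c * K) ^+ 2 < n%:R.
  apply: le_lt_trans nbig; rewrite addrAC lerDr addr_ge0 // divr_ge0 // ltW //.
have cvn : c * v / n%:R <= 1.
  rewrite ler_pdivrMr // mul1r; apply: le_trans (ltW cv) _.
  by rewrite (@le_trans _ _ 1) ?ler1n // invf_le1 // ler1n.
pose q := (c * K) ^+ 2 / n%:R ^+ 2.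
have q0 : 0 <= q by rewrite divr_ge0 // exprn_ge0 // ltW.
have nq : n%:R * q = (c * K) ^+ 2 / n%:R by rewrite /q; field; rewrite gt_eqF.
pose t : C := (c / n%:R)%:C.
have iterP w m y : P y -> P (iter m (fun y => y + w *: (t *: S y)) y).
  move=> Py; elim: m => //= m IH; rewrite addrC scalerA; apply: Plin => //; exact: PS.
have itb (w : C) m y : P y -> nm w = 1 ->
    nm (iter m (fun y => y + w *: (t *: S y)) y) * (1 - c * v / n%:R) ^+ m <=
    (1 + q) ^+ m * nm y.
  move=> Py nw; elim: m => [|m IH]; first by rewrite !expr0 mulr1 mul1r.
  have := step w n _ (iterP w m y Py) nw n0; rewrite -[w * _ *: _]scalerA => h.
  rewrite iterS !exprS.
  rewrite mulrA; apply: (@le_trans _ _ ((1 + q) * nm (iter m (fun y => y + w *: (t *: S y)) y) * (1 - c * v / n%:R) ^+ m)).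
    by rewrite ler_wpM2r // exprn_ge0 // subr_ge0.
  by rewrite -mulrA -[leRHS]mulrA; apply: ler_wpM2l => //; rewrite addr_ge0.
have := @cauchy_estimate R V idfun (t \*: S) n x (2 * nm x) n0 (fun=> erefl).
have -> : nm (iter n.-1 idfun ((t \*: S) x)) *+ n = c * nm (S x).
  have -> : iter n.-1 idfun ((t \*: S) x) = t *: S x by elim: n.-1.
  rewrite nmZp ?divr_ge0 ?ltW // -mulr_natl; field; rewrite gt_eqF //.
apply=> w nw; have := itb w n x Px nw.
set Y := nm _ => hY; change (Y <= 2 * nm x).
have Y0 : 0 <= Y by exact: nm_ge0.
have b1 : 1 - c * v <= (1 - c * v / n%:R) ^+ n.
  have cvn0 : 0 <= c * v / n%:R <= 1 by rewrite cvn andbT divr_ge0 // ltW.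
  have := bernoulliB n cvn0.
  by rewrite [n%:R * _]mulrCA mulfV ?mulr1 // gt_eqF.
have nq1 : n%:R * q <= 1 by rewrite nq ler_pdivrMr // mul1r ltW.
have b2 := pow_bound q0 nq1.
have b3 : 2^-1 <= (1 - c * v) * (1 - n%:R * q).
  have : (c * K) ^+ 2 / n%:R <= 2^-1 - c * v.
    by move: q1; rewrite ltr_pdivrMr // => q1; rewrite ler_pdivrMr // [leRHS]mulrC ltW.
  rewrite -nq; have : 0 <= (c * v) * (n%:R * q).
    by apply: mulr_ge0 => //; apply: mulr_ge0 => //; exact: ltW.
  lra.
have n1 : 0 <= 1 - n%:R * q by rewrite subr_ge0.
have : Y * 2^-1 <= nm x.
  apply: (@le_trans _ _ (Y * ((1 - c * v) * (1 - n%:R * q)))).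
    by rewrite ler_wpM2l.
  apply: (@le_trans _ _ ((1 + q) ^+ n * nm x * (1 - n%:R * q))).
    rewrite mulrA ler_wpM2r //; apply: le_trans hY; by rewrite ler_wpM2l.
  by rewrite mulrAC ler_piMl ?nm_ge0.
lra.
Qed.

End Operator.

(** * Hermitian operators bounded below *)

Section Hermitian.
Context {R : realType}.
Local Notation C := (R[i]).
Variable V : normedModType C.

Definition mklin (f : V -> V) (H : linear f) : {linear V -> V} :=
  HB.pack f (GRing.isLinear.Build C V V *:%R f H).

Definition hermop (T : V -> V) :=
  forall x f, dualpair x f -> complex.Im (f (T x) : C) = 0.

Definition accretive (T : V -> V) :=
  forall x f, dualpair x f -> 0 <= complex.Re (f (T x) : C).

Lemma dualpair_scale (x : V) f (a : R) : 0 <= a -> dualpair x f ->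
  dualpair (a%:C *: x) f.
Proof.
by move=> a0 [f1 fx]; split=> //; rewrite dualZ fx nmZp // rmorphM.
Qed.

Lemma hermitian_hermop (T : {linear V -> V}) : hermitian_operator T -> hermop T.
Proof.
move=> hT x f [f1 fx]; have [->|x0] := eqVneq x 0; first by rewrite op0 dual0.
have nx : 0 < nm x.
  by rewrite lt_neqAle nm_ge0 andbT eq_sym; apply: contra_neq x0; exact: nm_eq0.
have nf : nm f = 1.
  apply/eqP; rewrite eq_le f1 /= -(ler_pM2r nx) mul1r.
  by apply: le_trans (dual_le f x); rewrite fx nmRp // ltW.
pose y := (nm x)^-1%:C *: x.
have ny : nm y = 1 by rewrite nmZp ?invr_ge0 ?ltW // mulVf ?gt_eqF.
have fy : f y = 1.
  by rewrite /y [LHS]dualZ fx -rmorphM mulVf ?gt_eqF.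
have := hT y f; rewrite !nmE ny nf => /(_ erefl erefl fy).
rewrite RealE /y (opZ T) [f _]dualZ ImMr mulf_eq0 invr_eq0 (gt_eqF nx) /=.
by move/eqP.
Qed.

Variables (S : {linear V -> V}) (K : R).
Hypotheses (K0 : 0 <= K) (SK : opbound S K) (hS : hermop S).

(** [1 + g^2 S^2] is the product of [1 + i g S] and [1 - i g S], and each factor expands norms since
    a supporting functional sees its second term as purely imaginary. *)
Lemma hermop_expand (g : R) x : nm x <= nm (x + (g ^+ 2)%:C *: S (S x)).
Proof.
have one (h : R) y : nm y <= nm (y + ('i * h%:C) *: S y).
  have [f [f1 fy]] := norming y; have := hS (conj f1 fy) => im.
  apply: le_trans (dual_le1 _ f1); rewrite dualD dualZ fy.
  apply: le_trans (Re_le_nm _); case: (f (S y) : C) im => a b /= ->.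
  lra.
have := one g (x + ('i * (- g)%:C) *: S x); rewrite (opD S) (opZ S).
have -> : x + ('i * (- g)%:C) *: S x + ('i * g%:C) *: (S x + ('i * (- g)%:C) *: S (S x)) =
    x + (g ^+ 2)%:C *: S (S x).
  have ii : 'i * g%:C * ('i * (- g)%:C) = (g ^+ 2)%:C :> C.
    by apply/eqP; rewrite eq_complex /=; apply/andP; split; apply/eqP; ring.
  rewrite scalerDr scalerA ii; vec.
by apply: le_trans; exact: one.
Qed.

Hypothesis aS : accretive S.

(** [1 + z S] expands norms when [S] is hermitian and accretive and [z] has non-negative real part;
    applied to [y = (1 - z S) x] it gives [x - z^2 S^2 x]. *)
Lemma accretive_step (z : C) x : 0 <= complex.Re z ->
  nm (x - z *: S x) <= (1 + (nm z * K) ^+ 2) * nm x.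
Proof.
move=> rz; set y := x - _; have [f [f1 fy]] := norming y.
have E : y + z *: S y = x - (z * z) *: S (S x).
  by rewrite /y (opB S) (opZ S) scalerBr scalerA addrA subrK.
apply: (@le_trans _ _ (nm (y + z *: S y))).
  apply: le_trans (dual_le1 _ f1); rewrite dualD dualZ fy.
  apply: le_trans (Re_le_nm _).
  have := hS (conj f1 fy); have := aS (conj f1 fy).
  rewrite ReD /= lerDl; case: (f (S y) : C) => a b /= a0 ->.
  by case: (z) rz => p q /= p0; rewrite mulr0 subr0 mulr_ge0.
rewrite E; apply: le_trans (nmB _ _) _; rewrite mulrDl mul1r lerD2l nmZ nmM.
rewrite exprMn -expr2 -[leRHS]mulrA; apply: ler_wpM2l; first exact: sqr_ge0.
by apply: le_trans (SK _) _; rewrite expr2 -mulrA ler_wpM2l.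
Qed.

(* The sequence [j |-> |(1 - h S)^j x|] is almost convex, because
   [(1 - h S)^2 + 1] is [2 + h^2 S^2] applied to [1 - h S] up to third order
   and the latter factor is expansive; so its initial decrease dominates its
   average decrease, which the lower bound on [S] and the Cauchy estimate make
   uniform. *)
Lemma hermitian_gap (k : R) : 0 < k -> (forall z, k * nm z <= nm (S z)) ->
  exists2 d : R, 0 < d & forall x f, dualpair x f -> d * nm x <= complex.Re (f (S x) : C).
Proof.
(* The total time [4 / k] is what makes the sequence drop to one half: the Cauchy estimate bounds
   [t] times the norm of [S A^(m-1) x] by [2 |x|], and [t k = 4]. The number of steps [m] is then
   large enough to make the quadratic and cubic errors small. *)
move=> k0 Sk; pose t := 4 / k; have t0 : 0 < t by rewrite divr_gt0.
have [m m0 mbig] := archi_lt (8 * (t * K) ^+ 2 + 8 * (t * K) ^+ 3).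
have mR : 0 < m%:R :> R by rewrite ltr0n.
have tK2 : 0 <= (t * K) ^+ 2 by exact: sqr_ge0.
have tK3 : 0 <= (t * K) ^+ 3 by rewrite exprn_ge0 // mulr_ge0 // ltW.
pose h := t / m%:R; have h0 : 0 < h by rewrite divr_gt0.
have Alin : linear (fun x : V => x - h%:C *: S x).
  move=> a x y; rewrite linearP scalerDr opprD !scalerA [h%:C * a]mulrC -scalerA.
  by rewrite addrACA -scalerBr.
pose A := mklin Alin; have AE x : A x = x - h%:C *: S x by [].
have AS y : A (S y) = S (A y) by rewrite !AE (opB S) (opZ S).
pose q := (2 * h * K) ^+ 2; have q0 : 0 <= q by exact: sqr_ge0.
have mq : m%:R * q = 4 * (t * K) ^+ 2 / m%:R.
  by rewrite /q /h; field; rewrite gt_eqF.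
have mq2 : m%:R * q <= 2^-1.
  rewrite mq ler_pdivrMr // -ler_pdivrMl ?invr_gt0 // invrK mulrA.
  by apply: ltW; apply: le_lt_trans mbig; lra.
have two j : (j <= m)%N -> (1 + q) ^+ j <= 2.
  move=> jm; apply: (@le_trans _ _ ((1 + q) ^+ m)).
    by apply: ler_weXn2l => //; rewrite lerDl.
  have := @pow_bound _ q m q0; move=> /(_ (le_trans mq2 _)).
  rewrite invf_le1 // ler1n => /(_ isT).
  have p0 : 0 <= (1 + q) ^+ m by rewrite exprn_ge0 // addr_ge0.
  move=> H; rewrite -[leLHS](mulfK (_ : 2^-1 != 0 :> R)) ?invr_eq0 // invrK.
  apply: (@le_trans _ _ ((1 + q) ^+ m * (1 - m%:R * q) * 2)); last lra.
  by rewrite ler_pM2r // ler_wpM2l //; lra.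
have itA (z : C) j x : (j <= m)%N -> 0 <= complex.Re z -> nm z <= 2 * h ->
    nm (iter j (fun y => y - z *: S y) x) <= 2 * nm x.
  move=> jm rz nz; apply: (@le_trans _ _ ((1 + q) ^+ j * nm x)); last first.
    by apply: ler_wpM2r; [exact: nm_ge0|exact: two].
  elim: j {jm} => [|j IH]; first by rewrite expr0 mul1r.
  rewrite iterS exprS -mulrA; apply: le_trans (accretive_step _ rz) _.
  apply: ler_pM => //; first by rewrite addr_ge0 // sqr_ge0.
    exact: nm_ge0.
  rewrite lerD2l /q; apply: sqr_le; first by rewrite mulr_ge0 ?nm_ge0.
  exact: ler_wpM2r.
(* Cauchy's estimate for [A + w B] with [B = - h S], that is for [1 - (1 + w) h S]; here [1 + w] has
   non-negative real part, so [accretive_step] still bounds the iterates. *)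
have half x : nm (iter m.-1 A x) <= 2^-1 * nm x.
  have Blin : linear (fun x : V => - (h%:C *: S x)).
    by move=> a y z; rewrite linearP scalerDr opprD !scalerA [h%:C * a]mulrC -scalerA -scalerN.
  have AB y : A (mklin Blin y) = mklin Blin (A y).
    by rewrite /= (opB S) (opN S) (opZ S); vec.
  have := @cauchy_estimate R V A (mklin Blin) m x (2 * nm x) m0 AB.
  have -> : nm (iter m.-1 A (mklin Blin x)) *+ m = t * nm (S (iter m.-1 A x)).
    have -> : mklin Blin x = - h%:C *: S x by rewrite scaleNr.
    have -> : iter m.-1 A (- h%:C *: S x) = - h%:C *: iter m.-1 A (S x).
      by elim: m.-1 => // j; rewrite !iterS => ->; rewrite (opZ A).
    rewrite (iter_comm _ _ AS) scaleNr nmN nmZp ?(ltW h0) // -mulr_natl /h mulrA.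
    by rewrite mulrCA mulfV ?gt_eqF // mulr1.
  have bd : forall w : C, nm w = 1 ->
      nm (iter m (fun y => A y + w *: mklin Blin y) x) <= 2 * nm x.
    move=> w nw; have -> : iter m (fun y => A y + w *: mklin Blin y) x =
        iter m (fun y => y - (h%:C + w * h%:C) *: S y) x.
      apply: eq_iter => y; rewrite AE /= scalerN scalerA scalerDl opprD addrA.
      by [].
    apply: itA => //.
      rewrite ReD [w * _]mulrC ReMr /=; have := Re_nm w; rewrite nw ler_norml => /andP[w1 _].
      by have := ltW h0; nra.
    apply: le_trans (nmD _ _) _; rewrite nmM nw nmRp ?(ltW h0) //; lra.
  move=> /(_ bd) H.
  have := Sk (iter m.-1 A x); rewrite -(ler_pM2l t0) => /le_trans/(_ H).
  rewrite mulrA /t divfK ?gt_eqF // => H4; lra.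
(* The sequence loses at least [|x| / 2]; one half of that pays for the cubic errors, and the
   remaining [|x| / 4] is at most [t] times the real part of [f (S x)]. *)
exists (4 * t)^-1; first by rewrite invr_gt0 mulr_gt0.
move=> x f [f1 fx].
pose c j := nm (iter j A x).
have c2 j : (j <= m)%N -> c j <= 2 * nm x.
  move=> jm; have := @itA h%:C j x jm (ltW h0); rewrite nmRp ?(ltW h0) //; apply.
  by have := h0; lra.
have conv j : 2 * c j.+1 <= c j.+2 + c j + (h * K) ^+ 3 * c j.
  rewrite /c !iterS; set w := iter j A x.
  have e := hermop_expand (h / Num.sqrt 2) (A w).
  have hs : (h / Num.sqrt 2) ^+ 2 = h ^+ 2 / 2 by rewrite expr_div_n sqr_sqrtr.
  rewrite hs in e.
  have E : 2 *: (A w + (h ^+ 2 / 2)%:C *: S (S (A w))) =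
      (A (A w) + w) - (h ^+ 3)%:C *: S (S (S w)).
    have -> : S (S (A w)) = S (S w) - h%:C *: S (S (S w)).
      by rewrite AE !(opB S) !(opZ S).
    rewrite [A (A w)]AE (_ : S (A w) = S w - h%:C *: S (S w)); last first.
      by rewrite AE (opB S) (opZ S).
    rewrite AE; vecf.
  have : 2 * nm (A w) <= nm (A (A w) + w - (h ^+ 3)%:C *: S (S (S w))).
    rewrite -E nmZ -(rmorph_nat (real_complex R)) nmRp ?ler0n //.
    by rewrite ler_pM2l.
  move=> /le_trans; apply; apply: le_trans (nmB _ _) _; apply: lerD.
    exact: nmD.
  have h3 : 0 <= h ^+ 3 by rewrite exprn_ge0 // ltW.
  have S3 : nm (S (S (S w))) <= K * (K * (K * nm w)).
    apply: le_trans (SK _) _; apply: ler_wpM2l => //.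
    by apply: le_trans (SK _) _; apply: ler_wpM2l.
  rewrite nmZp // (_ : (h * K) ^+ 3 * nm w = h ^+ 3 * (K * (K * (K * nm w)))); last by ring.
  exact: ler_wpM2l.
pose E := (h * K) ^+ 3 * (2 * nm x).
have E0 : 0 <= E.
  by rewrite /E; nneg.
have dj j : (j <= m)%N -> c j - c j.+1 <= c 0%N - c 1%N + j%:R * E.
  elim: j => [|j IH] jm; first by rewrite mul0r addr0.
  have := IH (ltnW jm); have := conv j; rewrite -natr1.
  have : (h * K) ^+ 3 * c j <= E.
    by apply: ler_wpM2l; [nneg|apply: c2; exact: ltnW].
  lra.
have tele j : (j <= m)%N -> c 0%N - c j <= j%:R * (c 0%N - c 1%N) + j%:R ^+ 2 * E.
  elim: j => [|j IH] jm; first by rewrite subrr !mul0r expr0n mul0r addr0.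
  have := IH (ltnW jm); have := dj j (ltnW jm); rewrite -natr1.
  have : 0 <= (j%:R : R) by rewrite ler0n.
  have : 0 <= j%:R * E by rewrite mulr_ge0.
  nra.
have := tele m.-1 (leq_pred m); have -> : c 0%N = nm x by [].
have := half x; rewrite -/(c m.-1) => hc.
have d0 : nm x - c 1%N <= h * complex.Re (f (S x) : C).
  have : complex.Re (f (A x) : C) <= c 1%N.
    by apply: le_trans (Re_le_nm _) _; exact: dual_le1.
  rewrite AE dualB dualZ ReB ReMr fx /=; lra.
have m2E : m%:R ^+ 2 * E <= 4^-1 * nm x.
  have -> : m%:R ^+ 2 * E = (8 * (t * K) ^+ 3) / m%:R * (4^-1 * nm x).
    by rewrite /E /h; field; rewrite gt_eqF.
  rewrite ler_piMl ?mulr_ge0 ?nm_ge0 // ler_pdivrMr // mul1r; apply: ltW.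
  by apply: le_lt_trans mbig; lra.
set M : R := m.-1%:R; have M0 : 0 <= M by rewrite ler0n.
have Mm : M <= m%:R by rewrite ler_nat leq_pred.
have M2 : M ^+ 2 * E <= m%:R ^+ 2 * E.
  by apply: ler_wpM2r => //; rewrite ler_pXn2r ?nnegrE ?ler0n.
have r0 := aS (conj f1 fx); set r := complex.Re _ in d0 r0 *.
have Mr : M * (h * r) <= t * r.
  rewrite mulrA; apply: ler_wpM2r => //.
  by rewrite -[leRHS](divfK (lt0r_neq0 mR)) -/h mulrC; apply: ler_wpM2l => //; exact: ltW.
have Md : M * (nm x - c 1%N) <= M * (h * r) by apply: ler_wpM2l.
move=> H; rewrite invfM -mulrA mulrCA ler_pdivrMl //; lra.
Qed.

End Hermitian.

(** * From non-negative spectrum to non-negative numerical range *)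

Section Spectrum.
Context {R : realType}.
Local Notation C := (R[i]).
Variable V : completeNormedModType C.

Lemma lin_opbound (T : {linear V -> V}) : continuous T ->
  exists2 K, 0 <= K & opbound T K.
Proof.
move=> cT; have [_ /(_ cT)] := @linear_bounded_continuous _ _ _ T.
move=> /linear_boundedP/pinfty_ex_gt0[M M0 TM]; exists (complex.Re M).
  exact/Re_ge0/ltW.
by move=> x; rewrite -lecR rmorphM /= -!nmE (ReK (ltW M0)).
Qed.

(** The bottom [m] of the numerical range belongs to the spectrum if it is negative: otherwise
    [T - m] would be accretive and bounded below, and [hermitian_gap] would move its numerical range
    above a positive number, against the choice of [m]. *)
Lemma spectrum_accretive (T : {linear V -> V}) (K : R) : 0 <= K -> opbound T K ->
  hermop T -> (forall l, spectrum T l -> 0 <= l) -> accretive T.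
Proof.
move=> K0 TK hT sT x0 f0 d0; rewrite leNgt; apply/negP => neg.
pose VS := [set r : R | exists x f, [/\ dualpair x f, nm x = 1 &
  r = complex.Re (f (T x) : C)]].
have unit (x : V) (f : dual V) : dualpair x f -> x != 0 ->
    exists y, [/\ dualpair y f, nm y = 1, 0 < nm x & x = (nm x)%:C *: y].
  move=> dx xn0; have nx : 0 < nm x.
    by rewrite lt_neqAle nm_ge0 andbT eq_sym; apply: contra_neq xn0; exact: nm_eq0.
  exists ((nm x)^-1%:C *: x); split=> //.
  - by apply: dualpair_scale => //; rewrite invr_ge0 ltW.
  - by rewrite nmZp ?invr_ge0 ?(ltW nx) // mulVf ?gt_eqF.
  - by rewrite scalerA -rmorphM mulfV ?gt_eqF // scale1r.
have hi : has_inf VS.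
  split; last first.
    exists (- K) => _ [x [f [[f1 fx] nx ->]]].
    have : nm (f (T x) : C) <= K.
      by apply: le_trans (dual_le1 _ f1) _; apply: le_trans (TK _) _; rewrite nx mulr1.
    by have := Re_nm (f (T x) : C); rewrite ler_norml => /andP[]; lra.
  have [x00|x00] := eqVneq x0 0.
    by move: neg; rewrite x00 op0 dual0 ltxx.
  have [y [dy ny _ _]] := unit _ _ d0 x00.
  by exists (complex.Re (f0 (T y) : C)), y, f0.
set m := inf VS.
have mle (x : V) (f : dual V) : dualpair x f -> m * nm x <= complex.Re (f (T x) : C).
  move=> dx; have [->|xn0] := eqVneq x 0; first by rewrite nm0 mulr0 op0 dual0.
  have [y [dy ny nx ->]] := unit _ _ dx xn0.
  rewrite nmZp ?nm_ge0 // ny mulr1 (opZ T) dualZ ReMr mulrC.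
  apply: ler_wpM2l; first exact: ltW.
  by apply: ge_inf; [exact: hi.2|exists y, f].
have m0 : m < 0.
  rewrite ltNge; apply/negP => m0; have := mle _ _ d0.
  have : 0 <= m * nm x0 by rewrite mulr_ge0 ?nm_ge0.
  lra.
have Slin : linear (fun x : V => T x - m%:C *: x).
  move=> a x y; rewrite linearP scalerDr opprD !scalerA [m%:C * a]mulrC -scalerA.
  by rewrite addrACA -scalerBr.
pose S := mklin Slin; have SE x : S x = T x - m%:C *: x by [].
have SK : opbound S (K + `|m|).
  move=> x; rewrite SE; apply: le_trans (nmB _ _) _.
  by rewrite mulrDl nmZR lerD2r; exact: TK.
have KS0 : 0 <= K + `|m| by rewrite addr_ge0.
have hS : hermop S.
  move=> x f dx; rewrite SE dualB dualZ dx.2 -rmorphM.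
  by rewrite (raddfB (@complex.Im R)) /= (hT _ _ dx) subr0.
have aS : accretive S.
  move=> x f dx; rewrite SE dualB dualZ dx.2 -rmorphM ReB /= subr_ge0.
  exact: mle.
have : ~ spectrum T m%:C by move/sT; rewrite lecR leNgt m0.
move/contrapT => [U [Ulin Uc U1 _]].
have [K' K'0 UK] := lin_opbound (Uc : continuous (mklin Ulin)).
have k0 : 0 < (K' + 1)^-1 by rewrite invr_gt0 ltr_wpDl.
have Sk z : (K' + 1)^-1 * nm z <= nm (S z).
  rewrite ler_pdivrMl ?ltr_wpDl // -{1}(U1 z).
  apply: le_trans (UK _) _; rewrite -(nmN (_ - _)) opprB -SE.
  by apply: ler_wpM2r; rewrite ?nm_ge0 // lerDl.
have [d dpos dS] := hermitian_gap KS0 SK hS aS k0 Sk.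
suff : m + d <= m by rewrite gerDl leNgt dpos.
apply: lb_le_inf; first exact: hi.1.
move=> _ [x [f [dx nx ->]]]; have := dS _ _ dx; rewrite SE dualB dualZ dx.2.
rewrite -rmorphM ReB /= nx !mulr1; lra.
Qed.

End Spectrum.

(** * Moment functionals *)

Section Moments.
Context {R : realType}.
Implicit Types (p q g s l : {poly R}) (F : {poly R} -> R).

Definition lfun F := forall a p q, F (a *: p + q) = a * F p + F q.

Lemma lfunD F p q : lfun F -> F (p + q) = F p + F q.
Proof. by move=> lF; have := lF 1 p q; rewrite scale1r mul1r. Qed.
Lemma lfun0 F : lfun F -> F 0 = 0.
Proof. by move=> lF; have := lfunD 0 0 lF; rewrite addr0 => h; lra. Qed.
Lemma lfunZ F a p : lfun F -> F (a *: p) = a * F p.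
Proof. by move=> lF; have := lF a p 0; rewrite lfun0 // !addr0. Qed.
Lemma lfunN F p : lfun F -> F (- p) = - F p.
Proof. by move=> lF; rewrite -scaleN1r lfunZ // mulN1r. Qed.
Lemma lfunB F p q : lfun F -> F (p - q) = F p - F q.
Proof. by move=> lF; rewrite lfunD // lfunN. Qed.

Lemma discr_le (a b c : R) : (forall t, 0 <= a + 2 * t * b + t ^+ 2 * c) ->
  b ^+ 2 <= a * c.
Proof.
move=> h; have a0 : 0 <= a by have := h 0; lra.
have [c0|c0|c0] := ltgtP c 0.
- set d := a / - c; have dc : a = - (d * c) by rewrite /d; field; rewrite lt_eqF.
  have d0 : 0 <= d by rewrite /d divr_ge0 // oppr_ge0 ltW.
  have h1 := h (d + 1); have h2 := h (- (d + 1)); exfalso.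
  have : 0 < - c * (d ^+ 2 + d + 1) by rewrite mulr_gt0 ?oppr_gt0 //; nra.
  nra.
- have := h (- b / c).
  have -> : a + 2 * (- b / c) * b + (- b / c) ^+ 2 * c = (a * c - b ^+ 2) / c.
    by field; rewrite gt_eqF.
  by rewrite pmulr_lge0 ?invr_gt0 // subr_ge0.
- have [->|b0] := eqVneq b 0; first by rewrite expr0n c0 mulr0.
  have := h (- (a + 1) / (2 * b)); rewrite c0 mulr0 addr0.
  have -> : a + 2 * (- (a + 1) / (2 * b)) * b = - 1 by field.
  lra.
Qed.

Lemma psd_CS F p q : lfun F -> (forall p, 0 <= F (p ^+ 2)) ->
  F (p * q) ^+ 2 <= F (p ^+ 2) * F (q ^+ 2).
Proof.
move=> lF pF; apply: discr_le => t; have := pF (p + t *: q).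
have -> : (p + t *: q) ^+ 2 = (2 * t) *: (p * q) + ((t ^+ 2) *: q ^+ 2 + p ^+ 2).
  by rewrite -!mul_polyC !rmorphM rmorph_nat /=; ring.
rewrite lF lF; lra.
Qed.

(* Along powers of [s] the moments are log-convex, so a geometric bound on a
   subsequence already bounds their first ratio. *)
Lemma psd_growth F s (r : R) : lfun F -> (forall p, 0 <= F (p ^+ 2)) -> 0 < r ->
  (forall g, exists c : R, forall N0, exists2 N, (N0 <= N)%N &
    F ((s ^+ N * g) ^+ 2) <= c * r ^+ (2 * N)) ->
  forall g, `|F (s * g ^+ 2)| <= r * F (g ^+ 2).
Proof.
move=> lF pF r0 gr g; pose f j := F ((s ^+ j * g) ^+ 2).
have f0 j : 0 <= f j by exact: pF.
have lc j : f j.+1 ^+ 2 <= f j * f j.+2.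
  have := psd_CS (s ^+ j * g) (s ^+ j.+2 * g) lF pF.
  have -> : s ^+ j * g * (s ^+ j.+2 * g) = (s ^+ j.+1 * g) ^+ 2.
    by rewrite !exprS; ring.
  by [].
have key : f 1%N <= r ^+ 2 * f 0%N.
  rewrite leNgt; apply/negP => f1.
  have r2 : 0 < r ^+ 2 by rewrite exprn_gt0.
  have f00 : 0 < f 0%N.
    rewrite lt_neqAle f0 andbT; apply/eqP => f00.
    have := lc 0%N; rewrite -f00 mul0r => h.
    have : f 1%N = 0 by apply/eqP; rewrite -sqrf_eq0 eq_le h sqr_ge0.
    by move=> f10; move: f1; rewrite -f00 mulr0 f10 ltxx.
  pose rho := f 1%N / f 0%N.
  have rho_r : r ^+ 2 < rho by rewrite ltr_pdivlMr.
  have rho0 : 0 < rho by apply: lt_trans rho_r.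
  have gro j : 0 < f j /\ rho * f j <= f j.+1.
    elim: j => [|j [fj fj1]]; first by rewrite /rho divfK // gt_eqF.
    have fj10 : 0 < f j.+1 by apply: lt_le_trans fj1; rewrite mulr_gt0.
    split=> //; rewrite -(ler_pM2l fj); apply: le_trans (lc j).
    by rewrite expr2 mulrA; apply: ler_wpM2r; [exact: ltW|rewrite mulrC].
  have gp j : f 0%N * rho ^+ j <= f j.
    elim: j => [|j IH]; first by rewrite expr0 mulr1.
    apply: le_trans (gro j).2; rewrite exprS mulrCA; apply: ler_wpM2l => //; exact: ltW.
  have [c hc] := gr g; pose th := rho / r ^+ 2.
  have th1 : 1 < th by rewrite ltr_pdivlMr // mul1r.
  have [n0 _ nbig] := archi_lt (c / f 0%N / (th - 1)).
  have [N nN hN] := hc n0.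
  have : f 0%N * rho ^+ N <= c * r ^+ (2 * N) by apply: le_trans (gp N) _.
  have -> : rho ^+ N = th ^+ N * r ^+ (2 * N).
    by rewrite exprM -exprMn /th divfK // gt_eqF.
  rewrite mulrA ler_pM2r ?exprn_gt0 // -ler_pdivlMl // mulrC => thN.
  have bern : N%:R * (th - 1) <= th ^+ N.
    have : 1 + N%:R * (th - 1) <= th ^+ N.
      elim: {nN hN thN} N => [|N IH]; first by rewrite mul0r addr0.
      rewrite exprS -natr1; have N0 : 0 <= (N%:R : R) by rewrite ler0n.
      have : 0 <= N%:R * (th - 1) ^+ 2 by rewrite mulr_ge0 // sqr_ge0.
      nra.
    lra.
  have : c / f 0%N / (th - 1) < N%:R by apply: lt_le_trans nbig _; rewrite ler_nat.
  rewrite ltr_pdivrMr ?subr_gt0 // ltNge => /negP; apply.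
  by apply: le_trans bern thN.
have : F (s * g ^+ 2) ^+ 2 <= (r * F (g ^+ 2)) ^+ 2.
  have := psd_CS g (s * g) lF pF; rewrite (_ : g * (s * g) = s * g ^+ 2); last by ring.
  move=> /le_trans; apply.
  have := key; rewrite /f expr1 expr0 mul1r => k.
  apply: le_trans (ler_wpM2l (pF g) k) _.
  by rewrite le_eqVlt; apply/orP; left; apply/eqP; ring.
rewrite -(ger0_norm (_ : 0 <= r * F (g ^+ 2))); last by rewrite mulr_ge0 // ltW.
by rewrite -(real_normK (num_real (F (s * _)))) ler_sqr ?nnegrE // ger0_norm // mulr_ge0 // ltW.
Qed.

(* Functionals behaving like integration over the set where [0 <= l <= 1]. *)
Definition ipf l F := [/\ lfun F, forall g, 0 <= F (g ^+ 2),
  forall g, 0 <= F (l * g ^+ 2) & forall g, 0 <= F ((1 - l) * g ^+ 2)].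

(** The substitute for [q >= 0] wherever [0 <= l <= 1]. It is stable under sums and products, so
    certificates are built from squares, [l] and [1 - l]. *)
Definition ipos l q := forall F, ipf l F -> 0 <= F q.

Lemma lfun_mul F q : lfun F -> lfun (fun p => F (p * q)).
Proof. by move=> lF a p p'; rewrite mulrDl -scalerAl lF. Qed.

Lemma ipf_sq l F g : ipf l F -> ipf l (fun p => F (p * g ^+ 2)).
Proof.
move=> [lF F0 F1 F2]; split=> [|h|h|h]; first exact: lfun_mul.
- by rewrite -exprMn.
- by rewrite -mulrA -exprMn.
- by rewrite -mulrA -exprMn.
Qed.

(** The product [l (1 - l)] is brought back to the admissible weights by
    [l (1 - l) = (1 - l) l^2 + l (1 - l)^2]. *)
Lemma ipf_l l F : ipf l F -> ipf l (fun p => F (p * l)).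
Proof.
move=> [lF F0 F1 F2]; split=> [|h|h|h]; first exact: lfun_mul.
- by rewrite mulrC.
- by rewrite (_ : l * h ^+ 2 * l = (l * h) ^+ 2) //; ring.
- have -> : (1 - l) * h ^+ 2 * l = (1 - l) * (l * h) ^+ 2 + l * ((1 - l) * h) ^+ 2 by ring.
  by rewrite lfunD // addr_ge0.
Qed.

Lemma ipf_1l l F : ipf l F -> ipf l (fun p => F (p * (1 - l))).
Proof.
move=> [lF F0 F1 F2]; split=> [|h|h|h]; first exact: lfun_mul.
- by rewrite mulrC.
- have -> : l * h ^+ 2 * (1 - l) = (1 - l) * (l * h) ^+ 2 + l * ((1 - l) * h) ^+ 2 by ring.
  by rewrite lfunD // addr_ge0.
- by rewrite (_ : (1 - l) * h ^+ 2 * (1 - l) = ((1 - l) * h) ^+ 2) //; ring.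
Qed.

Lemma ipf_mul l F q : ipos l q -> ipf l F -> ipf l (fun p => F (p * q)).
Proof.
move=> lq iF; have [lF _ _ _] := iF; split=> [|h|h|h]; first exact: lfun_mul.
- have := lq _ (ipf_sq h iF); by rewrite mulrC.
- have := lq _ (ipf_l (ipf_sq h iF)); by rewrite (_ : q * l * h ^+ 2 = l * h ^+ 2 * q) //; ring.
- have := lq _ (ipf_1l (ipf_sq h iF)); by rewrite (_ : q * (1 - l) * h ^+ 2 = (1 - l) * h ^+ 2 * q) //; ring.
Qed.

Lemma iposM l q q' : ipos l q -> ipos l q' -> ipos l (q * q').
Proof. by move=> lq lq' F iF; exact: lq (ipf_mul lq' iF). Qed.

Lemma iposD l q q' : ipos l q -> ipos l q' -> ipos l (q + q').
Proof. by move=> lq lq' F iF; case: (iF) => lF _ _ _; rewrite lfunD //; apply: addr_ge0; [exact: lq|exact: lq']. Qed.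

Lemma iposZ l (c : R) q : 0 <= c -> ipos l q -> ipos l (c *: q).
Proof. by move=> c0 lq F iF; case: (iF) => lF _ _ _; rewrite lfunZ //; apply: mulr_ge0 => //; exact: lq. Qed.

Lemma ipos_sq l g : ipos l (g ^+ 2).
Proof. by move=> F []. Qed.

Lemma ipos1 l : ipos l 1.
Proof. by rewrite -(expr1n _ 2); exact: ipos_sq. Qed.

Lemma ipos_l l : ipos l l.
Proof. by move=> F [_ _ /(_ 1) h _]; rewrite expr1n mulr1 in h. Qed.

Lemma ipos_1l l : ipos l (1 - l).
Proof. by move=> F [_ _ _ /(_ 1)]; rewrite expr1n mulr1. Qed.

Lemma ipos0 l : ipos l 0.
Proof. by move=> F [lF _ _ _]; rewrite lfun0. Qed.

Lemma iposX l q n : ipos l q -> ipos l (q ^+ n).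
Proof. by move=> lq; elim: n => [|n IH]; [exact: ipos1|rewrite exprS; exact: iposM]. Qed.

Lemma iposC l (c : R) : 0 <= c -> ipos l c%:P.
Proof. by move=> c0; rewrite -[c%:P]mulr1 mul_polyC; apply: iposZ => //; exact: ipos1. Qed.

Lemma ipos_sum l (I : Type) (r : seq I) (P : pred I) (G : I -> {poly R}) :
  (forall i, P i -> ipos l (G i)) -> ipos l (\sum_(i <- r | P i) G i).
Proof. by move=> h; elim/big_rec: _ => [|i q Pi lq]; [exact: ipos0|apply: iposD => //; exact: h]. Qed.

(** The bound [x (1 - x)^n <= 1 / (n + 1)] on the unit interval: with [m = 1 - l], each of the
    [n + 1] terms [(1 - m) m^i] of [1 - m^(n+1)] dominates [(1 - m) m^n]. All convergence rates for
    powers go back to it. *)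
Lemma ipos_xpow l n : ipos l (1 - (n.+1%:R) *: (l * (1 - l) ^+ n)).
Proof.
set m := 1 - l; have lE : l = 1 - m by rewrite /m; ring.
have im : ipos l m by exact: ipos_1l.
have il : ipos l (1 - m) by rewrite -lE; exact: ipos_l.
have pw k : ipos l (1 - m ^+ k).
  rewrite -opprB subrX1 -mulNr opprB; apply: iposM => //.
  by apply: ipos_sum => i _; exact: iposX.
have : 1 - n.+1%:R *: (l * m ^+ n) =
    m ^+ n.+1 + \sum_(i < n.+1) ((1 - m) * m ^+ i * (1 - m ^+ (n - i))).
  have tel : 1 - m ^+ n.+1 = \sum_(i < n.+1) (1 - m) * m ^+ i.
    by rewrite -mulr_sumr -opprB subrX1 -mulNr opprB.
  have : \sum_(i < n.+1) ((1 - m) * m ^+ i * (1 - m ^+ (n - i))) =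
    \sum_(i < n.+1) (1 - m) * m ^+ i - n.+1%:R *: (l * m ^+ n).
    under eq_bigr => i _ do rewrite mulrBr mulr1 -mulrA -exprD subnKC ?leq_ord //.
    by rewrite sumrB sumr_const card_ord -scaler_nat lE.
  by move=> ->; rewrite -tel; ring.
move=> ->; apply: iposD; first exact: iposX.
by apply: ipos_sum => i _; apply: iposM => //; apply: iposM => //; exact: iposX.
Qed.

End Moments.

(** * Polynomials evaluated on a sequence of vectors *)

Section PolyEval.
Context {R : realType}.
Local Notation C := (R[i]).
Variable V : normedModType C.
Implicit Types (u v w : nat -> V) (p q : {poly R}).

(** The real-linear map sending ['X^i] to [u i], a polynomial calculus that asks for no product on
    [V]. *)
Definition pev u p : V := \sum_(i < size p) (p`_i)%:C *: u i.

Lemma pevE u p n : (size p <= n)%N -> pev u p = \sum_(i < n) (p`_i)%:C *: u i.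
Proof.
move=> pn; rewrite /pev (big_ord_widen _ (fun i => (p`_i)%:C *: u i) pn) [RHS](bigID (fun i : 'I_n => (i < size p)%N)) /=.
rewrite [X in _ = _ + X]big1 ?addr0 // => i; rewrite -leqNgt => pi.
by rewrite nth_default // rmorph0 scale0r.
Qed.

Lemma pevP u (a : R) p q : pev u (a *: p + q) = a%:C *: pev u p + pev u q.
Proof.
pose n := maxn (size (a *: p + q)) (maxn (size p) (size q)).
rewrite !(@pevE u _ n) ?leq_max ?leqnn ?orbT // scaler_sumr -big_split /=.
by apply: eq_bigr => i _; rewrite coefD coefZ rmorphD rmorphM scalerDl scalerA.
Qed.

Lemma pevD u p q : pev u (p + q) = pev u p + pev u q.
Proof. by have := pevP u 1 p q; rewrite scale1r rmorph1 scale1r. Qed.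
Lemma pev0 u : pev u 0 = 0.
Proof. by rewrite /pev size_poly0 big_ord0. Qed.
Lemma pevZ u a p : pev u (a *: p) = a%:C *: pev u p.
Proof. by have := pevP u a p 0; rewrite !addr0 pev0 addr0. Qed.
Lemma pevN u p : pev u (- p) = - pev u p.
Proof. by rewrite -scaleN1r pevZ rmorphN rmorph1 scaleN1r. Qed.
Lemma pevB u p q : pev u (p - q) = pev u p - pev u q.
Proof. by rewrite pevD pevN. Qed.
Lemma pev_sum u (I : Type) (r : seq I) (P : pred I) (G : I -> {poly R}) :
  pev u (\sum_(i <- r | P i) G i) = \sum_(i <- r | P i) pev u (G i).
Proof. by elim/big_rec2: _ => [|i y x _ <-]; [exact: pev0|rewrite pevD]. Qed.
Lemma pevXn u n : pev u 'X^n = u n.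
Proof.
rewrite /pev size_polyXn (bigD1 ord_max) //= coefXn eqxx rmorph1 scale1r.
rewrite big1 ?addr0 // => i ni; rewrite coefXn.
have /negbTE -> : (i : nat) != n by apply: contra_neq ni => ni; apply/val_inj.
by rewrite rmorph0 scale0r.
Qed.
Lemma pevX u : pev u 'X = u 1%N.
Proof. by rewrite -['X]expr1 pevXn. Qed.
Lemma pev1 u : pev u 1 = u 0%N.
Proof. by rewrite -(expr0 'X) pevXn. Qed.

(** Real scalars only, so that the outer variables of a triple product and its conjugate-linear
    middle one are treated alike. *)
Definition rlin (T : V -> V) := forall (a : R) x y, T (a%:C *: x + y) = a%:C *: T x + T y.

Lemma rlinD T x y : rlin T -> T (x + y) = T x + T y.
Proof. by move=> h; have := h 1 x y; rewrite rmorph1 !scale1r. Qed.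
Lemma rlin0 T : rlin T -> T 0 = 0.
Proof. by move=> h; have := rlinD 0 0 h; rewrite addr0 => /eqP; rewrite -subr_eq subrr => /eqP. Qed.
Lemma rlinZ T (a : R) x : rlin T -> T (a%:C *: x) = a%:C *: T x.
Proof. by move=> h; have := h a x 0; rewrite (rlin0 h) !addr0. Qed.
Lemma rlin_sum T (I : Type) (r : seq I) (P : pred I) (G : I -> V) : rlin T ->
  T (\sum_(i <- r | P i) G i) = \sum_(i <- r | P i) T (G i).
Proof. by move=> h; elim/big_rec2: _ => [|i y x _ <-]; [exact: rlin0|exact: rlinD]. Qed.

Lemma pev_map (T : V -> V) u v p : rlin T -> (forall i, T (u i) = v i) ->
  T (pev u p) = pev v p.
Proof.
by move=> lT Tu; rewrite rlin_sum //; apply: eq_bigr => i _; rewrite rlinZ // Tu.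
Qed.

Lemma pev_bilin (B : V -> V -> V) u v w p q :
  (forall y, rlin (B^~ y)) -> (forall x, rlin (B x)) ->
  (forall i j, B (u i) (v j) = w (i + j)%N) ->
  B (pev u p) (pev v q) = pev w (p * q).
Proof.
move=> l1 l2 Bw; rewrite -{2}[p]coefK -{2}[q]coefK !poly_def mulr_suml pev_sum.
rewrite {1}/pev (rlin_sum _ _ _ (l1 _)) ; apply: eq_bigr => i _.
rewrite (rlinZ _ _ (l1 _)) /= mulr_sumr pev_sum [X in B _ X]/pev (rlin_sum _ _ _ (l2 _)) scaler_sumr.
apply: eq_bigr => j _; rewrite (rlinZ _ _ (l2 _)) Bw -scalerAl -scalerAr -exprD.
by rewrite !pevZ pevXn.
Qed.

Lemma pev_shift u p n : pev u (p * 'X^n) = pev (fun i => u (i + n)%N) p.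
Proof.
rewrite -{1}[p]coefK poly_def mulr_suml pev_sum; apply: eq_bigr => i _.
by rewrite -scalerAl -exprD pevZ pevXn.
Qed.

End PolyEval.

(** * Triple algebra *)

Section TripleAlgebra.
Context {R : realType}.
Local Notation C := (R[i]).
Variable Z : completeNormedModType C.
Variable tp : Z -> Z -> Z -> Z.
Hypothesis H : is_jbstar_triple tp.
Local Notation half := (2^-1%:C : C).

Lemma tpC x y z : tp x y z = tp z y x. Proof. exact: (triple_sym H). Qed.
Lemma tpPl a x x' y z : tp (a *: x + x') y z = a *: tp x y z + tp x' y z.
Proof. exact: (triple_linear H). Qed.
Lemma tpPm a x y y' z : tp x (a *: y + y') z = a^*%C *: tp x y z + tp x y' z.
Proof. exact: (triple_antilinear H). Qed.
Lemma tpPr a x y z z' : tp x y (a *: z + z') = a *: tp x y z + tp x y z'.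
Proof. by rewrite tpC tpPl ![tp _ y x]tpC. Qed.
Lemma tpDl x x' y z : tp (x + x') y z = tp x y z + tp x' y z.
Proof. by have := tpPl 1 x x' y z; rewrite !scale1r. Qed.
Lemma tpDr x y z z' : tp x y (z + z') = tp x y z + tp x y z'.
Proof. by have := tpPr 1 x y z z'; rewrite !scale1r. Qed.
Lemma tpDm x y y' z : tp x (y + y') z = tp x y z + tp x y' z.
Proof. by have := tpPm 1 x y y' z; rewrite rmorph1 !scale1r. Qed.
Lemma tp0l y z : tp 0 y z = 0.
Proof. by have /eqP := tpDl 0 0 y z; rewrite addr0 -subr_eq subrr => /eqP. Qed.
Lemma tp0r x y : tp x y 0 = 0. Proof. by rewrite tpC tp0l. Qed.
Lemma tp0m x z : tp x 0 z = 0.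
Proof. by have /eqP := tpDm x 0 0 z; rewrite addr0 -subr_eq subrr => /eqP. Qed.
Lemma tpZl a x y z : tp (a *: x) y z = a *: tp x y z.
Proof. by have := tpPl a x 0 y z; rewrite !addr0 tp0l addr0. Qed.
Lemma tpZr a x y z : tp x y (a *: z) = a *: tp x y z.
Proof. by rewrite tpC tpZl tpC. Qed.
Lemma tpZm a x y z : tp x (a *: y) z = a^*%C *: tp x y z.
Proof. by have := tpPm a x y 0 z; rewrite !addr0 tp0m addr0. Qed.
Lemma tpZRm (a : R) x y z : tp x (a%:C *: y) z = a%:C *: tp x y z.
Proof. by rewrite tpZm; congr (_ *: _); apply/eqP; rewrite eq_complex /= oppr0 !eqxx. Qed.
Lemma tpNl x y z : tp (- x) y z = - tp x y z.
Proof. by rewrite -scaleN1r tpZl scaleN1r. Qed.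
Lemma tpNr x y z : tp x y (- z) = - tp x y z.
Proof. by rewrite -scaleN1r tpZr scaleN1r. Qed.
Lemma tpNm x y z : tp x (- y) z = - tp x y z.
Proof. by rewrite -scaleN1r -(rmorphN1 (real_complex R)) tpZRm rmorphN1 scaleN1r. Qed.
Lemma tpBl x x' y z : tp (x - x') y z = tp x y z - tp x' y z.
Proof. by rewrite tpDl tpNl. Qed.
Lemma tpBr x y z z' : tp x y (z - z') = tp x y z - tp x y z'.
Proof. by rewrite tpDr tpNr. Qed.
Lemma tpBm x y y' z : tp x (y - y') z = tp x y z - tp x y' z.
Proof. by rewrite tpDm tpNm. Qed.

Lemma jordan a b x y z : tp a b (tp x y z) =
  tp (tp a b x) y z - tp x (tp b a y) z + tp x y (tp a b z).
Proof. by rewrite (triple_jordan H); vec. Qed.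

Lemma jordan_mid x y z y' x' : tp x (tp y z y') x' =
  tp (tp z y x) y' x' + tp x y' (tp z y x') - tp z y (tp x y' x').
Proof. by rewrite (jordan z y x y' x'); vec. Qed.

Lemma tp_op_linear a b : linear (tp a b).
Proof. by move=> c x y; exact: tpPr. Qed.

Definition Lop a b : {linear Z -> Z} := mklin (@tp_op_linear a b).

(** Continuity at the origin and homogeneity in each variable. *)
Lemma triple_bound : exists2 M : R, 1 <= M &
  forall x y z, nm (tp x y z) <= M * nm x * nm y * nm z.
Proof.
have /cvgrPdist_lt/(_ 1 ltr01) := @triple_continuous _ _ _ H ((0, 0), 0).
rewrite /= tp0l => /nbhs_ballP[e /= e0 eb].
pose d := complex.Re e / 2.
have e0' : 0 < complex.Re e by rewrite -ltcR ReK // ltW.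
have d0 : 0 < d by rewrite divr_gt0.
have small x y z : nm x <= d -> nm y <= d -> nm z <= d -> nm (tp x y z) <= 1.
  have bl (w : Z) : nm w <= d -> ball (0 : Z) e w.
    move=> wd; rewrite -ball_normE /= sub0r nmE nmN -[e]ReK ?ltW // ltcR.
    by apply: le_lt_trans wd _; rewrite /d ltr_pdivrMr // mulr_natr mulr2n ltrDl.
  move=> xd yd zd; have := eb ((x, y), z) (conj (conj (bl _ xd) (bl _ yd)) (bl _ zd)).
  by rewrite /= sub0r nmE nmN ltcR => /ltW.
pose M := Num.max 1 (d^-1 ^+ 3); exists M; first by rewrite le_max lexx.
move=> x y z.
have [->|x0] := eqVneq x 0; first by rewrite tp0l !nm0 mulr0 !mul0r.
have [->|y0] := eqVneq y 0; first by rewrite tp0m !nm0 mulr0 mul0r.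
have [->|z0] := eqVneq z 0; first by rewrite tp0r !nm0 mulr0.
have pos (w : Z) : w != 0 -> 0 < nm w.
  by move=> w0; rewrite lt_neqAle nm_ge0 andbT eq_sym; apply: contra_neq w0; exact: nm_eq0.
have px := pos _ x0; have py := pos _ y0; have pz := pos _ z0.
have sc (w : Z) : 0 < nm w -> nm ((d / nm w)%:C *: w) <= d.
  by move=> pw; rewrite nmZp ?divfK ?(gt_eqF pw) // divr_ge0 ?nm_ge0 // ltW.
have := small _ _ _ (sc _ px) (sc _ py) (sc _ pz).
have dn (w : Z) : 0 <= d / nm w by rewrite divr_ge0 ?nm_ge0 // ltW.
rewrite tpZl tpZRm tpZr !nmZp // => h.
apply: (@le_trans _ _ (d^-1 ^+ 3 * nm x * nm y * nm z)); last first.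
  by do 3!(apply: ler_wpM2r; first exact: nm_ge0); rewrite le_max lexx orbT.
have -> : nm (tp x y z) = (d^-1 ^+ 3 * nm x * nm y * nm z) *
    (d / nm x * (d / nm y * (d / nm z * nm (tp x y z)))).
  by field; rewrite !gt_eqF.
by rewrite ler_piMr //; nneg.
Qed.

Lemma Lop_opbound a b : exists2 K, 0 <= K & opbound (Lop a b) K.
Proof.
have [M M1 hM] := triple_bound; exists (M * nm a * nm b) => [|x]; last exact: hM.
by rewrite !mulr_ge0 ?nm_ge0 // (le_trans ler01).
Qed.

Lemma L_hermop a : hermop (Lop a a).
Proof. by apply: hermitian_hermop; exact: (triple_hermitian H). Qed.

Lemma L_accretive a : accretive (Lop a a).
Proof.
have [K K0 LK] := Lop_opbound a a.
by apply: (spectrum_accretive K0 LK (L_hermop a)); exact: (triple_positive H).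
Qed.

Lemma nm_cube a : nm (tp a a a) = nm a ^+ 3.
Proof. by apply: complexI; rewrite -nmE (triple_norm H) nmE rmorphXn. Qed.

Lemma cube0 a : tp a a a = 0 -> a = 0.
Proof.
move=> a0; apply: nm_eq0; apply/eqP; have := nm_cube a; rewrite a0 nm0 => /esym/eqP.
by rewrite expf_eq0.
Qed.

Section Powers.
Variable a : Z.
Local Notation T := (tp a a).
Local Notation pw := (odd_power tp a).

Lemma pwS n : pw n.+1 = T (pw n). Proof. by []. Qed.

(** Power associativity, proved together with the commutation that drives the induction. The
    commutator [K] equals each difference [L(a_(i+1), a_j) - L(a_i, a_(j+1))] at [x] with
    [i + j = n + 1], where [a_i] is [pw i]. Their sum telescopes to [(n + 2) K], whereas the Jordan
    identity for [L(a_(n+1), a)] evaluates the same sum as [- K]; hence [(n + 3) K = 0]. *)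
Lemma tri_powers n : (forall i j, (i + j)%N = n -> forall x, tp (pw i) (pw j) x = tp (pw n) a x)
  /\ forall x, T (tp (pw n) a x) = tp (pw n) a (T x).
Proof.
elim: n => [|n [IHe IHc]].
  by split=> // i j /eqP; rewrite addn_eq0 => /andP[/eqP-> /eqP->].
have shift i j : (i + j)%N = n -> forall x, tp (pw i.+1) (pw j) x = tp (pw i) (pw j.+1) x.
  move=> ij x; have := jordan a a (pw i) (pw j) x.
  rewrite (IHe _ _ ij) IHc (IHe _ _ ij) -!pwS => /eqP.
  by rewrite -subr_eq subrr eq_sym subr_eq0 => /eqP.
have e1 i j : (i + j)%N = n.+1 -> forall x, tp (pw i) (pw j) x = tp (pw n.+1) a x.
  elim: j i => [|j IH] i; first by rewrite addn0 => ->.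
  rewrite addnS => -[ij] x; rewrite -shift // IH //.
  by rewrite addSn ij.
split=> // x.
set K := T (tp (pw n.+1) a x) - tp (pw n.+1) a (T x).
have K1 i j : (i + j)%N = n.+1 -> K = tp (pw i.+1) (pw j) x - tp (pw i) (pw j.+1) x.
  by move=> ij; rewrite /K -!(e1 _ _ ij) jordan -!pwS addrK.
have K2 m : (m <= n.+2)%N -> K *+ m = tp (pw m) (pw (n.+2 - m)) x - tp a (pw n.+2) x.
  elim: m => [|m IH] mn; first by rewrite subn0 mulr0n subrr.
  rewrite mulrSr IH ?(ltnW mn) // (K1 m (n.+1 - m)%N) ?subnKC // subSS.
  by rewrite subSn // addrA [X in X - _]addrC addrA; vec.
have K3 : - K = tp (pw n.+2) a x - tp a (pw n.+2) x.
  rewrite /K (jordan (pw n.+1) a a a x).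
  have -> : tp (pw n.+1) a a = pw n.+2 by rewrite tpC.
  have -> : tp a (pw n.+1) a = pw n.+2.
    by have := e1 0%N n.+1 (add0n _) a; rewrite /= => ->; rewrite tpC.
  by vec.
have := K2 n.+2 (leqnn _); rewrite subnn -/(pw 0) -K3 => /eqP.
rewrite -subr_eq0 opprK -mulrSr -scaler_nat scaler_eq0 pnatr_eq0 /= => /eqP K0.
by apply/eqP; rewrite -subr_eq0; apply/eqP.
Qed.

Lemma tpw i j x : tp (pw i) (pw j) x = tp (pw (i + j)) a x.
Proof. exact: (tri_powers (i + j)).1. Qed.

Lemma tpw_T n x : T (tp (pw n) a x) = tp (pw n) a (T x).
Proof. exact: (tri_powers n).2. Qed.

Lemma tpwww i j k : tp (pw i) (pw j) (pw k) = pw (i + j + k).+1.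
Proof.
rewrite tpw; elim: k => [|k IH]; first by rewrite addn0 tpC.
by rewrite pwS -tpw_T IH addnS.
Qed.

Lemma tpw_comm i j x : tp (pw i) a (tp (pw j) a x) = tp (pw j) a (tp (pw i) a x).
Proof.
have := jordan (pw i) (pw 0) (pw j) (pw 0) x.
rewrite (tpwww i 0 j) (tpwww 0 i 0) (tpw j) (tpw (i + 0 + j).+1) -/(pw 0) => ->.
by rewrite (_ : (0 + i + 0).+1 = i.+1) ?addn0 // tpw addnS addnC subrr add0r.
Qed.

Local Notation Q := (fun z => tp a z a).

Lemma Q2E z : tp a (tp a z a) a = T (T z) + T (T z) - tp (pw 1) a z.
Proof. by rewrite jordan_mid; congr (_ + _ - _); rewrite ?[tp z a a]tpC 1?tpC. Qed.

(** With [Q z = {a, z, a}] and [P = {a_1, z, a}], two instances of the Jordan identity read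
    [T Q = 2 P - Q T] and [Q T = 2 T Q - P]; together they force [T Q = Q T = P]. *)
Lemma LQ_QL z : T (tp a z a) = tp a (T z) a /\ T (tp a z a) = tp (pw 1) z a.
Proof.
set P := tp (pw 1) z a.
have e1 : T (tp a z a) = P - tp a (T z) a + P.
  by rewrite jordan; congr (_ + _); rewrite tpC.
have e2 : tp a (T z) a = T (tp a z a) + T (tp a z a) - P.
  have := jordan_mid a z a a a; rewrite [tp z a a]tpC => ->.
  by congr (_ + _ - _); rewrite tpC.
have e3 : T (tp a z a) = tp a (T z) a.
  have e4 : 3 *: T (tp a z a) - 3 *: tp a (T z) a =
    - (T (tp a z a) - (P - tp a (T z) a + P)) - 2 *: (tp a (T z) a - (T (tp a z a) + T (tp a z a) - P)) by vec.
  move: e4; rewrite -e1 -e2 !subrr scaler0 oppr0 addr0 -scalerBr => /eqP.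
  by rewrite scaler_eq0 pnatr_eq0 subr_eq0 => /eqP.
split=> //; move: e1; rewrite -e3 => e1.
have : 2 *: T (tp a z a) - 2 *: P = T (tp a z a) - (P - T (tp a z a) + P) by vec.
by rewrite -e1 subrr -scalerBr => /eqP; rewrite scaler_eq0 pnatr_eq0 subr_eq0 => /eqP.
Qed.

(* On a joint Peirce space with eigenvalues [(s + t) / 2] of [T], the operator
   [L(a^[2k+1], a)] has eigenvalue [(s^(k+1) + t^(k+1)) / 2]; this is Newton's
   identity for the third power sum of two variables. *)
Lemma newton z : tp (pw 2) a z =
  3 *: T (tp (pw 1) a z) - 2 *: T (T (T z)).
Proof.
have e := jordan_mid (pw 1) a z a a.
have [_ l] := LQ_QL (tp a z a); rewrite -l Q2E in e.
have e1 : tp (tp z a (pw 1)) a a = T (tp (pw 1) a z).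
  by rewrite [tp z a _]tpC tpC.
have e2 : tp (pw 1) a (tp z a a) = T (tp (pw 1) a z).
  by rewrite tpw_T [tp z a a]tpC.
have e3 : tp z a (tp (pw 1) a a) = tp (pw 2) a z.
  by rewrite [tp (pw 1) a a]tpC tpC.
rewrite e1 e2 e3 tpBr tpDr in e.
have -> : tp (pw 2) a z = (T (tp (pw 1) a z) + T (tp (pw 1) a z)) - (T (tp (pw 1) a z) + T (tp (pw 1) a z) - tp (pw 2) a z) by vec.
by rewrite -e; vec.
Qed.

End Powers.
End TripleAlgebra.

(** * Peirce decomposition *)

Section Peirce.
Context {R : realType}.
Local Notation C := (R[i]).
Variable Z : completeNormedModType C.
Variable tp : Z -> Z -> Z -> Z.
Hypothesis H : is_jbstar_triple tp.

(** Peirce spaces are indexed by the eigenvalue of [L(e, e)], so [1], [1/2] and [0] stand for the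
    customary indices 2, 1 and 0. *)
Definition pc (e : Z) (l : R) (x : Z) := tp e e x = l%:C *: x.

(* Locked, so that unification never unfolds the Peirce projections. *)
Fact peirce_key : unit. Proof. exact: tt. Qed.
Definition P2 := locked_with peirce_key (fun e x => 2 *: tp e e (tp e e x) - tp e e x).
Definition P1 := locked_with peirce_key (fun e x => 4 *: (tp e e x - tp e e (tp e e x))).
Definition P0 := locked_with peirce_key (fun e x => x - 3 *: tp e e x + 2 *: tp e e (tp e e x)).

Lemma P2def e x : P2 e x = 2 *: tp e e (tp e e x) - tp e e x.
Proof. by rewrite /P2 unlock. Qed.
Lemma P1def e x : P1 e x = 4 *: (tp e e x - tp e e (tp e e x)).
Proof. by rewrite /P1 unlock. Qed.
Lemma P0def e x : P0 e x = x - 3 *: tp e e x + 2 *: tp e e (tp e e x).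
Proof. by rewrite /P0 unlock. Qed.

Lemma P2_linear e : linear (P2 e).
Proof. by move=> a x y; rewrite !P2def !(tpPr H); vec. Qed.
Lemma P1_linear e : linear (P1 e).
Proof. by move=> a x y; rewrite !P1def !(tpPr H); vec. Qed.
Lemma P0_linear e : linear (P0 e).
Proof. by move=> a x y; rewrite !P0def !(tpPr H); vec. Qed.

Lemma P2E e x : P2 e x = mklin (@P2_linear e) x. Proof. by []. Qed.
(** The three projections are the Lagrange interpolation polynomials of [L(e, e)] at the nodes [1],
    [1/2] and [0], whose sum is 1. *)
Lemma peirce_sum e x : x = P2 e x + P1 e x + P0 e x.
Proof. by rewrite !P2def !P1def !P0def; vec. Qed.

Lemma pc0 e l : pc e l 0.
Proof. by rewrite /pc (tp0r H) scaler0. Qed.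

Lemma pcD e l x y : pc e l x -> pc e l y -> pc e l (x + y).
Proof. by rewrite /pc (tpDr H) => -> ->; rewrite scalerDr. Qed.

Lemma pcZ e l a x : pc e l x -> pc e l (a *: x).
Proof. by rewrite /pc (tpZr H) => ->; rewrite !scalerA mulrC. Qed.

Lemma pcN e l x : pc e l x -> pc e l (- x).
Proof. by rewrite -scaleN1r; exact: pcZ. Qed.

Lemma pcB e l x y : pc e l x -> pc e l y -> pc e l (x - y).
Proof. by move=> hx hy; apply: pcD => //; exact: pcN. Qed.

Lemma pc1P e x : pc e 1 x <-> tp e e x = x.
Proof. by rewrite /pc scale1r. Qed.
Lemma pc0P e x : pc e 0 x <-> tp e e x = 0.
Proof. by rewrite /pc scale0r. Qed.

Lemma pc_rule e a b c x y z : pc e a x -> pc e b y -> pc e c z ->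
  pc e (a - b + c) (tp x y z).
Proof.
rewrite /pc => ex ey ez; rewrite (jordan H) ex ey ez (tpZl H) (tpZRm H) (tpZr H).
by rewrite rmorphD rmorphB /=; vec.
Qed.

Lemma P2_comm e x : P2 e (tp e e x) = tp e e (P2 e x).
Proof. by rewrite !P2def (tpBr H) (tpZr H). Qed.
Lemma P1_comm e x : P1 e (tp e e x) = tp e e (P1 e x).
Proof. by rewrite !P1def (tpZr H) (tpBr H). Qed.
Lemma P0_comm e x : P0 e (tp e e x) = tp e e (P0 e x).
Proof. by rewrite !P0def (tpDr H) (tpBr H) !(tpZr H). Qed.

Variable e : Z.
Hypothesis He : tripotent tp e.
Local Notation L := (tp e e).

Lemma pw_e n : odd_power tp e n = e.
Proof. by elim: n => // n IH; rewrite pwS IH. Qed.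

(** [newton] at a tripotent, all of whose odd powers are [e]; it says that [l (2 l - 1) (l - 1)]
    annihilates [L(e, e)]. *)
Lemma L_cubic x : L x = 3 *: L (L x) - 2 *: L (L (L x)).
Proof. by have := newton H e x; rewrite !pw_e. Qed.

Lemma pc_e : pc e 1 e. Proof. by apply/pc1P. Qed.

Lemma pc_P2 x : pc e 1 (P2 e x).
Proof.
apply/pc1P; rewrite !P2def (tpBr H) (tpZr H); have := L_cubic x.
set t := L (L (L x)) => h; have -> : 2 *: t = 3 *: L (L x) - L x by rewrite {2}h; vec.
by vec.
Qed.

Lemma pc_P1 x : pc e (2^-1) (P1 e x).
Proof.
rewrite /pc !P1def (tpZr H) (tpBr H); have := L_cubic x.
set t := L (L (L x)) => h; have -> : t = 2^-1 *: (3 *: L (L x) - L x) by rewrite {2}h; vecf.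
by rewrite (_ : (2^-1)%:C = 2^-1 :> C) ?fmorphV ?rmorph_nat //; vecf.
Qed.

Lemma pc_P0 x : pc e 0 (P0 e x).
Proof.
apply/pc0P; rewrite !P0def (tpDr H) (tpBr H) !(tpZr H); have := L_cubic x.
by set t := L (L (L x)) => h; rewrite {1}h; vec.
Qed.

Lemma pc_zero l x : pc e l x -> l != 0 -> l != 1 -> l != 2^-1 -> x = 0.
Proof.
rewrite /pc => ex l0 l1 l2; have := L_cubic x.
rewrite ex !(tpZr H) ex (tpZr H) ex => h.
have : (l * (l - 1) * (2 * l - 1))%:C *: x = 0.
  rewrite !rmorphM !rmorphB rmorphM rmorph1 rmorph_nat.
  have -> : (l%:C * (l%:C - 1) * (2 * l%:C - 1)) *: x = l%:C *: x -
     (3 *: (l%:C *: (l%:C *: x)) - 2 *: (l%:C *: (l%:C *: (l%:C *: x)))) by vec.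
  by rewrite -h subrr.
move=> /eqP; rewrite scaler_eq0 fmorph_eq0 !mulf_eq0 (negbTE l0) !subr_eq0 (negbTE l1) /=.
case/orP => [/eqP h2|/eqP //].
by case/eqP: l2; apply: (mulfI (_ : 2 != 0 :> R)); rewrite ?pnatr_eq0 // h2 mulfV ?pnatr_eq0.
Qed.

(** The inequality states that the eigenvalue predicted by [pc_rule] lies outside the unit interval,
    in a form that [lra] checks on concrete indices. *)
Lemma pc_van a b c x y z : pc e a x -> pc e b y -> pc e c z ->
  1 < (2 * (a - b + c) - 1) ^+ 2 -> tp x y z = 0.
Proof.
move=> hx hy hz h; apply: (pc_zero (pc_rule hx hy hz)); apply: contraTneq h => ->.
- by rewrite -leNgt; lra.
- by rewrite -leNgt; lra.
- by rewrite mulfV ?pnatr_eq0 // subrr expr0n -leNgt.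
Qed.

Lemma P2_id x : pc e 1 x -> P2 e x = x.
Proof. by move/pc1P => h; rewrite !P2def !h; vec. Qed.
Lemma P2_0 x : pc e 0 x -> P2 e x = 0.
Proof. by move/pc0P => h; rewrite !P2def h (tp0r H); vec. Qed.
Lemma P2_1 x : pc e (2^-1) x -> P2 e x = 0.
Proof.
move=> h; rewrite !P2def h (tpZr H) h fmorphV rmorph_nat; vecf.
Qed.
Local Notation Q x := (tp e x e).

Lemma tp_peirce a b z : tp a b z = tp a b (P2 e z) + tp a b (P1 e z) + tp a b (P0 e z).
Proof. by rewrite {1}(peirce_sum e z) (tpDr H _ _ (P2 e z + P1 e z)) (tpDr H _ _ (P2 e z)). Qed.

Lemma QQ x : Q (Q x) = P2 e x.
Proof. by rewrite (Q2E H) !pw_e !P2def; vec. Qed.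

Lemma pc_Q x : pc e 1 (Q x).
Proof. by apply/pc1P; have [_] := LQ_QL H e x; rewrite pw_e. Qed.

Lemma QQ_id x : pc e 1 x -> Q (Q x) = x.
Proof. by move=> h; rewrite QQ P2_id. Qed.

(** On the components of [z] with eigenvalue [1/2] and [0] the predicted eigenvalue is negative. The
    remaining component is [Q] of something, and expanding it by the Jordan identity leaves only
    vanishing terms. *)
Lemma perp_unit1 x z : pc e 0 x -> tp x e z = 0.
Proof.
move=> hx; rewrite (tp_peirce _ _ z).
rewrite (_ : tp x e (P1 e z) = 0); last by apply: (pc_van hx pc_e (pc_P1 z)); lra.
rewrite (_ : tp x e (P0 e z) = 0); last by apply: (pc_van hx pc_e (pc_P0 z)); lra.
rewrite !addr0 -(QQ_id (pc_P2 z)) (jordan H).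
have -> : tp x e e = 0 by rewrite (tpC H); apply/pc0P.
rewrite (tp0l H) (tp0r H).
rewrite (_ : tp e x (tp e (P2 e z) e) = 0); last by apply: (pc_van pc_e hx (pc_Q (P2 e z))); lra.
by rewrite !(tp0m H) subrr addr0.
Qed.

(** Eigenvalues settle all but the Peirce-0 component [b] of [z]. There [w = {e, x, b}] has zero
    cube, because expanding the middle [w] makes [L(x, e)] appear in every term. *)
Lemma perp_unit2 x z : pc e 0 x -> tp e x z = 0.
Proof.
move=> hx; rewrite (tp_peirce _ _ z).
rewrite (_ : tp e x (P1 e z) = 0); last by apply: (pc_van pc_e hx (pc_P1 z)); lra.
rewrite (_ : tp e x (P2 e z) = 0); last by apply: (pc_van pc_e hx (pc_P2 z)); lra.
rewrite !add0r; have hb := pc_P0 z; set b := P0 e z in hb *.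
apply: (cube0 H); set w := tp e x b.
rewrite {2}/w (jordan_mid H) !(perp_unit1 _ hx).
by rewrite (tp0l H) (tp0r H) subr0 addr0.
Qed.

Lemma perp1 u x z : pc e 1 u -> pc e 0 x -> tp x u z = 0.
Proof.
move=> hu hx; have := jordan H (Q u) e x e z.
rewrite (perp_unit1 _ hx) (perp_unit1 _ hx) (tp0r H) [tp (tp e u e) e x](tpC H) (perp_unit1 _ hx) (tp0l H).
rewrite (QQ_id hu).
by rewrite add0r addr0 => /esym/eqP; rewrite oppr_eq0 => /eqP.
Qed.

Lemma perp2 u x z : pc e 1 u -> pc e 0 x -> tp u x z = 0.
Proof.
move=> hu hx; have := jordan H e (Q u) e x z.
rewrite !(perp_unit2 _ hx) (tp0r H) (QQ_id hu).
rewrite [tp (tp e u e) e x](tpC H) (perp_unit1 _ hx) (tp0m H).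
by rewrite subr0 addr0.
Qed.

(** [Q] is the involution of the Peirce-2 space as a Jordan algebra with unit [e]; an element moves
    across the unit at the price of this involution, since [L(e, v)] commutes with [L(e, e)]. *)
Lemma unit_flip v z : pc e 1 v -> tp (Q v) e z = tp e v z.
Proof.
move=> hv; have := jordan H e v e e z.
have -> : tp v e e = v by rewrite (tpC H); apply/pc1P.
have -> : tp e v (tp e e z) = tp e e (tp e v z).
  have Lv : tp e e v = v by exact/pc1P.
  by rewrite (jordan H e e e v z) Lv He subrr add0r.
by move/eqP; rewrite -subr_eq subrr eq_sym subr_eq0 => /eqP.
Qed.

(* The product of the Jordan algebra with unit [e] recovers the triple product. *)
Lemma unit_triple a b c : tp a (Q b) c =
  tp (tp b e a) e c + tp a e (tp b e c) - tp b e (tp a e c).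
Proof. by rewrite (jordan H b e a e c); vec. Qed.

Lemma Q_auto x y z : pc e 1 x -> pc e 1 y -> pc e 1 z ->
  Q (tp x y z) = tp (Q x) (Q y) (Q z).
Proof.
move=> hx hy hz; rewrite (unit_triple (Q x) y (Q z)).
rewrite (jordan_mid H) -(unit_flip _ hz) [tp (tp y x e) z e](tpC H) -(unit_flip _ hz).
rewrite [tp y x e](tpC H) -(unit_flip _ hx).
have E : tp y x (Q z) = tp (tp (Q x) e y) e (Q z) + tp y e (tp (Q x) e (Q z)) - tp (Q x) e (tp y e (Q z)).
  by rewrite -{1}(QQ_id hx) (unit_triple y (Q x) (Q z)).
rewrite E [tp (tp y e (Q x)) e (Q z)](tpC H) [tp y e (Q x)](tpC H).
rewrite [tp (tp (Q x) e y) e (Q z)](tpC H); vec.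
Qed.

Lemma cube_perp u x : pc e 1 u -> pc e 0 x ->
  tp (u + x) (u + x) (u + x) = tp u u u + tp x x x.
Proof.
move=> hu hx; rewrite !(tpDl H) !(tpDm H) !(tpDr H).
rewrite !(perp1 _ hu hx) !(perp2 _ hu hx) [tp u u x](tpC H) [tp x x u](tpC H).
by rewrite (perp1 _ hu hx) (perp2 _ hu hx); vec.
Qed.

Lemma pc_cube l x : pc e l x -> pc e l (tp x x x).
Proof. by move=> h; have := pc_rule h h h; rewrite subrr add0r. Qed.

End Peirce.

(** * Norms by iterated cubes, and positive forms *)

Section NormPerp.
Context {R : realType}.
Local Notation C := (R[i]).
Variable Z : completeNormedModType C.
Variable tp : Z -> Z -> Z -> Z.
Hypothesis H : is_jbstar_triple tp.

Definition cubes (x : Z) k := iter k (fun y => tp y y y) x.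

Lemma nm_cubes x k : nm (cubes x k) = nm x ^+ (3 ^ k).
Proof.
elim: k => [|k IH]; first by rewrite expr1.
by rewrite /cubes iterS (nm_cube H) -/(cubes x k) IH -exprM expnSr.
Qed.

Lemma nm_cubes_le1 x k : nm x <= 1 -> nm (cubes x k) <= 1.
Proof. by move=> x1; rewrite nm_cubes exprn_ile1 // nm_ge0. Qed.

(** The iterated cubes have norms [(nm x)^(3^k)], which are unbounded as soon as [nm x > 1]. However
    bad [c] is, the conclusion is sharp. *)
Lemma cubes_bounded x c : (forall k, nm (cubes x k) <= c) -> nm x <= 1.
Proof.
move=> h; rewrite leNgt; apply/negP => x1.
have c0 : 0 <= c by apply: le_trans (h 0%N); exact: nm_ge0.
have [n _ nb] := archi_lt (c / (nm x - 1)).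
have := h n; rewrite nm_cubes leNgt => /negP; apply.
have d0 : 0 < nm x - 1 by rewrite subr_gt0.
apply: (@lt_le_trans _ _ (n%:R * (nm x - 1))); first by rewrite -ltr_pdivrMr.
apply: (@le_trans _ _ (nm x ^+ n)); last first.
  by apply: ler_weXn2l; [exact: ltW|apply: ltnW; exact: ltn_expl].
elim: n {nb} => [|n IH]; first by rewrite mul0r.
rewrite exprS -natr1; have n0 : 0 <= n%:R :> R by [].
have : 1 <= nm x ^+ n by apply: exprn_ege1; exact: ltW.
nra.
Qed.

(** Cubes of orthogonal elements add, so the iterated cubes of [u + x] stay within norm 2. *)
Lemma nm_perp_le1 e u x : tripotent tp e -> pc tp e 1 u -> pc tp e 0 x ->
  nm u <= 1 -> nm x <= 1 -> nm (u + x) <= 1.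
Proof.
move=> He hu hx u1 x1; apply: (@cubes_bounded _ 2) => k.
have [-> _ _] : [/\ cubes (u + x) k = cubes u k + cubes x k, pc tp e 1 (cubes u k)
    & pc tp e 0 (cubes x k)].
  elim: k => // k [IH hu' hx']; rewrite /cubes !iterS -!/(cubes _ k) IH.
  rewrite (cube_perp H He hu' hx'); split=> //; exact: pc_cube.
apply: le_trans (nmD _ _) _; have := nm_cubes_le1 k u1; have := nm_cubes_le1 k x1; lra.
Qed.

(** [Q] preserves cubes on the Peirce-2 space, so the crude bound of [Q] applies to all iterated
    cubes at once. *)
Lemma Q_contr e x : tripotent tp e -> pc tp e 1 x -> nm x <= 1 -> nm (tp e x e) <= 1.
Proof.
move=> He hx x1; have [M M1 hM] := triple_bound H.
apply: (@cubes_bounded _ (M * nm e * 1 * nm e)) => k.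
have [-> hk] : cubes (tp e x e) k = tp e (cubes x k) e /\ pc tp e 1 (cubes x k).
  elim: k => // k [IH hk]; rewrite /cubes !iterS -!/(cubes _ k) IH.
  by split; [rewrite (Q_auto H He hk hk hk)|exact: pc_cube].
apply: le_trans (hM _ _ _) _; apply: ler_wpM2r; first exact: nm_ge0.
apply: ler_wpM2l; first by rewrite mulr_ge0 ?nm_ge0 // (le_trans ler01).
exact: nm_cubes_le1.
Qed.

Lemma trip_le1 e : tripotent tp e -> nm e <= 1.
Proof.
move=> He; apply: (@cubes_bounded _ (nm e)) => k.
by suff -> : cubes e k = e by []; elim: k => // k IH; rewrite /cubes iterS -/(cubes e k) IH.
Qed.

Section CS.
Variables (x : Z) (f : dual Z).
Hypothesis df : dualpair x f.

Lemma L_form_real y : complex.Im (f (tp y y x) : C) = 0.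
Proof. exact: (L_hermop H y df). Qed.

Lemma L_form_ge0 y : 0 <= complex.Re (f (tp y y x) : C).
Proof. exact: (L_accretive H y df). Qed.

Lemma L_formE y : f (tp y y x) = (complex.Re (f (tp y y x) : C))%:C :> C.
Proof. by apply/eqP; rewrite eq_complex /= L_form_real !eqxx. Qed.

Lemma L_form_sym y z : f (tp z y x) = (f (tp y z x) : C)^*%C :> C.
Proof.
have h1 := L_form_real (y + z); have h2 := L_form_real (y + 'i *: z).
rewrite !(tpDl H) !(tpDm H) !dualD !ImD !L_form_real !(add0r, addr0) in h1.
rewrite !(tpDl H) !(tpDm H) !(tpZl H) !(tpZm H) !dualD !dualZ !ImD !L_form_real in h2.
move: h1 h2; have := L_form_real z; have := L_form_real y.
case: (f (tp z y x) : C) => a b; case: (f (tp y z x) : C) => c d.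
case: (f (tp z z x) : C) => a' b'; rewrite /= => _ -> h1 h2.
by apply/eqP; rewrite eq_complex /=; apply/andP; split; apply/eqP; lra.
Qed.

(** Cauchy-Schwarz for the positive form [(y, z) -> f {y, z, x}]; the phase [w] makes the cross
    terms real before the discriminant is taken. *)
Lemma L_CS y z : nm (f (tp y z x) : C) ^+ 2 <=
  complex.Re (f (tp y y x) : C) * complex.Re (f (tp z z x) : C).
Proof.
set F := f (tp y z x) : C.
have [->|F0] := eqVneq F 0.
  by rewrite nm0 expr0n mulr_ge0 // L_form_ge0.
have nF : 0 < nm F by rewrite lt_neqAle nm_ge0 andbT eq_sym; apply: contra_neq F0; exact: nm_eq0.
pose w : C := F / (nm F)%:C.
have nw : nm w = 1 by rewrite nmM nmV nmRp ?nm_ge0 // mulfV // gt_eqF.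
have wF : w^*%C * F = (nm F)%:C.
  have FF : F^*%C * F = (nm F ^+ 2)%:C.
    rewrite nm_sq; case: (F) => a b; apply/eqP; rewrite eq_complex /=.
    by apply/andP; split; apply/eqP; ring.
  rewrite /w rmorphM mulrAC FF.
  have cR (r : R) : (r%:C)^*%C = r%:C :> C by apply/eqP; rewrite eq_complex /= oppr0 !eqxx.
  rewrite fmorphV [X in _ / X]cR -fmorphV -rmorphM /=.
  by congr (_%:C); field; rewrite gt_eqF.
apply: discr_le => t; have := L_form_ge0 (y + (t%:C * w) *: z).
rewrite !(tpDl H) !(tpDm H) !(tpZl H) !(tpZm H) !dualD !dualZ (L_form_sym y z) -/F.
rewrite [(f (tp z z x) : C)]L_formE conjcM.
have -> : (t%:C)^*%C = t%:C :> C by apply/eqP; rewrite eq_complex /= oppr0 !eqxx.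
have -> : t%:C * w * F^*%C = (t * nm F)%:C.
  rewrite -mulrA rmorphM; congr (_ * _).
  rewrite -[w]conjcK -rmorphM wF; apply/eqP; rewrite eq_complex /= oppr0 !eqxx //.
have -> : t%:C * w^*%C * F = (t * nm F)%:C by rewrite -mulrA wF rmorphM.
set A := complex.Re (f (tp z z x) : C).
have -> : t%:C * w * (t%:C * w^*%C * A%:C) = (t ^+ 2 * A)%:C.
  have ww : w * w^*%C = 1.
    have := nm_sq w; rewrite nw; case: (w) => a b /= h; apply/eqP; rewrite eq_complex /=.
    by apply/andP; split; apply/eqP; lra.
  transitivity ((t ^+ 2 * A)%:C * (w * w^*%C)); first by rewrite !rmorphM /=; ring.
  by rewrite ww mulr1.
rewrite !ReD /=; lra.
Qed.

End CS.
End NormPerp.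

(** * Odd powers of a contraction *)

Section Contraction.
Context {R : realType}.
Local Notation C := (R[i]).
Variable Z : completeNormedModType C.
Variable tp : Z -> Z -> Z -> Z.
Hypothesis H : is_jbstar_triple tp.
Implicit Types (p q g : {poly R}).

Lemma ipos_sym (l q : {poly R}) : ipos (1 - l) q -> ipos l q.
Proof.
move=> h F [lF F0 F1 F2]; apply: h; split=> // g.
by rewrite (_ : 1 - (1 - l) = l) //; ring.
Qed.

Lemma rlin_l y z : rlin (fun x => tp x y z).
Proof. by move=> c x x'; rewrite (tpPl H). Qed.
Lemma rlin_m x z : rlin (fun y => tp x y z).
Proof. by move=> c y y'; rewrite (tpDm H) (tpZRm H). Qed.
Lemma rlin_r x y : rlin (fun z => tp x y z).
Proof. by move=> c z z'; rewrite (tpPr H). Qed.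

Variable a : Z.
Local Notation T := (tp a a).
Local Notation pw := (odd_power tp a).
Local Notation pv := (pev pw).

Lemma pv_tp x p q : tp (pv p) (pv q) x = tp (pv (p * q)) a x.
Proof.
rewrite (@pev_bilin _ _ (fun y z => tp y z x) pw pw (fun i => tp (pw i) a x)).
- exact/esym/(pev_map _ (rlin_l a x)).
- by move=> y; exact: rlin_l.
- by move=> y; exact: rlin_m.
- by move=> i j; rewrite (tpw H).
Qed.

Lemma pv1 : pv 1 = a. Proof. exact: pev1. Qed.

(** [pv p] stands for the odd function [t p(t^2)] of [a], with ['X] in the role of [t^2]; a product
    of three odd functions therefore gains one factor ['X]. *)
Lemma pv_pv p q : tp (pv p) a (pv q) = pv ('X * p * q).
Proof.
rewrite (@pev_bilin _ _ (fun y z => tp y a z) pw pw (fun i => pw (i + 1)%N)).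
- by rewrite -pev_shift; congr (pv _); rewrite expr1; ring.
- by move=> z; exact: rlin_l.
- by move=> y; exact: rlin_r.
- by move=> i j; have := tpwww H a i 0 j; rewrite !addn0 addn1.
Qed.

Lemma pv3 p q r : tp (pv p) (pv q) (pv r) = pv ('X * p * q * r).
Proof. by rewrite pv_tp pv_pv !mulrA. Qed.

(** On a joint Peirce space with eigenvalues [(s + t) / 2] of [T] this condition amounts to [s = t].
    It thus singles out vectors on which [p -> L(pv p, a)] behaves like multiplication by one
    function. *)
Definition pspan x := forall i, T (tp (pw i) a x) = tp (pw i.+1) a x.

Lemma pspanP c x y : pspan x -> pspan y -> pspan (c *: x + y).
Proof. by move=> hx hy i; rewrite !(tpPr H) hx hy. Qed.

Lemma pspanZ c x : pspan x -> pspan (c *: x).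
Proof. by move=> hx i; rewrite !(tpZr H) hx. Qed.

Lemma pspan_sum (I : Type) (r : seq I) (P : pred I) (F : I -> Z) :
  (forall i, P i -> pspan (F i)) -> pspan (\sum_(i <- r | P i) F i).
Proof.
move=> h; elim/big_rec: _ => [i|i x Pi hx]; first by rewrite !(tp0r H).
by rewrite -[F i]scale1r; apply: pspanP => //; exact: h.
Qed.

Lemma pspan_pv p : pspan (pv p).
Proof.
apply: pspan_sum => j _; apply: pspanZ => i.
have := tpwww H a i 0 j; have := tpwww H a i.+1 0 j; rewrite /= addn0 => -> ->.
by [].
Qed.

Lemma pspan_op p x : pspan x -> pspan (tp (pv p) a x).
Proof.
move=> hx; rewrite (pev_map (v := fun i => tp (pw i) a x) _ (rlin_l a x)) //.
apply: pspan_sum => j _; apply: pspanZ => i.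
by rewrite !(tpw_comm H a _ j) (tpw_T H) hx.
Qed.

Lemma pspan_T p x : pspan x -> T (tp (pv p) a x) = tp (pv ('X * p)) a x.
Proof.
move=> hx; rewrite (pev_map (v := fun i => tp (pw i) a x) _ (rlin_l a x)) //.
have -> : 'X * p = p * 'X^1 by rewrite mulrC.
rewrite pev_shift (pev_map (v := fun i => tp (pw i.+1) a x) _ (rlin_r a a)) //.
by apply/esym/(pev_map _ (rlin_l a x)) => i; rewrite addn1.
Qed.

Lemma pw_cube n : nm (pw (3 * n).+1) = nm (pw n) ^+ 3.
Proof. by rewrite -(nm_cube H) (tpwww H) -addnA addnn -mul2n -mulSn. Qed.

Hypothesis a1 : nm a <= 1.

(** Cubing sends the index [n] to [3 n + 1]; two cubings keep it even, and even exponents are what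
    [psd_growth] asks for. *)
Lemma pw_even N0 : exists2 N, (N0 <= N)%N & nm (pw (2 * N)) <= 1.
Proof.
elim: N0 => [|N0 [N NN hN]]; first by exists 0%N.
exists (9 * N + 2)%N; first by rewrite addn2 ltnS; apply: (leq_trans NN); apply: leqW; rewrite leq_pmull.
have -> : (2 * (9 * N + 2) = (3 * (3 * (2 * N)).+1).+1)%N by ring.
by rewrite !pw_cube; do 2!(apply: exprn_ile1; rewrite ?nm_ge0 ?exprn_ge0 ?nm_ge0 //).
Qed.

Section Form.
Variables (x : Z) (f : dual Z).
Hypotheses (px : pspan x) (df : dualpair x f).
Let F q := complex.Re (f (tp (pv q) a x) : C).

Let F_lfun : lfun F.
Proof. by move=> c q r; rewrite /F pevP (tpPl H) dualD dualZ ReD ReMr. Qed.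

Let F_sq g : 0 <= F (g ^+ 2).
Proof. by rewrite /F expr2 -pv_tp; exact: (L_form_ge0 H df). Qed.

(** Both weights come from [psd_growth]. The powers of [1 - e 'X] grow at most by [1 + (e K)^2] per
    step because [L(a, a)] is accretive, which gives [F ('X g^2) >= 0] as [e] tends to 0; the
    contractive powers of even index give ['X <= 1]. *)
Lemma span_ipf : ipf 'X F.
Proof.
split=> // g.
  have [K K0 TK] := Lop_opbound H a a.
  apply: (@le_eps _ _ _ (K ^+ 2 * F (g ^+ 2))) => e e0.
  pose s : {poly R} := 1 - e *: 'X.
  have r0 : 0 < 1 + (e * K) ^+ 2 by rewrite ltr_pwDl // sqr_ge0.
  have := @psd_growth _ F s _ F_lfun F_sq r0 _ g.
  set G := (X in (X -> _) -> _); have hG : G.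
    move=> h; exists (nm (tp (pv (h ^+ 2)) a x)) => N0; exists N0 => //.
    have it n q : iter n (fun z => z - e%:C *: Lop H a a z) (tp (pv q) a x) = tp (pv (s ^+ n * q)) a x.
      elim: n => [|n IH]; first by rewrite expr0 mul1r.
      rewrite iterS IH /= pspan_T // exprS -[s * _ * q]mulrA; move: (s ^+ n * q) => w.
      by rewrite /s mulrBl mul1r pevB (tpBl H) -scalerAl pevZ (tpZl H).
    rewrite /F exprMn -exprM muln2 -mul2n -it.
    apply: le_trans (Re_le_nm _) _; apply: le_trans (dual_le1 _ df.1) _.
    move: (h ^+ 2) => w; elim: (2 * N0)%N => [|n IH]; first by rewrite expr0 mulr1.
    rewrite iterS [X in _ <= _ * X]exprS.
    have eC : 0 <= complex.Re (e%:C : C) by exact: ltW.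
    apply: le_trans (accretive_step K0 TK (L_hermop H a) (L_accretive H a) _ eC) _.
    by rewrite nmRp ?(ltW e0) // mulrCA; apply: ler_wpM2l => //; exact: ltW.
  move=> /(_ hG); rewrite ler_norml => /andP[_].
  have -> : s * g ^+ 2 = g ^+ 2 - e *: ('X * g ^+ 2) by rewrite /s mulrBl mul1r scalerAl.
  rewrite (lfunB _ _ F_lfun) (lfunZ _ _ F_lfun) => h.
  have : 0 <= e * (F ('X * g ^+ 2) + e * (K ^+ 2 * F (g ^+ 2))).
    by move: h; set u := F _; set v := F _; lra.
  by rewrite pmulr_rge0.
have := @psd_growth _ F 'X 1 F_lfun F_sq ltr01 _ g.
set G := (X in (X -> _) -> _); have hG : G.
  have [M M1 hM] := triple_bound H.
  move=> h; exists (M * nm (pv (h ^+ 2)) * nm x) => N0.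
  have [N NN hN] := pw_even N0; exists N => //; rewrite expr1n mulr1.
  rewrite /F exprMn -exprM muln2 -mul2n -pv_tp pevXn.
  apply: le_trans (Re_le_nm _) _; apply: le_trans (dual_le1 _ df.1) _.
  apply: le_trans (hM _ _ _) _; apply: ler_wpM2r; first exact: nm_ge0.
  apply: ler_wpM2r; first exact: nm_ge0.
  by rewrite ler_piMr // (le_trans ler01).
move=> /(_ hG); rewrite mul1r ler_norml => /andP[_].
by rewrite mulrBl mul1r (lfunB _ _ F_lfun) subr_ge0.
Qed.

Lemma span_real q : complex.Im (f (tp (pv q) a x) : C) = 0.
Proof.
have := L_form_sym H df a (pv q); have := pv_tp x 1 q; rewrite pv1 mul1r => ->.
by move=> /(congr1 (@complex.Im R)); case: (f _ : C) => c d /=; lra.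
Qed.

End Form.

(** An order bound on polynomials becomes a norm bound: moments control the numerical radius on
    [pspan] by [c F 1], where [F 1] is a value of [T], and passing to the norm costs 4. *)
Lemma span_bound K q c x : 0 <= K -> opbound T K -> 0 <= c ->
  ipos 'X (c%:P - q) -> ipos 'X (c%:P + q) -> pspan x ->
  nm (tp (pv q) a x) <= 4 * (c * K) * nm x.
Proof.
move=> K0 TK c0 q1 q2 px; have [K' K'0 SK] := Lop_opbound H (pv q) a.
apply: (@numerical_radius_bound _ _ (Lop H (pv q) a) pspan K' (c * K)) => //.
- exact: mulr_ge0.
- exact: pspanP.
- by move=> y py; exact: pspan_op.
move=> y py; have [f df] := norming y; exists f => //.
have iF := span_ipf py df; have [lF _ _ _] := iF.
set F := (fun q => _) in iF lF.
have F1 : F 1 <= K * nm y.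
  rewrite /F pv1; apply: le_trans (Re_le_nm _) _; apply: le_trans (dual_le1 _ df.1) _.
  exact: TK.
have cF : F c%:P = c * F 1 by rewrite -[c%:P]mulr1 mul_polyC (lfunZ _ _ lF).
apply: le_trans (nm_le_ReIm _) _; rewrite /= (span_real df) normr0 addr0 -/(F q).
apply: (@le_trans _ _ (c * F 1)); last by rewrite -mulrA; apply: ler_wpM2l.
have := q1 _ iF; have := q2 _ iF; rewrite (lfunD _ _ lF) (lfunB _ _ lF) cF => h1 h2.
by rewrite ler_norml; apply/andP; split; lra.
Qed.

(** The rate is [x^n (1 - x) <= 1 / (n + 1)]. Consecutive powers merge, so a shift of the index does
    not affect their weak* limits. *)
Lemma powers_asymp : exists2 K : R, 0 <= K & forall n,
  nm (pw n) <= K /\ nm (pw n.+1 - pw n.+2) <= K / n.+1%:R.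
Proof.
have [K K0 TK] := Lop_opbound H a a; exists (1 + 4 * K); first by lra.
have iX n : ipos 'X ('X^n : {poly R}) by apply: iposX; exact: ipos_l.
have X1 n : ipos 'X (1 - 'X^n : {poly R}).
  rewrite -opprB subrX1 -mulNr opprB; apply: iposM; first exact: ipos_1l.
  by apply: ipos_sum => i _; exact: iX.
have b1 n : nm (pw n.+1) <= 4 * K.
  have := @span_bound K 'X^n 1 (pv 1) K0 TK ler01 (X1 n) (iposD (@ipos1 _ _) (iX n)) (pspan_pv 1).
  rewrite pv_pv mulr1 -exprS pevXn pv1 mul1r => /le_trans; apply.
  by rewrite ler_piMr // mulr_ge0.
split; first by case: n => [|n]; [have := a1; rewrite /=; lra|have := b1 n; lra].
have c0 : 0 <= n.+1%:R^-1 :> R by rewrite invr_ge0.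
pose q : {poly R} := 'X^n * (1 - 'X).
have iq : ipos 'X q by apply: iposM => //; exact: ipos_1l.
have q1 : ipos 'X ((n.+1%:R^-1)%:P - q).
  have : ipos 'X (n.+1%:R^-1 *: (1 - n.+1%:R *: ((1 - 'X) * (1 - (1 - 'X)) ^+ n)) : {poly R}).
    by apply: iposZ => //; apply: ipos_sym; exact: ipos_xpow.
  rewrite scalerBr scalerA mulVf ?pnatr_eq0 // scale1r.
  have -> : 1 - (1 - 'X) = 'X :> {poly R} by ring.
  by rewrite [_ * 'X^n]mulrC -mul_polyC mulr1.
have := @span_bound K q _ (pv 1) K0 TK c0 q1 (iposD (@iposC _ _ _ c0) iq) (pspan_pv 1).
rewrite pv_pv (_ : 'X * q * 1 = 'X ^+ n.+1 - 'X ^+ n.+2); last by rewrite /q !exprS; ring.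
rewrite pevB !pevXn pv1 => h.
apply: le_trans h _; rewrite -mulrA mulrA.
apply: (@le_trans _ _ (4 * (n.+1%:R^-1 * K))).
  by rewrite ler_piMr // mulr_ge0 // mulr_ge0.
rewrite [leRHS]mulrC mulrDr; have : 0 <= n.+1%:R^-1 * 1 :> R by rewrite mulr1.
by rewrite (mulrCA 4) lerDr.
Qed.

(** The function [t + (t - t^3) / 4] maps the unit interval to itself: with [u = 1 - 'X] its square
    [s = 'X q^2] satisfies [1 - s = u/2 + 7 u^2/16 + u^3/16]. The iterated cubes are of the form
    [s^m q], and [cubes_bounded] removes the loss in their bounds. *)
Lemma smoothing_le1 : nm (a + (4^-1)%:C *: (a - tp a a a)) <= 1.
Proof.
have [K K0 TK] := Lop_opbound H a a.
pose q : {poly R} := 1 + 4^-1 *: (1 - 'X).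
have iu : ipos 'X (1 - 'X : {poly R}) by exact: ipos_1l.
have iq : ipos 'X q.
  by apply: iposD; [exact: ipos1|apply: iposZ => //; rewrite invr_ge0].
have iX : ipos 'X ('X : {poly R}) by exact: ipos_l.
pose s := 'X * q ^+ 2.
have is0 : ipos 'X s by apply: iposM => //; exact: iposX.
have s1 : ipos 'X (1 - s).
  have -> : 1 - s = 2^-1 *: (1 - 'X) + ((7 / 16) *: (1 - 'X) ^+ 2 + 16^-1 *: (1 - 'X) ^+ 3).
    rewrite /s /q -!mul_polyC.
    have e4 : (4^-1)%:P = 4 * (16^-1)%:P :> {poly R} by rewrite -(rmorph_nat (polyC)) -rmorphM; congr (_%:P); field.
    have e2 : (2^-1)%:P = 8 * (16^-1)%:P :> {poly R} by rewrite -(rmorph_nat (polyC)) -rmorphM; congr (_%:P); field.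
    have e7 : (7 / 16)%:P = 7 * (16^-1)%:P :> {poly R} by rewrite rmorphM rmorph_nat.
    have e1 : 16 * (16^-1)%:P = 1 :> {poly R} by rewrite -(rmorph_nat (polyC)) -rmorphM mulfV ?pnatr_eq0.
    rewrite e4 e2 e7; set c := (16^-1)%:P in e1 *; set X := 'X.
    have -> : 1 - X * (1 + 4 * c * (1 - X)) ^+ 2 = 16 * c - X * (16 * c + 4 * c * (1 - X)) ^+ 2 + (X * (16 * c - 1) * (2 + 16 * c - 1 + 8 * c * (1 - X)) + (1 - 16 * c)) by ring.
    rewrite e1 !subrr mulr0 mul0r !addr0.
    have -> : 1 - X * (1 + 4 * c * (1 - X)) ^+ 2 = (1 - X) - X * (8 * c * (1 - X)) - X * (1 - X) ^+ 2 * c * (16 * c) by ring.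
    rewrite e1 mulr1.
    have -> : 1 - X - X * (8 * c * (1 - X)) = (16 * c) * (1 - X) - X * (8 * c * (1 - X)) by rewrite e1 mul1r.
    by ring.
  apply: iposD; first by apply: iposZ => //; rewrite invr_ge0.
  by apply: iposD; apply: iposZ; rewrite ?invr_ge0 ?divr_ge0 //; exact: iposX.
pose y := pv q; have yE : y = a + (4^-1)%:C *: (a - tp a a a).
  by rewrite /y /q pevD pevZ pevB pv1 pevX.
rewrite -yE; apply: (@cubes_bounded _ _ _ H _ (nm y + 4 * (4 * K) * nm y)) => k.
have [m [-> _]] : exists m, cubes tp y k = pv (s ^+ m * q) /\ True.
  elim: k => [|k [m [IH _]]]; first by exists 0%N; rewrite expr0 mul1r.
  exists (m + m + m).+1; split=> //; rewrite /cubes iterS -/(cubes tp y k) IH pv3; congr (pv _).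
  by rewrite exprS !exprD /s; ring.
case: m => [|m]; first by rewrite expr0 mul1r lerDl !mulr_ge0 ?nm_ge0.
have := @span_bound K (q ^+ 2 * s ^+ m) 4 y K0 TK _ _ _ (pspan_pv q).
rewrite /y pv_pv => h; apply: (@le_trans _ _ (4 * (4 * K) * nm y)); last by rewrite lerDr nm_ge0.
have -> : s ^+ m.+1 * q = 'X * (q ^+ 2 * s ^+ m) * q by rewrite exprS /s; ring.
have iqs : ipos 'X (q ^+ 2 * s ^+ m) by apply: iposM; exact: iposX.
apply: h => //; last by apply: iposD => //; exact: iposC.
have sm1 : ipos 'X (1 - s ^+ m).
  rewrite -opprB subrX1 -mulNr opprB; apply: iposM => //.
  by apply: ipos_sum => i _; exact: iposX.
have q2 : ipos 'X (2 - q).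
  have -> : 2 - q = 4^-1 *: 'X + (3 / 4)%:P.
    rewrite /q scalerBr -!mul_polyC mulr1.
    have -> : (3 / 4)%:P = 1 - (4^-1)%:P :> {poly R}.
      by rewrite -polyC1 -polyCB; congr (_%:P); field.
    by ring.
  by apply: iposD; [apply: iposZ; rewrite ?invr_ge0|apply: iposC; rewrite divr_ge0].
have -> : 4%:P - q ^+ 2 * s ^+ m = (2 + q) * (2 - q) + q ^+ 2 * (1 - s ^+ m).
  by rewrite rmorph_nat; ring.
apply: iposD; apply: iposM => //; last exact: iposX.
apply: iposD => //; have -> : 2 = 2%:P :> {poly R} by rewrite rmorph_nat.
by apply: iposC; exact: ler0n.
Qed.

(** Evaluated at the element of [smoothing_le1], [f] has real part [1 + (1 - r) / 4], with [r] the
    real part of [f {a, a, a}]; this is at most 1, so [r >= 1]. *)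
Lemma face_cube (f : dual Z) : nm f <= 1 -> f a = 1 :> C -> f (tp a a a) = 1 :> C.
Proof.
move=> f1 fa; apply: nm1_Re1.
  apply: le_trans (dual_le1 _ f1) _; rewrite (nm_cube H).
  by apply: exprn_ile1; rewrite ?nm_ge0.
have := le_trans (dual_le1 _ f1) smoothing_le1; move/(le_trans (Re_le_nm _)).
rewrite dualD dualZ dualB fa ReD ReMr ReB /=; lra.
Qed.

End Contraction.

(** * Weak* limits *)

Section Tends.
Context {R : realType}.
Local Notation C := (R[i]).

(** Convergence with real tolerances; [wtendsP] links it to the topology [weakstar] of the
    statement. *)
Definition tends (I : Type) (U : set_system I) (z : I -> C) (l : C) :=
  forall e : R, 0 < e -> U [set i | nm (z i - l) < e].

Section OneFilter.
Variables (I : Type) (U : set_system I).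
Hypothesis FU : ProperFilter U.
Implicit Types (z : I -> C) (l : C).

Lemma tends_uniq z l l' : tends U z l -> tends U z l' -> l = l'.
Proof.
move=> h h'; apply/eqP; rewrite -subr_eq0; apply/eqP; apply: nm_eq0.
apply/eqP; rewrite eq_le nm_ge0 andbT; apply: (@le_eps _ _ _ 2) => e e0.
have [i [/= zi zi']] := filter_ex (filterI (h e e0) (h' e e0)).
have -> : l - l' = (z i - l') - (z i - l) by ring.
by apply: le_trans (nmB _ _) _; lra.
Qed.

Lemma tends_ext z z' l : U [set i | z i = z' i] -> tends U z l -> tends U z' l.
Proof.
move=> E h e e0; apply: filterS (filterI E (h e e0)) => i [/= <-].
by [].
Qed.

Lemma tends_cst l : tends U (fun=> l) l.
Proof. by move=> e e0; apply: filterE => i /=; rewrite subrr nm0. Qed.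

Lemma tends_le z z' l l' (K : R) : 0 <= K -> (forall i, nm (z' i - l') <= K * nm (z i - l)) ->
  tends U z l -> tends U z' l'.
Proof.
move=> K0 hK h e e0; have K1 : 0 < K + 1 by lra.
have e' : 0 < e / (K + 1) by rewrite divr_gt0.
apply: filterS (h _ e') => i /= zi; apply: le_lt_trans (hK i) _.
apply: (@le_lt_trans _ _ ((K + 1) * nm (z i - l))).
  by apply: ler_wpM2r; [exact: nm_ge0|lra].
by rewrite mulrC -ltr_pdivlMr.
Qed.

Lemma tendsD z z' l l' : tends U z l -> tends U z' l' ->
  tends U (fun i => z i + z' i) (l + l').
Proof.
move=> h h' e e0; have e2 : 0 < e / 2 by rewrite divr_gt0.
apply: filterS (filterI (h _ e2) (h' _ e2)) => i [/= a b].
have -> : z i + z' i - (l + l') = (z i - l) + (z' i - l') by ring.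
by apply: le_lt_trans (nmD _ _) _; lra.
Qed.

Lemma tendsZ (c : C) z l : tends U z l -> tends U (fun i => c * z i) (c * l).
Proof.
by apply: (tends_le (nm_ge0 c)) => i; rewrite -mulrBr nmM.
Qed.

Lemma tendsN z l : tends U z l -> tends U (fun i => - z i) (- l).
Proof. by apply: (tends_le (ler01)) => i; rewrite -opprD nmN mul1r. Qed.

Lemma tends_conj z l : tends U z l -> tends U (fun i => (z i)^*%C) (l^*%C).
Proof.
apply: (tends_le (ler01)) => i; rewrite -[_ - _](@rmorphB _ _ (@conjc R)) mul1r.
by rewrite /nm normcJ.
Qed.

Lemma tends_Re_le z l (c : R) : U [set i | complex.Re (z i) <= c] -> tends U z l ->
  complex.Re l <= c.
Proof.
move=> Uc h; apply: (@le_eps _ _ _ 1) => e e0; rewrite mulr1.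
have [i [/= zi]] := filter_ex (filterI Uc (h e e0)); rewrite nm_distC.
by move=> /(le_lt_trans (Re_le_nm _)); rewrite ReB; lra.
Qed.

Lemma tends_Re_ge z l (c : R) : U [set i | c <= complex.Re (z i)] -> tends U z l ->
  c <= complex.Re l.
Proof.
move=> Uc /tendsN h; rewrite -lerN2 -ReN; apply: tends_Re_le h.
by apply: filterS Uc => i /=; rewrite ReN lerN2.
Qed.

Lemma tends_nm_le z l (c : R) : U [set i | nm (z i) <= c] -> tends U z l -> nm l <= c.
Proof.
move=> Uc h; apply: (@le_eps _ _ _ 1) => e e0; rewrite mulr1.
have [i [/= zi]] := filter_ex (filterI Uc (h e e0)); rewrite nm_distC => zl.
by have := nmBD l (z i); lra.
Qed.

End OneFilter.

Lemma fmap_ultra (I J : Type) (f : I -> J) (U : set_system I) :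
  UltraFilter U -> UltraFilter (f @ U).
Proof.
move=> uU; have pU : ProperFilter (f @ U) by exact: fmap_proper_filter.
apply: Build_UltraFilter => G pG UG; apply/seteqP; split=> A GA; last exact: UG.
have [//|nA] := in_ultra_setVsetC (f @^-1` A) uU.
have /UG GnA : (f @ U) (~` A) by [].
by have [x []] := filter_ex (filterI GA GnA).
Qed.

Lemma ultra_real (I : Type) (U : set_system I) (f : I -> R) (M : R) : UltraFilter U ->
  (forall i, `|f i| <= M) -> exists l, forall e, 0 < e -> U [set i | `|f i - l| < e].
Proof.
move=> uU fM; have := @normed_module.segment_compact R (- M) M; rewrite compact_ultra.
move=> /(_ (f @ U) (fmap_ultra f uU)); case.
  by apply: (@filterE _ U) => i /=; rewrite in_itv /= -ler_norml.
move=> l [_ /= fl]; exists l => e e0.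
have : nbhs l (ball l e) by exact: nbhsx_ballx.
move=> /fl; apply: (@filterS _ U) => i /=.
by rewrite -ball_normE /= distrC.
Qed.

Lemma ultra_tends (I : Type) (U : set_system I) (z : I -> C) (M : R) : UltraFilter U ->
  (forall i, nm (z i) <= M) -> exists l, tends U z l.
Proof.
move=> uU zM.
have [a ha] := ultra_real uU (fun i => le_trans (Re_nm (z i)) (zM i)).
have [b hb] := ultra_real uU (fun i => le_trans (Im_nm (z i)) (zM i)).
exists (a +i* b)%C => e e0; have e2 : 0 < e / 2 by rewrite divr_gt0.
apply: filterS (filterI (ha _ e2) (hb _ e2)) => i [/= h1 h2].
by apply: le_lt_trans (nm_le_ReIm _) _; rewrite !raddfB /=; lra.
Qed.

Section Weak.
Variable V : normedModType C.
Implicit Types (l : dual V).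

Definition wtends (I : Type) (U : set_system I) (w : I -> dual V) l :=
  forall v, tends U (fun i => w i v : C) (l v : C).

(** Banach-Alaoglu along an ultrafilter: the bounded values at each vector converge, and linearity
    and the bound pass to the limit. *)
Lemma ultra_wtends (I : Type) (U : set_system I) (w : I -> dual V) (M : R) :
  UltraFilter U -> 0 <= M -> (forall i, nm (w i) <= M) ->
  exists2 l, nm l <= M & wtends U w l.
Proof.
move=> uU M0 wM; have pU := @ultra_proper _ _ uU.
have wv v i : nm (w i v : C) <= M * nm v.
  by apply: le_trans (dual_le _ _) _; apply: ler_wpM2r; [exact: nm_ge0|exact: wM].
have [L hL] := choice (fun v => ultra_tends uU (wv v)).
have lL a x y : L (a *: x + y) = a * L x + L y.
  apply: (tends_uniq pU (hL _)); have := tendsD pU (tendsZ pU a (hL x)) (hL y).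
  by apply: tends_ext; apply: filterE => i /=; rewrite dualD dualZ.
have bL v : nm (L v) <= M * nm v by apply: (tends_nm_le pU _ (hL v)); apply: filterE => i /=; exact: wv.
exists (dualmk lL M0 bL) => [|v]; last exact: hL.
by apply: dual_nm_le => // v; exact: bL.
Qed.

Lemma wtends_uniq (I : Type) (U : set_system I) (w : I -> dual V) l l' :
  ProperFilter U -> wtends U w l -> wtends U w l' -> l = l'.
Proof. by move=> pU h h'; apply: dualP => v; have E := tends_uniq pU (h v) (h' v); exact: E. Qed.

Lemma wtends_cst (I : Type) (U : set_system I) l : ProperFilter U -> wtends U (fun=> l) l.
Proof. by move=> pU v; exact: tends_cst. Qed.

Lemma wtends_ext (I : Type) (U : set_system I) (w w' : I -> dual V) l : ProperFilter U ->
  U [set i | w i = w' i] -> wtends U w l -> wtends U w' l.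
Proof.
move=> pU E h v; apply: tends_ext (h v); apply: filterS E => i /= -> //.
Qed.

Lemma wtendsP (I : Type) (F : set_system I) (w : I -> dual V) l : Filter F ->
  wtends F w l <-> ((w : I -> weakstar V) @ F --> (l : weakstar V)).
Proof.
move=> FF.
have tE (z : I -> C) c : tends F z c <-> ((z : I -> C^o) @ F --> (c : C^o)).
  split=> [h|/cvgrPdist_lt h e e0].
    apply/cvgrPdist_lt => e e0; have e0' : 0 < complex.Re e by rewrite -ltcR ReK // ltW.
    have eE : e = (complex.Re e)%:C by rewrite ReK // ltW.
    by apply: filterS (h _ e0') => i /= zi; rewrite eE nmE ltcR nm_distC.
  have /h : 0 < e%:C :> C by rewrite ltcR.
  by apply: filterS => i /=; rewrite nmE ltcR nm_distC.
split=> [h|h v].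
  have pw : {ptws, ((fun i => w i : V -> C^o) @ F) --> (l : V -> C^o)}.
    by apply/pointwise_cvgP => v; exact/(tE (fun i => w i v))/h.
  move=> A; rewrite nbhsE => -[B [[B' oB' <-] lB] BA].
  have : nbhs (dual_fun l : {ptws V -> C^o}) B' by apply: open_nbhs_nbhs.
  by move=> /pw; apply: (@filterS _ F) => i /= Bi; exact: BA.
apply/(tE (fun i => w i v)).
have pw : {ptws, ((fun i => w i : V -> C^o) @ F) --> (l : V -> C^o)}.
  move=> A /= nA; have := @initial_continuous _ _ (dual_fun : dual V -> {ptws V -> C^o}) l A nA.
  by move=> /h.
by move: pw => /pointwise_cvgP/(_ v).
Qed.

Lemma wclosedP (A : set (dual V)) :
  (forall (U : set_system (dual V)) l, UltraFilter U -> U A -> wtends U id l -> A l) ->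
  closed (A : set (weakstar V)).
Proof.
move=> h l; rewrite closureEcvg => -[F pF [Fl AF]].
have [U [uU FU]] := ultraFilterLemma pF.
apply: (h U) => //; first exact/FU/AF.
by apply/wtendsP; apply: cvg_trans Fl; move=> B /FU.
Qed.

Lemma wclosed_lim (A : set (dual V)) (I : Type) (U : set_system I) (w : I -> dual V) l :
  ProperFilter U -> closed (A : set (weakstar V)) -> U [set i | A (w i)] ->
  wtends U w l -> A l.
Proof. by move=> pU cA UA /wtendsP; exact: (@closed_cvg _ _ U pU (w : I -> weakstar V) A cA UA l). Qed.

End Weak.

(** Finite subsets directed by inclusion, encoded as lists; it turns a failure at every finite stage
    into a net. *)
Definition list_filter (T : choiceType) : set_system (seq T) :=
  [set A | exists s0 : seq T, forall s : seq T, {subset s0 <= s} -> A s].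

Lemma list_filter_proper (T : choiceType) : ProperFilter (@list_filter T).
Proof.
apply: Build_ProperFilter => [[s0 h]|]; first exact: (h s0 (fun _ x => x)).
split=> [|A B [s hs] [t ht]|A B AB [s hs]].
- by exists [::].
- exists (s ++ t) => u su; split; [apply: hs|apply: ht] => x xs; apply: su;
    by rewrite mem_cat xs ?orbT.
- by exists s => t st; apply: AB; exact: hs.
Qed.

Section Preadjoint.
Variable Y : normedModType C.
Local Notation W := (dual Y).

Definition wcont (S : W -> W) := forall (I : Type) (F : set_system I) w l,
  ProperFilter F -> wtends F w l -> wtends F (fun i => S (w i)) (S l).

Lemma finite_support_eval (g : W -> C) (s : seq Y) :
  (forall a x y, g (a *: x + y) = a * g x + g y) ->
  (forall w : W, (forall v, v \in s -> w v = 0 :> C) -> g w = 0) ->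
  exists v, forall w : W, g w = w v.
Proof.
elim: s g => [|v s IH] g lg hg.
  by exists 0 => w; rewrite hg // dual0.
have g0 : g 0 = 0 by apply: hg => u _.
have gZ a x : g (a *: x) = a * g x by have := lg a x 0; rewrite g0 !addr0.
have [[w0 [ws wv]]|no] := pselect (exists w0 : W, (forall u, u \in s -> w0 u = 0 :> C) /\ w0 v <> 0 :> C).
  pose c := g w0 / w0 v.
  have [|w hw|u hu] := IH (fun w => g w - c * w v).
  - by move=> a x y; rewrite lg dualDE dualZE; rewrite -[a *: (x v)]/(a * x v); ring.
  - have := hg (- (w v / w0 v) *: w0 + w) _; rewrite lg => h.
    have : - (w v / w0 v) * g w0 + g w = 0.
      apply: h => u; rewrite in_cons dualDE dualZE => /orP[/eqP->|us].
        rewrite -[_ *: _]/(- (w v / w0 v) * w0 v) mulNr divfK ?addNr //; exact/eqP.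
      by rewrite (hw u us) (ws u us) addr0 -[_ *: _]/(_ * 0) mulr0.
    by move=> E; rewrite -[RHS]E /c; ring.
  exists (u + c *: v) => w; rewrite dualD dualZ -hu; ring.
apply: IH => // w hw; apply: hg => u; rewrite in_cons => /orP[/eqP->|/hw //].
by apply: contrapT => wv; apply: no; exists w.
Qed.

(** If [w -> S w v] were no evaluation, each finite list would have a [w] vanishing on it with
    [S w v = 1]. Along [list_filter] these tend weak* to 0, against the continuity of [S]. *)
Lemma preadjoint (S : {linear W -> W}) : wcont S ->
  forall v, exists v', forall w : W, S w v = w v' :> C.
Proof.
move=> cS v; apply: contrapT => no.
have bad (s : seq Y) : exists w : W, (forall u, u \in s -> w u = 0 :> C) /\ S w v = 1 :> C.
  apply: contrapT => h; apply: no; apply: (@finite_support_eval (fun w => S w v) s).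
    by move=> a x y; rewrite linearP.
  move=> w hw; apply: contrapT => /eqP Sw; apply: h.
  exists ((S w v : C)^-1 *: w); split.
    by move=> u us; rewrite dualZE hw // -[_ *: _]/(_ * 0) mulr0.
  by rewrite (opZ S) dualcZ mulVf.
have [w hw] := choice bad.
have pF := @list_filter_proper Y.
have w0 : wtends (@list_filter Y) w 0.
  move=> u e e0; exists [:: u] => s us /=.
  by rewrite (hw s).1 ?us ?inE // subr0 nm0.
have := cS _ _ _ _ pF w0 v; rewrite linear0 => /(_ 1 ltr01)[s h].
by have := h s (fun _ x => x); rewrite /= (hw s).2 subr0 nm1 ltxx.
Qed.

End Preadjoint.
End Tends.

(** * Peirce projections and states *)

Section OperatorNorm.
Context {R : realType}.
Local Notation C := (R[i]).
Variable V : normedModType C.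

Lemma opbound_continuous (T : {linear V -> V}) (K : R) : opbound T K -> continuous T.
Proof.
move=> TK; apply: bounded_linear_continuous; apply/linear_boundedP.
near=> r => x; apply: (@le_trans _ _ (K%:C * `|x|)).
  by rewrite !nmE -rmorphM lecR.
rewrite ler_wpM2r //.
by near: r; apply: nbhs_pinfty_ge; by rewrite RealE.
Unshelve. all: by end_near. Qed.

Lemma accretive_expand (T : V -> V) (t : R) y : accretive T -> 0 <= t ->
  nm y <= nm (y + t%:C *: T y).
Proof.
move=> aT t0; have [f df] := norming y; apply: le_trans (dual_le1 _ df.1).
apply: le_trans (Re_le_nm _); rewrite dualD dualZ df.2 ReD ReMr /= lerDl.
by apply: mulr_ge0 => //; exact: aT.
Qed.

(** Multiplying [x] by the conjugate of [f x] makes the value of [f] equal to the squared modulus of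
    [f x]. *)
Lemma Re_le0_vanish (f : dual V) (P : V -> Prop) :
  (forall c x, P x -> P (c *: x)) -> (forall x, P x -> complex.Re (f x : C) <= 0) ->
  forall x, P x -> f x = 0 :> C.
Proof.
move=> PZ h x Px; have := h _ (PZ (f x : C)^*%C _ Px); rewrite dualZ.
have := nm_sq (f x : C); case: (f x : C) => a b /= e.
have -> : a * a - - b * b = nm (a +i* b)%C ^+ 2 by rewrite e; ring.
move=> n0; apply: nm_eq0; apply/eqP; rewrite -sqrf_eq0 eq_le n0 sqr_ge0 //.
Qed.

End OperatorNorm.

Section PeirceNorm.
Context {R : realType}.
Local Notation C := (R[i]).
Variable Z : completeNormedModType C.
Variable tp : Z -> Z -> Z -> Z.
Hypothesis H : is_jbstar_triple tp.
Variable e : Z.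
Hypothesis He : tripotent tp e.
Local Notation L := (tp e e).
Local Notation P2 := (P2 tp e).
Local Notation P1 := (P1 tp e).
Local Notation P0 := (P0 tp e).
Local Notation pc := (pc tp e).

Let half : (2^-1)%:C = 2^-1 :> C. Proof. by rewrite fmorphV rmorph_nat. Qed.

Lemma LP2 x : L (P2 x) = P2 x. Proof. exact/(pc1P _ _ _)/(pc_P2 H He). Qed.
Lemma LP0 x : L (P0 x) = 0. Proof. exact/(pc0P _ _ _)/(pc_P0 H He). Qed.
Lemma LP1 x : L (P1 x) = 2^-1 *: P1 x. Proof. by rewrite -half; exact: (pc_P1 H He). Qed.
Lemma P2L x : P2 (L x) = P2 x.
Proof. by rewrite (P2_comm H) LP2. Qed.
Lemma P0L x : P0 (L x) = 0.
Proof. by rewrite (P0_comm H) LP0. Qed.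
Lemma P1L x : P1 (L x) = 2^-1 *: P1 x.
Proof. by rewrite (P1_comm H) LP1. Qed.

Definition peirce_comb (a b c : C) (x : Z) := a *: P2 x + b *: P1 x + c *: P0 x.

Lemma peirce_comb_linear a b c : linear (peirce_comb a b c).
Proof.
by move=> t x y; rewrite /peirce_comb (P2_linear H) (P1_linear H) (P0_linear H); vec.
Qed.

Lemma peirce_comb_bound a b c : exists2 K, 0 <= K & opbound (peirce_comb a b c) K.
Proof.
have [K K0 LK] := Lop_opbound H e e.
have LLK x : nm (L (L x)) <= K * (K * nm x).
  by apply: le_trans (LK _) _; apply: ler_wpM2l => //; exact: LK.
exists (nm a * (2 * K * K + K) + nm b * (4 * (K + K * K)) + nm c * (1 + 3 * K + 2 * K * K)).
  by nneg.
have n2 : nm (2 : C) = 2 by rewrite -(rmorph_nat (real_complex R)) nmRp.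
have n3 : nm (3 : C) = 3 by rewrite -(rmorph_nat (real_complex R)) nmRp.
have n4 : nm (4 : C) = 4 by rewrite -(rmorph_nat (real_complex R)) nmRp.
move=> x; have LKx := LK x; have LLKx := LLK x; rewrite /= in LKx.
have b2 : nm (P2 x) <= (2 * K * K + K) * nm x.
  by rewrite P2def; apply: le_trans (nmB _ _) _; rewrite nmZ n2; lra.
have b1 : nm (P1 x) <= 4 * (K + K * K) * nm x.
  by rewrite P1def nmZ n4 -mulrA; apply: ler_wpM2l => //; apply: le_trans (nmB _ _) _; lra.
have b0 : nm (P0 x) <= (1 + 3 * K + 2 * K * K) * nm x.
  rewrite P0def; apply: le_trans (nmD _ _) _; rewrite nmZ n2.
  by have := nmB x (3 *: L x); rewrite nmZ n3; lra.
apply: le_trans (nmD _ _) _; rewrite nmZ [leRHS]mulrDl; apply: lerD; last first.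
  by rewrite -mulrA; apply: ler_wpM2l => //; exact: nm_ge0.
apply: le_trans (nmD _ _) _; rewrite !nmZ [leRHS]mulrDl.
by apply: lerD; rewrite -mulrA; apply: ler_wpM2l => //; exact: nm_ge0.
Qed.

(** Every [l] that is not a non-negative real avoids [0], [1/2] and [1], so the resolvent is the
    explicit combination of Peirce projections [S]; then [spectrum_accretive] applies. *)
Lemma coL_accretive : accretive (fun x => x - L x).
Proof.
have lin : linear (fun x => x - L x) by move=> a x y; rewrite (tpPr H); vec.
have [K K0 LK] := Lop_opbound H e e.
apply: (@spectrum_accretive _ _ (mklin lin) (1 + K)).
- by lra.
- by move=> x; apply: le_trans (nmB _ _) _; rewrite mulrDl mul1r lerD2l; exact: LK.
- move=> x f df; rewrite /= dualB df.2 (raddfB (@complex.Im R)) /= sub0r.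
  by have := L_hermop H e df; rewrite /= => ->; rewrite oppr0.
move=> l; apply: contraPT => ln; apply; rewrite /= in ln *.
have l0 : l != 0 by apply: contraNneq ln => ->.
have l1 : l - 1 != 0 by apply: contraNneq ln => /eqP; rewrite subr_eq0 => /eqP ->.
have l2 : l - 2^-1 != 0.
  by apply: contraNneq ln => /eqP; rewrite subr_eq0 => /eqP ->; rewrite invr_ge0 ler0n.
pose S := peirce_comb l^-1 (l - 2^-1)^-1 (l - 1)^-1.
have lS := peirce_comb_linear l^-1 (l - 2^-1)^-1 (l - 1)^-1.
have [KS _ SK] := peirce_comb_bound l^-1 (l - 2^-1)^-1 (l - 1)^-1.
exists S; split=> //; first exact: (@opbound_continuous _ _ (mklin lS) _ SK).
  move=> x; have -> : l *: x - (x - L x) = (l - 1) *: x + L x by vec.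
  rewrite /S /peirce_comb (P2_linear H) (P1_linear H) (P0_linear H) P2L P1L P0L.
  rewrite [RHS](peirce_sum tp e x); congr (_ + _ + _).
  - by rewrite -{2}[P2 x]scale1r -scalerDl scalerA subrK mulVf // scale1r.
  - have E : l - 1 + 2^-1 = l - 2^-1 by field.
    by rewrite -scalerDl scalerA E mulVf // scale1r.
  - by rewrite addr0 scalerA mulVf // scale1r.
move=> x; have -> : l *: S x - (S x - L (S x)) = (l - 1) *: S x + L (S x) by vec.
rewrite /S /peirce_comb !(tpDr H) !(tpZr H) LP2 LP1 LP0 scaler0 addr0 [RHS](peirce_sum tp e x).
set A := P2 x; set B := P1 x; set D := P0 x.
have -> : (l - 1) *: (l^-1 *: A + (l - 2^-1)^-1 *: B + (l - 1)^-1 *: D) +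
    (l^-1 *: A + (l - 2^-1)^-1 *: (2^-1 *: B)) =
    (l / l) *: A + ((l - 1 + 2^-1) / (l - 2^-1)) *: B + ((l - 1) / (l - 1)) *: D by vec.
rewrite (_ : l - 1 + 2^-1 = l - 2^-1); last by field.
by rewrite !mulfV // !scale1r.
Qed.

(** The left side is the resolvent of [1 - L(e, e)] at time [t], contractive because that operator
    is accretive. As [t] grows, only [P2] survives; [L(e, e)] itself plays this part for [P0]. *)
Lemma peirce_contr2 (t : R) x : 0 <= t ->
  nm (P2 x + (1 + t / 2)^-1%:C *: P1 x + (1 + t)^-1%:C *: P0 x) <= nm x.
Proof.
move=> t0; set y := _ + _; have := accretive_expand y coL_accretive t0.
have t1 : 1 + t%:C != 0 :> C by rewrite -(rmorph1 (real_complex R)) -rmorphD fmorph_eq0; apply: lt0r_neq0; lra.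
have t2 : 1 + t%:C / 2 != 0 :> C.
  rewrite -(rmorph1 (real_complex R)) -half -rmorphM -rmorphD fmorph_eq0; apply: lt0r_neq0.
  have : 0 <= t * 2^-1 by rewrite mulr_ge0 // invr_ge0.
  lra.
have -> : L y = P2 x + (2^-1 * (1 + t / 2)^-1%:C) *: P1 x.
  by rewrite /y !(tpDr H) !(tpZr H) LP2 LP1 LP0 scaler0 addr0 scalerA mulrC.
have -> // : y + t%:C *: (y - (P2 x + (2^-1 * (1 + t / 2)^-1%:C) *: P1 x)) = x.
rewrite [RHS](peirce_sum tp e x) /y; set A := P2 x; set B := P1 x; set D := P0 x.
rewrite !fmorphV !rmorphD rmorph1 rmorphM fmorphV rmorph_nat.
have e2 : (1 + t%:C / 2) / (1 + t%:C / 2) = 1 by rewrite mulfV.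
have e1 : (1 + t%:C) / (1 + t%:C) = 1 by rewrite mulfV.
rewrite -[B in RHS]scale1r -[D in RHS]scale1r -e2 -e1.
by apply: dual_ext => f; rewrite ?(dualD, dualB, dualN, dualZ); field; rewrite t1 /=; move: t2; apply: contra_neq => h; rewrite -(mulr0 2^-1) -h; field.
Qed.

Lemma peirce_contr0 (t : R) x : 0 <= t ->
  nm (P0 x + (1 + t / 2)^-1%:C *: P1 x + (1 + t)^-1%:C *: P2 x) <= nm x.
Proof.
move=> t0; set y := _ + _; have := accretive_expand y (L_accretive H e) t0.
have t1 : 1 + t%:C != 0 :> C by rewrite -(rmorph1 (real_complex R)) -rmorphD fmorph_eq0; apply: lt0r_neq0; lra.
have t2 : 1 + t%:C / 2 != 0 :> C.
  rewrite -(rmorph1 (real_complex R)) -half -rmorphM -rmorphD fmorph_eq0; apply: lt0r_neq0.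
  have : 0 <= t * 2^-1 by rewrite mulr_ge0 // invr_ge0.
  lra.
have -> : Lop H e e y = (1 + t)^-1%:C *: P2 x + (2^-1 * (1 + t / 2)^-1%:C) *: P1 x.
  by rewrite /y /= !(tpDr H) !(tpZr H) LP2 LP1 LP0 add0r scalerA [_ * 2^-1]mulrC addrC.
have -> // : y + t%:C *: ((1 + t)^-1%:C *: P2 x + (2^-1 * (1 + t / 2)^-1%:C) *: P1 x) = x.
rewrite [RHS](peirce_sum tp e x) /y; set A := P2 x; set B := P1 x; set D := P0 x.
rewrite !fmorphV !rmorphD rmorph1 rmorphM fmorphV rmorph_nat.
have e2 : (1 + t%:C / 2) / (1 + t%:C / 2) = 1 by rewrite mulfV.
have e1 : (1 + t%:C) / (1 + t%:C) = 1 by rewrite mulfV.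
rewrite -[B in RHS]scale1r -[A in RHS]scale1r -e2 -e1.
by apply: dual_ext => f; rewrite ?(dualD, dualB, dualN, dualZ); field; rewrite t1 /=; move: t2; apply: contra_neq => h; rewrite -(mulr0 2^-1) -h; field.
Qed.

Let contr_lim (A B D : Z) (m : R) :
  (forall t : R, 0 <= t -> nm (A + (1 + t / 2)^-1%:C *: B + (1 + t)^-1%:C *: D) <= m) -> nm A <= m.
Proof.
move=> h; apply: (@le_eps _ _ _ (nm B + nm D)) => s s0.
have t0 : 0 <= 2 / s by rewrite divr_ge0 // ltW.
have c1 : (1 + 2 / s / 2)^-1 <= s.
  rewrite invf_ple ?posrE //; last by rewrite ltr_pwDl // divr_ge0.
  by rewrite (_ : 2 / s / 2 = s^-1); [rewrite lerDr|field; rewrite gt_eqF].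
have c2 : (1 + 2 / s)^-1 <= s.
  rewrite invf_ple ?posrE //; last by rewrite ltr_pwDl.
  have : s^-1 <= 2 / s by rewrite ler_peMl ?ler1n // invr_ge0 ltW.
  by lra.
have p1 : 0 <= (1 + 2 / s / 2)^-1 by rewrite invr_ge0 addr_ge0 // divr_ge0.
have p2 : 0 <= (1 + 2 / s)^-1 by rewrite invr_ge0 addr_ge0.
have := h _ t0; set b := _ *: B; set d := _ *: D => h1.
have nb : nm b <= s * nm B by rewrite nmZp //; apply: ler_wpM2r => //; exact: nm_ge0.
have nd : nm d <= s * nm D by rewrite nmZp //; apply: ler_wpM2r => //; exact: nm_ge0.
have -> : A = (A + b + d) - (b + d) by vec.
by apply: le_trans (nmB _ _) _; have := nmD b d; lra.
Qed.

Lemma P2_contr x : nm (P2 x) <= nm x.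
Proof. by apply: contr_lim => t; exact: peirce_contr2. Qed.

Lemma P0_contr x : nm (P0 x) <= nm x.
Proof. by apply: contr_lim => t; exact: peirce_contr0. Qed.

Section State.
Variable f : dual Z.
Hypotheses (f1 : nm f <= 1) (fe : f e = 1 :> C).

(** For small [s] the orthogonal sum [e + s b] lies in the unit ball, so [f] cannot have positive
    real part at [b], nor at any rotation of [b]. *)
Lemma state_kill0 b : pc 0 b -> f b = 0 :> C.
Proof.
apply: Re_le0_vanish b => [c x|b hb]; first exact: pcZ.
pose s := (nm b + 1)^-1; have b1 : 0 < nm b + 1 by rewrite ltr_wpDl ?nm_ge0.
have s0 : 0 < s by rewrite invr_gt0.
have n1 : nm (s%:C *: b) <= 1.
  by rewrite nmZp ?(ltW s0) // mulrC ler_pdivrMr // mul1r lerDl.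
have := nm_perp_le1 H He (pc_e He) (pcZ H _ hb) (trip_le1 H He) n1.
move=> /(le_trans (dual_le1 _ f1))/(le_trans (Re_le_nm _)).
rewrite dualD dualZ fe ReD ReMr /= gerDl => h.
by rewrite -(pmulr_rle0 _ s0).
Qed.

(** As [{e, e, a} = a / 2] and [{e, a, e} = 0], the cube of [e + t a] agrees with [e + t a] to first
    order. Its norm [N] satisfies [N^3 <= N + t^2 K], hence [N <= 1 + t^2 K], which leaves no room
    for a first-order term of [f]. *)
Lemma state_kill1 a : pc (2^-1) a -> f a = 0 :> C.
Proof.
apply: Re_le0_vanish a => [c x|a ha]; first exact: pcZ.
have La : tp e e a = 2^-1 *: a by rewrite -half.
have Qa : tp e a e = 0 by apply: (pc_van H He (pc_e He) ha (pc_e He)); lra.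
pose K := nm (2 *: tp e a a + tp a e a) + nm (tp a a a).
have K0 : 0 <= K by rewrite addr_ge0 ?nm_ge0.
apply: (@le_eps _ _ _ K) => s s0; rewrite add0r.
pose t := Num.min s 1; have t0 : 0 < t by rewrite lt_min s0 ltr01.
have ts : t <= s by rewrite ge_min lexx.
have t1 : t <= 1 by rewrite ge_min lexx orbT.
apply: (@le_trans _ _ (t * K)); last by apply: ler_wpM2r.
pose N := nm (e + t%:C *: a).
have N3 : N ^+ 3 <= N + t ^+ 2 * K.
  rewrite -(nm_cube H).
  have -> : tp (e + t%:C *: a) (e + t%:C *: a) (e + t%:C *: a) =
     (e + t%:C *: a) + (t ^+ 2)%:C *: ((2 *: tp e a a + tp a e a) + t%:C *: tp a a a).
    rewrite !(tpDl H) !(tpDm H) !(tpDr H) !(tpZl H) !(tpZRm H) !(tpZr H) Qa.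
    rewrite [tp a e e](tpC H) La [tp a a e](tpC H) He rmorphXn /=; vecf.
  apply: le_trans (nmD _ _) _; rewrite lerD2l nmZp ?sqr_ge0 //; apply: ler_wpM2l; first exact: sqr_ge0.
  by apply: le_trans (nmD _ _) _; rewrite lerD2l nmZp ?(ltW t0) // ler_piMl // nm_ge0.
have N1 : N <= 1 + t ^+ 2 * K.
  have [N1|/ltW N1] := lerP N 1; first by rewrite (le_trans N1) // lerDl mulr_ge0 // sqr_ge0.
  have N0 : 0 <= N by exact: nm_ge0.
  have : 0 <= (N - 1) * (N * (N + 1) - 1).
    apply: mulr_ge0; first by rewrite subr_ge0.
    have : 1 <= N * (N + 1) by nra.
    lra.
  by rewrite (_ : (N - 1) * _ = N ^+ 3 - N - (N - 1)); [lra|ring].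
have := le_trans (Re_le_nm _) (le_trans (dual_le1 (e + t%:C *: a) f1) N1).
by rewrite dualD dualZ fe ReD ReMr /= lerD2l expr2 -mulrA ler_pM2l.
Qed.

Lemma state_P2 x : f (P2 x) = f x :> C.
Proof.
rewrite [x in RHS](peirce_sum tp e x) !dualD.
by rewrite (state_kill1 (pc_P1 H He x)) (state_kill0 (pc_P0 H He x)) !addr0.
Qed.

End State.

(** * Powers of a self-adjoint element of the Peirce-2 space *)

Section UnitCalculus.
Variable k : Z.
Hypotheses (hk : pc 1 k) (Qk : tp e k e = k).
Local Notation M := (tp k e).
Definition upow n := iter n M e.

Lemma upowS n : upow n.+1 = M (upow n). Proof. by []. Qed.

Lemma upow_pc n : pc 1 (upow n).
Proof.
elim: n => [|n IH]; first exact: pc_e.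
by have := pc_rule H hk (pc_e He) IH; rewrite subrr add0r.
Qed.

Lemma upow_Q n : tp e (upow n) e = upow n.
Proof.
elim: n => [|n IH]; first exact: He.
rewrite /upow iterS -/(upow n) (Q_auto H He hk (pc_e He) (upow_pc n)) Qk IH.
by rewrite (_ : tp e e e = e).
Qed.

Lemma ML z : M z = tp e k z.
Proof. by rewrite -(unit_flip H He z hk) Qk. Qed.

(** The telescoping argument of [tri_powers]; here the two ends of the sum agree, by [unit_flip] and
    self-adjointness of the powers, so [n + 2] times the commutator is zero. *)
Lemma upow_L n : (forall i j, (i + j)%N = n -> forall x, tp (upow i) (upow j) x = tp (upow n) e x)
  /\ forall x, M (tp (upow n) e x) = tp (upow n) e (M x).
Proof.
elim: n => [|n [IHe IHc]].
  split; first by move=> i j /eqP; rewrite addn_eq0 => /andP[/eqP-> /eqP->].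
  have Me : M e = k by rewrite (tpC H); exact/(pc1P _ _ _).
  by move=> x; rewrite /upow /= (jordan H k e e e x) Me Qk (ML x) subrr add0r.
have MJ x y z : M (tp x y z) = tp (M x) y z - tp x (M y) z + tp x y (M z).
  by rewrite (jordan H) -(ML y).
have shift i j : (i + j)%N = n -> forall x, tp (upow i.+1) (upow j) x = tp (upow i) (upow j.+1) x.
  move=> ij x; have := MJ (upow i) (upow j) x.
  rewrite (IHe _ _ ij) IHc (IHe _ _ ij) => /eqP.
  by rewrite -subr_eq subrr eq_sym subr_eq0 => /eqP.
have e1 i j : (i + j)%N = n.+1 -> forall x, tp (upow i) (upow j) x = tp (upow n.+1) e x.
  elim: j i => [|j IH] i; first by rewrite addn0 => ->.
  by rewrite addnS => -[ij] x; rewrite -shift // IH // addSn ij.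
split=> // x.
set K := M (tp (upow n.+1) e x) - tp (upow n.+1) e (M x).
have K1 i j : (i + j)%N = n.+1 -> K = tp (upow i.+1) (upow j) x - tp (upow i) (upow j.+1) x.
  by move=> ij; rewrite /K -!(e1 _ _ ij) MJ addrK.
have K2 m : (m <= n.+2)%N -> K *+ m = tp (upow m) (upow (n.+2 - m)) x - tp e (upow n.+2) x.
  elim: m => [|m IH] mn; first by rewrite subn0 mulr0n subrr.
  rewrite mulrSr IH ?(ltnW mn) // (K1 m (n.+1 - m)%N) ?subnKC // subSS.
  by rewrite subSn // addrA [X in X - _]addrC addrA; vec.
have := K2 n.+2 (leqnn _); rewrite subnn -(unit_flip H He x (upow_pc n.+2)) upow_Q subrr => /eqP.
by rewrite -scaler_nat scaler_eq0 pnatr_eq0 /= subr_eq0 => /eqP.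
Qed.

Lemma upow_tp i j l : tp (upow i) (upow j) (upow l) = upow (i + j + l).
Proof.
rewrite (upow_L (i + j)).1 //; elim: l => [|l IH].
  by rewrite addn0 (tpC H); apply/(pc1P _ _ _); exact: upow_pc.
by rewrite addnS !upowS -(upow_L (i + j)).2 IH.
Qed.

Local Notation up := (pev upow).

Lemma up_tp x p q : tp (up p) (up q) x = tp (up (p * q)) e x.
Proof.
rewrite (@pev_bilin _ _ (fun y z => tp y z x) upow upow (fun i => tp (upow i) e x)).
- exact/esym/(pev_map _ (rlin_l H e x)).
- by move=> y; exact: rlin_l.
- by move=> y; exact: rlin_m.
- by move=> i j; rewrite (upow_L (i + j)).1.
Qed.

Lemma up_mul p q : tp (up p) e (up q) = up (p * q).
Proof.
rewrite (@pev_bilin _ _ (fun y z => tp y e z) upow upow upow) //.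
- by move=> z; exact: rlin_l.
- by move=> y; exact: rlin_r.
- by move=> i j; have := upow_tp i 0 j; rewrite addn0.
Qed.

Lemma up1 : up 1 = e. Proof. exact: pev1. Qed.
Lemma upX : up 'X = k.
Proof. by rewrite pevX /upow /= (tpC H); exact/(pc1P _ _ _). Qed.

Lemma up_pc p : pc 1 (up p).
Proof.
rewrite /pev; elim/big_rec: _ => [|i x _ hx]; first exact: pc0.
by apply: pcD => //; apply: pcZ => //; exact: upow_pc.
Qed.

Lemma up_Q p : tp e (up p) e = up p.
Proof. by rewrite (pev_map (v := upow) _ (rlin_m H e e)) // => i; exact: upow_Q. Qed.

Variables (x : Z) (f : dual Z).
Hypotheses (df : dualpair x f) (k1 : nm k <= 1).

Let F p := complex.Re (f (tp (up p) e x) : C).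

(** That [(1 + 'X) / 2] lies between 0 and 1 encodes [-1 <= k <= 1], derived from [nm k <= 1] by
    [psd_growth]. *)
Lemma unit_ipf : ipf (2^-1 *: (1 + 'X)) F.
Proof.
have F_lfun : lfun F by move=> c q r; rewrite /F pevP (tpPl H) dualD dualZ ReD ReMr.
have F_sq g : 0 <= F (g ^+ 2) by rewrite /F expr2 -up_tp; exact: (L_form_ge0 H df).
have [B B1 hB] := triple_bound H.
have kc j : cubes tp k j = upow (3 ^ j).
  elim: j => [|j IH]; first by rewrite -upX pevX.
  by rewrite /cubes iterS -/(cubes tp k j) IH upow_tp expnS -addnA addnn -mul2n -mulSn.
(* The powers known to be bounded are iterated cubes, with odd exponents [3^j], whereas an even
   exponent is required; one factor ['X] is moved over to [g^2]. *)
have gr g : exists c : R, forall N0, exists2 N, (N0 <= N)%N & F (('X ^+ N * g) ^+ 2) <= c * 1 ^+ (2 * N).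
  exists (B * nm (up ('X * g ^+ 2)) * nm x) => N0; pose n := (3 ^ (2 * N0))%N.
  have on : odd n by rewrite oddX orbT.
  exists n.+1./2.
    rewrite -[N0]doubleK; apply: half_leq; rewrite -muln2 mulnC.
    by apply: leqW; apply: ltnW; exact: ltn_expl.
  have nn : (n.+1./2 * 2 = n.+1)%N by rewrite muln2 -[RHS]odd_double_half /= on.
  rewrite expr1n mulr1 /F exprMn -exprM nn exprSr -mulrA -up_tp pevXn -kc.
  apply: le_trans (Re_le_nm _) _; apply: le_trans (dual_le1 _ df.1) _.
  apply: le_trans (hB _ _ _) _; apply: ler_wpM2r; first exact: nm_ge0.
  apply: ler_wpM2r; first exact: nm_ge0.
  by rewrite ler_piMr ?(le_trans ler01) //; exact: nm_cubes_le1.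
have FX g : `|F ('X * g ^+ 2)| <= F (g ^+ 2).
  by have := psd_growth F_lfun F_sq ltr01 gr g; rewrite mul1r.
split=> // g; have := FX g; rewrite ler_norml => /andP[h1 h2].
  rewrite -scalerAl mulrDl mul1r lfunZ // lfunD // mulr_ge0 ?invr_ge0 //; lra.
have -> : (1 - 2^-1 *: (1 + 'X)) * g ^+ 2 = 2^-1 *: (g ^+ 2 - 'X * g ^+ 2) :> {poly R}.
  rewrite -!mul_polyC; have : (2^-1)%:P * 2 = 1 :> {poly R}.
    by rewrite -(rmorph_nat (@polyC R)) -rmorphM /= mulVf.
  move: (2^-1)%:P => c c2; have -> : 1 - c * (1 + 'X) = c * (1 - 'X) by rewrite -{1}c2; ring.
  by ring.
by rewrite lfunZ // lfunB // mulr_ge0 ?invr_ge0 //; lra.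
Qed.

Lemma unit_real q : complex.Im (f (tp (up q) e x) : C) = 0.
Proof.
have := L_form_sym H df e (up q).
have -> : tp e (up q) x = tp (up q) e x.
  by have := unit_flip H He x (up_pc q); rewrite up_Q.
by move=> /(congr1 (@complex.Im R)); case: (f _ : C) => c d /=; lra.
Qed.

Lemma unit_numrange_sa : nm (f (tp k e x) : C) <= complex.Re (f (tp e e x) : C).
Proof.
apply: le_trans (nm_le_ReIm _) _.
have [lF _ h1 h2] := unit_ipf; have := unit_real 'X; rewrite upX => ->.
rewrite normr0 addr0 -{2}up1 -upX -/(F 'X) -/(F 1) ler_norml.
move: (h1 1) (h2 1); rewrite expr1n !mulr1 lfunB // lfunZ // lfunD //.
by move=> *; apply/andP; split; lra.
Qed.

End UnitCalculus.

(** A rotation of [h] makes the value real and non-negative; the self-adjoint part [s] of the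
    rotated element has the same value and is covered by the polynomial calculus. *)
Lemma unit_numrange x f h : dualpair x f -> pc 1 h -> nm h <= 1 ->
  nm (f (tp h e x) : C) <= complex.Re (f (tp e e x) : C).
Proof.
move=> df hh h1; set F := f (tp h e x) : C.
have [->|F0] := eqVneq F 0; first by rewrite nm0; exact: (L_form_ge0 H df).
have nF : nm F != 0 by apply: contra_neq F0; exact: nm_eq0.
pose c : C := (nm F)%:C / F.
have c1 : nm c = 1 by rewrite nmM nmV nmRp ?nm_ge0 // mulfV.
have cF : c * F = (nm F)%:C by rewrite /c divfK.
have hch : pc 1 (c *: h) by apply: pcZ.
have nch : nm (c *: h) <= 1 by rewrite nmZ c1 mul1r.
pose s := 2^-1%:C *: (c *: h + tp e (c *: h) e).
have hs : pc 1 s by apply: pcZ => //; apply: pcD => //; exact: pc_Q.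
have Qs : tp e s e = s.
  by rewrite /s (tpZRm H) (tpDm H) (QQ_id H He hch) addrC.
have s1 : nm s <= 1.
  rewrite nmZp ?invr_ge0 // ler_pdivrMl // mulr1; apply: le_trans (nmD _ _) _.
  by have := Q_contr H He hch nch; lra.
have := unit_numrange_sa hs Qs df s1.
rewrite /s (tpZl H) (tpDl H) (unit_flip H He x hch) dualZ dualD (L_form_sym H df (c *: h) e).
rewrite (tpZl H) dualZ -/F cF => /(le_trans (Re_le_nm _)).
by rewrite ReMr /=; lra.
Qed.

End PeirceNorm.

(** * Elements close to 1 on a norming set of states *)

Section NormingStates.
Context {R : realType}.
Local Notation C := (R[i]).
Variable Z : completeNormedModType C.
Variable tp : Z -> Z -> Z -> Z.
Hypothesis H : is_jbstar_triple tp.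
Variable e : Z.
Hypothesis He : tripotent tp e.
Local Notation pc := (pc tp e).
Local Notation P2 := (P2 tp e).
Local Notation P1 := (P1 tp e).
Local Notation P0 := (P0 tp e).

Lemma state_dualpair (f : dual Z) : nm f <= 1 -> f e = 1 :> C -> dualpair e f.
Proof.
move=> f1 fe; split=> //; rewrite fe; have := dual_le1 e f1; rewrite fe nm1 => e1.
have -> // : nm e = 1 by apply/eqP; rewrite eq_le e1 (trip_le1 H He).
Qed.

Lemma cube_diff k w : tp (k + w) (k + w) (k + w) - tp w w w =
  tp k (k + w) (k + w) + tp w k (k + w) + tp w w k.
Proof. by rewrite !(tpDl H) !(tpDm H) !(tpDr H); vec. Qed.

Lemma state_off (f : dual Z) l x : nm f <= 1 -> f e = 1 :> C -> pc l x -> l != 1 -> f x = 0 :> C.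
Proof.
move=> f1 fe hx l1; rewrite -(state_P2 H He f1 fe).
have E := P2L H He x; rewrite hx (P2E H) (opZ (mklin (P2_linear H e))) -(P2E H) in E.
have : (l - 1)%:C *: P2 x = 0 by rewrite rmorphB rmorph1 scalerBl E scale1r subrr.
by move/eqP; rewrite scaler_eq0 fmorph_eq0 subr_eq0 (negbTE l1) /= => /eqP ->; rewrite dual0.
Qed.

(** Eigenvalues are written as halves of natural numbers, so that the mismatch of Peirce indices is
    decided by computation. *)
Lemma state_off_nat (f : dual Z) (i j l : nat) x y z : nm f <= 1 -> f e = 1 :> C ->
  pc (i%:R / 2) x -> pc (j%:R / 2) y -> pc (l%:R / 2) z -> (i + l != j + 2)%N ->
  f (tp x y z) = 0 :> C.
Proof.
move=> f1 fe hx hy hz ne; apply: (state_off f1 fe (pc_rule H hx hy hz)).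
apply: contra_neq ne => E; apply/eqP; rewrite -(eqr_nat R) !natrD; apply/eqP.
have : (i%:R / 2 - j%:R / 2 + l%:R / 2) * 2 = 1 * 2 :> R by rewrite E.
by rewrite mulrDl mulrBl !divfK ?pnatr_eq0 // mul1r => h; lra.
Qed.

(* Only [{e, e, e}], [{a, a, e}] and [{a, x, a}] lie in the Peirce space of [e]
   that states see. *)
Lemma state_cube (f : dual Z) a x (c d : R) : nm f <= 1 -> f e = 1 :> C ->
  pc (2^-1) a -> pc 0 x ->
  f (tp (e + (c%:C *: a + d%:C *: x)) (e + (c%:C *: a + d%:C *: x)) (e + (c%:C *: a + d%:C *: x))) =
  1 + (2 * c ^+ 2)%:C * f (tp a a e) + (c ^+ 2 * d)%:C * f (tp a x a) :> C.
Proof.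
move=> f1 fe ha0 hx0.
have he : pc (2%:R / 2) e by rewrite mulfV ?pnatr_eq0 //; exact: pc_e.
have ha : pc (1%:R / 2) a by rewrite mul1r.
have hx : pc (0%:R / 2) x by rewrite mul0r.
have off i j l x1 x2 x3 := @state_off_nat f i j l x1 x2 x3 f1 fe.
rewrite !(tpDl H) !(tpDm H) !(tpDr H) !(tpZl H) !(tpZRm H) !(tpZr H) !dualD !dualZ He fe.
rewrite (perp_unit2 H He x hx0) [tp x x e](tpC H) (perp_unit2 H He x hx0) dual0.
rewrite [tp e a a](tpC H).
rewrite (off _ _ _ _ _ _ he he ha isT) (off _ _ _ _ _ _ he he hx isT) (off _ _ _ _ _ _ he ha he isT).
rewrite (off _ _ _ _ _ _ he ha hx isT) (off _ _ _ _ _ _ he hx he isT) (off _ _ _ _ _ _ he hx ha isT).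
rewrite (off _ _ _ _ _ _ ha he he isT) (off _ _ _ _ _ _ ha he ha isT) (off _ _ _ _ _ _ ha he hx isT).
rewrite (off _ _ _ _ _ _ ha ha ha isT) (off _ _ _ _ _ _ ha ha hx isT) (off _ _ _ _ _ _ ha hx he isT).
rewrite (off _ _ _ _ _ _ ha hx hx isT) (off _ _ _ _ _ _ hx he he isT) (off _ _ _ _ _ _ hx he ha isT).
rewrite (off _ _ _ _ _ _ hx he hx isT) (off _ _ _ _ _ _ hx ha he isT) (off _ _ _ _ _ _ hx ha ha isT).
rewrite (off _ _ _ _ _ _ hx ha hx isT) (off _ _ _ _ _ _ hx hx ha isT) (off _ _ _ _ _ _ hx hx hx isT).
by rewrite !rmorphM rmorph_nat /=; ring.
Qed.

Lemma P2_unit_op k x : pc 1 k -> P2 (tp k e x) = tp k e (P2 x).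
Proof.
move=> hk; rewrite {1}(tp_peirce H e k e x) !(P2E H) !(opD (mklin (P2_linear H e))) -!(P2E H).
have r l y : pc l y -> pc l (tp k e y).
  by move=> hy; have := pc_rule H hk (pc_e He) hy; rewrite subrr add0r.
rewrite (P2_id (r _ _ (pc_P2 H He x))) (P2_1 H (r _ _ (pc_P1 H He x))) (P2_0 H (r _ _ (pc_P0 H He x))).
by rewrite !addr0.
Qed.

Variable Sig : dual Z -> Prop.
Hypothesis Sig_state : forall f, Sig f -> nm f <= 1 /\ f e = 1 :> C.
Hypothesis Sig_norming : forall k (eps : R), pc 1 k -> 0 <= eps ->
  (forall f, Sig f -> nm (f k : C) <= eps) -> nm k <= 4 * eps.

(** At a state the moments of [L(a, a)] are positive, and the boundedness of the powers of [a] puts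
    ['X^m] below 1 in the sense of [psd_growth]; the factor 4 is that of [Sig_norming]. *)
Lemma half_powers a m : nm a <= 1 -> pc (2^-1) a ->
  nm (tp (odd_power tp a m) a e) <= 4 * nm (tp a a e).
Proof.
move=> a1 ha; have pa n : pc (2^-1) (odd_power tp a n).
  by elim: n => // n IH; have := pc_rule H ha ha IH; rewrite subrr add0r.
have h1 n : pc 1 (tp (odd_power tp a n) a e).
  by have := pc_rule H (pa n) ha (pc_e He); rewrite subrr add0r.
apply: Sig_norming (h1 m) (nm_ge0 _) _ => phi s; have [s1 s2] := Sig_state s; have df := state_dualpair s1 s2.
pose F q := complex.Re (phi (tp (pev (odd_power tp a) q) a e) : C).
have F_lfun : lfun F by move=> c q r; rewrite /F pevP (tpPl H) dualD dualZ ReD ReMr.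
have F_sq g : 0 <= F (g ^+ 2) by rewrite /F expr2 -(pv_tp H); exact: (L_form_ge0 H df).
have [K K0 aK] := powers_asymp H a1; have [B B1 hB] := triple_bound H.
have gr g : exists c : R, forall N0, exists2 N, (N0 <= N)%N & F (('X^m ^+ N * g) ^+ 2) <= c * 1 ^+ (2 * N).
  exists (B * K * nm (pev (odd_power tp a) (g ^+ 2)) * nm e) => N0; exists N0 => //.
  rewrite expr1n mulr1 /F exprMn -!exprM -(pv_tp H) pevXn.
  apply: le_trans (Re_le_nm _) _; apply: le_trans (dual_le1 _ df.1) _.
  apply: le_trans (hB _ _ _) _; do 2!(apply: ler_wpM2r; first exact: nm_ge0).
  by apply: ler_wpM2l; [exact: le_trans ler01 B1|exact: (aK _).1].
have := psd_growth F_lfun F_sq ltr01 gr 1; rewrite expr1n mulr1 mul1r => h.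
apply: le_trans (nm_le_ReIm _) _.
have := span_real H a df 'X^m; rewrite pevXn => ->; rewrite normr0 addr0.
move: h; rewrite /F pevXn pv1 => /le_trans; apply; apply: le_trans (Re_le_nm _) _.
exact: (dual_le1 _ df.1).
Qed.

Lemma pw_unit a N0 : nm a = 1 -> exists2 n, (N0 <= n)%N & nm (odd_power tp a n) = 1.
Proof.
move=> a1; elim: N0 => [|N0 [n Nn hn]]; first by exists 0%N.
exists (3 * n).+1; last by rewrite (pw_cube H) hn expr1n.
by rewrite ltnS (leq_trans Nn) // leq_pmull.
Qed.

(* With [d] a high power of [a], [z = {d, e, d}] is almost fixed by half of every
   [L(a^[2k+1], a)], so Newton's identity makes it small, and then
   [{d, d, d} = 4 {{d, d, e}, e, d} - 2 {e, d, z}] would be small as well. *)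
Lemma half_lower : exists2 c : R, 0 < c & forall a, pc (2^-1) a ->
  c * nm a ^+ 2 <= nm (tp a a e).
Proof.
have [M M1 hM] := triple_bound H; have M0 : 0 < M by apply: lt_le_trans M1.
(* The final estimate is [1 <= 16 M eta + 2 M |z|] with [M |z| <= 12 M^4 eta], so the right side is
   at most [40 M^4 eta = 1/2]. *)
pose eta := (80 * M ^+ 4)^-1; have eta0 : 0 < eta by rewrite invr_gt0 mulr_gt0 // exprn_gt0.
exists eta => // a0 ha0; have [->|a00] := eqVneq a0 0.
  by rewrite nm0 expr0n mulr0 nm_ge0.
have na0 : 0 < nm a0 by rewrite lt_neqAle nm_ge0 andbT eq_sym; apply: contra_neq a00; exact: nm_eq0.
have ia : 0 <= (nm a0)^-1 by rewrite invr_ge0 ltW.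
pose a := (nm a0)^-1%:C *: a0; have ha : pc (2^-1) a by exact: pcZ.
have a1 : nm a = 1 by rewrite nmZp // mulVf ?gt_eqF.
suff : eta <= nm (tp a a e).
  rewrite /a (tpZl H) (tpZRm H) !nmZp // => h.
  have := ler_wpM2r (sqr_ge0 (nm a0)) h; congr (_ <= _).
  by field; rewrite gt_eqF.
rewrite leNgt; apply/negP => small.
have a1' : nm a <= 1 by rewrite a1.
have Le m : nm (tp (odd_power tp a m) a e) <= 4 * eta.
  by apply: le_trans (half_powers m a1' ha) _; lra.
have [K K0 aK] := powers_asymp H a1'.
have [N N0 nb] := archi_lt (3 * K / eta).
have [[|n] Nn nd] := pw_unit N a1; first by rewrite leqn0 in Nn; rewrite (eqP Nn) in N0.
set d := odd_power tp a n.+1 in nd.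
have Kn : K / n.+1%:R <= eta / 3.
  rewrite ler_pdivrMr ?ltr0n // -ler_pdivrMl ?divr_gt0 //.
  apply: le_trans (_ : N%:R <= _); last by rewrite ler_nat.
  by apply: ltW; rewrite (_ : _ * K = 3 * K / eta) //; field; rewrite gt_eqF.
have step j : nm (odd_power tp a (n.+1 + j) - odd_power tp a (n.+1 + j).+1) <= eta / 3.
  apply: le_trans (aK (n + j)%N).2 _; apply: le_trans Kn.
  by apply: ler_wpM2l => //; rewrite lef_pV2 ?posrE ?ltr0n // ler_nat ltnS leq_addr.
have close k : (k < 3)%N -> nm (tp (odd_power tp a k) a d - d) <= eta.
  have -> : tp (odd_power tp a k) a d = odd_power tp a (n.+1 + k).+1.
    by have := tpwww H a k 0 n.+1; rewrite addn0 addnC.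
  have s0 := step 0%N; have s1 := step 1%N; have s2 := step 2%N.
  rewrite addn0 -/d in s0; rewrite !addn1 in s1; rewrite !addn2 in s2; rewrite nm_distC.
  case: k => [|[|[|//]]] _; rewrite ?addn0 ?addn1 ?addn2.
  - by lra.
  - have := nmD (d - odd_power tp a n.+2) (odd_power tp a n.+2 - odd_power tp a n.+3).
    by rewrite addrA subrK; lra.
  - have := nmD (d - odd_power tp a n.+2) (odd_power tp a n.+2 - odd_power tp a n.+3).
    rewrite addrA subrK => h1.
    have := nmD (d - odd_power tp a n.+3) (odd_power tp a n.+3 - odd_power tp a n.+4).
    by rewrite addrA subrK; lra.
have ne := trip_le1 H He.
have M3 x y z c : nm x <= c -> nm y <= 1 -> nm z <= 1 -> nm (tp x y z) <= M * c.
  move=> hx hy hz; apply: le_trans (hM _ _ _) _.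
  apply: (@le_trans _ _ (M * c * 1 * 1)); last by rewrite !mulr1.
  have n1 := nm_ge0 x; have n2 := nm_ge0 y; have n3 := nm_ge0 z.
  have c0 : 0 <= c by apply: le_trans hx.
  apply: ler_pM => //; first by rewrite !mulr_ge0 // ltW.
  apply: ler_pM => //; first by rewrite !mulr_ge0 // ltW.
  by apply: ler_wpM2l => //; exact: ltW.
have M3m x y z c : nm x <= 1 -> nm y <= c -> nm z <= 1 -> nm (tp x y z) <= M * c.
  move=> hx hy hz; apply: le_trans (hM _ _ _) _.
  apply: (@le_trans _ _ (M * 1 * c * 1)); last by rewrite !mulr1.
  have n1 := nm_ge0 x; have n2 := nm_ge0 y; have n3 := nm_ge0 z.
  have c0 : 0 <= c by apply: le_trans hy.
  apply: ler_pM => //; first by rewrite !mulr_ge0 // ltW.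
  apply: ler_pM => //; first by rewrite !mulr_ge0 // ltW.
  by apply: ler_wpM2l => //; exact: ltW.
have nd1 : nm d <= 1 by rewrite nd.
pose z := tp d e d.
pose L k := tp (odd_power tp a k) a.
pose E k := L k z - 2 *: z.
have bE k : (k < 3)%N -> nm (E k) <= 6 * M * eta.
  move=> k3; have -> : E k = 2 *: tp (L k d - d) e d - tp d (L k e) d.
    rewrite /E /L /z (jordan H) (tpBl H) [tp d e (tp _ _ _)](tpC H).
    have -> : tp a (odd_power tp a k) e = tp (odd_power tp a k) a e.
      by have := tpw H a 0 k e; rewrite add0n.
    by vec.
  have b1 := M3 _ _ _ _ (close k k3) ne nd1.
  have b2 := M3m _ _ _ _ nd1 (Le k) nd1.
  apply: le_trans (nmB _ _) _; rewrite nmZ -(rmorph_nat (real_complex R)) nmRp // /L.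
  by lra.
have L0 x : nm (L 0%N x) <= M * nm x.
  apply: le_trans (hM _ _ _) _; rewrite /= a1 !mulr1 //.
have nz : 6 * nm z <= (3 + 7 * M + 2 * M ^+ 2) * (6 * M * eta).
  have nw := newton H a z; rewrite -!/(L _ _) in nw.
  have LD k x y : L k (x + y) = L k x + L k y by rewrite /L (tpDr H).
  have LZ k c x : L k (c *: x) = c *: L k x by rewrite /L (tpZr H).
  have EL k : L k z = 2 *: z + E k by rewrite /E; vec.
  have L01 : L 0%N (L 1%N z) = 4 *: z + 2 *: E 0%N + L 0%N (E 1%N).
    by rewrite (EL 1%N) LD LZ (EL 0%N); vec.
  have L00 : L 0%N (L 0%N (L 0%N z)) = 8 *: z + 4 *: E 0%N + 2 *: L 0%N (E 0%N) + L 0%N (L 0%N (E 0%N)).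
    have L2 : L 0%N (L 0%N z) = 4 *: z + 2 *: E 0%N + L 0%N (E 0%N).
      by rewrite (EL 0%N) LD LZ (EL 0%N); vec.
    by rewrite L2 (LD 0%N (4 *: z + 2 *: E 0%N)) (LD 0%N (4 *: z)) !(LZ 0%N _ z) (LZ 0%N _ (E 0%N)) (EL 0%N); vec.
  have E6 : 6 *: z = 3 *: L 0%N (E 1%N) - (E 2%N + 2 *: E 0%N + 4 *: L 0%N (E 0%N) + 2 *: L 0%N (L 0%N (E 0%N))).
    move: nw; rewrite (EL 2%N) -[tp a a (L 1%N z)]/(L 0%N (L 1%N z)) L01.
    rewrite -[tp a a (tp a a (tp a a z))]/(L 0%N (L 0%N (L 0%N z))) L00 => nw.
    have -> : E 2%N = (2 *: z + E 2%N) - 2 *: z by vec.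
    by rewrite nw; vec.
  have n2 : nm (2 : C) = 2 by rewrite -(rmorph_nat (real_complex R)) nmRp.
  have n3 : nm (3 : C) = 3 by rewrite -(rmorph_nat (real_complex R)) nmRp.
  have n4 : nm (4 : C) = 4 by rewrite -(rmorph_nat (real_complex R)) nmRp.
  have n6 : nm (6 : C) = 6 by rewrite -(rmorph_nat (real_complex R)) nmRp.
  rewrite -{1}n6 -nmZ E6; apply: le_trans (nmB _ _) _; rewrite nmZ n3.
  have h0 := bE 0%N isT; have h1 := bE 1%N isT; have h2 := bE 2%N isT.
  have g1 := L0 (E 1%N); have g0 := L0 (E 0%N); have g00 := L0 (L 0%N (E 0%N)).
  have m1 : M * nm (E 1%N) <= M * (6 * M * eta) by apply: ler_wpM2l => //; exact: ltW.
  have m0 : M * nm (E 0%N) <= M * (6 * M * eta) by apply: ler_wpM2l => //; exact: ltW.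
  have m00 : M * nm (L 0%N (E 0%N)) <= M * (M * (6 * M * eta)).
    by apply: ler_wpM2l; [exact: ltW|exact: le_trans g0 m0].
  have := nmD (E 2%N + 2 *: E 0%N + 4 *: L 0%N (E 0%N)) (2 *: L 0%N (L 0%N (E 0%N))).
  have := nmD (E 2%N + 2 *: E 0%N) (4 *: L 0%N (E 0%N)).
  have := nmD (E 2%N) (2 *: E 0%N).
  rewrite !nmZ n2 n4 => q1 q2 q3.
  by lra.
have d3 : tp d d d = 4 *: tp (tp d d e) e d - 2 *: tp e d z.
  have hd : pc (2^-1) d.
    by rewrite /d; elim: (n.+1) => // j IH; have := pc_rule H ha ha IH; rewrite subrr add0r.
  have := jordan_mid H d d e e d; rewrite -/z.
  have -> : tp d e e = 2^-1 *: d.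
    by rewrite (tpC H) (_ : tp e e d = (2^-1)%:C *: d) // fmorphV rmorph_nat.
  rewrite (tpZm H) [tp e d d](tpC H) [tp d e (tp d d e)](tpC H).
  have -> : (2^-1 : C)^*%C = 2^-1 by rewrite -(rmorph_nat (real_complex R)) -fmorphV; apply/eqP; rewrite eq_complex /= oppr0 !eqxx.
  move=> E2; have -> : tp d d d = 2 *: (2^-1 *: tp d d d) by rewrite scalerA mulfV ?pnatr_eq0 // scale1r.
  by rewrite E2; vec.
have := nm_cube H d; rewrite nd expr1n d3 => n1.
have h1 : nm (tp (tp d d e) e d) <= M * (4 * eta).
  apply: M3 => //; have := tpw H a n.+1 n.+1 e; rewrite -/d => ->; exact: Le.
have h2 : nm (tp e d z) <= M * nm z.
  by rewrite (tpC H); apply: M3.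
have := nmB (4 *: tp (tp d d e) e d) (2 *: tp e d z).
have n2 : nm (2 : C) = 2 by rewrite -(rmorph_nat (real_complex R)) nmRp.
have n4 : nm (4 : C) = 4 by rewrite -(rmorph_nat (real_complex R)) nmRp.
rewrite n1 !nmZ n2 n4 => h3.
have eM : M ^+ 4 * eta = 80^-1 by rewrite /eta; field; rewrite gt_eqF.
have z6 : nm z <= (3 + 7 * M + 2 * M ^+ 2) * (M * eta) by lra.
have Mz : M * nm z <= M * ((3 + 7 * M + 2 * M ^+ 2) * (M * eta)).
  by apply: ler_wpM2l => //; exact: ltW.
have M2 : 1 <= M ^+ 2 by rewrite exprn_ege1.
have p1 : M * eta <= M ^+ 4 * eta by apply: ler_wpM2r; [exact: ltW|rewrite ler_eXnr].
have p2 : M ^+ 2 * eta <= M ^+ 4 * eta by apply: ler_wpM2r; [exact: ltW|apply: ler_weXn2l].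
have p3 : M ^+ 3 * eta <= M ^+ 4 * eta by apply: ler_wpM2r; [exact: ltW|apply: ler_weXn2l].
have E4 : M * ((3 + 7 * M + 2 * M ^+ 2) * (M * eta)) = 3 * (M ^+ 2 * eta) + 7 * (M ^+ 3 * eta) + 2 * (M ^+ 4 * eta) by ring.
lra.
Qed.

Lemma state_real f a : Sig f -> f (tp a a e) = (complex.Re (f (tp a a e) : C))%:C :> C.
Proof. by move=> /Sig_state[f1 fe]; exact: (L_formE H (state_dualpair f1 fe)). Qed.

(* Damping the Peirce components of [x] by resolvents and cubing shows that
   [{a, a, e}] is small on the states for [a = P1 x]. *)
Lemma face_quant (eta : R) : 0 < eta -> exists2 eps : R, 0 < eps & forall x, nm x <= 1 ->
  (forall f, Sig f -> 1 - eps <= complex.Re (f x : C)) -> nm (x - e - P0 x) <= eta.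
Proof.
move=> eta0; have [M M1 hM] := triple_bound H; have M0 : 0 < M by apply: lt_le_trans M1.
have [c0 c00 hc0] := half_lower.
(* Chosen so that [4 d M <= c0]: the unwanted term [{a, x0, a}] then uses up only half of the lower
   bound [c0 |a|^2]. *)
pose t := 4 * M / c0; have t0 : 0 < t by rewrite divr_gt0 // mulr_gt0.
pose c := (1 + t / 2)^-1; pose d := (1 + t)^-1.
have c_gt0 : 0 < c by rewrite invr_gt0 ltr_pwDl // divr_ge0 // ltW.
have d_gt0 : 0 < d by rewrite invr_gt0; lra.
have t2 : 0 < t / 2 by rewrite divr_gt0.
have c1 : c <= 1 by rewrite invf_le1; lra.
have d1 : d <= 1 by rewrite invf_le1; lra.
have dM : 4 * d * M <= c0.
  rewrite /d mulrAC ler_pdivrMr; last by lra.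
  by rewrite mulrDr mulr1 /t [c0 * _]mulrC divfK ?gt_eqF //; lra.
(* Here [31 = 1 + 5 + 25] counts the terms of [cube_diff] for [|y| <= 1] and [|w| <= 5], and the
   factor 4 comes from [Sig_norming]. *)
pose B := 124 * M / (c0 * c ^+ 2).
have B0 : 0 < B by rewrite divr_gt0 ?mulr_gt0 // exprn_gt0.
pose kap := Num.min 1 (Num.min (eta / 2) ((eta / 2) ^+ 2 / B)).
have kap0 : 0 < kap by rewrite !lt_min ltr01 divr_gt0 //= divr_gt0 // exprn_gt0 // divr_gt0.
have kap1 : kap <= 1 by rewrite ge_min lexx.
have kap2 : kap <= eta / 2 by rewrite !ge_min lexx orbT.
have kap3 : B * kap <= (eta / 2) ^+ 2.
  by rewrite mulrC -ler_pdivlMr // !ge_min lexx !orbT.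
exists (kap ^+ 2 / 32); first by rewrite divr_gt0 // exprn_gt0.
move=> x x1 hx; pose k := P2 x - e; pose a := P1 x; pose x0 := P0 x.
have hk : pc 1 k by apply: pcB => //; [exact: pc_P2|exact: pc_e].
(* A number of the unit disc with real part at least [1 - kap^2 / 32] is within [kap / 4] of 1; the
   norming property multiplies this by 4. *)
have nk : nm k <= kap.
  have -> : kap = 4 * (kap / 4) by field.
  apply: Sig_norming => //; first by rewrite divr_ge0 // ltW.
  move=> f sf; have [f1 fe] := Sig_state sf; have := hx f sf.
  have := dual_le1 x f1; rewrite dualB (state_P2 H He f1 fe) fe => n1 r1.
  rewrite -(@ler_pXn2r _ 2) ?nnegrE ?nm_ge0 ?divr_ge0 ?(ltW kap0) //.
  have := nm_sq (f x : C); have := nm_sq (f x - 1 : C).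
  have : nm (f x : C) ^+ 2 <= 1 by apply: exprn_ile1; rewrite ?nm_ge0 // (le_trans n1).
  case: (f x : C) r1 => u v /= r1 h1 -> h2; rewrite h2 in h1.
  by rewrite expr_div_n; lra.
have ha : pc (2^-1) a by exact: pc_P1.
have h0 : pc 0 x0 by exact: pc_P0.
have n0 : nm x0 <= 1 by apply: le_trans (P0_contr H He x) x1.
have na3 : nm a <= 3.
  have -> : a = x - P2 x - x0 by rewrite {1}(peirce_sum tp e x) -/a -/x0; vec.
  have := P2_contr H He x; have := nmB (x - P2 x) x0; have := nmB x (P2 x); lra.
have ne := trip_le1 H He.
pose w := e + (c%:C *: a + d%:C *: x0); pose y := k + w.
have y1 : nm y <= 1.
  have -> : y = P2 x + c%:C *: P1 x + d%:C *: P0 x by rewrite /y /w /k -/a -/x0; vec.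
  by apply: le_trans x1; apply: (peirce_contr2 H He); exact: ltW.
have w5 : nm w <= 5.
  have := nmD e (c%:C *: a + d%:C *: x0); have := nmD (c%:C *: a) (d%:C *: x0).
  rewrite !nmZp ?(ltW c_gt0) ?(ltW d_gt0) // -/w => q1 q2.
  have q3 : c * nm a <= nm a by rewrite ler_piMl ?nm_ge0.
  have q4 : d * nm x0 <= nm x0 by rewrite ler_piMl ?nm_ge0.
  lra.
have cubes_close : nm (tp y y y - tp w w w) <= 31 * M * kap.
  rewrite (cube_diff k w) -/y.
  have b3 u1 u2 u3 (m1 m2 m3 : R) : nm u1 <= m1 -> nm u2 <= m2 -> nm u3 <= m3 ->
      nm (tp u1 u2 u3) <= M * m1 * m2 * m3.
    move=> l1 l2 l3; have k1 := nm_ge0 u1; have k2 := nm_ge0 u2; have k3 := nm_ge0 u3.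
    apply: le_trans (hM _ _ _) _; apply: ler_pM => //; first by rewrite !mulr_ge0 // ltW.
    apply: ler_pM => //; first by rewrite !mulr_ge0 // ltW.
    by apply: ler_wpM2l => //; exact: ltW.
  have g1 := b3 _ _ _ _ _ _ nk y1 y1; have g2 := b3 _ _ _ _ _ _ w5 nk y1.
  have g3 := b3 _ _ _ _ _ _ w5 w5 nk.
  have := nmD (tp k y y + tp w k y) (tp w w k); have := nmD (tp k y y) (tp w k y).
  by lra.
have main f : Sig f -> nm (f (tp a a e) : C) <= 31 * M * kap / (2 * c ^+ 2) + d / 2 * (M * nm a ^+ 2).
  move=> sf; have [f1 fe] := Sig_state sf.
  have fw := state_cube c d f1 fe ha h0; rewrite -/w in fw.
  have ry : complex.Re (f (tp y y y) : C) <= 1.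
    apply: le_trans (Re_le_nm _) _; apply: le_trans (dual_le1 _ f1) _.
    by rewrite (nm_cube H); apply: exprn_ile1; rewrite ?nm_ge0.
  have rc : complex.Re (f (tp w w w) : C) <= 1 + 31 * M * kap.
    have := le_trans (Re_nm _) (le_trans (dual_le1 (tp y y y - tp w w w) f1) cubes_close).
    by rewrite dualB ReB ler_norml => /andP[q1 q2]; lra.
  have rx : - (M * nm a ^+ 2) <= complex.Re (f (tp a x0 a) : C).
    have : nm (tp a x0 a) <= M * nm a ^+ 2.
      apply: le_trans (hM _ _ _) _; rewrite expr2 [leRHS]mulrA; apply: ler_wpM2r; first exact: nm_ge0.
      by rewrite ler_piMr // mulr_ge0 ?nm_ge0 // ltW.
    move=> /(le_trans (dual_le1 _ f1))/(le_trans (Re_nm _)).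
    by rewrite ler_norml => /andP[].
  have aa := L_form_ge0 H (state_dualpair f1 fe) a.
  rewrite (state_real a sf) nmRp //.
  rewrite fw !ReD !ReMr /= in rc.
  have c2 : 0 < c ^+ 2 by rewrite exprn_gt0.
  move: rc rx; set A := complex.Re (f (tp a a e) : C); set X := complex.Re (f (tp a x0 a) : C).
  move=> rc rx; rewrite -(ler_pM2l (_ : 0 < 2 * c ^+ 2)); last by rewrite mulr_gt0.
  have -> : 2 * c ^+ 2 * (31 * M * kap / (2 * c ^+ 2) + d / 2 * (M * nm a ^+ 2)) =
    31 * M * kap + c ^+ 2 * d * (M * nm a ^+ 2) by field; rewrite gt_eqF.
  have cd : 0 <= c ^+ 2 * d by rewrite mulr_ge0 // ltW.
  have := ler_wpM2l cd rx; lra.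
have haa : pc 1 (tp a a e).
  by have := pc_rule H ha ha (pc_e He); rewrite subrr add0r.
have s0 : 0 <= 31 * M * kap / (2 * c ^+ 2) + d / 2 * (M * nm a ^+ 2).
  by nneg.
have naae := Sig_norming haa s0 main.
have fin := le_trans (hc0 a ha) naae.
have sq : nm a ^+ 2 <= (eta / 2) ^+ 2.
  apply: le_trans kap3; have -> : B * kap = (2 * (62 * M * kap / c ^+ 2)) / c0.
    by rewrite /B; field; rewrite !gt_eqF // exprn_gt0.
  rewrite ler_pdivlMr //.
  have -> : 62 * M * kap / c ^+ 2 = 4 * (31 * M * kap / (2 * c ^+ 2)).
    by field; rewrite gt_eqF.
  have := ler_wpM2r (sqr_ge0 (nm a)) dM; move: fin; set q := 31 * M * kap / _; lra.
have na : nm a <= eta / 2.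
  by rewrite -(@ler_pXn2r _ 2) ?nnegrE ?nm_ge0 // divr_ge0 // ltW.
have -> : x - e - P0 x = k + a.
  by rewrite {1}(peirce_sum tp e x) /k /a; vec.
by have := nmD k a; lra.
Qed.

Lemma face_exact x : nm x <= 1 -> (forall f, Sig f -> f x = 1 :> C) -> x = e + P0 x.
Proof.
move=> x1 hx; have E : nm (x - e - P0 x) = 0.
  apply/eqP; rewrite eq_le nm_ge0 andbT; apply: (@le_eps _ _ _ 1) => eta eta0.
  rewrite add0r mulr1; have [eps eps0 h] := face_quant eta0.
  by apply: h => // f sf; rewrite hx //= lerBlDr lerDl ltW.
have -> : e + P0 x = x - (x - e - P0 x) by vec.
by rewrite (nm_eq0 E) subr0.
Qed.

End NormingStates.

(** * Normal states of a dual triple *)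

Section Predual.
Context {R : realType}.
Local Notation C := (R[i]).
Variable Y : normedModType C.
Local Notation W := (dual Y).
Variable tp : W -> W -> W -> W.
Hypothesis H : is_jbstar_triple tp.
Hypothesis wc1 : forall b c, wcont (fun x => tp x b c).
Hypothesis wc2 : forall a c, wcont (fun x => tp a x c).
Local Notation ev := (@canonical_embedding R Y).

Lemma nm_ev v : nm (ev v) <= nm v.
Proof. by apply: dual_nm_le => [|w]; [exact: nm_ge0|rewrite mulrC; exact: (dual_le w v)]. Qed.

Lemma evE v w : ev v w = w v :> C. Proof. by []. Qed.

Lemma wnm_le (c : R) (w : W) : 0 <= c -> (forall v, nm v <= 1 -> nm (w v : C) <= c) -> nm w <= c.
Proof.
move=> c0 h; apply: dual_nm_le => // v.
have [->|v0] := eqVneq v 0; first by rewrite dual0 !nm0 mulr0.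
have nv : 0 < nm v by rewrite lt_neqAle nm_ge0 andbT eq_sym; apply: contra_neq v0; exact: nm_eq0.
have iv : 0 <= (nm v)^-1 by rewrite invr_ge0 ltW.
have := h ((nm v)^-1%:C *: v); rewrite nmZp // mulVf ?gt_eqF // => /(_ (lexx _)).
by rewrite dualZ nmM nmRp // ler_pdivrMl // mulrC.
Qed.

Lemma wcontr a b : wcont (tp a b).
Proof. by have -> : tp a b = (fun x => tp x b a) by apply/funext => x; rewrite (tpC H). Qed.

Lemma wcont_comp (S T : W -> W) : wcont S -> wcont T -> wcont (fun x => S (T x)).
Proof. by move=> hS hT I F w l pF h; apply: (hS _ _ (fun i => T (w i))) => //; exact: hT. Qed.

Lemma wcont_lin (S T : W -> W) (a b : C) : wcont S -> wcont T -> wcont (fun x => a *: S x + b *: T x).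
Proof.
move=> hS hT I F w l pF h v.
have := tendsD pF (tendsZ pF a (hS _ _ _ _ pF h v)) (tendsZ pF b (hT _ _ _ _ pF h v)).
by [].
Qed.

Lemma wcont_id : @wcont R Y id. Proof. by []. Qed.

Lemma wcont_peirce_comb e a b c : wcont (peirce_comb tp e a b c).
Proof.
have c1 := wcontr e e; have c2 := wcont_comp c1 c1.
have h := wcont_lin 1 1 (wcont_lin c (4 * b - a - 3 * c) wcont_id c1)
   (wcont_lin (2 * a - 4 * b + 2 * c) 0 c2 c2).
have -> // : peirce_comb tp e a b c = (fun x => 1 *: (c *: x + (4 * b - a - 3 * c) *: tp e e x) +
   1 *: ((2 * a - 4 * b + 2 * c) *: tp e e (tp e e x) + 0 *: tp e e (tp e e x))).
by apply/funext => x; rewrite /peirce_comb P2def P1def P0def; vec.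
Qed.

Lemma wcont_P2 e : wcont (P2 tp e).
Proof.
have -> : P2 tp e = peirce_comb tp e 1 0 0; last exact: wcont_peirce_comb.
by apply/funext => x; rewrite /peirce_comb; vec.
Qed.

Lemma preadj_op (S : {linear W -> W}) (K : R) : wcont S -> 0 <= K -> opbound S K ->
  exists2 S' : {linear Y -> Y}, (forall w v, S w v = w (S' v) :> C) & opbound S' K.
Proof.
move=> cS K0 SK; have [S' hS'] := choice (preadjoint cS).
have lS : linear S'.
  by move=> a x y; apply: dual_ext => w; rewrite -hS' dualD dualZ !hS' dualD dualZ.
exists (mklin lS) => [w v|v]; first exact: hS'.
have [w [w1 wv]] := norming (mklin lS v); rewrite -(nmRp (nm_ge0 _)) -wv /= -hS'.
apply: le_trans (dual_le _ _) _; apply: ler_wpM2r; first exact: nm_ge0.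
by apply: le_trans (SK w) _; rewrite ler_piMr.
Qed.

Section OneTripotent.
Variable e : W.
Hypothesis He : tripotent tp e.
Local Notation pc := (pc tp e).
Local Notation P2 := (P2 tp e).
Local Notation P1 := (P1 tp e).
Local Notation P0 := (P0 tp e).

Definition nstate (phi : Y) := nm phi <= 1 /\ e phi = 1 :> C.

Lemma nstate_ev phi : nstate phi -> nm (ev phi) <= 1 /\ ev phi e = 1 :> C.
Proof. by move=> [p1 ep]; split=> //; apply: le_trans (nm_ev _) p1. Qed.

(* The numerical radius bound, applied on the predual to the adjoint of
   [L(k, e)]: the functional [h |-> rho({P2 h, e, z})] is a multiple of a
   normal state. *)
Lemma unit_norm_le k (eps : R) : pc 1 k -> 0 <= eps ->
  (forall phi, nstate phi -> nm (k phi : C) <= eps) -> nm k <= 4 * eps.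
Proof.
move=> hk eps0 hs.
have [K K0 LK] := Lop_opbound H k e.
have [S' hS' S'K] := @preadj_op (Lop H k e) K (wcontr k e) K0 LK.
(* The predual of the Peirce-2 space; on it a norming element [z0] may be replaced by [P2 z0]. *)
pose P rho := forall w : W, P2 w rho = w rho :> C.
have numr rho : P rho -> exists2 f, dualpair rho f & nm (f (S' rho) : C) <= eps * nm rho.
  move=> Pr; have [z0 [z01 z0r]] := norming rho.
  pose z := P2 z0; have z1 : nm z <= 1 by apply: le_trans (P2_contr H He z0) z01.
  have zr : z rho = (nm rho)%:C :> C by rewrite Pr.
  exists z => //; have [r0|r0] := eqVneq (nm rho) 0.
    by rewrite (nm_eq0 r0) op0 dual0 !nm0 mulr0.
  have rp : 0 < nm rho by rewrite lt_neqAle nm_ge0 andbT eq_sym.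
  have nz : nm z = 1.
    apply/eqP; rewrite eq_le z1 /=; have := dual_le z rho; rewrite zr nmRp ?nm_ge0 //.
    by move=> h; rewrite -(ler_pM2r rp) mul1r.
  have hz : pc 1 z by exact: pc_P2.
  have Tlin : linear (fun h => tp (P2 h) e z).
    by move=> a x y; rewrite (P2_linear H) (tpPl H).
  have [B B0 TB] := Lop_opbound H z e.
  have cT : wcont (mklin Tlin) by apply: (wcont_comp (wc1 e z)); exact: wcont_P2.
  have [r1 hr1] := preadjoint cT rho; rewrite /= in hr1.
  pose f := (nm rho)^-1%:C *: ev rho.
  have ir : 0 <= (nm rho)^-1 by rewrite invr_ge0 ltW.
  have df : dualpair z f.
    split; last by rewrite nz dualcZ evE zr -rmorphM mulVf.
    by rewrite nmZp // ler_pdivrMl // mulr1; exact: nm_ev.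
  have tez : tp e e z = z by exact/(pc1P _ _ _).
  pose s := (nm rho)^-1%:C *: r1.
  have sE (w : W) : w s = f (tp (P2 w) e z) :> C.
    by rewrite dualZ -hr1 /f dualcZ.
  have es : e s = 1 :> C.
    by rewrite sE (P2_id (pc_e He)) tez df.2 nz.
  have s1 : nm s <= 1.
    have [w [w1 ws]] := norming s; rewrite -(nmRp (nm_ge0 s)) -ws sE.
    apply: le_trans (unit_numrange H He df (pc_P2 H He w) _) _.
      exact: le_trans (P2_contr H He w) w1.
    by rewrite tez df.2 nz.
  have := hs s (conj s1 es); rewrite sE (P2_id hk) /f dualcZ evE nmM nmRp // ler_pdivrMl //.
  by rewrite -hS' mulrC.
have PS rho : P rho -> P (S' rho).
  by move=> Pr w; rewrite -!hS' /= -P2_unit_op // Pr.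
have Plin a x y : P x -> P y -> P (a *: x + y).
  by move=> hx hy w; rewrite !dualD !dualZ hx hy.
have bnd := numerical_radius_bound K0 eps0 S'K Plin PS numr.
have P21 : opbound (mklin (P2_linear H e)) 1 by move=> x; rewrite mul1r; exact: P2_contr.
have [D hD DK] := @preadj_op (mklin (P2_linear H e)) 1 (@wcont_P2 e) ler01 P21.
apply: wnm_le => [|phi p1]; first by rewrite mulr_ge0.
have PD : P (D phi) by move=> w; rewrite -!hD /= P2_id //; exact: pc_P2.
(* As [k = {k, e, e}], evaluating [k] means evaluating [e] after the pre-adjoint of [L(k, e)], to
   which the numerical radius bound applies. *)
have -> : k phi = e (S' (D phi)) :> C.
  rewrite -hS' /= -[k in LHS](P2_id hk) [LHS](hD k phi); congr (_ _ _).
  by rewrite (tpC H); apply/esym/(pc1P _ _ _).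
apply: le_trans (dual_le _ _) _; apply: (@le_trans _ _ (nm (S' (D phi)))).
  exact: ler_piMl (nm_ge0 _) (trip_le1 H He).
apply: le_trans (bnd _ PD) _; rewrite ler_piMr ?mulr_ge0 //.
by apply: le_trans (DK phi) _; rewrite mul1r.
Qed.

End OneTripotent.
End Predual.

(* [u + (unit ball of the Peirce-0 space)] determines its center [u]. *)
Lemma center_unique (R : realType) (Z : normedModType R[i]) (D : Z -> Prop) u v : (forall w, D w -> nm w <= 1) -> D u ->
  (forall w, D w -> D (u + u - w)) -> (forall w, D w -> D (v + v - w)) -> u = v.
Proof.
move=> D1 Du su sv; apply/eqP; rewrite eq_sym -subr_eq0; apply/eqP; set b := v - u.
(* The reflections about [u] and [v] compose to the translation by [2 b], which cannot preserve a
   bounded non-empty set unless [b = 0]. *)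
have it n : D (u + b *+ n.*2).
  elim: n => [|n IH]; first by rewrite mulr0n addr0.
  have := sv _ (su _ IH); congr (D _); rewrite doubleS !mulrSr.
  have -> : v = u + b by rewrite /b addrC subrK.
  by move: (b *+ n.*2) => x; vec.
apply: nm_eq0; apply/eqP; rewrite eq_le nm_ge0 andbT leNgt; apply/negP => b0.
have [n n0 nb] := archi_lt (2 / nm b).
have := D1 _ (it n); have := D1 _ Du; have := nmB (u + b *+ n.*2) u.
rewrite addrAC subrr add0r nmMn -muln2 mulrnA -mulr_natr -mulr_natr => h1 h2 h3.
move: nb; rewrite ltr_pdivrMr // => nb; have n1 : 1 <= n%:R :> R by rewrite ler1n.
have := nm_ge0 b; nra.
Qed.

(** * Support tripotents *)

Section TripotentOrder.
Context {R : realType}.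
Local Notation C := (R[i]).
Variable Z : completeNormedModType C.
Variable tp : Z -> Z -> Z -> Z.
Hypothesis H : is_jbstar_triple tp.
Implicit Types (u e v p q : Z).
Local Notation trip := (tripotent tp).
Local Notation "u <=t e" := (tripotent_le tp u e) (at level 70).

Lemma le_perp u e : u <=t e -> pc tp u 0 (e - u).
Proof.
move=> [tb ob]; apply/pc0P; rewrite (tpC H).
by apply: (perp_unit2 H tb); exact/pc0P.
Qed.

Lemma trip_add u b : trip u -> pc tp u 0 b -> trip (u + b) <-> trip b.
Proof.
move=> tu hb; rewrite /tripotent (cube_perp H tu (pc_e tu) hb) tu.
by split=> [/addrI|->].
Qed.

Lemma le_of_perp u e : trip u -> trip e -> pc tp u 0 (e - u) -> u <=t e.
Proof.
move=> tu te hb; split.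
  by apply/(trip_add tu hb); rewrite addrC subrK.
by rewrite /triple_orthogonal (tpC H); exact: (perp_unit2 H tu).
Qed.

Lemma le_state u e (f : dual Z) : trip u -> u <=t e -> nm f <= 1 -> f u = 1 :> C -> f e = 1 :> C.
Proof.
move=> tu ue f1 fu; have := state_kill0 H tu f1 fu (le_perp ue).
by rewrite dualB fu => /eqP; rewrite subr_eq0 => /eqP.
Qed.

Lemma le_tpl p q z : trip p -> p <=t q -> tp p q z = tp p p z.
Proof.
move=> hp pq; rewrite -[q](subrK p) (tpDm H) (perp_unit2 H hp) ?add0r //; exact: le_perp.
Qed.

Lemma le_tpr p q z : trip p -> p <=t q -> tp q p z = tp p p z.
Proof.
move=> hp pq; rewrite -[q](subrK p) (tpDl H) (perp_unit1 H hp) ?add0r //; exact: le_perp.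
Qed.

Lemma le_tpp p q : trip p -> p <=t q -> tp p p q = p.
Proof.
move=> hp pq; rewrite -[q](subrK p) (tpDr H) hp (_ : tp p p (q - p) = 0) ?add0r //.
by apply/pc0P; exact: le_perp.
Qed.

Lemma le_qqp p q : trip p -> p <=t q -> tp q q p = p.
Proof. by move=> hp pq; rewrite (tpC H) le_tpl // le_tpp. Qed.

Lemma tle_anti u e : trip u -> trip e -> u <=t e -> e <=t u -> u = e.
Proof. by move=> tu te ue eu; rewrite -(le_tpp tu ue) (le_qqp te eu). Qed.

Lemma tp_min p q q' : trip p -> p <=t q -> p <=t q' -> tp p q q' = p.
Proof. by move=> hp pq pq'; rewrite le_tpl // le_tpp. Qed.

Lemma tp_mid p q : trip p -> p <=t q -> tp q p q = p.
Proof. by move=> hp pq; rewrite le_tpr // le_tpp. Qed.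

(** The order is recovered from a few product identities, each of which passes to a weak* limit in
    one variable. *)
Lemma le_of_limit v e : trip v -> trip e -> tp e v e = v -> tp v e e = v -> tp v v e = v ->
  tp v e v = v -> v <=t e.
Proof.
move=> tv te evev veev vvev vev; have eev : tp e e v = v by rewrite (tpC H).
have evv : tp e v v = v by rewrite (tpC H).
split.
  rewrite /tripotent !(tpBl H) !(tpBm H) !(tpBr H) tv te evev veev vvev vev eev evv; vec.
rewrite /triple_orthogonal !(tpBl H) !(tpBm H) tv eev evv vev; vec.
Qed.

End TripotentOrder.

Section Support.
Context {R : realType}.
Local Notation C := (R[i]).
Variable Y : normedModType C.
Local Notation W := (dual Y).
Variable tp : W -> W -> W -> W.
Hypothesis H : is_jbstar_triple tp.
Hypothesis wc1 : forall b c, wcont (fun x => tp x b c).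
Hypothesis wc2 : forall a c, wcont (fun x => tp a x c).
Local Notation ev := (@canonical_embedding R Y).
Local Notation wc3 := (wcontr H wc1).
Local Notation nstate := (@nstate R Y).

Lemma wtends_closed_eq (I : Type) (U : set_system I) (pU : ProperFilter U) (S : W -> W) (w : I -> W) l c :
  wcont S -> wtends U w l -> U [set i | S (w i) = c] -> S l = c.
Proof.
move=> cS wl Uc; apply: (wtends_uniq pU (cS _ _ _ _ pU wl)).
by apply: (wtends_ext pU _ (wtends_cst c pU)); apply: filterS Uc => i /= ->.
Qed.

Lemma wtends_close (I : Type) (U : set_system I) (pU : ProperFilter U) (w w' : I -> W) l :
  (forall e : R, 0 < e -> U [set i | nm (w' i - w i) <= e]) -> wtends U w l -> wtends U w' l.
Proof.
move=> hc wl v e e0; have s0 : 0 < e / 2 / (nm v + 1) by rewrite !divr_gt0 // ltr_wpDl ?nm_ge0.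
have e2 : 0 < e / 2 by rewrite divr_gt0.
apply: filterS (filterI (hc _ s0) (wl v _ e2)) => i [/= h1 h2].
have -> : w' i v - l v = (w' i - w i) v + (w i v - l v) :> C by rewrite dualcB addrA subrK.
apply: le_lt_trans (nmD _ _) _; apply: (@lt_le_trans _ _ (e / 2 + e / 2)); last by rewrite -splitr.
apply: ler_ltD => //; apply: le_trans (dual_le _ _) _.
apply: (@le_trans _ _ (e / 2 / (nm v + 1) * nm v)); first by apply: ler_wpM2r; [exact: nm_ge0|].
rewrite mulrAC ler_pdivrMr ?ltr_wpDl ?nm_ge0 //; apply: ler_wpM2l; first exact: ltW.
by rewrite lerDl.
Qed.

Section OneElement.
Variable a : W.
Hypothesis a1 : nm a <= 1.
Local Notation pw := (odd_power tp a).

Lemma pw_shift_close (U : set_system nat) (pU : ProperFilter U) k l : \oo `<=` U ->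
  wtends U pw l -> wtends U (fun n => pw (n + k)%N) l.
Proof.
move=> oU; elim: k => [|k IH] wl.
  by apply: (wtends_ext pU _ wl); apply: filterE => n /=; rewrite addn0.
apply: (wtends_close pU _ (IH wl)) => e e0.
have [K K0 aK] := powers_asymp H a1; have [N N0 nb] := archi_lt (K / e).
apply: oU; exists N.+1 => // n /= Nn; rewrite addnS nm_distC.
case: n Nn => [//|n] Nn; rewrite addSn; apply: le_trans (aK _).2 _.
rewrite ler_pdivrMr ?ltr0n // mulrC -ler_pdivrMr //; apply: ltW; apply: lt_le_trans nb _.
by rewrite ler_nat; apply: leqW; apply: leq_trans (leq_addr k n).
Qed.

(** A product of powers depends on the sum of the indices only, and shifts do not change limits; so
    a limit in one factor absorbs the other two. Then [{u, v, a}] equals both [u] and [v], and the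
    limits do not depend on the ultrafilter. *)
Lemma limit_products (U V : set_system nat) u v : UltraFilter U -> UltraFilter V ->
  \oo `<=` U -> \oo `<=` V -> wtends U pw u -> wtends V pw v ->
  u = v /\ (forall n k, tp u (pw n) (pw k) = u).
Proof.
move=> uU uV oU oV wu wv.
have pU := @ultra_proper _ _ uU; have pV := @ultra_proper _ _ uV.
have L1 n k : tp u (pw n) (pw k) = u.
  apply: (wtends_uniq pU (wc1 (pw n) (pw k) pU wu)).
  apply: (wtends_ext pU _ (pw_shift_close pU (n + k).+1 oU wu)).
  by apply: filterE => m /=; rewrite (tpwww H) addnS addnA.
have L2 m k : tp (pw m) v (pw k) = v.
  apply: (wtends_uniq pV (wc2 (pw m) (pw k) pV wv)).
  apply: (wtends_ext pV _ (pw_shift_close pV (m + k).+1 oV wv)).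
  by apply: filterE => n /=; rewrite (tpwww H) addnS addnA [(n + m)%N]addnC.
have Lu k : tp u v (pw k) = u.
  by apply: (wtends_closed_eq pV (wc2 u (pw k)) wv); apply: filterE => n /=; exact: L1.
have Lv k : tp u v (pw k) = v.
  by apply: (wtends_closed_eq pU (wc1 v (pw k)) wu); apply: filterE => n /=; exact: L2.
by split=> //; rewrite -(Lu 0%N) {1}(Lv 0%N).
Qed.

Lemma support_exists : exists u, [/\ wtends \oo pw u, tripotent tp u, pc tp u 0 (a - u) & nm u <= 1].
Proof.
have [K K0 aK] := powers_asymp H a1.
have [U [uU oU]] := @ultraFilterLemma nat \oo _.
have pU := @ultra_proper _ _ uU.
have [u _ wu] := ultra_wtends uU K0 (fun n => (aK n).1).
have [_ L] := limit_products uU uU oU oU wu wu.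
have Lu k : tp u u (pw k) = u.
  by apply: (wtends_closed_eq pU (wc2 u (pw k)) wu); apply: filterE => n /=; exact: L.
have tu : tripotent tp u.
  by apply: (wtends_closed_eq pU (wc3 u u) wu); apply: filterE => n /=; exact: Lu.
exists u; split=> //.
(* If the sequence stayed away from [u] at [v] infinitely often, an ultrafilter on those indices
   would have another limit, against [limit_products]. *)
- move=> v e e0; apply: contrapT => no.
  have pG : ProperFilter (filter_from [set N : nat | True] (fun N => [set n | (N <= n)%N /\ ~ (nm (pw n v - u v : C) < e)])).
    apply: filter_from_proper => [|N _].
      apply: filter_from_filter; first by exists 0%N.
      move=> i j _ _; exists (maxn i j) => // n [/= mn bad].
      by move: mn; rewrite geq_max => /andP[h1 h2]; split; split.
    apply: contrapT => none; apply: no; exists N => // n /= Nn.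
    by apply: contrapT => bad; apply: none; exists n.
  have [V [uV GV]] := ultraFilterLemma pG; have pV := @ultra_proper _ _ uV.
  have oV : \oo `<=` V.
    by move=> A [N _ NA]; apply: GV; exists N => // n [/= Nn _]; exact: NA.
  have [l _ wl] := ultra_wtends uV K0 (fun n => (aK n).1).
  have [ul _] := limit_products uU uV oU oV wu wl.
  have bad : V [set n | ~ (nm (pw n v - u v : C) < e)].
    by apply: GV; exists 0%N => // n [].
  rewrite -ul in wl.
  by have [n [/= b1 b2]] := filter_ex (filterI bad (wl v e e0)).
- apply/pc0P; rewrite (tpBr H) tu; have := Lu 0%N; rewrite /= => ->; exact: subrr.
- exact: (trip_le1 H tu).
Qed.

(** Forwards, [face_cube] keeps the value 1 along the indices produced by repeated cubing, hence in
    the limit. Backwards, [a - u] lies in the Peirce-0 space of [u], which states of [u]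
    annihilate. *)
Lemma support_face (u : W) (phi : Y) : wtends \oo pw u -> tripotent tp u -> pc tp u 0 (a - u) ->
  nm phi <= 1 -> a phi = 1 :> C <-> u phi = 1 :> C.
Proof.
move=> wu tu hu p1; have e1 : nm (ev phi) <= 1 by apply: le_trans (nm_ev phi) p1.
split=> [aphi|uphi].
  have many N : exists2 n, (N <= n)%N & pw n phi = 1 :> C /\ nm (pw n) <= 1.
    elim: N => [|N [n Nn [hn n1]]]; first by exists 0%N.
    exists (3 * n).+1; first by rewrite ltnS (leq_trans Nn) // leq_pmull.
    have E : pw (3 * n).+1 = tp (pw n) (pw n) (pw n).
      by rewrite (tpwww H) -addnA addnn -mul2n -mulSn.
    split; first by rewrite E; have := face_cube H n1 e1 hn.
    by rewrite (pw_cube H); apply: exprn_ile1; rewrite ?nm_ge0.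
  apply/eqP; rewrite -subr_eq0; apply/eqP; apply: nm_eq0.
  apply/eqP; rewrite eq_le nm_ge0 andbT; apply: (@le_eps _ _ _ 1) => e e0; rewrite mulr1 add0r.
  have [N _ hN] := wu phi e e0; have [n Nn [hn _]] := many N.
  by have := hN n Nn; rewrite /= hn nm_distC => /ltW.
have := state_kill0 H tu e1 uphi hu; rewrite evE dualcB uphi => /eqP.
by rewrite subr_eq0 => /eqP.
Qed.

End OneElement.

Definition nstates (e : W) (f : dual W) := exists2 phi, nstate e phi & f = ev phi.

Lemma nstates_state e f : nstates e f -> nm f <= 1 /\ f e = 1 :> C.
Proof. by move=> [phi [p1 ep] ->]; split=> //; apply: le_trans (nm_ev phi) p1. Qed.

Lemma nstates_norming e : tripotent tp e -> forall k (eps : R), pc tp e 1 k -> 0 <= eps ->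
  (forall f, nstates e f -> nm (f k : C) <= eps) -> nm k <= 4 * eps.
Proof.
move=> te k eps hk e0 h; apply: (unit_norm_le H wc1 te hk e0) => phi s.
by apply: (h (ev phi)); exists phi.
Qed.

Lemma nface_quant e (eta : R) : tripotent tp e -> 0 < eta ->
  exists2 eps : R, 0 < eps & forall x : W, nm x <= 1 ->
  (forall phi, nstate e phi -> 1 - eps <= complex.Re (x phi : C)) -> nm (x - e - P0 tp e x) <= eta.
Proof.
move=> te eta0.
have [eps eps0 h] := face_quant H te (@nstates_state e) (nstates_norming te) eta0.
by exists eps => // x x1 hx; apply: h => // _ [phi s ->]; exact: hx.
Qed.

Lemma nface_exact e (x : W) : tripotent tp e -> nm x <= 1 ->
  (forall phi, nstate e phi -> x phi = 1 :> C) -> x = e + P0 tp e x.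
Proof.
move=> te x1 hx; apply: (face_exact H te (@nstates_state e) (nstates_norming te) x1).
by move=> _ [phi s ->]; exact: hx.
Qed.

(** By [nface_exact], [e] is [u] plus an element orthogonal to [u]. *)
Lemma nstate_le (u e : W) : tripotent tp u -> tripotent tp e ->
  (forall phi, nstate u phi -> e phi = 1 :> C) -> tripotent_le tp u e.
Proof.
move=> tu te h; apply: (le_of_perp H tu te).
rewrite {1}(nface_exact tu (trip_le1 H te) h) addrC addKr; exact: (pc_P0 H tu).
Qed.

Lemma le_nstate (u e : W) phi : tripotent tp u -> tripotent_le tp u e -> nstate u phi -> nstate e phi.
Proof.
move=> tu ue [p1 up]; split=> //; rewrite -evE.
by apply: (le_state H tu ue) => //; apply: le_trans (nm_ev phi) p1.
Qed.

Section Net.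
Variables (I : Type) (r : I -> I -> Prop) (e : I -> W).
Hypotheses (dr : is_directed r) (te : forall i, tripotent tp (e i)).
Hypothesis mono : forall i j, r i j -> tripotent_le tp (e j) (e i).

Definition tails : set_system I := [set A | exists i, forall j, r i j -> A j].

Lemma tails_proper : ProperFilter tails.
Proof.
case: dr => [[i0] rr rt ru].
apply: Build_ProperFilter => [[i h]|]; first exact: (h i (rr i)).
split=> [|A B [i hA] [j hB]|A B AB [i hA]].
- by exists i0.
- by have [k ik jk] := ru i j; exists k => l kl; split; [apply: hA|apply: hB]; exact: rt kl.
- by exists i => j ij; apply: AB; exact: hA.
Qed.

(** For late [i] the product [{e_i, e_k, e_l}] is [e_i]; letting the variables go to the limit one
    after the other gives all identities of [le_of_limit]. *)
Lemma net_limit : exists v, [/\ tripotent tp v, forall i, tripotent_le tp v (e i) &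
  exists2 U : set_system I, ProperFilter U & wtends U e v].
Proof.
have [U [uU tU]] := ultraFilterLemma tails_proper; have pU := @ultra_proper _ _ uU.
have [v _ wv] := ultra_wtends uU (ler01) (fun i => trip_le1 H (te i)).
have L1 k l : tp v (e k) (e l) = v.
  apply: (wtends_uniq pU (wc1 (e k) (e l) pU wv)); apply: (wtends_ext pU _ wv).
  apply: tU; have [j kj lj] := directed_ub dr k l; exists j => i ji /=.
  have rt := directed_trans dr.
  by rewrite (tp_min H (te i)) //; apply: mono; [exact: rt kj ji|exact: rt lj ji].
have M1 k : tp (e k) v (e k) = v.
  apply: (wtends_uniq pU (wc2 (e k) (e k) pU wv)); apply: (wtends_ext pU _ wv).
  apply: tU; exists k => i ki /=.
  by rewrite (tp_mid H (te i)) //; exact: mono.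
have L2 l : tp v v (e l) = v.
  by apply: (wtends_closed_eq pU (wc2 v (e l)) wv); apply: filterE => k /=; exact: L1.
have L3 k : tp v (e k) v = v.
  by apply: (wtends_closed_eq pU (wc3 v (e k)) wv); apply: filterE => l /=; exact: L1.
have tv : tripotent tp v.
  by apply: (wtends_closed_eq pU (wc3 v v) wv); apply: filterE => l /=; exact: L2.
exists v; split=> //; last by exists U.
by move=> i; apply: (le_of_limit H tv (te i)).
Qed.

End Net.

Section Real.
Variable tau : conjugation Y.
Local Notation tau2 := (sharp tau).

Lemma tau2E (w : W) phi : tau2 w phi = (w (tau phi) : C)^*%C :> C. Proof. by []. Qed.

Lemma tauD phi psi : tau (phi + psi) = tau phi + tau psi.
Proof. by have := conj_antilinear tau 1 phi psi; rewrite scale1r rmorph1 scale1r. Qed.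

Lemma tau0 : tau 0 = 0.
Proof. by have /eqP := tauD 0 0; rewrite addr0 -subr_eq subrr => /eqP. Qed.

Lemma tauZR (t : R) phi : tau (t%:C *: phi) = t%:C *: tau phi.
Proof.
have := conj_antilinear tau t%:C phi 0; rewrite tau0 !addr0 => ->.
by congr (_ *: _); apply/eqP; rewrite eq_complex /= oppr0 !eqxx.
Qed.

Lemma tau_nm phi : nm (tau phi) = nm phi.
Proof. by rewrite /nm conj_isometry. Qed.

Definition real_part phi := 2^-1%:C *: (phi + tau phi).

Lemma real_part_real phi : tau (real_part phi) = real_part phi.
Proof. by rewrite tauZR tauD conj_involutive addrC. Qed.

Lemma real_part_nm phi : nm (real_part phi) <= nm phi.
Proof.
rewrite nmZp ?invr_ge0 // ler_pdivrMl //; apply: le_trans (nmD _ _) _.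
by rewrite tau_nm mulr_natl mulr2n.
Qed.

Lemma real_part_eval (w : W) phi : tau2 w = w -> w (real_part phi) = (complex.Re (w phi : C))%:C :> C.
Proof.
move=> rw; rewrite dualZ dualD; have -> : w (tau phi) = (w phi : C)^*%C :> C.
  by rewrite -{1}rw tau2E conj_involutive.
by case: (w phi : C) => x y; apply/eqP; rewrite eq_complex /=; apply/andP; split; apply/eqP; field.
Qed.

Definition rstate (u : W) phi := nstate u phi /\ tau phi = phi.

Lemma nstate_real_part (u : W) phi : tau2 u = u -> nstate u phi -> rstate u (real_part phi).
Proof.
move=> ru [p1 up]; split; last exact: real_part_real.
by split; [apply: le_trans (real_part_nm phi) p1|rewrite real_part_eval // up].
Qed.

Lemma rstate_le (u e : W) : tripotent tp u -> tripotent tp e -> tau2 u = u -> tau2 e = e ->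
  (forall phi, rstate u phi -> e phi = 1 :> C) -> tripotent_le tp u e.
Proof.
move=> tu te ru re h; apply: nstate_le => // phi s.
have := h _ (nstate_real_part ru s); rewrite real_part_eval // => /(congr1 (@complex.Re R)) /= e1.
apply: nm1_Re1; last by rewrite e1.
apply: le_trans (dual_le _ _) _; apply: mulr_ile1; rewrite ?nm_ge0 //; first exact: (trip_le1 H te).
exact: s.1.
Qed.

Lemma wtends_tau2 (I : Type) (U : set_system I) (pU : ProperFilter U) w l :
  wtends U w l -> wtends U (fun i => tau2 (w i)) (tau2 l).
Proof. by move=> wl phi; rewrite tau2E; apply: (tends_conj pU (wl (tau phi))). Qed.

Lemma wtends_real (I : Type) (U : set_system I) (pU : ProperFilter U) w l :
  (forall i, tau2 (w i) = w i) -> wtends U w l -> tau2 l = l.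
Proof.
move=> rw wl; apply: (wtends_uniq pU (wtends_tau2 pU wl)).
by rewrite (_ : (fun i => tau2 (w i)) = w) //; apply/funext => i; exact: rw.
Qed.

Lemma sharpB (w w' : W) : tau2 (w - w') = tau2 w - tau2 w'.
Proof. by apply: dualP => phi; rewrite tau2E dualcB conjcD; congr (_ + _); rewrite rmorphN. Qed.
Lemma sharpD (w w' : W) : tau2 (w + w') = tau2 w + tau2 w'.
Proof. by apply: dualP => phi; rewrite tau2E dualcD conjcD. Qed.

(* The unit-ball elements equal to 1 on the states of [u] form a set with
   center [u] which is invariant under the conjugation. *)
Lemma support_real (a u : W) : tripotent tp u -> tau2 a = a ->
  (forall phi, nm phi <= 1 -> a phi = 1 :> C <-> u phi = 1 :> C) -> tau2 u = u.
Proof.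
move=> tu ra fa.
pose D (w : W) := nm w <= 1 /\ forall phi, nstate u phi -> w phi = 1 :> C.
have st phi : nstate u phi -> nstate u (tau phi).
  move=> [p1 up]; have t1 : nm (tau phi) <= 1 by rewrite tau_nm.
  split=> //; apply/(fa _ t1); have /(fa _ p1) ap := up.
  by rewrite -ra tau2E conj_involutive ap rmorph1.
have Dt (w : W) : D w -> D (tau2 w).
  move=> [w1 hw]; split; first by rewrite /nm conj_isometry.
  by move=> phi s; rewrite tau2E (hw _ (st _ s)) rmorph1.
have Du : D u by split; [exact: (trip_le1 H tu)|move=> phi []].
have Ds (w : W) : D w -> D (u + u - w).
  move=> [w1 hw]; have wE := nface_exact tu w1 hw.
  have h0 := pc_P0 H tu w.
  have -> : u + u - w = u + (- P0 tp u w).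
    by rewrite {1}wE opprD addrA addrK.
  split.
    apply: (nm_perp_le1 H tu (pc_e tu) (pcN H h0) (trip_le1 H tu)).
    by rewrite nmN; apply: le_trans (P0_contr H tu w) w1.
  move=> phi s; have [e1 eu] := nstate_ev s.
  by rewrite dualcD dualcN; have := state_kill0 H tu e1 eu h0; rewrite evE s.2 => ->; rewrite oppr0 addr0.
apply/esym; apply: (@center_unique R W D) => // [w []//|w Dw].
have -> : tau2 u + tau2 u - w = tau2 (u + u - tau2 w).
  by rewrite sharpB sharpD conj_involutive.
by apply/Dt/Ds/Dt.
Qed.

End Real.
End Support.

(** * Minimax *)

Section Minimax.
Context {R : realType}.
Local Notation C := (R[i]).
Variables (P : Type) (B : choiceType) (g : B -> P -> R).
Implicit Types (Q : set P) (b : B) (p : P).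

Definition rtends (U : set_system P) (f : P -> R) (l : R) :=
  forall e : R, 0 < e -> U [set p | `|f p - l| < e].

(** Compactness and convexity of [Q] are required only as far as the functions [g b] see them, so
    [P] carries neither a topology nor a linear structure. *)
Definition ultracompact Q := forall U, UltraFilter U -> U Q ->
  exists2 p, Q p & forall b, rtends U (g b) (g b p).

Definition convexlike Q := forall p q (t : R), Q p -> Q q -> 0 <= t <= 1 ->
  exists2 r, Q r & forall b, g b r = t * g b p + (1 - t) * g b q.

Hypothesis affine : forall b b' (t : R), 0 <= t <= 1 ->
  exists c, forall p, g c p = t * g b p + (1 - t) * g b' p.

Lemma rtends_le (U : set_system P) (pU : ProperFilter U) f l c :
  rtends U f l -> U [set p | f p <= c] -> l <= c.
Proof.
move=> fl fc; apply: (@le_eps _ _ _ 1) => e e0; rewrite mulr1.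
by have [p [/= h1]] := filter_ex (filterI fc (fl e e0)); rewrite ltr_norml => /andP[h2 _]; lra.
Qed.

Lemma sub_level Q b : ultracompact Q -> convexlike Q ->
  ultracompact (Q `&` [set p | g b p <= 0]) /\ convexlike (Q `&` [set p | g b p <= 0]).
Proof.
move=> kQ cQ; split.
  move=> U uU UQ; have [|p Qp gp] := kQ U uU; first by apply: filterS UQ => p [].
  exists p => //; split=> //=; apply: (rtends_le (@ultra_proper _ _ uU) (gp b)).
  by apply: filterS UQ => q [].
move=> p q t [Qp gp] [Qq gq] /[dup] /andP[t0 t1] t01; have [r Qr gr] := cQ p q t Qp Qq t01.
exists r => //; split=> //=; rewrite gr /= in gp gq *; nra.
Qed.

(* The bad parameters for [f] are closed upwards, those for [h] downwards;
   a common one would produce a point where both are non-positive. *)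
Lemma minimax2 Q f h : ultracompact Q -> convexlike Q ->
  (forall p, Q p -> 0 < g f p \/ 0 < g h p) ->
  exists c, forall p, Q p -> 0 < g c p.
Proof.
move=> kQ cQ fh; apply: contrapT => no.
pose G t p := t * g f p + (1 - t) * g h p.
have bad t : 0 <= t <= 1 -> exists2 p, Q p & G t p <= 0.
  move=> t01; have [c hc] := affine f h t01; apply: contrapT => none; apply: no.
  exists c => p Qp; rewrite hc ltNge; apply/negP => le0; apply: none; by exists p.
pose A k t := exists p, [/\ Q p, g k p <= 0 & G t p <= 0].
have clos k t : (forall e : R, 0 < e -> exists t', [/\ 0 <= t' <= 1, `|t' - t| < e & A k t']) -> A k t.
  move=> cl; pose T := set_system P.
  have [s hs] : exists s : nat -> R * P, forall n, [/\ 0 <= (s n).1 <= 1,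
      `|(s n).1 - t| < n.+1%:R^-1, Q (s n).2, g k (s n).2 <= 0 & G (s n).1 (s n).2 <= 0].
    suff h0 n : exists x : R * P, [/\ 0 <= x.1 <= 1,
      `|x.1 - t| < n.+1%:R^-1, Q x.2, g k x.2 <= 0 & G x.1 x.2 <= 0].
      by have [s hs] := choice h0; exists s.
    have n0 : 0 < n.+1%:R^-1 :> R by rewrite invr_gt0.
    by have [t' [t1 t2 [p [p1 p2 p3]]]] := cl _ n0; exists (t', p).
  have [U [uU oU]] := @ultraFilterLemma nat \oo _.
  have pU := @ultra_proper _ _ uU.
  have [|p Qp gp] := kQ ((fun n => (s n).2) @ U) (fmap_ultra _ uU).
    by apply: (@filterE _ U) => n; case: (hs n).
  have pF : ProperFilter ((fun n => (s n).2) @ U) by exact: fmap_proper_filter.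
  exists p; split=> //.
    by apply: (rtends_le pF (gp k)); apply: (@filterE _ U) => n; case: (hs n).
  apply: (@le_eps _ _ _ (2 + `|g f p| + `|g h p|)) => e e0; rewrite add0r.
  pose d := Num.min e 1; have d0 : 0 < d by rewrite lt_min e0 ltr01.
  have [N N0 nb] := archi_lt d^-1.
  have near_t : U [set n | `|(s n).1 - t| < d].
    apply: oU; exists N => // n /= Nn; case: (hs n) => _ tn _ _ _; apply: lt_trans tn _.
    rewrite invf_plt ?posrE //; apply: lt_trans nb _; rewrite ltr_nat; exact: leq_ltn_trans Nn (ltnSn n).
  have gpU b : U [set n | `|g b (s n).2 - g b p| < d] by exact: gp.
  have [n [[/= tn fn] hn]] := filter_ex (filterI (filterI near_t (gpU f)) (gpU h)).
  case: (hs n) => /andP[s0 s1] _ _ _; rewrite /G.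
  move: tn fn hn s0 s1; set s1 := (s n).1; set F := g f _; set Hn := g h (s n).2.
  rewrite !ltr_norml => /andP[a1 a2] /andP[b1 b2] /andP[c1 c2] s0 s2 le0.
  have de : d <= e by rewrite ge_min lexx.
  have nf := ler_norm (g f p); have nh := ler_norm (g h p).
  have nf' := ler_norm (- g f p); have nh' := ler_norm (- g h p); rewrite !normrN in nf' nh'.
  have e1 : (t - s1) * (g f p - g h p) <= d * (`|g f p| + `|g h p|).
    apply: le_trans (ler_norm _) _; rewrite normrM; apply: ler_pM => //.
      by rewrite ler_norml; apply/andP; split; lra.
    exact: ler_normB.
  have e2 : s1 * (g f p - F) <= d by nra.
  have e3 : (1 - s1) * (g h p - Hn) <= d by nra.
  have e4 : d * (`|g f p| + `|g h p|) <= e * (`|g f p| + `|g h p|).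
    by apply: ler_wpM2r => //; rewrite addr_ge0.
  have : t * g f p + (1 - t) * g h p = (s1 * F + (1 - s1) * Hn) + (t - s1) * (g f p - g h p) + s1 * (g f p - F) + (1 - s1) * (g h p - Hn) by ring.
  by move=> ->; lra.
have or t : 0 <= t <= 1 -> A f t \/ A h t.
  move=> /[dup] /andP[t0 t1] /bad[p Qp Gp]; have [fp|fp] := leP (g f p) 0; first by left; exists p.
  right; exists p; split=> //; rewrite leNgt; apply/negP => hp.
  by move: Gp; rewrite /G leNgt => /negP; apply; nra.
have A0 : ~ A f 0.
  move=> [p [Qp fp]]; rewrite /G mul0r add0r subr0 mul1r => hp.
  by case: (fh p Qp); rewrite ltNge ?fp ?hp.
have A1 : ~ A h 1.
  move=> [p [Qp hp]]; rewrite /G mul1r subrr mul0r addr0 => fp.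
  by case: (fh p Qp); rewrite ltNge ?fp ?hp.
pose S := [set t : R | 0 <= t <= 1 /\ A h t].
have hS : has_sup S.
  split; last by exists 1 => t [/andP[]].
  exists 0; split; first by rewrite lexx ler01.
  by case: (or 0); rewrite ?lexx ?ler01.
pose ts := sup S.
have ts0 : 0 <= ts.
  have [t St] := hS.1; apply: (@le_trans _ _ t); first by case: St => /andP[].
  by rewrite /ts; apply: (sup_upper_bound hS).
have ts1 : ts <= 1 by apply: ge_sup; [exact: hS.1|move=> t [/andP[]]].
have Ah : A h ts.
  apply: clos => e e0; have [t St lt] := sup_adherent e0 hS.
  have tle : t <= ts by rewrite /ts; apply: (sup_upper_bound hS).
  case: St => t01 At; exists t; split=> //; rewrite -/ts in lt.
  by rewrite ltr_norml; apply/andP; split; lra.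
have tlt : ts < 1.
  by rewrite lt_neqAle ts1 andbT; apply/eqP => E; apply: A1; rewrite -E.
have Af : A f ts.
  apply: clos => e e0; pose t' := Num.min (ts + e / 2) 1.
  have t'1 : t' <= 1 by rewrite ge_min lexx orbT.
  have t't : ts < t' by rewrite lt_min tlt andbT ltrDl divr_gt0.
  have t'e : t' <= ts + e / 2 by rewrite ge_min lexx.
  have t01 : 0 <= t' <= 1 by rewrite t'1 andbT; lra.
  exists t'; split=> //; first by rewrite ltr_norml; apply/andP; split; lra.
  case: (or t' t01) => // At; exfalso.
  have : t' <= ts by rewrite /ts; apply: (sup_upper_bound hS).
  lra.
have [p [Qp fp Gp]] := Af; have [q [Qq hq Gq]] := Ah.
have fq : 0 < g f q by case: (fh q Qq) => //; rewrite ltNge hq.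
(* The weight at which the combination [r] of [p] and [q] satisfies [g f r = 0]; then [g h r > 0],
   while the mixture [G ts r] is still at most 0. *)
pose l := g f q / (g f q - g f p).
have dn : 0 < g f q - g f p by lra.
have l01 : 0 <= l <= 1.
  by apply/andP; split; [rewrite divr_ge0 // ltW|rewrite ler_pdivrMr // mul1r; lra].
have [r Qr gr] := cQ p q l Qp Qq l01.
have fr : g f r = 0 by rewrite gr /l; field; rewrite gt_eqF.
have Gr : G ts r = l * G ts p + (1 - l) * G ts q by rewrite /G !gr; ring.
have Gr0 : G ts r <= 0 by rewrite Gr; case/andP: l01 => l0 l1; nra.
move: Gr0; rewrite /G fr mulr0 add0r => hr.
case: (fh r Qr); rewrite ?fr ?ltxx // => hr0.
have : 0 < (1 - ts) * g h r by rewrite mulr_gt0 // subr_gt0.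
lra.
Qed.

(** Where [g b <= 0] the rest of the list is enough and yields one parameter [c] by induction;
    [minimax2] merges [b] and [c]. *)
Lemma minimax_list (b0 : B) (s : seq B) Q : ultracompact Q -> convexlike Q ->
  (forall p, Q p -> has (fun b => 0 < g b p) s) -> exists c, forall p, Q p -> 0 < g c p.
Proof.
elim: s Q => [|b s IH] Q kQ cQ hQ; first by exists b0 => p /hQ.
have [kQ' cQ'] := sub_level b kQ cQ.
have [p [Qp /= gp]|c hc] := IH _ kQ' cQ'.
  by have := hQ p Qp; rewrite /= ltNge gp.
apply: (@minimax2 Q b c) => // p Qp; have [gp|gp] := leP (g b p) 0; last by left.
by right; apply: hc.
Qed.

(** Compactness leaves finitely many parameters: otherwise the counterexamples to all finite lists
    would have a limit at which every [g b] is at most 0. *)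
Theorem minimax (b0 : B) Q : ultracompact Q -> convexlike Q ->
  (forall p, Q p -> exists b, 0 < g b p) -> exists c, forall p, Q p -> 0 < g c p.
Proof.
move=> kQ cQ hQ.
have [s hs] : exists s : seq B, forall p, Q p -> has (fun b => 0 < g b p) s.
  apply: contrapT => no.
  have [p hp] : exists p : seq B -> P, forall s, Q (p s) /\ ~~ has (fun b => 0 < g b (p s)) s.
    suff h0 s : exists q, Q q /\ ~~ has (fun b => 0 < g b q) s.
      by have [p hp] := choice h0; exists p.
    apply: contrapT => none; apply: no; exists s => q Qq.
    by apply: contrapT => /negP nh; apply: none; exists q.
  have [U [uU lU]] := ultraFilterLemma (@list_filter_proper B).
  have [|q Qq gq] := kQ (p @ U) (fmap_ultra p uU).
    by apply: (@filterE _ U) => s; case: (hp s).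
  have pF : ProperFilter (p @ U) by exact: fmap_proper_filter (@ultra_proper _ _ uU).
  have [b gb] := hQ q Qq; have : g b q <= 0; last by rewrite leNgt gb.
  apply: (rtends_le pF (gq b)); apply: lU; exists [:: b] => s bs /=.
  case: (hp s) => _ /hasPn/(_ b); rewrite bs ?inE // => /(_ isT).
  by rewrite -leNgt.
exact: (minimax_list b0 kQ cQ hs).
Qed.

End Minimax.

(** * Elements subject to two norm bounds and a lower bound on a face *)

Section ThreeConstraints.
Context {R : realType}.
Local Notation C := (R[i]).
Variable X : normedModType C.
Local Notation Y := (dual X).

Lemma tendsM (I : Type) (U : set_system I) (pU : ProperFilter U) (z z' : I -> C) l l' :
  tends U z l -> tends U z' l' -> tends U (fun i => z i * z' i) (l * l').
Proof.
move=> h h' e e0; pose K := nm l' + 1 + nm l.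
have K0 : 0 < K by rewrite /K; have := nm_ge0 l; have := nm_ge0 l'; lra.
have d0 : 0 < e / (2 * K) by rewrite divr_gt0 // mulr_gt0.
apply: filterS (filterI (filterI (h _ d0) (h' _ d0)) (h' _ ltr01)) => i [[/= h1 h2] h3].
have -> : z i * z' i - l * l' = (z i - l) * z' i + l * (z' i - l') by ring.
apply: le_lt_trans (nmD _ _) _; rewrite !nmM.
have zb : nm (z' i) <= nm l' + 1 by have := nmD (z' i - l') l'; rewrite subrK; lra.
have n1 := nm_ge0 (z i - l); have n2 := nm_ge0 l; have n3 := nm_ge0 (z' i).
have n4 := nm_ge0 (z' i - l').
have b1 : nm (z i - l) * nm (z' i) <= e / (2 * K) * (nm l' + 1).
  by apply: ler_pM => //; exact: ltW.
have b2 : nm l * nm (z' i - l') <= nm l * (e / (2 * K)) by apply: ler_wpM2l => //; exact: ltW.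
apply: (@le_lt_trans _ _ (e / (2 * K) * K)); first by rewrite {2}/K; lra.
by rewrite (_ : _ * K = e / 2); [lra|field; rewrite gt_eqF].
Qed.

Lemma tends_Re (I : Type) (U : set_system I) (pU : ProperFilter U) (z : I -> C) l :
  tends U z l -> tends U (fun i => (complex.Re (z i))%:C) (complex.Re l)%:C.
Proof.
by apply: (tends_le pU ler01) => i; rewrite -rmorphB nmR mul1r -ReB; exact: Re_nm.
Qed.

Lemma ultra_wtends_on (I : Type) (U : set_system I) (A : set I) (w : I -> Y) (M : R) :
  UltraFilter U -> 0 <= M -> U A -> (forall i, A i -> nm (w i) <= M) ->
  exists2 l, nm l <= M & wtends U w l.
Proof.
move=> uU M0 UA wM; have pU := @ultra_proper _ _ uU.
pose w' i := if `[<A i>] then w i else 0.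
have [i|l l1 wl] := @ultra_wtends _ _ _ U w' M uU M0.
  by rewrite /w'; case: asboolP => [/wM|] //; rewrite nm0.
exists l => //; apply: (wtends_ext pU _ wl); apply: filterS UA => i Ai /=.
by rewrite /w'; case: asboolP.
Qed.

Lemma ultra_real_on (I : Type) (U : set_system I) (A : set I) (f : I -> R) (M : R) :
  UltraFilter U -> 0 <= M -> U A -> (forall i, A i -> `|f i| <= M) ->
  exists l : R, tends U (fun i => (f i)%:C) l%:C.
Proof.
move=> uU M0 UA fM; pose f' i := if `[<A i>] then f i else 0.
have [i|l hl] := @ultra_real _ _ U f' M uU.
  by rewrite /f'; case: asboolP => [/fM|] //; rewrite normr0.
exists l => e e0; apply: filterS (filterI UA (hl e e0)) => i [Ai] /=.
by rewrite -rmorphB nmR /f'; case: asboolP.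
Qed.

Record wcompact_convex (F : set Y) : Prop := WCompactConvex {
  wcc_ne : F !=set0 ;
  wcc_bound : exists2 M : R, 0 <= M & forall f, F f -> nm f <= M ;
  wcc_conv : forall f f' (t : R), F f -> F f' -> 0 <= t <= 1 -> F (t%:C *: f + (1 - t)%:C *: f') ;
  wcc_lim : forall (I : Type) (U : set_system I) w l, UltraFilter U ->
    U [set i | F (w i)] -> wtends U w l -> F l }.

Variables (F : set Y).
Hypothesis hF : wcompact_convex F.

(** Separation of a point from a weak*-compact convex set as an instance of the minimax; rescaling
    normalises the gap to 1. *)
Lemma separation psi : ~ F psi -> exists x, forall f, F f -> complex.Re (f x : C) + 1 <= complex.Re (psi x : C).
Proof.
move=> nF; pose g (x : X) (f : Y) := complex.Re (psi x - f x : C) - 1.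
have [||||c hc] := @minimax R Y X g _ 0 F.
- move=> b b' t t01; exists (t%:C *: b + (1 - t)%:C *: b') => f.
  by rewrite /g !dualD !dualZ !ReB !ReD !ReMr; ring.
- move=> U uU UF; have pU := @ultra_proper _ _ uU; have [M M0 FM] := wcc_bound hF.
  have [l lM wl] := ultra_wtends_on uU M0 UF FM; exists l; first exact: (wcc_lim hF uU UF wl).
  move=> b e e0; apply: filterS (wl b e e0) => f /= h.
  rewrite /g (_ : _ - 1 - _ = complex.Re (l b - f b)); last by rewrite !ReB; ring.
  by rewrite (le_lt_trans (Re_nm _)) // nm_distC.
- move=> f f' t Ff Ff' t01; exists (t%:C *: f + (1 - t)%:C *: f'); first exact: (wcc_conv hF).
  by move=> b; rewrite /g dualcD !dualcZ !ReB !ReD !ReMr; ring.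
- move=> f Ff; have [x hx] : exists x, complex.Re (psi x - f x : C) > 0.
    apply: contrapT => no; apply: nF; suff -> : psi = f by [].
    apply: dualP => x; apply/eqP; rewrite -subr_eq0; apply/eqP.
    have := @Re_le0_vanish R X (psi - f) (fun=> True) (fun _ _ _ => I) _ x I; apply=> y _.
    by rewrite leNgt; apply/negP => h; apply: no; exists y.
  exists ((2 / complex.Re (psi x - f x : C))%:C *: x).
  rewrite /g !dualZ -mulrBr ReMr divfK ?gt_eqF //; lra.
exists c => f Ff; have := hc f Ff; rewrite /g ReB; lra.
Qed.

Variables (c1 c2 : X) (r1 r2 s : R).
Hypotheses (r10 : 0 < r1) (r20 : 0 < r2) (c12 : nm (c1 - c2) < r1 + r2).
Hypothesis gap : forall f f1 f2, F f -> f = f1 + f2 ->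
  s < complex.Re (f1 c1 : C) + r1 * nm f1 + (complex.Re (f2 c2 : C) + r2 * nm f2).

Let PT := (Y * Y * Y * (R * R * R))%type.
(** A convex combination of a functional of [F] and functionals of two unit balls, with its weights
    recorded. Positivity of [g b] at the three kinds of vertices expresses the three constraints,
    and storing the product [al f] instead of [f] keeps [g b] affine. *)
Let Q (p : PT) := [/\ 0 <= p.2.1.1, 0 <= p.2.1.2, 0 <= p.2.2 & p.2.1.1 + p.2.1.2 + p.2.2 = 1] /\
  [/\ exists2 f, F f & p.1.1.1 = (p.2.1.1)%:C *: f, nm p.1.1.2 <= p.2.1.2 & nm p.1.2 <= p.2.2].
Let g (b : X) (p : PT) : R := complex.Re (p.1.1.1 b : C) - p.2.1.1 * s
  + (p.2.1.2 * r1 - complex.Re (p.1.1.2 (b - c1) : C))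
  + (p.2.2 * r2 - complex.Re (p.1.2 (b - c2) : C)).

Let gT b f h1 h2 al be ga : g b ((f, h1, h2), (al, be, ga)) =
  complex.Re (f b : C) - al * s + (be * r1 - complex.Re (h1 (b - c1) : C))
  + (ga * r2 - complex.Re (h2 (b - c2) : C)).
Proof. by []. Qed.

Let g_compact : ultracompact g Q.
Proof.
move=> U uU UQ; have pU := @ultra_proper _ _ uU.
have [M M0 FM] := wcc_bound hF.
have le1 (p : PT) : Q p -> [/\ `|p.2.1.1| <= 1, `|p.2.1.2| <= 1 & `|p.2.2| <= 1].
  by move=> [[a0 b0 d0 sm] _]; rewrite !ger0_norm //; split; lra.
have [al hal] : exists l : R, tends U (fun p : PT => (p.2.1.1)%:C) l%:C.
  by apply: (ultra_real_on uU ler01 UQ) => p /le1[].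
have [be hbe] : exists l : R, tends U (fun p : PT => (p.2.1.2)%:C) l%:C.
  by apply: (ultra_real_on uU ler01 UQ) => p /le1[].
have [ga hga] : exists l : R, tends U (fun p : PT => (p.2.2)%:C) l%:C.
  by apply: (ultra_real_on uU ler01 UQ) => p /le1[].
have [fF hfF] : exists f : PT -> Y, forall p, Q p -> F (f p) /\ p.1.1.1 = (p.2.1.1)%:C *: f p.
  suff h0 (p : PT) : exists f, Q p -> F f /\ p.1.1.1 = (p.2.1.1)%:C *: f.
    by have [f hf] := choice h0; exists f.
  have [[_ [[f Ff E] _ _]]|nQ] := pselect (Q p); first by exists f.
  by have [f Ff] := wcc_ne hF; exists f.
have UF : U [set p | F (fF p)] by apply: filterS UQ => p /hfF[].
have [f _ wf] : exists2 l, nm l <= M & wtends U fF l.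
  by apply: (ultra_wtends_on uU M0 UF) => p; exact: FM.
have Ff := wcc_lim hF uU UF wf.
have [h1 _ wh1] : exists2 l, nm l <= 1 & wtends U (fun p : PT => p.1.1.2) l.
  apply: (ultra_wtends_on uU ler01 UQ) => p Qp; have [_ b1 _] := le1 p Qp.
  by case: Qp => _ [_ h _]; apply: le_trans h _; apply: le_trans (ler_norm _) b1.
have [h2 _ wh2] : exists2 l, nm l <= 1 & wtends U (fun p : PT => p.1.2) l.
  apply: (ultra_wtends_on uU ler01 UQ) => p Qp; have [_ _ b1] := le1 p Qp.
  by case: Qp => _ [_ _ h]; apply: le_trans h _; apply: le_trans (ler_norm _) b1.
have ge0l (z : PT -> R) l : tends U (fun p => (z p)%:C) l%:C -> (forall p, Q p -> 0 <= z p) -> 0 <= l.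
  by move=> zl z0; apply: (tends_Re_ge pU _ zl); apply: filterS UQ => p Qp /=; exact: z0.
have nl (h : PT -> Y) (z : PT -> R) (l : Y) m : wtends U h l -> tends U (fun p => (z p)%:C) m%:C ->
    (forall p, Q p -> nm (h p) <= z p) -> nm l <= m.
  move=> hl zm hz; have m0 : 0 <= m.
    by apply: (ge0l z) => // p Qp; apply: le_trans (hz p Qp); exact: nm_ge0.
  apply: dual_nm_le => // v; have : forall e : R, 0 < e -> nm (l v : C) <= m * nm v + e * (1 + nm v).
    move=> e e0; have [p [[/= Qp a1] a2]] := filter_ex (filterI (filterI UQ (hl v e e0)) (zm e e0)).
    move: a2; rewrite -rmorphB nmR ltr_norml => /andP[_ a2].
    have a3 := dual_le (h p) v; have a4 := nmBD (l v : C) (h p v).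
    rewrite nm_distC in a1; have a5 := ler_wpM2r (nm_ge0 v) (hz p Qp).
    have a6 : z p * nm v <= (m + e) * nm v by apply: ler_wpM2r; [exact: nm_ge0|lra].
    lra.
  exact: le_eps.
exists ((al%:C *: f, h1, h2), (al, be, ga)) => /=.
  split=> /=.
    split; first by apply: (ge0l (fun p => p.2.1.1)) => // p [[]].
    - by apply: (ge0l (fun p => p.2.1.2)) => // p [[]].
    - by apply: (ge0l (fun p => p.2.2)) => // p [[]].
    have E : tends U (fun p : PT => (p.2.1.1 + p.2.1.2 + p.2.2)%:C) (al + be + ga)%:C.
      rewrite !rmorphD; apply: (tends_ext pU _ (tendsD pU (tendsD pU hal hbe) hga)).
      by apply: filterE => p /=; rewrite !rmorphD.
    have E1 : tends U (fun p : PT => (p.2.1.1 + p.2.1.2 + p.2.2)%:C) 1%:C.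
      by apply: (tends_ext pU _ (tends_cst pU 1%:C)); apply: filterS UQ => p [[_ _ _ E0] _] /=; rewrite E0.
    exact: (complexI (tends_uniq pU E E1)).
  split; first by exists f.
    by apply: (nl _ _ _ _ wh1 hbe) => p [_ []].
  by apply: (nl _ _ _ _ wh2 hga) => p [_ []].
move=> b.
have T : tends U (fun p : PT => (g b p)%:C) (g b ((al%:C *: f, h1, h2), (al, be, ga)))%:C.
  have t1 : tends U (fun p : PT => p.1.1.1 b : C) (al%:C * f b).
    apply: (tends_ext pU _ (tendsM pU hal (wf b))); apply: filterS UQ => p /hfF[_ /= ->].
    by rewrite dualcZ.
  have a1 := tends_Re pU t1; have a2 := tendsZ pU (- s%:C) hal.
  have a3 := tendsZ pU r1%:C hbe; have a4 := tendsN pU (tends_Re pU (wh1 (b - c1))).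
  have a5 := tendsZ pU r2%:C hga; have a6 := tendsN pU (tends_Re pU (wh2 (b - c2))).
  have := tendsD pU (tendsD pU (tendsD pU a1 a2) (tendsD pU a3 a4)) (tendsD pU a5 a6).
  rewrite (_ : _ + _ = (g b ((al%:C *: f, h1, h2), (al, be, ga)))%:C :> C); last first.
    by rewrite gT dualcZ !(rmorphD, rmorphB, rmorphM, rmorphN) /=; ring.
  apply: (tends_ext pU); apply: filterE => p /=.
  by rewrite /g !(rmorphD, rmorphB, rmorphM, rmorphN) /=; ring.
by move=> e e0; apply: filterS (T e e0) => p /=; rewrite -rmorphB nmR.
Qed.

Let g_convex : convexlike g Q.
Proof.
move=> p q t [[a0 b0 d0 sm] [[f Ff fE] h1 h2]] [[a0' b0' d0' sm'] [[f' Ff' fE'] h1' h2']] /[dup] t01 /andP[t0 t1].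
have u0 : 0 <= 1 - t by rewrite subr_ge0.
pose cmb (V : lmodType C) (x y : V) := t%:C *: x + (1 - t)%:C *: y.
pose rc (x y : R) := t * x + (1 - t) * y.
exists ((cmb _ p.1.1.1 q.1.1.1, cmb _ p.1.1.2 q.1.1.2, cmb _ p.1.2 q.1.2),
   (rc p.2.1.1 q.2.1.1, rc p.2.1.2 q.2.1.2, rc p.2.2 q.2.2)); last first.
  by move=> b; rewrite gT /g /cmb /rc !dualcD !dualcZ !ReD !ReMr; ring.
have nc (x y : Y) m m' : nm x <= m -> nm y <= m' -> nm (cmb _ x y) <= rc m m'.
  move=> xm ym; apply: le_trans (nmD _ _) _; rewrite !nmZp //.
  by apply: lerD; apply: ler_wpM2l.
have rc0 x y : 0 <= x -> 0 <= y -> 0 <= rc x y by move=> x0 y0; rewrite addr_ge0 // mulr_ge0.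
split=> /=; split; rewrite ?rc0 ?nc //.
  have -> : rc p.2.1.1 q.2.1.1 + rc p.2.1.2 q.2.1.2 + rc p.2.2 q.2.2 =
    t * (p.2.1.1 + p.2.1.2 + p.2.2) + (1 - t) * (q.2.1.1 + q.2.1.2 + q.2.2) by rewrite /rc; ring.
  by rewrite sm sm'; ring.
set a := rc _ _; have a0'' : 0 <= a by exact: rc0.
rewrite fE fE' /cmb; have [az|an] := eqVneq a 0.
  have z1 : t * p.2.1.1 = 0.
    have : 0 <= t * p.2.1.1 by exact: mulr_ge0.
    have : 0 <= (1 - t) * q.2.1.1 by exact: mulr_ge0.
    by move: az; rewrite /a /rc; lra.
  have z2 : (1 - t) * q.2.1.1 = 0 by move: az; rewrite /a /rc z1 add0r.
  by exists f => //; rewrite !scalerA -!rmorphM z1 z2 az !scale0r addr0.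
pose u := t * p.2.1.1 / a.
have u1 : 1 - u = (1 - t) * q.2.1.1 / a by apply: (mulIf an); rewrite mulrBl /u !divfK // mul1r /a /rc; ring.
exists (u%:C *: f + (1 - u)%:C *: f').
  apply: (wcc_conv hF) => //; apply/andP; split; first by rewrite /u divr_ge0 // mulr_ge0.
  by rewrite -subr_ge0 u1 divr_ge0 // mulr_ge0.
rewrite scalerDr !scalerA -!rmorphM u1 /u; congr (_%:C *: _ + _%:C *: _).
  by rewrite [a * _]mulrC divfK.
by rewrite [a * _]mulrC divfK.
Qed.

(** At a fixed point of [Q], the dependence of [g b] on [b] is the linear functional [ft - h1 - h2].
    If it is non-zero, scaling [b] makes the value positive; if it is zero, [ft = h1 + h2] is a
    splitting and [gap] applies, or [c12] when the weight of [F] is zero. *)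
Lemma three_constraints : exists b, [/\ nm (b - c1) <= r1, nm (b - c2) <= r2 &
  forall f, F f -> s <= complex.Re (f b : C)].
Proof.
have [|p Qp|c hc] := @minimax R PT X g _ 0 Q g_compact g_convex.
- move=> b b' t t01; exists (t%:C *: b + (1 - t)%:C *: b') => p.
  have E c0 : t%:C *: b + (1 - t)%:C *: b' - c0 = t%:C *: (b - c0) + (1 - t)%:C *: (b' - c0).
    by rewrite rmorphB rmorph1; vec.
  by rewrite /g !E !dualD !dualZ !ReD !ReMr; ring.
- case: p Qp => [[[ft h1] h2] [[a b] d]] [/= [a0 b0 d0 sm] [[f Ff fE] n1 n2]].
  pose L := ft - h1 - h2.
  have gE x : g x ((ft, h1, h2), (a, b, d)) = complex.Re (L x : C) + g 0 ((ft, h1, h2), (a, b, d)).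
    by rewrite !gT /L !dualcB !dualB !dual0 !ReB; ring.
  have [[x Lx]|no] := pselect (exists x, 0 < complex.Re (L x : C)).
    exists (((`|g 0 ((ft, h1, h2), (a, b, d))| + 1) / complex.Re (L x : C))%:C *: x).
    rewrite gE dualZ ReMr divfK ?gt_eqF //.
    have := ler_norm (- g 0 ((ft, h1, h2), (a, b, d))); rewrite normrN; lra.
  have L0 : ft = h1 + h2.
    apply: dualP => x; apply/eqP; rewrite dualDE -subr_eq0; apply/eqP.
    have := @Re_le0_vanish R X L (fun=> True) (fun _ _ _ => Logic.I) _ x Logic.I.
    rewrite /L !dualcB opprD addrA; apply=> y _.
    by rewrite leNgt; apply/negP => h; apply: no; exists y.
  exists 0; rewrite gT !dualB !dual0 !sub0r !ReN !opprK.
  have [az|an] := eqVneq a 0.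
    have h12 : h1 = - h2 by apply/eqP; rewrite -addr_eq0 -L0 fE az scale0r.
    have n12 : nm h1 = nm h2 by rewrite h12 nmN.
    rewrite az mul0r oppr0 add0r h12 dualcN ReN.
    have : complex.Re (h2 c1 - h2 c2 : C) <= nm h2 * nm (c1 - c2).
      by rewrite -dualB; apply: le_trans (Re_le_nm _) (dual_le _ _).
    rewrite ReB => h; have nh := nm_ge0 h2; rewrite n12 in n1.
    have k1 : 0 <= (b - nm h2) * r1 by rewrite mulr_ge0 ?subr_ge0 // ltW.
    have k2 : 0 <= (d - nm h2) * r2 by rewrite mulr_ge0 ?subr_ge0 // ltW.
    have [hz|hn] := eqVneq (nm h2) 0.
      rewrite hz mul0r in h; have : b = 1 \/ 0 < d.
        have [dz|dn] := eqVneq d 0; first by left; move: sm; rewrite dz az; lra.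
        by right; rewrite lt_neqAle eq_sym dn.
      case=> [b1|dp].
        have : 0 <= d * r2 by rewrite mulr_ge0 // ltW.
        by rewrite b1; have := r10; lra.
      have : 0 < d * r2 by rewrite mulr_gt0.
      have : 0 <= b * r1 by rewrite mulr_ge0 // ltW.
      lra.
    have hp : 0 < nm h2 by rewrite lt_neqAle eq_sym hn.
    have : nm h2 * nm (c1 - c2) < nm h2 * (r1 + r2) by rewrite ltr_pM2l.
    lra.
  have ap : 0 < a by rewrite lt_neqAle eq_sym an.
  have ia : 0 <= a^-1 by rewrite invr_ge0.
  have := gap Ff (_ : f = a^-1%:C *: h1 + a^-1%:C *: h2).
  rewrite -scalerDr -L0 fE scalerA -rmorphM mulVf // scale1r => /(_ erefl).
  rewrite !dualcZ !ReMr !nmZp // => h.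
  have {}h : a * s < a * (a^-1 * complex.Re (h1 c1 : C) + r1 * (a^-1 * nm h1) + (a^-1 * complex.Re (h2 c2 : C) + r2 * (a^-1 * nm h2))).
    by rewrite ltr_pM2l.
  have E : a * (a^-1 * complex.Re (h1 c1 : C) + r1 * (a^-1 * nm h1) + (a^-1 * complex.Re (h2 c2 : C) + r2 * (a^-1 * nm h2))) =
    complex.Re (h1 c1 : C) + r1 * nm h1 + (complex.Re (h2 c2 : C) + r2 * nm h2) by field.
  rewrite E in h; have := ler_wpM2l (ltW r10) n1; have := ler_wpM2l (ltW r20) n2.
  rewrite /=; lra.
have [f0 Ff0] := wcc_ne hF.
have ball (c0 : X) (r : R) (pr : Y -> PT) : (forall h, nm h <= 1 -> Q (pr h)) ->
    (forall h, g c (pr h) = r - complex.Re (h (c - c0) : C)) -> nm (c - c0) <= r.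
  move=> Qpr gpr; have [h [h1 hx]] := norming (c - c0).
  by have := hc _ (Qpr h h1); rewrite gpr hx /= subr_gt0 => /ltW.
exists c; split.
- apply: (ball _ _ (fun h => ((0, h, 0), (0, 1, 0)))) => h => [h1|]; last first.
    by rewrite gT !dualc0 /=; ring.
  split=> /=; split; rewrite ?nm0 ?lexx ?ler01 ?addr0 ?add0r //.
  by exists f0 => //; rewrite scale0r.
- apply: (ball _ _ (fun h => ((0, 0, h), (0, 0, 1)))) => h => [h1|]; last first.
    by rewrite gT !dualc0 /=; ring.
  split=> /=; split; rewrite ?nm0 ?lexx ?ler01 ?addr0 ?add0r //.
  by exists f0 => //; rewrite scale0r.
- move=> f Ff; have Qf : Q ((f, 0, 0), (1, 0, 0)).
    split=> /=; split; rewrite ?nm0 ?lexx ?ler01 ?addr0 //.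
    by exists f => //; rewrite scale1r.
  have := hc _ Qf; rewrite gT !dualc0 /= !mul0r; lra.
Qed.

End ThreeConstraints.

Section Complete.
Context {R : realType}.

Lemma ratio_small (a : R) (d r : R) : 0 < d -> 0 <= r < 1 -> exists n, a * r ^+ n < d.
Proof.
move=> d0 /andP[r0 r1]; have a1 : 0 < `|a| + 1 by rewrite ltr_wpDl.
have /cvgrPdist_lt/(_ (d / (`|a| + 1)) (divr_gt0 d0 a1))[n _ hn] :
  (r ^+ n) @[n --> \oo] --> (0 : R) by apply: cvg_expr; rewrite ger0_norm.
exists n; have := hn n (leqnn n); rewrite /= sub0r normrN ger0_norm ?exprn_ge0 // ltr_pdivlMr //.
have := ler_wpM2r (exprn_ge0 n r0) (ler_norm a); have := exprn_ge0 n r0; lra.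
Qed.

Lemma small_pow (a d : R) : 0 < d -> exists n, a / 2 ^+ n < d.
Proof.
move=> d0; have h : 0 <= (2^-1 : R) < 1 by apply/andP; split; lra.
by have [n hn] := ratio_small a d0 h; exists n; rewrite -exprVn.
Qed.

Variable X : completeNormedModType R[i].

Lemma telescoping_cvg (x : nat -> X) (b : nat -> R) :
  (forall n, 0 <= b n) -> (forall n, nm (x n.+1 - x n) <= b n - b n.+1) ->
  (forall e, 0 < e -> exists n, b n < e) ->
  exists l, forall n, nm (l - x n) <= b n.
Proof.
move=> b0 hx hb.
have dist n m : nm (x (n + m)%N - x n) <= b n - b (n + m)%N.
  elim: m => [|m IH]; first by rewrite addn0 !subrr nm0.
  rewrite addnS -[_ - x n](subrKA (x (n + m)%N)); apply: le_trans (nmD _ _) _.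
  by have := hx (n + m)%N; move: IH; lra.
have {}dist n m : (n <= m)%N -> nm (x m - x n) <= b n.
  by move=> /subnKC <-; apply: le_trans (dist _ _) _; rewrite gerBl.
have cx : cvg (x @ \oo).
  apply: cauchy_cvg; apply: cauchy_exP => e e0; have en : 0 < nm e by rewrite -ltcR -nmE normr_gt0 gt_eqF.
  have [n hn] := hb _ en.
  exists (x n); exists n => // m /= nm'.
  rewrite -ball_normE /= distrC nmE -[e]ger0_norm ?(ltW e0) // nmE ltcR.
  by apply: le_lt_trans hn; exact: dist.
exists (lim (x @ \oo)) => n.
apply: (@le_eps _ _ _ 1) => e e0; rewrite mulr1.
have e0' : 0 < e%:C :> R[i] by rewrite ltcR.
have /cvgrPdist_lt/(_ _ e0')[m _ hm] := cx.
have /= := hm (maxn n m) (leq_maxr _ _); rewrite nmE ltcR => h1.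
rewrite -[_ - x n](subrKA (x (maxn n m))); apply: le_trans (nmD _ _) _.
by have := dist n (maxn n m) (leq_maxl _ _); lra.
Qed.

End Complete.

Section WCompact.
Context {R : realType}.
Local Notation C := (R[i]).
Variable X : normedModType C.

Lemma wcc_translate (F : set (dual X)) g : wcompact_convex F ->
  wcompact_convex [set f | F (f - g)].
Proof.
move=> hF; split.
- by have [f Ff] := wcc_ne hF; exists (f + g) => /=; rewrite addrK.
- have [M M0 FM] := wcc_bound hF; exists (M + nm g) => [|f /= /FM h]; first by nneg.
  by rewrite -[f](subrK g); apply: le_trans (nmD _ _) _; rewrite lerD2r.
- move=> f f' t /= Ff Ff' t01; have -> : t%:C *: f + (1 - t)%:C *: f' - g = t%:C *: (f - g) + (1 - t)%:C *: (f' - g).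
    by rewrite rmorphB rmorph1; vec.
  exact: (wcc_conv hF).
- move=> I U w l uU UF wl; have pU := @ultra_proper _ _ uU.
  apply: (wcc_lim hF uU UF) => x; apply: (tends_le pU ler01) (wl x) => i.
  by rewrite !dualcB mul1r (_ : _ - _ - _ = w i x - l x) //; ring.
Qed.

End WCompact.

Lemma conjugationB (R : realType) (V : normedModType R[i]) (tau : conjugation V) x y :
  tau (x - y) = tau x - tau y.
Proof. by rewrite -scaleN1r addrC conj_antilinear rmorphN1 scaleN1r addrC. Qed.

(** * Exposing the state space of a tripotent *)

Section ExactElement.
Context {R : realType}.
Local Notation C := (R[i]).
Variable X : completeNormedModType C.
Local Notation Y := (dual X).
Local Notation W := (dual Y).
Variable tp : W -> W -> W -> W.
Hypothesis H : is_jbstar_triple tp.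
Hypothesis wc1 : forall b c, wcont (fun x => tp x b c).
Hypothesis wc2 : forall a c, wcont (fun x => tp a x c).
Variable tau : conjugation X.
Local Notation ev := (@canonical_embedding R X).
Local Notation tau1 := (sharp tau).
Local Notation tau2 := (sharp tau1).

Lemma ev_real x : tau x = x -> tau2 (ev x) = ev x.
Proof. by move=> hx; apply: dualP => f; rewrite /= conjcK hx. Qed.

Lemma real_fun_eval (f : Y) x : tau1 f = f -> f (real_part tau x) = (complex.Re (f x : C))%:C :> C.
Proof. by move=> hf; rewrite (real_part_eval x hf). Qed.

Variable e : W.
Hypotheses (He : tripotent tp e) (Re : tau2 e = e).
Local Notation F := (rstate tau1 e).
Hypothesis hF : wcompact_convex F.

(* [y = e + P0 e x] takes the value 1 on [F] and is close to [x], which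
   makes the constraints [nm b <= 1], [nm (b - x) <= d], [s <= b] compatible. *)
Lemma improve (d : R) : 0 < d -> exists2 eps : R, 0 < eps & forall x (s : R),
  tau x = x -> nm x <= 1 -> (forall f, F f -> 1 - eps <= complex.Re (f x : C)) -> s < 1 ->
  exists x', [/\ tau x' = x', nm x' <= 1, nm (x' - x) <= d & forall f, F f -> s <= complex.Re (f x' : C)].
Proof.
move=> d0; have [eps e0 he] := nface_quant H wc1 He d0.
exists eps => // x s tx x1 hx s1.
have [||b [b1 b2 b3]] := @three_constraints R X F hF 0 x 1 d s ltr01 d0.
- by rewrite sub0r nmN; lra.
- have hq : nm (ev x - e - P0 tp e (ev x)) <= d.
    apply: he; first by apply: le_trans (nm_ev x) x1.
    move=> f sf; have := hx _ (nstate_real_part Re sf).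
    have := real_part_eval f (ev_real tx); rewrite evE => ->.
    by rewrite evE.
  move=> f f1 f2 Ff fE; set y : W := e + P0 tp e (ev x).
  have y1 : nm y <= 1.
    apply: (nm_perp_le1 H He (pc_e He) (pc_P0 H He _)); first exact: (trip_le1 H He).
    by apply: le_trans (P0_contr H He _) _; apply: le_trans (nm_ev x) x1.
  have fy : y f = 1 :> C.
    have [[f1' fe] _] := Ff; rewrite /y dualcD fe.
    have := @state_kill0 R _ tp H e He (canonical_embedding f) (le_trans (nm_ev _) f1') fe _ (pc_P0 H He (ev x)).
    by rewrite evE => ->; rewrite addr0.
  rewrite dual0 add0r mul1r.
  have h1 : complex.Re (y f1 : C) <= nm f1.
    by apply: le_trans (Re_le_nm _) _; exact: dual_le1.
  have h2 : complex.Re (y f2 : C) <= complex.Re (f2 x : C) + d * nm f2.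
    have : complex.Re ((ev x - e - P0 tp e (ev x)) f2 : C) >= - (d * nm f2).
      have := dual_le (ev x - e - P0 tp e (ev x)) f2.
      have := Re_nm ((ev x - e - P0 tp e (ev x)) f2 : C).
      rewrite ler_norml => /andP[g1 _] g2; have := ler_wpM2r (nm_ge0 f2) hq; lra.
    by rewrite /y dualcD !dualcB !ReB !ReD evE; lra.
  have : complex.Re (y f1 : C) + complex.Re (y f2 : C) = 1 by rewrite -ReD -dualD -fE fy.
  by move: h1 h2; lra.
(* The constraints survive passing to the real part, because [x] and all functionals of [F] are
   real. *)
exists (real_part tau b); split.
- exact: real_part_real.
- by apply: le_trans (real_part_nm _ _) _; move: b1; rewrite subr0.
- have -> : real_part tau b - x = real_part tau (b - x).
    by rewrite /real_part conjugationB tx; vecf.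
  exact: le_trans (real_part_nm _ _) b2.
- move=> f Ff; rewrite real_fun_eval /=; first exact: b3.
  by case: Ff.
Qed.

(** [improve] is iterated with moves of size [d / 2^(n+1)], each step reaching the accuracy that the
    next one demands; the moves add up to at most [d]. *)
Lemma exact_from (d : R) : 0 < d -> exists2 eps : R, 0 < eps &
  forall x0, tau x0 = x0 -> nm x0 <= 1 -> (forall f, F f -> 1 - eps <= complex.Re (f x0 : C)) ->
  exists a, [/\ tau a = a, nm a <= 1, nm (a - x0) <= d & forall f, F f -> f a = 1 :> C].
Proof.
move=> d0; pose dn n := d / 2 ^+ n.+1.
have p2 n : 0 < (2 : R) ^+ n by rewrite exprn_gt0.
have dn0 n : 0 < dn n by rewrite divr_gt0.
have [ep hep] : exists ep : nat -> R, forall n, 0 < ep n /\ forall x (s : R),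
  tau x = x -> nm x <= 1 -> (forall f, F f -> 1 - ep n <= complex.Re (f x : C)) -> s < 1 ->
  exists x', [/\ tau x' = x', nm x' <= 1, nm (x' - x) <= dn n & forall f, F f -> s <= complex.Re (f x' : C)].
  suff h0 n : exists ep : R, 0 < ep /\ forall x (s : R),
  tau x = x -> nm x <= 1 -> (forall f, F f -> 1 - ep <= complex.Re (f x : C)) -> s < 1 ->
  exists x', [/\ tau x' = x', nm x' <= 1, nm (x' - x) <= dn n & forall f, F f -> s <= complex.Re (f x' : C)].
    by have [ep hep] := choice h0; exists ep.
  by have [ep h1 h2] := improve (dn0 n); exists ep.
(* The first entry makes the next step possible, the second drives the values on [F] to 1. *)
pose em n := Num.min (ep n) ((2 ^+ n)^-1).
have em0 n : 0 < em n by rewrite lt_min (hep n).1 invr_gt0 p2.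
pose P n x := [/\ tau x = x, nm x <= 1 & forall f, F f -> 1 - em n <= complex.Re (f x : C)].
exists (em 0%N) => // x0 tx0 x01 hx0.
have [g hg] : exists g : nat * X -> X, forall q, P q.1 q.2 -> P q.1.+1 (g q) /\ nm (g q - q.2) <= dn q.1.
  suff h0 q : exists x', P q.1 q.2 -> P q.1.+1 x' /\ nm (x' - q.2) <= dn q.1.
    by have [g hg] := choice h0; exists g.
  have [[t1 n1 f1]|nP] := pselect (P q.1 q.2); last by exists 0.
  have [_ h] := hep q.1; have [||x' [t2 n2 n3 f2]] := h q.2 (1 - em q.1.+1) t1 n1.
  - move=> f /f1; apply: le_trans; rewrite lerD2l lerN2 /em ge_min lexx //.
  - by rewrite gtrBl.
  by exists x'.
pose xs := fix xs n := if n is k.+1 then g (k, xs k) else x0.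
have Pxs n : P n (xs n) by elim: n => [//|n IH]; exact: (hg (n, xs n) IH).1.
have [n|n||a ha] := @telescoping_cvg R X xs (fun n => d / 2 ^+ n).
- by rewrite divr_ge0 ?ltW.
- apply: le_trans (hg (n, xs n) (Pxs n)).2 _; rewrite /dn /= exprS.
  by rewrite invfM mulrCA; have := divr_ge0 (ltW d0) (ltW (p2 n)); lra.
- by move=> e'; exact: small_pow.
have lim0 (c : R) : (forall n, c <= 2 * (d / 2 ^+ n) + (2 ^+ n)^-1) -> c <= 0.
  move=> hc; apply: (@le_eps _ _ _ 1) => e' e0'; have [n hn] := small_pow (2 * d + 1) e0'.
  rewrite add0r mulr1; apply: le_trans (hc n) _.
  have -> : 2 * (d / 2 ^+ n) + (2 ^+ n)^-1 = (2 * d + 1) / 2 ^+ n by set q := (2 ^+ n)^-1; ring.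
  exact: ltW.
exists a; split.
- apply/eqP; rewrite -subr_eq0; apply/eqP; apply: nm_eq0; apply/eqP; rewrite eq_le nm_ge0 andbT.
  apply: lim0 => n; have [tx _ _] := Pxs n.
  have -> : tau a - a = tau (a - xs n) - (a - xs n).
    by rewrite conjugationB tx; vec.
  apply: le_trans (nmB _ _) _; rewrite tau_nm; have := ha n.
  by have : 0 <= (2 ^+ n)^-1 :> R; [rewrite invr_ge0 ltW|lra].
- rewrite -subr_le0; apply: lim0 => n; have [_ x1 _] := Pxs n.
  have := nmD (a - xs n) (xs n); rewrite subrK; have := ha n.
  have : 0 <= (2 ^+ n)^-1 :> R by rewrite invr_ge0 ltW.
  have := divr_ge0 (ltW d0) (ltW (p2 n)); lra.
- by have := ha 0%N; rewrite expr0 divr1.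
- move=> f Ff; have f1 : nm f <= 1 by case: Ff => -[].
  have anm : nm a <= 1.
    rewrite -subr_le0; apply: lim0 => n; have [_ x1 _] := Pxs n.
    have := nmD (a - xs n) (xs n); rewrite subrK; have := ha n.
    have : 0 <= (2 ^+ n)^-1 :> R by rewrite invr_ge0 ltW.
    have := divr_ge0 (ltW d0) (ltW (p2 n)); lra.
  apply: nm1_Re1; first by apply: le_trans (dual_le1 _ f1) _.
  rewrite -subr_le0; apply: lim0 => n; have [_ _ hf] := Pxs n.
  have := hf f Ff; have : em n <= (2 ^+ n)^-1 by rewrite /em ge_min lexx orbT.
  have := Re_le_nm (f (xs n) - f a : C); rewrite ReB -dualB => h1 h2 h3.
  have := dual_le1 (xs n - a) f1; rewrite nm_distC; have := ha n.
  have := divr_ge0 (ltW d0) (ltW (p2 n)); lra.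
Qed.

(* Adding a small multiple of [f0 - psi] to the states keeps [psi] away from 1. *)
Theorem exact_element psi : tau1 psi = psi -> nm psi <= 1 -> ~ F psi ->
  exists a, [/\ tau a = a, nm a <= 1, forall f, F f -> f a = 1 :> C & psi a <> 1 :> C].
Proof.
move=> tpsi psi1 nF; have [f0 Ff0] := wcc_ne hF.
have e1 : nm e <= 1 := trip_le1 H He.
have epsi : complex.Re (e psi : C) < 1.
  rewrite lt_neqAle; apply/andP; split; last first.
    by apply: le_trans (Re_le_nm _) _; apply: le_trans (dual_le1 _ e1) psi1.
  apply/eqP => E; apply: nF; split=> //; split=> //; apply: nm1_Re1; last by rewrite E.
  by apply: le_trans (dual_le1 _ e1) psi1.
pose k := 1 - complex.Re (e psi : C); have k0 : 0 < k by rewrite subr_gt0.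
have k40 : 0 < k / 4 by rewrite divr_gt0.
have [ep ep0 hep] := exact_from k40.
(* With [c <= ep / 3] the values of [x0] on [F] are at least [1 - 3 c >= 1 - ep]. With [c <= k / 4]
   the value of [psi] at [x0] stays at least [3 k / 4] below 1, more than the [k / 4] lost in moving
   from [x0] to [a]. *)
pose c := Num.min (ep / 3) (Num.min (k / 4) 1).
have c0 : 0 < c by rewrite !lt_min ltr01 k40 divr_gt0.
have [c1 c2 c3] : [/\ c <= ep / 3, c <= k / 4 & c <= 1].
  by split; rewrite !ge_min lexx ?orbT.
pose g := c%:C *: (f0 - psi).
have eg : complex.Re (e g : C) = c * k.
  rewrite /g dualZ dualB ReMr ReB; have [[_ ->] _] := Ff0; by rewrite /k.
(* On the translate of [F] by [g], the element [e] has real part [1 + c k]; its norm being at most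
   1, this bounds every splitting from below, and [c^2] provides strictness. *)
have [||b [b1 _ b3]] := @three_constraints R X _ (wcc_translate g hF) 0 0 1 2 (1 + c * k - c ^+ 2) ltr01 (ltr0n _ 2).
- by rewrite subrr nm0; lra.
- move=> f f1 f2 /= Ff fE; rewrite !dual0 !add0r mul1r.
  have : complex.Re (e f1 : C) + complex.Re (e f2 : C) = 1 + c * k.
    rewrite -ReD -dualD -fE -[f](subrK g) dualD ReD eg; have [[_ ->] _] := Ff; by [].
  have h1 : complex.Re (e f1 : C) <= nm f1 by apply: le_trans (Re_le_nm _) _; exact: dual_le1.
  have h2 : complex.Re (e f2 : C) <= nm f2 by apply: le_trans (Re_le_nm _) _; exact: dual_le1.
  have := nm_ge0 f2; have : 0 < c ^+ 2 by rewrite exprn_gt0.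
  by move: h1 h2; lra.
rewrite subr0 in b1; pose x0 := real_part tau b.
have x01 : nm x0 <= 1 by exact: le_trans (real_part_nm _ _) b1.
have hb f : F f -> 1 + c * k - c ^+ 2 <= complex.Re (f x0 : C) + c * complex.Re (f0 x0 - psi x0 : C).
  move=> Ff; have := b3 (f + g); rewrite /mkset addrK => /(_ Ff); rewrite dualcD ReD.
  rewrite /g dualcZ ReMr dualcB !ReB /x0 !real_fun_eval //=; first by case: Ff0.
  by case: Ff.
have Fx f : F f -> complex.Re (f x0 : C) <= 1.
  by move=> [[f1 _] _]; apply: le_trans (Re_le_nm _) _; apply: le_trans (dual_le1 _ f1) x01.
have psix : - 1 <= complex.Re (psi x0 : C).
  have := Re_nm (psi x0 : C); rewrite ler_norml => /andP[h _].
  by have := le_trans (dual_le1 x0 psi1) x01; lra.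
have [||f Ff|a [ta a1 a2 a3]] := hep x0.
- exact: real_part_real.
- by [].
- have h1 := hb f Ff; have h2 := Fx f0 Ff0; rewrite ReB in h1.
  have : c * (complex.Re (f0 x0 : C) - complex.Re (psi x0 : C)) <= c * 2 by rewrite ler_pM2l //; lra.
  have : c ^+ 2 <= c by rewrite expr2 -[leRHS]mulr1 ler_pM2l.
  have : 0 <= c * k by rewrite mulr_ge0 // ltW.
  by lra.
exists a; split=> // psia.
have h1 := hb f0 Ff0; have h2 := Fx f0 Ff0; rewrite ReB in h1.
have h3 : c * (k - c) <= c * (complex.Re (f0 x0 : C) - complex.Re (psi x0 : C)).
  by rewrite mulrBr -expr2; lra.
rewrite ler_pM2l // in h3.
have h4 : complex.Re (psi a - psi x0 : C) <= k / 4.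
  by rewrite -dualB; apply: le_trans (Re_le_nm _) _; apply: le_trans (dual_le1 _ psi1) a2.
rewrite ReB psia /= in h4; clear psia; clearbody k; move: h3 h4 c2 k0 h2; clear; lra.
Qed.

End ExactElement.

(** * Spectral projections *)

Section SignPolynomials.
Context {R : realType}.
Local Notation half := ((2^-1)%:P : {poly R}).
Local Notation l := (2^-1 *: (1 + 'X) : {poly R}).

Lemma polyC_half : half * 2 = 1.
Proof. by rewrite -(rmorph_nat (@polyC R)) -rmorphM /= mulVf. Qed.

Lemma polyC_half2 : half ^+ 2 * 4 = 1.
Proof. by rewrite (_ : half ^+ 2 * 4 = (half * 2) ^+ 2); [rewrite polyC_half expr1n|ring]. Qed.

(** The certificate for [-c <= q <= c] wherever [-1 <= 'X <= 1]. *)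
Definition ibd (c : R) q := ipos l (c%:P - q) /\ ipos l (c%:P + q).

Lemma ibdM c c' q q' : ibd c q -> ibd c' q' -> ibd (c * c') (q * q').
Proof.
move=> [h1 h2] [h3 h4].
have hh : ipos l half by apply: iposC; rewrite invr_ge0.
split.
  have -> : (c * c')%:P - q * q' = half * ((c%:P - q) * (c'%:P + q') + (c%:P + q) * (c'%:P - q')).
    by rewrite rmorphM /= -[LHS]mul1r -polyC_half; ring.
  by apply: iposM => //; apply: iposD; apply: iposM.
have -> : (c * c')%:P + q * q' = half * ((c%:P - q) * (c'%:P - q') + (c%:P + q) * (c'%:P + q')).
  by rewrite rmorphM /= -[LHS]mul1r -polyC_half; ring.
by apply: iposM => //; apply: iposD; apply: iposM.
Qed.

Lemma ipos_sub (l1 l2 q : {poly R}) : ipos l1 l2 -> ipos l1 (1 - l2) -> ipos l2 q -> ipos l1 q.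
Proof.
move=> h1 h2 h F iF; apply: h; have [lF F0 _ _] := iF; split=> // g.
  exact: (iposM h1 (@ipos_sq _ l1 g) iF).
exact: (iposM h2 (@ipos_sq _ l1 g) iF).
Qed.

Lemma ibdX : ibd 1 'X.
Proof.
have E : l = half * (1 + 'X) by rewrite mul_polyC.
split.
  have -> : 1%:P - 'X = (1 - l) + (1 - l) :> {poly R}.
    rewrite E rmorph1 (_ : _ + (1 - _) = 2 - (half * 2) * (1 + 'X)); last by ring.
    by rewrite polyC_half; ring.
  by apply: iposD; exact: ipos_1l.
have e2 : l + l = 1%:P + 'X.
  rewrite E rmorph1 (_ : _ * _ + _ = (half * 2) * (1 + 'X)); last by ring.
  by rewrite polyC_half mul1r.
by have := iposD (@ipos_l _ l) (@ipos_l _ l); rewrite e2.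
Qed.

(* Newton's iteration for the sign function. *)
Definition sgnp n : {poly R} := iter n (fun y => half * y * (3 - y ^+ 2)) 'X.
Local Notation E n := (1 - sgnp n ^+ 2).

Lemma sgnpS n : sgnp n.+1 = half * sgnp n * (3 - sgnp n ^+ 2). Proof. by []. Qed.

Lemma sgnp_diff n : sgnp n.+1 - sgnp n = half * sgnp n * E n.
Proof.
rewrite (_ : sgnp n.+1 = half * sgnp n * E n + (half * 2) * sgnp n); last by rewrite sgnpS; ring.
by rewrite polyC_half mul1r addrK.
Qed.

Lemma sgnp_E n : E n.+1 = half ^+ 2 * (E n) ^+ 2 * (3 + E n).
Proof.
by rewrite sgnpS -[X in X - _]polyC_half2; ring.
Qed.

Let hh : ipos l half. Proof. by apply: iposC; rewrite invr_ge0. Qed.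

Let pos1 q : ipos l q -> ipos l (1 + q).
Proof. by move=> hq; apply: iposD => //; exact: ipos1. Qed.

Lemma sgnp_bd n : ibd 1 (sgnp n).
Proof.
elim: n => [|n [h1 h2]]; first exact: ibdX.
rewrite rmorph1 in h1 h2; split; rewrite rmorph1 sgnpS.
  have -> : 1 - half * sgnp n * (3 - sgnp n ^+ 2) = half * (1 - sgnp n) ^+ 2 * (1 + (1 + sgnp n)).
    by rewrite -{1}polyC_half; ring.
  by apply: iposM; [apply: iposM => //; exact: iposX|exact: pos1].
have -> : 1 + half * sgnp n * (3 - sgnp n ^+ 2) = half * (1 + sgnp n) ^+ 2 * (1 + (1 - sgnp n)).
  by rewrite -{1}polyC_half; ring.
by apply: iposM; [apply: iposM => //; exact: iposX|exact: pos1].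
Qed.

Lemma sgnp_E_ge0 n : ipos l (E n).
Proof.
have [h1 h2] := sgnp_bd n; rewrite rmorph1 in h1 h2.
by rewrite (_ : E n = (1 - sgnp n) * (1 + sgnp n)); [exact: iposM|ring].
Qed.

Lemma sgnp_E_bd n : ibd 1 (E n).
Proof.
split; rewrite rmorph1; last by apply: pos1; exact: sgnp_E_ge0.
by rewrite opprB addrCA subrr addr0; exact: ipos_sq.
Qed.

Lemma sgnp_X n : ipos l ('X * sgnp n).
Proof.
elim: n => [|n IH]; first by rewrite -expr2; exact: ipos_sq.
have -> : 'X * sgnp n.+1 = half * ('X * sgnp n) * (1 + (1 + E n)) by rewrite sgnpS; ring.
by apply: iposM; [exact: iposM|do 2 apply: pos1; exact: sgnp_E_ge0].
Qed.

(** The error satisfies [E_(n+1) = E_n^2 (3 + E_n) / 4 <= E_n^2], and [E_0 = 1 - 'X^2]. *)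
Lemma sgnp_E_pow n : ipos l ((1 - 'X ^+ 2) ^+ (2 ^ n) - E n).
Proof.
have X0 : ipos l (1 - 'X ^+ 2) by exact: (sgnp_E_ge0 0).
elim: n => [|n IH]; first by rewrite expr1 subrr; exact: ipos0.
have -> : (1 - 'X ^+ 2) ^+ (2 ^ n.+1) - E n.+1 =
  ((1 - 'X ^+ 2) ^+ (2 ^ n) - E n) * ((1 - 'X ^+ 2) ^+ (2 ^ n) + E n) + half ^+ 2 * (E n) ^+ 2 * (sgnp n) ^+ 2.
  rewrite sgnp_E expnSr exprM.
  have gen (x y : {poly R}) : x ^+ 2 - half ^+ 2 * (1 - y ^+ 2) ^+ 2 * (3 + (1 - y ^+ 2)) =
      (x - (1 - y ^+ 2)) * (x + (1 - y ^+ 2)) + half ^+ 2 * (1 - y ^+ 2) ^+ 2 * y ^+ 2.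
    have -> : (x - (1 - y ^+ 2)) * (x + (1 - y ^+ 2)) = x ^+ 2 - (half ^+ 2 * 4) * (1 - y ^+ 2) ^+ 2.
      by rewrite polyC_half2; ring.
    by ring.
  exact: gen.
have E0 := sgnp_E_ge0 n.
apply: iposD; last by apply: iposM; [apply: iposM; exact: iposX|exact: ipos_sq].
by apply: iposM => //; apply: iposD => //; exact: iposX.
Qed.

Lemma sgnp_XXE n : ibd (2 ^+ n)^-1 ('X ^+ 2 * E n).
Proof.
have p2 : 0 <= (2 ^+ n)^-1 :> R by rewrite invr_ge0 exprn_ge0.
split; last by apply: iposD; [exact: iposC|apply: iposM; [exact: ipos_sq|exact: sgnp_E_ge0]].
have X0 : ipos l (1 - 'X ^+ 2) by exact: (sgnp_E_ge0 0).
pose N := (2 ^ n)%N.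
have h1 : ipos l (1 - (N.+1)%:R *: ('X ^+ 2 * (1 - 'X ^+ 2) ^+ N)).
  by apply: (ipos_sub (l2 := 'X ^+ 2)) => //; [exact: ipos_sq|exact: ipos_xpow].
have h2 : ipos l ('X ^+ 2 * ((1 - 'X ^+ 2) ^+ N - E n)).
  by apply: iposM; [exact: ipos_sq|exact: sgnp_E_pow].
have h3 : ipos l ('X ^+ 2 * (1 - 'X ^+ 2) ^+ N) by apply: iposM; [exact: ipos_sq|exact: iposX].
have -> : (2 ^+ n)^-1%:P - 'X ^+ 2 * E n =
  (2 ^+ n)^-1 *: (1 - (N.+1)%:R *: ('X ^+ 2 * (1 - 'X ^+ 2) ^+ N)) + (2 ^+ n)^-1 *: ('X ^+ 2 * (1 - 'X ^+ 2) ^+ N)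
  + 'X ^+ 2 * ((1 - 'X ^+ 2) ^+ N - E n).
  set t := 'X ^+ 2 * (1 - 'X ^+ 2) ^+ N.
  have -> : 'X ^+ 2 * ((1 - 'X ^+ 2) ^+ N - E n) = t - 'X ^+ 2 * E n by rewrite mulrBr.
  have N1 : (2 ^+ n)^-1 * N%:R = 1 :> R by rewrite /N natrX mulVf ?expf_neq0.
  have e3 : N.+1%:R = N%:R + 1 :> R by rewrite natr1.
  have N2 : (2 ^+ n)^-1 * N.+1%:R = 1 + (2 ^+ n)^-1 :> R by rewrite e3 mulrDr N1 mulr1.
  by rewrite scalerBr scalerA N2 alg_polyC scalerDl scale1r; ring.
apply: iposD => //; apply: iposD; exact: iposZ.
Qed.

(** The square of ['X E] is at most ['X^2 E <= 2^(-n) <= (3/4)^(2n)], so [3/4] is a rational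
    substitute for the square root of [1/2]. The root is taken by
    [2 c (c - y) = (c - y)^2 + (c^2 - y^2)]. *)
Lemma sgnp_XE n : ibd ((3 / 4) ^+ n) ('X * E n).
Proof.
set c : R := (3 / 4) ^+ n; have c0 : 0 < c by rewrite exprn_gt0 // divr_gt0.
have [h1 _] := sgnp_XXE n; have h2 := sgnp_E_ge0 n; have [h3 _] := sgnp_E_bd n.
have cc : (2 ^+ n)^-1 <= c ^+ 2.
  rewrite /c -exprM mulnC exprM -exprVn lerXn2r ?nnegrE ?invr_ge0 ?exprn_ge0 ?divr_ge0 //; lra.
clearbody c.
have h4 : ipos l ('X ^+ 2 * E n * (1%:P - E n) + ((c ^+ 2 - (2 ^+ n)^-1)%:P + ((2 ^+ n)^-1%:P - 'X ^+ 2 * E n))).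
  apply: iposD; first by apply: iposM => //; apply: iposM => //; exact: ipos_sq.
  by apply: iposD => //; apply: iposC; rewrite subr_ge0.
have E1 : c%:P * (2 * c)^-1%:P *+ 2 = 1 :> {poly R}.
  by rewrite -rmorphM -rmorphMn /= (_ : _ *+ 2 = 1) ?rmorph1 // -mulr_natl; field; rewrite gt_eqF.
have i0 : ipos l (2 * c)^-1%:P by apply: iposC; rewrite invr_ge0 mulr_ge0 // ltW.
have key s : s ^+ 2 = 1 -> c%:P - s * ('X * E n) = (2 * c)^-1%:P * ((c%:P - s * ('X * E n)) ^+ 2 +
   ('X ^+ 2 * E n * (1%:P - E n) + ((c ^+ 2 - (2 ^+ n)^-1)%:P + ((2 ^+ n)^-1%:P - 'X ^+ 2 * E n)))) :> {poly R}.
  move=> s1; set w := E n; rewrite rmorph1 rmorphB /= rmorphXn /=.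
  have -> : (c%:P - s * ('X * w)) ^+ 2 = c%:P ^+ 2 - 2 * c%:P * (s * ('X * w)) + s ^+ 2 * ('X ^+ 2 * w ^+ 2) by ring.
  by rewrite s1 -[LHS]mul1r -{1}E1; ring.
split.
  rewrite -['X * E n]mul1r key ?expr1n //; apply: iposM => //; apply: iposD => //; exact: ipos_sq.
rewrite (_ : c%:P + _ = c%:P - (-1) * ('X * E n)); last by rewrite mulN1r opprK.
rewrite key ?sqrrN ?expr1n //; apply: iposM => //; apply: iposD => //; exact: ipos_sq.
Qed.

End SignPolynomials.

(** * Positive and negative parts of a self-adjoint element *)

Section SpectralSplit.
Context {R : realType}.
Local Notation C := (R[i]).
Variable Z : completeNormedModType C.
Variable tp : Z -> Z -> Z -> Z.
Hypothesis H : is_jbstar_triple tp.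
Variable e : Z.
Hypothesis He : tripotent tp e.
Local Notation pc := (pc tp e).
Variable Sig : dual Z -> Prop.
Hypothesis Sig_state : forall f, Sig f -> nm f <= 1 /\ f e = 1 :> C.
Hypothesis Sig_norming : forall k (eps : R), pc 1 k -> 0 <= eps ->
  (forall f, Sig f -> nm (f k : C) <= eps) -> nm k <= 4 * eps.
Variable k : Z.
Hypotheses (hk : pc 1 k) (Qk : tp e k e = k) (k1 : nm k <= 1).
Local Notation up := (pev (upow tp e k)).
Local Notation l := (2^-1 *: (1 + 'X) : {poly R}).

Let upe q : tp (up q) e e = up q.
Proof. by rewrite (tpC H); apply/(pc1P _ _ _); exact: (up_pc H He hk). Qed.

Lemma up_ipf f : Sig f -> ipf l (fun q => complex.Re (f (up q) : C)).
Proof.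
move=> /Sig_state[f1 fe]; have := unit_ipf H He hk Qk (state_dualpair H He f1 fe) k1.
rewrite (_ : (fun q => complex.Re (f (up q) : C)) = fun q => complex.Re (f (tp (up q) e e) : C)) //.
by apply/funext => q; rewrite upe.
Qed.

Lemma up_real f q : Sig f -> complex.Im (f (up q) : C) = 0.
Proof.
move=> /Sig_state[f1 fe]; rewrite -upe.
exact: (unit_real H He hk Qk (state_dualpair H He f1 fe)).
Qed.

Lemma up_ibd f c q : ibd c q -> Sig f -> nm (f (up q) : C) <= c.
Proof.
move=> [h1 h2] Sf; have iF := up_ipf Sf; have [lF _ _ _] := iF.
apply: le_trans (nm_le_ReIm _) _; rewrite up_real // normr0 addr0.
have [f1 fe] := Sig_state Sf.
have c1 : complex.Re (f (up c%:P) : C) = c.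
  by rewrite -[c%:P]mulr1 mul_polyC pevZ dualZ ReMr (up1 tp e k) fe mulr1.
have := h1 _ iF; have := h2 _ iF; rewrite (lfunD _ _ lF) (lfunB _ _ lF) c1 ler_norml => *.
by apply/andP; split; lra.
Qed.

Lemma up_norm c q : 0 <= c -> ibd c q -> nm (up q) <= 4 * c.
Proof.
move=> c0 h; apply: Sig_norming => //; first exact: (up_pc H He hk).
by move=> f; exact: up_ibd.
Qed.

(** Cubes of [q] satisfy the same certificate, so iterated cubing removes the factor 4 of
    [up_norm]. *)
Lemma up_norm1 q : ibd 1 q -> nm (up q) <= 1.
Proof.
move=> h; apply: (@cubes_bounded _ _ _ H _ 4) => j.
have [g -> hg] : exists2 g, cubes tp (up q) j = up g & ibd 1 g.
  elim: j => [|j [g hj hg]]; first by exists q.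
  exists (g * g * g); last by rewrite -(mulr1 1) -{1}(mulr1 1); do 2 apply: ibdM => //.
  rewrite /cubes iterS -/(cubes tp (up q) j) hj (up_tp H He hk Qk).
  by rewrite (up_mul H He hk Qk).
by rewrite -[4]mulr1; exact: up_norm.
Qed.

Local Notation r n := ((3 / 4) ^+ n : R).
Local Notation Y := (@sgnp R).
Local Notation E n := (1 - Y n ^+ 2).

Let r34 : 0 <= (3 / 4 : R) < 1. Proof. by apply/andP; split; lra. Qed.

Let rn0 n : 0 <= r n. Proof. by rewrite exprn_ge0 // divr_ge0. Qed.

Lemma up_XE n : nm (up ('X * E n)) <= 4 * r n.
Proof. by apply: up_norm => //; exact: sgnp_XE. Qed.

Let nm0_lim (x : Z) (K : R) : (forall n, nm x <= K * r n) -> x = 0.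
Proof.
move=> hx; apply: nm_eq0; apply/eqP; rewrite eq_le nm_ge0 andbT.
have K0 : 0 <= K by have := hx 0%N; rewrite expr0 mulr1; apply: le_trans; exact: nm_ge0.
apply: (@le_eps _ _ _ 1) => d d0; rewrite add0r mulr1.
have [n hn] := ratio_small K d0 r34.
exact: le_trans (hx n) (ltW hn).
Qed.

(* [a = |k|] is the norm limit of [k sgn(k)]. *)
Lemma up_abs : exists2 a, pc 1 a /\ tp e a e = a & forall n, nm (a - up ('X * Y n)) <= 8 * r n.
Proof.
have [n|||a ha] := @telescoping_cvg R Z (fun n => up ('X * Y n)) (fun n => 8 * r n).
- by rewrite mulr_ge0.
- move=> n; rewrite /= -pevB -mulrBr sgnp_diff.
  have -> : 'X * ((2^-1)%:P * Y n * E n) = 2^-1 *: ('X * E n * Y n) by rewrite -mul_polyC; ring.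
  rewrite pevZ nmZp ?invr_ge0 //.
  have := up_norm (rn0 n) (_ : ibd (r n) ('X * E n * Y n)).
  rewrite -{1}[r n]mulr1 => h; have {h} := h (ibdM (sgnp_XE n) (sgnp_bd n)).
  rewrite [r n.+1]exprS; lra.
- move=> d d0; exact: (ratio_small 8 d0 r34).
have fixed (S : Z -> Z) (K : R) : 0 <= K -> (forall x y, S (x - y) = S x - S y) ->
    (forall x, nm (S x) <= K * nm x) -> (forall p, S (up p) = up p) -> S a = a.
  move=> K0 SB SK Su; apply/eqP; rewrite -subr_eq0; apply/eqP.
  apply: (@nm0_lim _ ((K + 1) * 8)) => n.
  have -> : S a - a = S (a - up ('X * Y n)) - (a - up ('X * Y n)) by rewrite SB Su; vec.
  apply: le_trans (nmB _ _) _; have h := SK (a - up ('X * Y n)).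
  have := ler_wpM2l K0 (ha n); have := ha n; lra.
have [B B1 hB] := triple_bound H; have B0 : 0 <= B by lra.
have ee : nm e * nm e <= 1 by apply: mulr_ile1; rewrite ?nm_ge0 ?(trip_le1 H He).
exists a => //; split.
  apply/(pc1P _ _ _); apply: (fixed (tp e e) B) => // [x y|x|p]; first exact: tpBr.
    apply: le_trans (hB _ _ _) _; rewrite -(mulrA B) ler_wpM2r ?nm_ge0 // ler_piMr //.
  by apply/(pc1P _ _ _); exact: (up_pc H He hk).
apply: (fixed (fun x => tp e x e) B) => // [x y|x|p]; first exact: tpBm.
  apply: le_trans (hB _ _ _) _; rewrite mulrAC -(mulrA B) ler_wpM2r ?nm_ge0 // ler_piMr //.
exact: (up_Q H He hk Qk).
Qed.

(* The positive and negative parts of [k]. *)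
Lemma spectral_split : exists m1 m2, [/\ k = m1 - m2, pc 1 m1, pc 1 m2, tp e m2 e = m2 &
  [/\ forall w, tp m1 m2 w = 0, forall w, tp m2 m1 w = 0, nm (e - m1) <= 1 &
  forall f, Sig f -> 0 <= complex.Re (f m2 : C)]].
Proof.
have [a [pa Qa] ha] := up_abs.
have half : (2^-1)%:C = 2^-1 :> C by rewrite fmorphV rmorph_nat.
pose m1 := 2^-1%:C *: (a + k); pose m2 := 2^-1%:C *: (a - k).
pose u1 n := up (2^-1 *: ('X * Y n + 'X)); pose u2 n := up (2^-1 *: ('X * Y n - 'X)).
have h1 n : nm (m1 - u1 n) <= 4 * r n.
  have -> : m1 - u1 n = 2^-1%:C *: (a - up ('X * Y n)).
    by rewrite /u1 /m1 pevZ pevD (upX H hk); vec.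
  by rewrite nmZp ?invr_ge0 //; have := ha n; lra.
have h2 n : nm (m2 - u2 n) <= 4 * r n.
  have -> : m2 - u2 n = 2^-1%:C *: (a - up ('X * Y n)).
    by rewrite /u2 /m2 pevZ pevB (upX H hk); vec.
  by rewrite nmZp ?invr_ge0 //; have := ha n; lra.
have [B B1 hB] := triple_bound H; have B0 : 0 <= B by lra.
have r1 n : r n <= 1 by rewrite exprn_ile1 // ?divr_ge0 //; lra.
(* The approximants multiply to [- 'X^2 E / 4], which tends to 0 in norm. *)
have orth (x y : Z) (p q : nat -> {poly R}) w : (forall n, nm (x - up (p n)) <= 4 * r n) ->
    (forall n, nm (y - up (q n)) <= 4 * r n) ->
    (forall n, p n * q n = - ((2^-1 * 2^-1) *: ('X * ('X * E n)))) -> tp x y w = 0.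
  move=> hx hy pq.
  apply: (@nm0_lim _ ((B * 4 * (nm x + nm y + 4) + B * nm e) * nm w)) => n.
  have -> : tp x y w = tp (x - up (p n)) y w + tp (up (p n)) (y - up (q n)) w + tp (up (p n)) (up (q n)) w.
    by rewrite (tpBl H) (tpBm H); vec.
  have xb : nm (up (p n)) <= nm x + 4.
    have := nmB x (x - up (p n)); rewrite subKr; have := hx n; have := r1 n; lra.
  have t1 : nm (tp (x - up (p n)) y w) <= B * (4 * r n) * nm y * nm w.
    by apply: le_trans (hB _ _ _) _; rewrite ler_wpM2r ?ler_wpM2r ?ler_wpM2l //; nneg.
  have t2 : nm (tp (up (p n)) (y - up (q n)) w) <= B * (nm x + 4) * (4 * r n) * nm w.
    apply: le_trans (hB _ _ _) _; apply: ler_wpM2r; first exact: nm_ge0.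
    by apply: ler_pM; [by nneg|exact: nm_ge0|exact: ler_wpM2l|exact: hy].
  have t3 : nm (tp (up (p n)) (up (q n)) w) <= B * r n * nm e * nm w.
    rewrite (up_tp H He hk Qk) pq; apply: le_trans (hB _ _ _) _.
    rewrite ler_wpM2r ?ler_wpM2r ?ler_wpM2l //; try by nneg.
    rewrite pevN nmN pevZ nmZp ?mulr_ge0 ?invr_ge0 //.
    have : nm (up ('X * ('X * E n))) <= 4 * r n; last by lra.
    by apply: up_norm => //; rewrite -[r n]mul1r; apply: ibdM; [exact: ibdX|exact: sgnp_XE].
  apply: le_trans (nmD _ _) _; apply: le_trans (lerD (nmD _ _) (lexx _)) _; lra.
exists m1, m2; split.
- by rewrite /m1 /m2; vecf.
- by apply: pcZ => //; apply: pcD.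
- by apply: pcZ => //; apply: pcB.
- by rewrite /m2 (tpZRm H) (tpBm H) Qa Qk.
split.
- move=> w; apply: (orth _ _ _ _ w h1 h2) => n.
  by rewrite -scalerAl -scalerAr scalerA -scalerN; congr (_ *: _); ring.
- move=> w; apply: (orth _ _ _ _ w h2 h1) => n.
  by rewrite -scalerAl -scalerAr scalerA -scalerN; congr (_ *: _); ring.
- apply: (@le_eps _ _ _ 1) => d d0; rewrite mulr1.
  have [n hn] := ratio_small 8 d0 r34.
  (* It approximates the positive part of ['X] without becoming negative, which allows the sharp
     bound [up_norm1] for [1 - q]. *)
  pose q := 'X * Y n * (2^-1 *: (1 + Y n)).
  have hq : ibd 1 (1 - q).
    have [b1 b2] := sgnp_bd (R := R) n; rewrite rmorph1 in b1 b2.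
    have i2 : (0 : R) <= 2^-1 by rewrite invr_ge0.
    have [_ e1 e2] : [/\ True, 1 - 2^-1 *: (1 + Y n) = 2^-1 *: (1 - Y n) & 1 = 1 :> R].
      split=> //; rewrite -!mul_polyC -[X in X - _](@polyC_half R); ring.
    have p1 := iposZ i2 b2; have p2 := iposZ i2 b1.
    have [x1 _] := ibdM (@ibdX R) (sgnp_bd (R := R) n); rewrite mulr1 rmorph1 in x1.
    have q0 : ipos l q by apply: iposM => //; exact: sgnp_X.
    split; rewrite rmorph1; first by rewrite opprB addrCA subrr addr0.
    have -> : 1 + (1 - q) = 1 + ((1 - 'X * Y n) + 'X * Y n * (2^-1 *: (1 - Y n))).
      by rewrite -e1 /q; ring.
    apply: iposD; first exact: ipos1; apply: iposD => //; apply: iposM => //; exact: sgnp_X.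
  have := up_norm1 hq; rewrite pevB (up1 tp e k) => h.
  have qE : up q = 2^-1%:C *: (up ('X * Y n) + k - up ('X * E n)).
    have -> : q = 2^-1 *: ('X * Y n + 'X - 'X * E n) by rewrite /q -scalerAr; congr (_ *: _); ring.
    by rewrite pevZ pevB pevD (upX H hk).
  have -> : e - m1 = (e - up q) - 2^-1%:C *: ((a - up ('X * Y n)) + up ('X * E n)).
    by rewrite qE /m1; vec.
  apply: le_trans (nmB _ _) _; rewrite nmZp ?invr_ge0 //.
  have := nmD (a - up ('X * Y n)) (up ('X * E n)); have := ha n; have := up_XE n.
  have := rn0 n; lra.
move=> f Sf; have [f1 fe] := Sig_state Sf; rewrite /m2 dualZ ReMr; apply: mulr_ge0; first by rewrite invr_ge0.
apply: (@le_eps _ _ _ 1) => d d0; rewrite mulr1.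
have [n hn] := ratio_small 12 d0 r34.
have [b1 _] := sgnp_bd (R := R) n; rewrite rmorph1 in b1.
have {}h1 := iposM (@sgnp_X R n) b1 (up_ipf Sf).
have -> : a - k = (a - up ('X * Y n)) + up ('X * Y n * (1 - Y n)) - up ('X * E n).
  have -> : up ('X * Y n * (1 - Y n)) = up ('X * Y n) - k + up ('X * E n).
    have -> : 'X * Y n * (1 - Y n) = 'X * Y n - 'X + 'X * E n by ring.
    by rewrite pevD pevB (upX H hk).
  by vec.
rewrite dualB dualD ReB ReD.
have g1 := le_trans (Re_nm _) (le_trans (dual_le1 (a - up ('X * Y n)) f1) (ha n)).
have g2 := le_trans (Re_nm _) (le_trans (dual_le1 (up ('X * E n)) f1) (up_XE n)).
move: g1 g2; rewrite !ler_norml => /andP[g1 _] /andP[_ g2].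
lra.
Qed.

End SpectralSplit.

(** * Compression to a smaller tripotent *)

Section Subtripotent.
Context {R : realType}.
Local Notation C := (R[i]).
Variable Z : completeNormedModType C.
Variable tp : Z -> Z -> Z -> Z.
Hypothesis H : is_jbstar_triple tp.

Lemma P2D p x y : P2 tp p (x + y) = P2 tp p x + P2 tp p y.
Proof. by rewrite !(P2E H) linearD. Qed.

Lemma P2B p x y : P2 tp p (x - y) = P2 tp p x - P2 tp p y.
Proof. by rewrite !(P2E H) linearB. Qed.

Lemma P2Z p (a : C) x : P2 tp p (a *: x) = a *: P2 tp p x.
Proof. by rewrite !(P2E H) linearZ_LR. Qed.

Variables (e p : Z).
Hypotheses (He : tripotent tp e) (Hp : tripotent tp p) (pe : tripotent_le tp p e).
Local Notation q := (e - p).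
Local Notation D := (tp q q).

Let hq : pc tp p 0 q. Proof. exact: le_perp. Qed.
Let hp : pc tp p 1 p. Proof. exact: pc_e. Qed.

Lemma tp_pq w : tp p q w = 0. Proof. exact: (perp2 H Hp w hp hq). Qed.
Lemma tp_qp w : tp q p w = 0. Proof. exact: (perp1 H Hp w hp hq). Qed.

Lemma tp_sub h : tp h p e = tp p p h.
Proof. by rewrite -(subrK p e) (tpDr H) [tp h p (e - p)](tpC H) tp_qp add0r (tpC H). Qed.

Lemma P2_sub_e : P2 tp p e = p.
Proof. by rewrite -[e in LHS](subrK p) P2D (P2_id hp) (P2_0 H hq) add0r. Qed.

Lemma tp_sube h : tp h e p = tp p p h.
Proof.
have gen q' : e = q' + p -> tp p q' h = 0 -> tp h e p = tp p p h.
  by move=> -> h1; rewrite (tpDm H) (tpC H) h1 add0r (tpC H).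
by apply: gen (tp_pq h); rewrite subrK.
Qed.

Lemma tp_subq h : tp h q e = D h.
Proof. by rewrite -[X in tp h q X](subrK p e) (tpDr H) [tp h q p](tpC H) tp_pq addr0 (tpC H). Qed.

Lemma tp_split h : tp e e h = tp p p h + D h.
Proof.
have gen q' : e = q' + p -> tp p q' h = 0 -> tp q' p h = 0 -> tp e e h = tp p p h + tp q' q' h.
  by move=> -> h1 h2; rewrite (tpDl H) !(tpDm H) h1 h2 add0r addr0 addrC.
by apply: gen; [rewrite subrK|exact: tp_pq|exact: tp_qp].
Qed.

Lemma sub_q_e : tp q q e = q.
Proof. by rewrite -[X in tp q q X](subrK p e) (tpDr H) [tp q q p](tpC H) tp_pq addr0; case: pe. Qed.

(** On the fixed space of [L(e, e)] one has [L(p, p) = 1 - D], so [1 - P2] becomes a polynomial in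
    [D]. *)
Lemma P2_sub h : tp e e h = h -> h - P2 tp p h = 3 *: D h - 2 *: D (D h).
Proof.
move=> eh; have Lp z : tp p p z = tp e e z - D z by rewrite tp_split addrK.
have De : tp e e (D h) = D h.
  have qe : pc tp e 1 q.
    apply/(pc1P _ _ _); rewrite (tpBr H) He; congr (_ - _).
    exact: (le_qqp H Hp pe).
  by have := pc_rule H qe qe ((pc1P _ _ _).2 eh); rewrite subrr add0r => /(pc1P _ _ _).
have e2 : tp e e (h - D h) = h - D h by rewrite (tpBr H) eh De.
have e3 : D (h - D h) = D h - D (D h) by rewrite (tpBr H).
by rewrite P2def !Lp eh e2 e3; vec.
Qed.

Variable f : dual Z.
Hypotheses (f1 : nm f <= 1) (fe : f e = 1 :> C).

Let df : dualpair e f. Proof. exact: (state_dualpair H He f1 fe). Qed.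

(** On the Peirce-2 space of [p], a state of [e] acts like a state of [p] multiplied by [f p]; this
    is [unit_numrange] for [p] at the vector [e]. *)
Lemma state_unit_le h (c : R) : pc tp p 1 h -> nm h <= c -> nm (f h : C) <= c * complex.Re (f p : C).
Proof.
move=> hh hc; have c0 : 0 <= c by apply: le_trans hc; exact: nm_ge0.
have ppe : tp p p e = p by rewrite tp_sub Hp.
have [c0'|cn] := eqVneq c 0.
  have -> : h = 0 by apply: nm_eq0; apply/eqP; rewrite eq_le nm_ge0 -c0' hc.
  by rewrite dual0 nm0 c0' mul0r.
have cp : 0 < c by rewrite lt_neqAle eq_sym cn.
have ci : 0 <= c^-1 by rewrite invr_ge0.
have := unit_numrange H Hp df (pcZ H (c^-1)%:C hh) (_ : nm ((c^-1)%:C *: h) <= 1).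
rewrite nmZp // ler_pdivrMl // mulr1 => /(_ hc).
rewrite tp_sub ppe (tpZr H) ((pc1P _ _ _).1 hh) dualZ nmM nmRp //.
by rewrite ler_pdivrMl.
Qed.

Lemma state_sub_real : f p = (complex.Re (f p : C))%:C :> C.
Proof.
have ppe : tp p p e = p by rewrite tp_sub Hp.
by rewrite -{1 2}ppe; exact: (L_formE H df p).
Qed.

(** Cauchy-Schwarz for the form of [f] at [e]: [D h = {h, q, e}], and [f {q, q, e} = f q] is the
    defect [1 - f p]. *)
Lemma state_D (B : R) h : (forall x y z, nm (tp x y z) <= B * nm x * nm y * nm z) -> 0 <= B ->
  nm (f (D h) : C) ^+ 2 <= B * nm h ^+ 2 * (1 - complex.Re (f p : C)).
Proof.
move=> hB B0; have := L_CS H df h q; rewrite tp_subq sub_q_e dualB fe ReB /= => /le_trans; apply.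
apply: ler_wpM2r.
  by rewrite subr_ge0; apply: le_trans (Re_le_nm _) _; apply: le_trans (dual_le1 _ f1) _; exact: (trip_le1 H).
apply: le_trans (Re_le_nm _) _; apply: le_trans (dual_le1 _ f1) _; apply: le_trans (hB _ _ _) _.
by rewrite -!mulrA ler_wpM2l // expr2 ler_wpM2l ?nm_ge0 // ler_piMr ?nm_ge0 // (trip_le1 H).
Qed.

(** [P2_sub] and [state_D], combined by [(3 x + 2 y)^2 <= 18 x^2 + 8 y^2]. *)
Lemma state_P2_close (B : R) h : (forall x y z, nm (tp x y z) <= B * nm x * nm y * nm z) -> 0 <= B ->
  tp e e h = h ->
  nm (f h - f (P2 tp p h) : C) ^+ 2 <= (18 * B + 8 * B ^+ 3) * nm h ^+ 2 * (1 - complex.Re (f p : C)).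
Proof.
move=> hB B0 eh; rewrite -dualB P2_sub // dualB !dualZ.
set x := f (D h); set y := f (D (D h)).
have hx := state_D h hB B0; have hy := state_D (D h) hB B0; rewrite -/x -/y in hx hy.
have p1 : 0 <= 1 - complex.Re (f p : C).
  by rewrite subr_ge0; apply: le_trans (Re_le_nm _) _; apply: le_trans (dual_le1 _ f1) _; exact: (trip_le1 H).
have Dh : nm (D h) ^+ 2 <= (B * nm h) ^+ 2.
  rewrite lerXn2r ?nnegrE ?nm_ge0 ?mulr_ge0 ?nm_ge0 //; apply: le_trans (hB _ _ _) _.
  have q1 : nm q <= 1 by apply: (trip_le1 H); case: pe.
  apply: ler_wpM2r; first exact: nm_ge0.
  by rewrite -mulrA ler_piMr // mulr_ile1 // nm_ge0.
have xy : nm (3 * x - 2 * y) <= 3 * nm x + 2 * nm y.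
  by apply: le_trans (nmB _ _) _; rewrite !nmM -!(rmorph_nat (real_complex R)) !nmRp.
have xy2 : nm (3 * x - 2 * y) ^+ 2 <= (3 * nm x + 2 * nm y) ^+ 2.
  by rewrite lerXn2r ?nnegrE ?nm_ge0 // addr_ge0 // mulr_ge0 ?nm_ge0.
have hy' : nm y ^+ 2 <= B ^+ 3 * nm h ^+ 2 * (1 - complex.Re (f p : C)).
  apply: le_trans hy _; apply: ler_wpM2r => //.
  by rewrite (_ : B ^+ 3 * _ = B * (B * nm h) ^+ 2); [exact: ler_wpM2l|ring].
have := sqr_ge0 (3 * nm x - 2 * nm y); move: xy2 hx hy'.
lra.
Qed.

End Subtripotent.

Section SpectralProjection.
Context {R : realType}.
Local Notation C := (R[i]).
Variable Y : normedModType C.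
Local Notation W := (dual Y).
Variable tp : W -> W -> W -> W.
Hypothesis H : is_jbstar_triple tp.
Hypothesis wc1 : forall b c, wcont (fun x => tp x b c).
Hypothesis wc2 : forall a c, wcont (fun x => tp a x c).
Variable e : W.
Hypothesis He : tripotent tp e.

(* [p] is the spectral projection of [e - s] for the interval [0, th]. *)
Lemma spectral_projection (s : W) (th : R) : pc tp e 1 s -> tp e s e = s -> nm s <= 1 -> 0 < th < 1 ->
  exists p, [/\ tripotent tp p, tripotent_le tp p e,
   forall f : dual W, nstates e f ->
     th * (1 - complex.Re (f p : C)) <= 1 - complex.Re (f s : C) &
   forall f : dual W, nstates e f ->
     complex.Re (f (P2 tp p (e - s)) : C) <= th * complex.Re (f p : C)].
Proof.
move=> hs Qs s1 /andP[th0 th1].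
(* Twice [k] is [(e - s) - th e]; its sign tells on which side of the threshold [e - s] lies, and
   the factor [1/2] makes [k] a contraction. *)
pose k := 2^-1%:C *: ((1 - th)%:C *: e - s).
have e1 := trip_le1 H He.
have hk : pc tp e 1 k by apply: pcZ => //; apply: pcB => //; apply: pcZ => //; exact: pc_e.
have Qk : tp e k e = k by rewrite /k (tpZRm H) (tpBm H) (tpZRm H) He Qs.
have k1 : nm k <= 1.
  rewrite nmZp ?invr_ge0 //; have := nmB ((1 - th)%:C *: e) s.
  rewrite nmZp; last by lra.
  have : (1 - th) * nm e <= 1 - th by rewrite ler_piMr //; lra.
  lra.
have [m1 [m2 [kE hm1 hm2 Qm2 [perp12 perp21 em1 m2pos]]]] :=
  spectral_split H He (@nstates_state _ _ e) (nstates_norming H wc1 He) hk Qk k1.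
(* In the commutative picture [v] is 1 exactly where the positive part [m1] of [k] vanishes, that is
   where [e - s] is at most [th]; its support tripotent is the desired projection. *)
pose v := e - 2^-1%:C *: m1.
have v1 : nm v <= 1.
  have -> : v = 2^-1%:C *: (e + (e - m1)) by rewrite /v; vecf.
  by rewrite nmZp ?invr_ge0 //; have := nmD e (e - m1); lra.
have [p [wp Hp hvp p1]] := support_exists H wc1 wc2 v1.
exists p.
have pe : tripotent_le tp p e.
  apply: (nstate_le H wc1 Hp He) => phi [phi1 pphi].
  have vphi : v phi = 1 :> C by exact: (support_face H v1 wp Hp hvp phi1).2.
  apply: nm1_Re1; first by apply: le_trans (dual_le1 _ e1) phi1.
  have h1 := le_trans (Re_le_nm _) (le_trans (dual_le1 phi em1) phi1).
  have : complex.Re (v phi : C) = 1 by rewrite vphi.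
  by rewrite /v dualcB dualcZ ReB ReMr; rewrite dualcB ReB in h1; lra.
have hm1p : pc tp p 0 m1.
  have -> : m1 = 2%:C *: ((e - p) - (v - p)).
    by rewrite /v (rmorph_nat (real_complex R)); vecf.
  by apply: pcZ => //; apply: pcB => //; exact: le_perp.
have m2e : tp m2 e e = m2 by rewrite (tpC H); apply/(pc1P _ _ _).
have m2v w : tp m2 v w = tp m2 e w by rewrite /v (tpBm H) (tpZRm H) perp21 scaler0 subr0.
have vm2 w : tp v m2 w = tp m2 e w.
  by rewrite /v (tpBl H) (tpZl H) perp12 scaler0 subr0 -(unit_flip H He _ hm2) Qm2.
have m2pw n : tp m2 e (odd_power tp v n) = m2.
  have m2v0 : tp m2 e v = m2 by rewrite -[X in tp X e v]Qm2 (unit_flip H He v hm2) (tpC H) vm2.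
  elim: n => [//|n IH]; rewrite pwS (jordan H) IH m2v0 m2v.
  have -> : tp e m2 v = m2 by rewrite -(unit_flip H He _ hm2) Qm2.
  by rewrite vm2 subrr add0r (tpC H v v) m2v.
have hm2p : pc tp p 1 m2.
  apply/(pc1P _ _ _); rewrite -(tp_sube H Hp pe).
  exact: (wtends_closed_eq _ (wcontr H wc1 m2 e) wp (filterE _ m2pw)).
have Pp := P2_sub_e H Hp pe.
have esE : e - s = th%:C *: e + 2 *: (m1 - m2) by rewrite -kE /k rmorphB; vecf.
have Pes : P2 tp p (e - s) = th%:C *: p - 2 *: m2.
  by rewrite esE (P2D H) !(P2Z H) (P2B H) Pp (P2_id hm2p) (P2_0 H hm1p) sub0r scalerN.
have Ps : P2 tp p s = p - (th%:C *: p - 2 *: m2).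
  by rewrite -Pes (P2B H) Pp subKr.
have two (z : C) : complex.Re (2 * z) = 2 * complex.Re z.
  by rewrite -(rmorph_nat (real_complex R)) ReMr.
split=> // f Sf; have [f1 fe] := nstates_state Sf; last first.
  by rewrite Pes dualB !dualZ ReB ReMr two; have := m2pos f Sf; lra.
have h1 : complex.Re (f (P2 tp p s) : C) <= 1 * complex.Re (f p : C).
  apply: le_trans (Re_le_nm _) _; apply: (state_unit_le H He Hp pe f1 fe); first exact: pc_P2.
  by apply: le_trans (P2_contr H Hp s) s1.
have h2 : complex.Re (f (e - m1) : C) <= 1.
  by apply: le_trans (Re_le_nm _) _; apply: le_trans (dual_le1 _ f1) em1.
have : complex.Re (f (e - s) : C) = th + 2 * (complex.Re (f m1 : C) - complex.Re (f m2 : C)).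
  by rewrite esE dualD !dualZ ReD ReMr two fe dualB ReB mulr1.
move: h1 h2; rewrite Ps !dualB !dualZ !ReB ReMr two fe /=; lra.
Qed.

End SpectralProjection.

Lemma real_part_self (R : realType) (V : normedModType R[i]) (tau : conjugation V) x :
  tau x = x -> real_part tau x = x.
Proof. by move=> tx; rewrite /real_part tx; vecf. Qed.

Lemma real_partD (R : realType) (V : normedModType R[i]) (tau : conjugation V) x y :
  real_part tau (x + y) = real_part tau x + real_part tau y.
Proof. by rewrite /real_part tauD; vec. Qed.

Lemma wtends_nm_le (R : realType) (V : normedModType R[i]) (I : Type) (U : set_system I)
  (w : I -> dual V) l (M : R) : UltraFilter U -> 0 <= M -> U [set i | nm (w i) <= M] ->
  wtends U w l -> nm l <= M.
Proof.
move=> uU M0 UM wl; have pU := @ultra_proper _ _ uU.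
by have [l' l'M wl'] := ultra_wtends_on uU M0 UM (fun i h => h); rewrite (wtends_uniq pU wl wl').
Qed.

(** * Weak*-closed faces *)

Section Penalty.
Context {R : realType}.
Local Notation C := (R[i]).
Variable X : completeNormedModType C.
Local Notation Y := (dual X).
Variable tau : conjugation X.
Local Notation tau1 := (sharp tau).
Variable F : set Y.
Hypotheses (hF : wcompact_convex F) (FR : forall f, F f -> tau1 f = f) (F1 : forall f, F f -> nm f = 1).
Hypothesis face : forall f g (t : R), tau1 f = f -> nm f <= 1 -> tau1 g = g -> nm g <= 1 -> 0 < t -> t < 1 ->
  F (t%:C *: f + (1 - t)%:C *: g) -> F f /\ F g.
Variables (x : X) (al : R).
Hypotheses (tx : tau x = x) (Fal : forall f, F f -> complex.Re (f x : C) <= al).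

(** As [f] has norm 1, the norms of the real parts of [f1] and [f2] are forced to be [a] and [b]
    with [a + b = 1]; after normalisation the face property puts both into [F]. *)
Lemma face_decomposition f f1 f2 a b : F f -> f = f1 + f2 -> nm f1 <= a -> nm f2 <= b -> a + b <= 1 ->
  complex.Re (f2 x : C) <= al * b.
Proof.
move=> Ff fE f1a f2b ab.
pose g1 := real_part tau1 f1; pose g2 := real_part tau1 f2.
have gE : f = g1 + g2 by rewrite -real_partD -fE real_part_self ?FR.
have g1a : nm g1 <= a by apply: le_trans (real_part_nm _ _) f1a.
have g2b : nm g2 <= b by apply: le_trans (real_part_nm _ _) f2b.
have g2x : complex.Re (f2 x : C) = complex.Re (g2 x : C).
  by have := real_part_eval f2 (ev_real tx); rewrite !evE => ->.
have := nmD g1 g2; rewrite -gE (F1 Ff) => h1; have n1 := nm_ge0 g1; have n2 := nm_ge0 g2.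
rewrite g2x; have [b0|bn] := eqVneq b 0.
  have -> : g2 = 0 by apply: nm_eq0; lra.
  by rewrite dualc0 b0 mulr0.
have [a0|an] := eqVneq a 0.
  have g10 : g1 = 0 by apply: nm_eq0; lra.
  have b1 : b = 1 by lra.
  by rewrite b1 mulr1 -[g2]add0r -g10 -gE; exact: Fal.
have ap : 0 < a by rewrite lt_neqAle eq_sym an; lra.
have bp : 0 < b by rewrite lt_neqAle eq_sym bn; lra.
have aE : 1 - a = b by lra.
have [|||||||_ Fg2] := @face (a^-1%:C *: g1) (b^-1%:C *: g2) a.
- by rewrite tauZR real_part_real.
- by rewrite nmZp ?invr_ge0 ?(ltW ap) // ler_pdivrMl // mulr1.
- by rewrite tauZR real_part_real.
- by rewrite nmZp ?invr_ge0 ?(ltW bp) // ler_pdivrMl // mulr1.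
- by [].
- lra.
- have sc (t : R) (g : Y) : t != 0 -> t%:C *: (t^-1%:C *: g) = g.
    by move=> t0; rewrite scalerA -rmorphM mulfV // scale1r.
  by rewrite aE !sc // -gE.
by have := Fal Fg2; rewrite dualcZ ReMr ler_pdivrMl // mulrC.
Qed.

Lemma penalty (eta : R) : 0 < eta -> exists la : R, [/\ 1 <= la, 0 < la + al, nm x < la + (la + al) &
  forall f f1 f2, F f -> f = f1 + f2 ->
    la - eta < la * nm f1 + ((la + al) * nm f2 - complex.Re (f2 x : C))].
Proof.
move=> eta0; pose K := nm x + `|al|; have K0 : 0 <= K by rewrite addr_ge0 // nm_ge0.
(* The constant [1 + 2 K] secures the side conditions on [la] and keeps all splittings bounded by
   2. *)
pose la (n : nat) : R := n%:R + (1 + 2 * K).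
have al1 := ler_norm al; have al2 := ler_norm (- al); rewrite normrN in al2.
have laK n : 1 + 2 * K <= la n by rewrite lerDr.
have nx := nm_ge0 x.
apply: contrapT => no.
have [p hp] : exists p : nat -> Y * Y * Y, forall n, [/\ F (p n).1.1, (p n).1.1 = (p n).1.2 + (p n).2 &
   la n * nm (p n).1.2 + ((la n + al) * nm (p n).2 - complex.Re ((p n).2 x : C)) <= la n - eta].
  suff h0 n : exists p : Y * Y * Y, [/\ F p.1.1, p.1.1 = p.1.2 + p.2 &
   la n * nm p.1.2 + ((la n + al) * nm p.2 - complex.Re (p.2 x : C)) <= la n - eta].
    by have [p hp] := choice h0; exists p.
  apply: contrapT => none; apply: no; exists (la n); have := laK n.
  rewrite /K => h; split; try lra.
  move=> f f1 f2 Ff fE; rewrite ltNge; apply/negP => h'; apply: none; by exists (f, f1, f2).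
pose a n := nm (p n).1.2; pose b n := nm (p n).2.
have a0 n : 0 <= a n := nm_ge0 _.
have b0 n : 0 <= b n := nm_ge0 _.
have ab1 n : 1 <= a n + b n by have [Ff fE _] := hp n; rewrite -(F1 Ff) {1}fE; exact: nmD.
have rx n : complex.Re ((p n).2 x : C) <= b n * nm x by apply: le_trans (Re_le_nm _) (dual_le _ _).
have alb n : al * b n - complex.Re ((p n).2 x : C) <= - eta.
  have [_ _ h] := hp n; rewrite -/(a n) -/(b n) in h.
  have : la n * 1 <= la n * (a n + b n) by apply: ler_wpM2l => //; have := laK n; lra.
  lra.
(* The excess of [|f1| + |f2|] over 1, multiplied by [la n], stays bounded, so the excess vanishes
   in the limit. *)
have up n : la n * (a n + b n - 1) <= K * b n.
  have [_ _ h] := hp n; rewrite -/(a n) -/(b n) in h; have := rx n.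
  have : - al * b n <= `|al| * b n by apply: ler_wpM2r.
  rewrite /K; lra.
have ab2 n : a n + b n <= 2.
  rewrite leNgt; apply/negP => h.
  have h1 : K * b n <= K * (a n + b n) by apply: ler_wpM2l => //; have := a0 n; lra.
  have : (1 + 2 * K) * (a n + b n - 1) <= la n * (a n + b n - 1).
    by apply: ler_wpM2r; [have := ab1 n; lra|exact: laK].
  have := up n; have : 0 <= K * (a n + b n - 2) by apply: mulr_ge0 => //; lra.
  lra.
have [U [uU lU]] := ultraFilterLemma eventually_filter.
have pU := @ultra_proper _ _ uU.
have K2 : 0 <= 2 :> R by [].
have [f _ wf] : exists2 l, nm l <= 1 & wtends U (fun n => (p n).1.1) l.
  by apply: (ultra_wtends uU ler01) => n; have [Ff _ _] := hp n; rewrite (F1 Ff).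
have Ff : F f by apply: (wcc_lim hF uU _ wf); apply: filterE => n; case: (hp n).
have [f1 _ wf1] : exists2 l, nm l <= 2 & wtends U (fun n => (p n).1.2) l.
  by apply: (ultra_wtends uU K2) => n; have := ab2 n; have := b0 n; rewrite /a; lra.
have [f2 _ wf2] : exists2 l, nm l <= 2 & wtends U (fun n => (p n).2) l.
  by apply: (ultra_wtends uU K2) => n; have := ab2 n; have := a0 n; rewrite /b; lra.
have fE : f = f1 + f2.
  apply: (wtends_uniq pU wf) => v; rewrite dualcD.
  apply: (tends_ext pU _ (tendsD pU (wf1 v) (wf2 v))); apply: filterE => n.
  by have [_ E _] := hp n; rewrite /mkset E dualcD.
have [ta hta] : exists l, forall e, 0 < e -> U [set i | `|a i - l| < e].
  by apply: (ultra_real (M := 2) uU) => n; rewrite ger0_norm //; have := ab2 n; have := b0 n; lra.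
have [tb htb] : exists l, forall e, 0 < e -> U [set i | `|b i - l| < e].
  by apply: (ultra_real (M := 2) uU) => n; rewrite ger0_norm //; have := ab2 n; have := a0 n; lra.
have lim_nm (c : nat -> R) tc (w : nat -> Y) l : (forall n, nm (w n) = c n) ->
    (forall e, 0 < e -> U [set i | `|c i - tc| < e]) -> wtends U w l -> nm l <= tc.
  move=> wc hc wl; apply: (@le_eps _ _ _ 1) => e e0; rewrite mulr1.
  have Un : U [set i | nm (w i) <= tc + e].
    by apply: filterS (hc e e0) => i /=; rewrite wc ltr_norml => /andP[h1 h2]; lra.
  have [i /= hi] := filter_ex Un.
  by apply: (wtends_nm_le uU _ Un wl); apply: le_trans hi; exact: nm_ge0.
have f1a := lim_nm a ta _ _ (fun=> erefl) hta wf1.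
have f2b := lim_nm b tb _ _ (fun=> erefl) htb wf2.
have tab : ta + tb <= 1.
  apply: (@le_eps _ _ _ 3) => e e0; have [N _ hN] := archi_lt (2 * K / e).
  have UN : U [set i | (N <= i)%N] by apply: lU; exists N.
  have [n [[/= h1 h2] h3]] := filter_ex (filterI (filterI (hta e e0) (htb e e0)) UN).
  move: h1 h2; rewrite !ltr_norml => /andP[h1 _] /andP[h2 _].
  have : a n + b n - 1 <= e; last by lra.
  have lan : 0 < la n by have := laK n; lra.
  rewrite -(ler_pM2l lan); apply: le_trans (up n) _.
  have : K * b n <= K * 2 by apply: ler_wpM2l => //; have := ab2 n; have := a0 n; lra.
  have : 2 * K <= n%:R * e.
    by rewrite -ler_pdivrMr //; apply: le_trans (ltW hN) _; rewrite ler_nat.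
  have : 0 <= (1 + 2 * K) * e by rewrite mulr_ge0 // ?ltW //; lra.
  rewrite /la; lra.
have := face_decomposition Ff fE f1a f2b tab.
have : al * tb - complex.Re (f2 x : C) <= - eta; last by lra.
apply: (@le_eps _ _ _ (`|al| + 1)) => e e0.
have [n [/= h1 h2]] := filter_ex (filterI (htb e e0) (wf2 x e e0)).
have := alb n; have := Re_nm ((p n).2 x - f2 x : C); rewrite ReB ler_norml => /andP[h3 h4].
have : al * (tb - b n) <= `|al| * e.
  apply: le_trans (ler_norm _) _; rewrite normrM distrC ler_wpM2l //; exact: ltW.
lra.
Qed.

Lemma penalty_element (eta : R) : 0 < eta -> exists la : R, exists b : X,
  [/\ 1 <= la, nm b <= la, nm (b + x) <= la + al &
   forall f, F f -> la - eta <= complex.Re (f b : C)].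
Proof.
move=> eta0; have [la [la1 laal nx gap]] := penalty eta0; have la0 : 0 < la by lra.
have [||b [b1 b2 Fb]] := @three_constraints R X F hF 0 (- x) la (la + al) (la - eta) la0 laal.
- by rewrite sub0r opprK.
- move=> f f1 f2 Ff fE; have := gap f f1 f2 Ff fE; rewrite dual0 dualN ReN /=; lra.
by exists la, b; rewrite subr0 in b1; rewrite opprK in b2.
Qed.

End Penalty.

(** * Separation of functionals from a face by the bidual *)

Section BidualExposed.
Context {R : realType}.
Local Notation C := (R[i]).
Variable X : completeNormedModType C.
Local Notation Y := (dual X).
Local Notation W := (dual Y).
Variable tp : W -> W -> W -> W.
Hypothesis H : is_jbstar_triple tp.
Hypothesis wc1 : forall b c, wcont (fun x => tp x b c).
Hypothesis wc2 : forall a c, wcont (fun x => tp a x c).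
Variable tau : conjugation X.
Local Notation tau1 := (sharp tau).
Local Notation tau2 := (sharp tau1).
Local Notation ev := (@canonical_embedding R X).
Variable F : set Y.
Hypotheses (hF : wcompact_convex F) (FR : forall f, F f -> tau1 f = f) (F1 : forall f, F f -> nm f = 1).
Hypothesis face : forall f g (t : R), tau1 f = f -> nm f <= 1 -> tau1 g = g -> nm g <= 1 -> 0 < t -> t < 1 ->
  F (t%:C *: f + (1 - t)%:C *: g) -> F f /\ F g.

Section OneTripotent.
Variables (e : W) (He : tripotent tp e) (psi : Y) (x : X) (al : R).
Hypotheses (Fe : forall f, F f -> e f = 1 :> C) (psi1 : nm psi <= 1) (epsi : e psi = 1 :> C).
Hypotheses (tx : tau x = x) (Fal : forall f, F f -> complex.Re (f x : C) <= al).

Lemma state_unit_re (f : dual W) (z : W) : nm f <= 1 -> f e = 1 :> C ->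
  f (2^-1%:C *: (P2 tp e z + tp e (P2 tp e z) e)) = (complex.Re (f z : C))%:C :> C.
Proof.
move=> f1 fe; have df := state_dualpair H He f1 fe.
have fz := state_P2 H He f1 fe z.
have Pe : tp (P2 tp e z) e e = P2 tp e z.
  by rewrite (tpC H); apply/(pc1P _ _ _); exact: (pc_P2 H He).
have := L_form_sym H df (P2 tp e z) e; rewrite Pe fz => h.
rewrite dualZ dualD fz h; case: (f z : C) => c d /=.
by apply/eqP; rewrite eq_complex /=; apply/andP; split; apply/eqP; field.
Qed.

Lemma approx_projection (eta : R) : 0 < eta -> exists p, [/\ tripotent tp p, tripotent_le tp p e,
  forall f, F f -> 1 - eta <= complex.Re (p f : C) &
  0 < complex.Re (p psi : C) ->
  complex.Re (P2 tp p (P2 tp e (ev x)) psi : C) <= complex.Re (p psi : C) * (al + 4^-1)].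
Proof.
move=> eta0; have eta4 : 0 < eta / 4 by rewrite divr_gt0.
have [la [b [la1 b1 b2 Fb]]] := penalty_element hF FR F1 face tx Fal eta4.
have la0 : 0 < la by lra.
have li : 0 <= la^-1 by rewrite invr_ge0 ltW.
pose z : W := la^-1%:C *: ev b.
have z1 : nm z <= 1.
  rewrite nmZp // ler_pdivrMl // mulr1; apply: le_trans b1; exact: nm_ev.
pose s := 2^-1%:C *: (P2 tp e z + tp e (P2 tp e z) e).
have hPz := pc_P2 H He z.
have hs : pc tp e 1 s by apply: pcZ => //; apply: pcD => //; exact: pc_Q.
have Qs : tp e s e = s by rewrite /s (tpZRm H) (tpDm H) (QQ_id H He hPz) addrC.
have Pz1 : nm (P2 tp e z) <= 1 by apply: le_trans (P2_contr H He z) z1.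
have s1 : nm s <= 1.
  rewrite nmZp ?invr_ge0 // ler_pdivrMl // mulr1; apply: le_trans (nmD _ _) _.
  by have := Q_contr H He hPz Pz1; lra.
(* Scaled back by [la], this threshold costs [1/4], the constant of the last clause; together with
   the accuracy [eta / 4] of [b] it gives [1 - eta] on [F]. *)
have th01 : 0 < (4 * la)^-1 < 1.
  rewrite invr_gt0 mulr_gt0 //= invf_lt1 ?mulr_gt0 //; lra.
have [p [Hp pe ps1 ps2]] := spectral_projection H wc1 wc2 He hs Qs s1 th01.
have st f : nm f <= 1 -> e f = 1 :> C -> nstates e (canonical_embedding f).
  by move=> f1 ef; exists f.
have sE f : nm f <= 1 -> e f = 1 :> C -> complex.Re (s f : C) = la^-1 * complex.Re (f b : C).
  move=> f1 ef; have [g1 ge] := nstates_state (st f f1 ef).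
  have := state_unit_re z g1 ge; rewrite !evE -/s => ->.
  by rewrite -[LHS]/(complex.Re (z f : C)) /z dualcZ ReMr.
exists p; split=> // [f Ff|ppsi].
  have f1 : nm f <= 1 by rewrite (F1 Ff).
  have := ps1 _ (st f f1 (Fe Ff)); rewrite !evE (sE f f1 (Fe Ff)) invfM -mulrA.
  have := ler_wpM2l li (Fb f Ff); rewrite mulrBr mulVf ?gt_eqF // => h1 h2.
  have : la^-1 * (4^-1 * (1 - complex.Re (p f : C))) <= la^-1 * (eta / 4) by move: h1 h2; rewrite [4^-1 * (la^-1 * _)]mulrCA; lra.
  by rewrite ler_pM2l ?invr_gt0 //; lra.
have [g1 ge] := nstates_state (st psi psi1 epsi).
set kap := complex.Re (p psi : C) in ppsi *.
have kn : kap != 0 by rewrite gt_eqF.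
have Pc h : nm (P2 tp p h psi : C) <= nm h * kap.
  have := state_unit_le H He Hp pe g1 ge (pc_P2 H Hp h) (P2_contr H Hp h).
  by rewrite !evE.
have ki : 0 <= kap^-1 by rewrite invr_ge0 ltW.
(* The compression of [psi] to [p], normalised to be a state of [e]; at it [b] is at least
   [la - 1/4], which leaves at most [al + 1/4] for [x]. *)
have rho_lin a h h' : kap^-1%:C * (P2 tp p (a *: h + h') psi : C) =
    a * (kap^-1%:C * (P2 tp p h psi : C)) + kap^-1%:C * (P2 tp p h' psi : C).
  by rewrite (P2D H) (P2Z H) dualcD dualcZ; ring.
have rho_le h : nm (kap^-1%:C * (P2 tp p h psi : C)) <= 1 * nm h.
  by rewrite nmM nmRp // mul1r ler_pdivrMl // mulrC.
pose rho : dual W := dualmk rho_lin ler01 rho_le.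
have rhoE h : rho h = kap^-1%:C * (P2 tp p h psi : C) :> C by [].
have rhoK h : complex.Re (P2 tp p h psi : C) = kap * complex.Re (rho h : C).
  by rewrite rhoE ReMr mulrA mulfV // mul1r.
clearbody rho.
have rho1 : nm rho <= 1 by apply: dual_nm_le => // h; rewrite rhoE.
have rhoe : rho e = 1 :> C.
  have := state_sub_real H He Hp pe g1 ge; rewrite !evE -/kap => h.
  by rewrite rhoE (P2_sub_e H Hp pe) h -rmorphM mulVf.
have rs : complex.Re (rho s : C) = la^-1 * complex.Re (rho (ev b) : C).
  by rewrite (state_unit_re z rho1 rhoe) /z dualZ ReMr.
have h1 : 1 - la^-1 * complex.Re (rho (ev b) : C) <= (4 * la)^-1.
  have := ps2 _ (st psi psi1 epsi); rewrite !evE rhoK -/kap mulrC ler_pM2r //.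
  by rewrite dualB ReB rhoe rs.
have h2 : complex.Re (rho (ev b) : C) + complex.Re (rho (ev x) : C) <= la + al.
  rewrite -ReD -dualD; apply: le_trans (Re_le_nm _) _; apply: le_trans (dual_le1 _ rho1) _.
  have -> : ev b + ev x = ev (b + x) by apply: dualP => f; rewrite dualDE /= linearD.
  by apply: le_trans b2; exact: nm_ev.
rewrite rhoK (state_P2 H He rho1 rhoe) ler_pM2l //.
have : la - 4^-1 <= complex.Re (rho (ev b) : C); last by move: h2; lra.
have := ler_wpM2l (ltW la0) h1; rewrite mulrBr mulr1 mulrA mulfV ?gt_eqF // mul1r.
by rewrite invfM mulrCA mulfV ?gt_eqF // mulr1; lra.
Qed.

End OneTripotent.

Let dual_face (w : W) := [/\ tau2 w = w, nm w <= 1 & forall f, F f -> w f = 1 :> C].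

Lemma real_part_dual (w : W) f : tau1 f = f -> real_part tau2 w f = (complex.Re (w f : C))%:C :> C.
Proof.
move=> tf; rewrite /real_part dualcZ dualcD tau2E tf; case: (w f : C) => c d.
by apply/eqP; rewrite eq_complex /=; apply/andP; split; apply/eqP; field.
Qed.

Lemma dual_face_limit (w : nat -> W) : (forall n, nm (w n) <= 1) ->
  (forall n f, F f -> 1 - n.+1%:R^-1 <= complex.Re (w n f : C)) ->
  exists U : set_system nat, exists l : W, [/\ UltraFilter U, \oo `<=` U, wtends U w l & dual_face (real_part tau2 l)].
Proof.
move=> w1 wF; have [U [uU lU]] := ultraFilterLemma eventually_filter.
have pU := @ultra_proper _ _ uU.
have [l l1 wl] := ultra_wtends uU ler01 w1.
exists U, l; split=> //; split; first exact: real_part_real.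
  exact: le_trans (real_part_nm _ _) l1.
move=> f Ff; rewrite real_part_dual ?FR //; congr _%:C.
apply/eqP; rewrite eq_le; apply/andP; split.
  by apply: le_trans (Re_le_nm _) _; apply: le_trans (dual_le1 _ l1) _; rewrite (F1 Ff).
apply: (@le_eps _ _ _ 1) => e e0; rewrite mulr1 -lerBlDr.
apply: (tends_Re_ge pU _ (wl f)); have [N N0 hN] := archi_lt e^-1.
have UN : U [set i | (N <= i)%N] by apply: lU; exists N.
apply: filterS UN => n /= Nn; apply: le_trans (wF n f Ff).
rewrite lerD2l lerN2 invf_ple ?posrE //; apply: le_trans (ltW hN) _.
by rewrite ler_nat ltnW.
Qed.

Theorem bidual_exposed psi : tau1 psi = psi -> nm psi <= 1 -> ~ F psi ->
  exists w : W, [/\ tau2 w = w, nm w <= 1, forall f, F f -> w f = 1 :> C & w psi <> 1 :> C].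
Proof.
move=> tpsi psi1 nF; apply: contrapT => no.
have all1 w : dual_face w -> w psi = 1 :> C.
  by move=> [w1 w2 w3]; apply: contrapT => w4; apply: no; exists w.
have inv0 n : 0 < n.+1%:R^-1 :> R by rewrite invr_gt0.
have [x0 hx0] := separation hF nF; pose x := real_part tau x0.
have tx : tau x = x by exact: real_part_real.
pose al := complex.Re (psi x : C) - 1.
have Fal f : F f -> complex.Re (f x : C) <= al.
  by move=> Ff; rewrite /al /x (real_fun_eval _ tpsi) (real_fun_eval _ (FR Ff)) /= lerBrDr hx0.
have psiE (w : W) := real_part_dual w tpsi; clear tpsi.
have [w0 Fw0] : exists w, dual_face w.
  have [w hw] : exists w : nat -> W, forall n, nm (w n) <= 1 /\
      forall f, F f -> 1 - n.+1%:R^-1 <= complex.Re (w n f : C).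
    suff h0 n : exists w : W, nm w <= 1 /\ forall f, F f -> 1 - n.+1%:R^-1 <= complex.Re (w f : C).
      by have [w hw] := choice h0; exists w.
    have [la [b [la1 b1 _ Fb]]] := penalty_element hF FR F1 face tx Fal (inv0 n).
    have la0 : 0 < la by lra.
    have li : 0 <= la^-1 by rewrite invr_ge0 ltW.
    exists (la^-1%:C *: ev b); split.
      rewrite nmZp // ler_pdivrMl // mulr1; apply: le_trans b1; exact: nm_ev.
    move=> f Ff; rewrite dualcZ ReMr evE; have := ler_wpM2l li (Fb f Ff).
    rewrite mulrBr mulVf ?gt_eqF //; apply: le_trans; rewrite lerD2l lerN2.
    by rewrite ler_piMl ?(ltW (inv0 n)) // invf_le1.
  have [U [l [_ _ _ hl]]] := dual_face_limit (fun n => (hw n).1) (fun n => (hw n).2).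
  by exists (real_part tau2 l).
have [_ w01 w0F] := Fw0.
have [e [we He hew _]] := support_exists H wc1 wc2 w01.
have Fe f : F f -> e f = 1 :> C.
  by move=> Ff; have f1 : nm f <= 1 by [rewrite (F1 Ff)]; exact: (support_face H w01 we He hew f1).1 (w0F f Ff).
have epsi : e psi = 1 :> C by exact: (support_face H w01 we He hew psi1).1 (all1 _ Fw0).
have [p hp] : exists p : nat -> W, forall n, [/\ tripotent tp (p n), tripotent_le tp (p n) e,
  forall f, F f -> 1 - n.+1%:R^-1 <= complex.Re (p n f : C) &
  0 < complex.Re (p n psi : C) ->
  complex.Re (P2 tp (p n) (P2 tp e (ev x)) psi : C) <= complex.Re (p n psi : C) * (al + 4^-1)].
  suff h0 n : exists p : W, [/\ tripotent tp p, tripotent_le tp p e,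
  forall f, F f -> 1 - n.+1%:R^-1 <= complex.Re (p f : C) &
  0 < complex.Re (p psi : C) ->
  complex.Re (P2 tp p (P2 tp e (ev x)) psi : C) <= complex.Re (p psi : C) * (al + 4^-1)].
    by have [p hp] := choice h0; exists p.
  exact: approx_projection He psi x al Fe psi1 epsi tx Fal _ (inv0 n).
have p1 n : nm (p n) <= 1 by have [Hp _ _ _] := hp n; exact: (trip_le1 H Hp).
have [U [l [uU lU wl hl]]] : exists U : set_system nat, exists l : W,
    [/\ UltraFilter U, \oo `<=` U, wtends U p l & dual_face (real_part tau2 l)].
  by apply: dual_face_limit => // n; case: (hp n).
have lpsi : complex.Re (l psi : C) = 1.
  by have := all1 _ hl; rewrite psiE => /complexI.
have [B B1 hB] := triple_bound H; have B0 : 0 <= B by lra.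
pose h := P2 tp e (ev x); pose K := (18 * B + 8 * B ^+ 3) * nm h ^+ 2.
have K0 : 0 <= K by rewrite mulr_ge0 ?exprn_ge0 ?nm_ge0 // addr_ge0 // mulr_ge0 // exprn_ge0.
(* With [M (1 - kap) < 1] both [K (1 - kap)] and [|al| (1 - kap)] are below [1/4]. Compression then
   changes the value [al + 1] of [psi] by less than [1/2], although it has to fall to
   [kap (al + 1/4)]. *)
pose M := 4 * K + 4 * `|al| + 2; have al0 := normr_ge0 al.
have M0 : 0 < M by rewrite /M; lra.
have Mi : 0 < M^-1 by rewrite invr_gt0.
have [n hn] := @filter_ex _ _ (@ultra_proper _ _ uU) _ (wl psi _ Mi).
rewrite /= in hn.
set kap := complex.Re (p n psi : C).
have kap1 : kap <= 1 by apply: le_trans (Re_le_nm _) _; apply: le_trans (dual_le1 _ (p1 n)) psi1.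
have kapM : 1 - kap < M^-1.
  by apply: le_lt_trans hn; rewrite nm_distC -lpsi -ReB; exact: Re_le_nm.
have Mb : M * (1 - kap) < 1 by rewrite -ltr_pdivlMl // mulr1.
have k0 : 0 <= 1 - kap by rewrite subr_ge0.
have Kk : 0 <= K * (1 - kap) by exact: mulr_ge0.
have ak : 0 <= `|al| * (1 - kap) by exact: mulr_ge0.
have kap0 : 0 < kap by move: Mb; rewrite /M; lra.
have [Hp pe _ hpx] := hp n; have {}hpx := hpx kap0; rewrite -/kap -/h in hpx.
have g1 : nm (canonical_embedding psi) <= 1 by apply: le_trans (nm_ev psi) psi1.
have eh : tp e e h = h by apply/(pc1P _ _ _); exact: (pc_P2 H He).
have := state_P2_close H He Hp pe g1 epsi hB B0 eh; rewrite !evE -/kap -/K.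
have hpsi : h psi = psi x :> C by exact: (state_P2 H He g1 epsi (ev x)).
rewrite hpsi => close.
have : 4^-1 <= nm (psi x - P2 tp (p n) h psi : C) ^+ 2; last by move: Mb; rewrite /M; lra.
have ge2 : 2^-1 <= nm (psi x - P2 tp (p n) h psi : C).
  apply: le_trans (Re_le_nm _); rewrite ReB -[complex.Re (psi x : C)](subrK 1) -/al.
  have : - al * (1 - kap) <= `|al| * (1 - kap).
    by apply: ler_wpM2r => //; rewrite -normrN; exact: ler_norm.
  have : M * (1 - kap) < 1 by []; rewrite /M; lra.
have i2 : 0 <= 2^-1 :> R by rewrite invr_ge0.
by have := sqr_le i2 ge2; lra.
Qed.

End BidualExposed.

(** * Faces cut out by elements of the unit ball *)

Section ConvexFaces.
Context {R : realType}.
Local Notation C := (R[i]).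

Lemma convex_setP (V : lmodType C) (A : set V) : convex_set A <->
  forall x y (t : R), A x -> A y -> 0 <= t <= 1 -> A (t%:C *: x + (1 - t)%:C *: y).
Proof.
split=> [cA x y t Ax Ay /andP[t0 t1]|cA x y la]; last first.
  rewrite !inE => Ax Ay; have E : (complex.Re (la%:num : C))%:C = la%:num by apply: ReK.
  have gen (r : R) (z : C) : r%:C = z -> (1 - r)%:C = 1 - z by move=> <-; rewrite rmorphB rmorph1.
  have E2 := gen _ _ E.
  have := cA x y (complex.Re (la%:num : C)) Ax Ay; rewrite E2 E; apply.
  have l1 : la%:num <= 1 :> C by [].
  by apply/andP; split; [exact: Re_ge0|exact: (@le_Re _ _ 1)].
have t0' : 0 <= t%:C :> C by rewrite lecR.
have t1' : t%:C <= 1 :> C by rewrite lecR.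
have := cA x y (Itv01 t0' t1'); rewrite !inE => /(_ Ax Ay).
by rewrite rmorphB rmorph1.
Qed.

Variable X : completeNormedModType C.
Local Notation Y := (dual X).
Variable tau : conjugation X.
Local Notation tau1 := (sharp tau).
Local Notation B := (real_dual_ball tau).

Lemma real_dual_ballP f : B f <-> tau1 f = f /\ nm f <= 1.
Proof.
have E : (`|f| <= 1) = (nm f <= 1) by rewrite nmE lecR.
by rewrite /real_dual_ball /real_form /= E.
Qed.

Lemma real_comb (f g : Y) (t : R) : tau1 f = f -> tau1 g = g ->
  tau1 (t%:C *: f + (1 - t)%:C *: g) = t%:C *: f + (1 - t)%:C *: g.
Proof. by move=> tf tg; rewrite tauD !tauZR tf tg. Qed.

Lemma ball_conv (f g : Y) (t : R) : 0 <= t <= 1 -> B f -> B g -> B (t%:C *: f + (1 - t)%:C *: g).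
Proof.
move=> /andP[t0 t1] /real_dual_ballP[tf f1] /real_dual_ballP[tg g1]; apply/real_dual_ballP.
split; first exact: real_comb.
apply: le_trans (nmD _ _) _; rewrite !nmZp ?subr_ge0 //.
have : t * nm f <= t * 1 by apply: ler_wpM2l.
have : (1 - t) * nm g <= (1 - t) * 1 by apply: ler_wpM2l => //; rewrite subr_ge0.
lra.
Qed.

Lemma average_one (z w : C) (t : R) : nm z <= 1 -> nm w <= 1 -> 0 < t -> t < 1 ->
  t%:C * z + (1 - t)%:C * w = 1 -> z = 1 /\ w = 1.
Proof.
move=> z1 w1 t0 t1 /(congr1 (@complex.Re R)); rewrite ReD !ReMr /= => h.
have hz := le_trans (Re_le_nm z) z1; have hw := le_trans (Re_le_nm w) w1.
have t1' : 0 < 1 - t by rewrite subr_gt0.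
have b1 : t * complex.Re z <= t by rewrite ler_piMr // ltW.
have b2 : (1 - t) * complex.Re w <= 1 - t by rewrite ler_piMr // ltW.
split; apply: nm1_Re1 => //.
  by rewrite -(ler_pM2l t0) mulr1; lra.
by rewrite -(ler_pM2l t1') mulr1; lra.
Qed.

Section Exposed.
Variable A : X -> Prop.
Hypothesis A1 : forall a, A a -> nm a <= 1.
Let F : set Y := [set f | B f /\ forall a, A a -> f a = 1 :> C].

Lemma exposed_face : is_face B F.
Proof.
split.
- by move=> f [].
- apply/convex_setP => f g t [Bf Af] [Bg Ag] t01; split; first exact: ball_conv.
  by move=> a Aa; rewrite dualcD !dualcZ Af // Ag // !mulr1 -rmorphD addrC subrK.
- move=> f g t Bf Bg t0 t1 [_ h].
  have [[_ f1] [_ g1]] := ((real_dual_ballP f).1 Bf, (real_dual_ballP g).1 Bg).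
  have key a : A a -> f a = 1 :> C /\ g a = 1 :> C.
    move=> Aa; apply: (@average_one _ _ t) => //.
    + by apply: le_trans (dual_le1 _ f1) (A1 Aa).
    + by apply: le_trans (dual_le1 _ g1) (A1 Aa).
    + by have := h a Aa; rewrite dualcD !dualcZ.
  by split; split=> // a /key[].
Qed.

Lemma exposed_closed : closed (F : set (weakstar X)).
Proof.
apply: wclosedP => U l uU UF wl; have pU := @ultra_proper _ _ uU.
split.
  apply/real_dual_ballP; split.
    apply: (wtends_uniq pU (wtends_tau2 tau pU wl)); apply: (wtends_ext pU _ wl).
    by apply: filterS UF => f [/real_dual_ballP[tf _] _]; exact/esym.
  apply: (wtends_nm_le uU ler01 _ wl).
  by apply: filterS UF => f [/real_dual_ballP[_ f1] _].
move=> a Aa; apply: (tends_uniq pU (wl a)); apply: (tends_ext pU _ (tends_cst pU 1)).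
by apply: filterS UF => f [_ h] /=; rewrite h.
Qed.

End Exposed.

Lemma ball_closed_face : is_face B B /\ closed (B : set (weakstar X)).
Proof.
have E : B = [set f | B f /\ forall a, False -> f a = 1 :> C].
  by apply/seteqP; split=> f; [move=> Bf; split|case].
have n1 (a : X) : False -> nm a <= 1 by [].
by split; [rewrite {2}E; exact: (exposed_face n1)|rewrite E; exact: (@exposed_closed (fun=> False))].
Qed.

Section ProperFace.
Variable F : set Y.
Hypothesis PF : weakstar_closed_proper_faces tau F.

Lemma proper_face_real f : F f -> tau1 f = f.
Proof. by case: PF => -[[FB _ _] _ _] _ /FB/real_dual_ballP[]. Qed.

(** A functional [f] of norm below 1 is a proper convex combination of any [g] in the ball and
    another point of the ball, with weight [(1 - |f|) / 2] on [g]; the face would contain every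
    [g]. *)
Lemma proper_face_nm f : F f -> nm f = 1.
Proof.
case: PF => -[[FB cF fF] _ nB] _ Ff; have [tf f1] := (real_dual_ballP f).1 (FB _ Ff).
apply/eqP; rewrite eq_le f1 /= leNgt; apply/negP => lt; apply: nB; apply/seteqP; split=> // g Bg.
have [tg g1] := (real_dual_ballP g).1 Bg.
pose t := (1 - nm f) / 2; have t0 : 0 < t by rewrite divr_gt0 // subr_gt0.
have t1 : t < 1 by rewrite /t; have := nm_ge0 f; lra.
have u0 : 0 < 1 - t by rewrite subr_gt0.
pose h := (1 - t)^-1%:C *: (f - t%:C *: g).
have Bh : B h.
  apply/real_dual_ballP; split.
    by rewrite tauZR conjugationB tauZR tf tg.
  rewrite nmZp ?invr_ge0 ?(ltW u0) // ler_pdivrMl // mulr1.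
  apply: le_trans (nmB _ _) _; rewrite nmZp ?(ltW t0) //.
  have : t * nm g <= t * 1 by apply: ler_wpM2l => //; exact: ltW.
  by rewrite /t; lra.
have fE : t%:C *: g + (1 - t)%:C *: h = f.
  rewrite /h scalerA -(rmorphM (real_complex R)) mulfV ?gt_eqF // rmorph1 scale1r.
  by rewrite addrC subrK.
by have [] := fF g h t Bg Bh t0 t1; rewrite ?fE.
Qed.

Lemma proper_face_compact : wcompact_convex F.
Proof.
case: PF => -[[FB /convex_setP cF fF] F0 nB] clF; split=> //.
  by exists 1 => // f Ff; rewrite proper_face_nm.
by move=> I U w l uU UF wl; exact: (wclosed_lim (@ultra_proper _ _ uU) clF UF wl).
Qed.

Lemma proper_faceP f g (t : R) : tau1 f = f -> nm f <= 1 -> tau1 g = g -> nm g <= 1 -> 0 < t -> t < 1 ->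
  F (t%:C *: f + (1 - t)%:C *: g) -> F f /\ F g.
Proof.
case: PF => -[[FB cF fF] F0 nB] clF tf f1 tg g1; apply: fF; exact/real_dual_ballP.
Qed.

End ProperFace.
End ConvexFaces.

(** * Nets of support tripotents and their infima *)

Section SupportNet.
Context {R : realType}.
Local Notation C := (R[i]).
Variable Y : normedModType C.
Local Notation W := (dual Y).
Variable tp : W -> W -> W -> W.
Hypothesis H : is_jbstar_triple tp.
Hypothesis wc1 : forall b c, wcont (fun x => tp x b c).
Hypothesis wc2 : forall a c, wcont (fun x => tp a x c).
Variable tau : conjugation Y.
Local Notation tau2 := (sharp tau).
Local Notation le := (tripotent_le tp).
Local Notation rtrip := [set u : W | tau2 u = u /\ tripotent tp u].

(** The weak* limit has exactly the common states of the net, and a real tripotent is compared with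
    it through real states alone. *)
Lemma net_infimum (I : Type) (r : I -> I -> Prop) (e : I -> W) : is_directed r ->
  (forall i j, r i j -> le (e j) (e i)) -> (forall i, rtrip (e i)) ->
  exists v, is_infimum le rtrip (range e) v /\
    forall phi, nm phi <= 1 -> (v phi = 1 :> C <-> forall i, e i phi = 1 :> C).
Proof.
move=> dr mono re; have te i := (re i).2.
have [v [tv ve [U pU wv]]] := net_limit H wc1 wc2 dr te mono.
have rv : tau2 v = v by apply: (wtends_real pU _ wv) => i; case: (re i).
have vP phi : nm phi <= 1 -> (v phi = 1 :> C <-> forall i, e i phi = 1 :> C).
  move=> p1; split=> [vp i|ep]; first by have [] := le_nstate H tv (ve i) (conj p1 vp).
  apply: (tends_uniq pU (wv phi)); apply: (tends_ext pU _ (tends_cst pU 1)).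
  by apply: filterE => i /=; rewrite ep.
exists v; split=> //; split=> [//|_ [i _ <-] //|v' [rv' tv'] v'e].
apply: (rstate_le (tau := tau) H wc1) => // phi [[p1 v'p] _]; apply/(vP phi p1) => i.
by have [] := le_nstate H tv' (v'e _ (ex_intro2 _ _ i Logic.I erefl)) (conj p1 v'p).
Qed.

Variable A : W -> Prop.
Hypotheses (A0 : exists w, A w) (AR : forall w, A w -> tau2 w = w) (A1 : forall w, A w -> nm w <= 1).
Hypothesis Amid : forall w w', A w -> A w' -> A (2^-1%:C *: (w + w')).

(** The index set is [A] itself, ordered by reverse inclusion of the sets where an element takes the
    value 1. It is directed by midpoints: a mean of two contractions is 1 at a state only if both
    are. *)
Lemma support_net : exists (r : {w | A w} -> {w | A w} -> Prop) (e : {w | A w} -> W),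
  [/\ is_directed r, forall i j, r i j -> le (e j) (e i),
      forall i, rtrip (e i) & forall i, wtends \oo (odd_power tp (sval i)) (e i)] /\
  forall phi, nm phi <= 1 -> ((forall i, e i phi = 1 :> C) <-> forall w, A w -> w phi = 1 :> C).
Proof.
have [e he] : exists e : {w | A w} -> W, forall i, [/\ wtends \oo (odd_power tp (sval i)) (e i),
    rtrip (e i) & forall phi, nm phi <= 1 -> sval i phi = 1 :> C <-> e i phi = 1 :> C].
  suff h0 (i : {w | A w}) : exists e, [/\ wtends \oo (odd_power tp (sval i)) e,
    rtrip e & forall phi, nm phi <= 1 -> sval i phi = 1 :> C <-> e phi = 1 :> C].
    by have [e he] := choice h0; exists e.
  case: i => w Aw /=; have [u [wu tu hu _]] := support_exists H wc1 wc2 (A1 Aw).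
  have uP phi : nm phi <= 1 -> w phi = 1 :> C <-> u phi = 1 :> C.
    by move=> p1; exact: (support_face H (A1 Aw) wu tu hu p1).
  exists u; split=> //; split=> //; exact: (support_real H wc1 tu (AR Aw) uP).
pose r (i j : {w | A w}) := forall phi, nm phi <= 1 -> sval j phi = 1 :> C -> sval i phi = 1 :> C.
exists r, e; split; last first.
  move=> phi p1; split=> [ep w Aw|wp i].
    by have [_ _ h] := he (exist _ w Aw); apply/(h phi p1).
  by have [_ _ h] := he i; apply/(h phi p1); apply: wp; exact: (proj2_sig i).
split; try by move=> i; case: (he i).
  split.
  - by have [w Aw] := A0; exists; exists w.
  - by move=> i phi.
  - by move=> i j k ij jk phi p1 h; apply: ij => //; exact: jk.
  - move=> i j; pose k : {w | A w} := exist _ _ (Amid (proj2_sig i) (proj2_sig j)).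
    have key phi : nm phi <= 1 -> sval k phi = 1 :> C -> sval i phi = 1 :> C /\ sval j phi = 1 :> C.
      move=> p1 kp; apply: (@average_one _ _ _ 2^-1).
      + by apply: le_trans (dual_le1 _ (A1 (proj2_sig i))) p1.
      + by apply: le_trans (dual_le1 _ (A1 (proj2_sig j))) p1.
      + by rewrite invr_gt0.
      + by rewrite invf_lt1 // ltr1n.
      have E : sval k phi = 2^-1%:C * (sval i phi + sval j phi) :> C.
        by rewrite -[sval k]/(2^-1%:C *: (sval i + sval j)) dualcZ dualcD.
      rewrite -[RHS]kp E mulrDr; congr (_ + _ * _); congr (_%:C); lra.
    by exists k => phi p1 kp; case: (key phi p1 kp).
move=> i j ij; have [_ [_ ti] hi] := he i; have [_ [_ tj] hj] := he j.
apply: (nstate_le H wc1) => // phi [p1 ejp]; apply/(hi phi p1); apply: ij => //; exact/(hj phi p1).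
Qed.

End SupportNet.

(** * Compact tripotents and weak*-closed faces *)

Section Assembly.
Context {R : realType}.
Local Notation C := (R[i]).
Variable X : completeNormedModType C.
Variables (tp : X -> X -> X -> X) (tau : conjugation X).
Variable tp2 : bidual X -> bidual X -> bidual X -> bidual X.
Hypothesis Htp2 : is_bidual_product tp tp2.
Local Notation Y := (dual X).
Local Notation W := (dual Y).
Local Notation ev := (@canonical_embedding R X).
Local Notation tau1 := (sharp tau).
Local Notation tau2 := (sharp tau1).
Local Notation le := (tripotent_le tp2).
Local Notation rtrip := (real_tripotents tau tp2).
Local Notation B := (real_dual_ball tau).

Let H : is_jbstar_triple tp2 := bidual_triple Htp2.

Lemma wcont_continuous (S : W -> W) :
  continuous (S : weakstar Y -> weakstar Y) -> wcont S.
Proof.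
move=> cS I F w l pF /wtendsP h; apply/wtendsP.
exact: (cvg_comp _ _ h (cS l)).
Qed.

Let wc1 b c : wcont (fun x => tp2 x b c).
Proof. apply: wcont_continuous; exact: (bidual_wcont1 Htp2). Qed.

Let wc2 a c : wcont (fun x => tp2 a x c).
Proof. apply: wcont_continuous; exact: (bidual_wcont2 Htp2). Qed.

Lemma odd_power_ev a n : odd_power tp2 (ev a) n = ev (odd_power tp a n).
Proof.
elim: n => [//|n IH]; rewrite /odd_power !iterS -!/(odd_power _ _ n) IH.
exact: (bidual_extends Htp2).
Qed.

Lemma supportP a u : is_support_tripotent tp a u <-> wtends \oo (odd_power tp2 (ev a)) u.
Proof.
have -> : odd_power tp2 (ev a) = (fun n => ev (odd_power tp a n)).
  by apply/funext => n; exact: odd_power_ev.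
by split=> h; apply/wtendsP.
Qed.

Lemma nm1E (V : normedModType C) (x : V) : (`|x| = 1) <-> nm x = 1.
Proof. by rewrite nmE; split=> [/complexI//|->]. Qed.

Lemma Gdelta_exposed u : compact_Gdelta tau tp tp2 u -> rtrip u /\
  exists a, [/\ tau a = a, nm a <= 1 & forall f : Y, nm f <= 1 -> (f a = 1 :> C <-> u f = 1 :> C)].
Proof.
move=> [[ru tu] [a [ta /nm1E a1 /supportP ua]]]; split=> //; exists a; split=> //; first by rewrite a1.
have a1' : nm (ev a) <= 1 by rewrite -a1; exact: nm_ev.
have [u' [ua' tu' hu' _]] := support_exists H wc1 wc2 a1'.
have uu : u = u' by exact: (wtends_uniq _ ua ua').
by move=> f f1; rewrite uu -(support_face H a1' ua' tu' hu' f1).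
Qed.

Lemma rtrip0 : rtrip 0.
Proof. by split; [apply: dualP => f; rewrite tau2E dualc0 rmorph0|exact: (tp0l H)]. Qed.

Lemma prime_face0 : prime_face tau (0 : W) = set0.
Proof.
apply/seteqP; split=> // f [_]; rewrite dualc0 => /esym/eqP; by rewrite oner_eq0.
Qed.

(** By uniqueness of infima, [u] is the limit of the net in its definition, so its face is cut out
    by elements of [X] and is therefore weak*-closed. *)
Lemma compact_exposed u : compact_tripotent tau tp tp2 u -> rtrip u /\
  (u = 0 \/ exists2 A : X -> Prop, forall a, A a -> nm a <= 1 &
    prime_face tau u = [set f | B f /\ forall a, A a -> f a = 1 :> C]).
Proof.
move=> [->|[I [r [e [dr mono ge inf]]]]]; first by split; [exact: rtrip0|left].
have re i := (Gdelta_exposed (ge i)).1.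
have [v [infv vP]] := net_infimum (tau := tau1) H wc1 wc2 dr mono re.
have [Pu ul umax] := inf; have [Pv vl vmax] := infv.
have uv : u = v by apply: (tle_anti H Pu.2 Pv.2); [exact: vmax|exact: umax].
split=> //; right.
have [a ha] : exists a : I -> X, forall i, nm (a i) <= 1 /\
    forall f : Y, nm f <= 1 -> (f (a i) = 1 :> C <-> e i f = 1 :> C).
  suff h0 i : exists a : X, nm a <= 1 /\ forall f : Y, nm f <= 1 -> (f a = 1 :> C <-> e i f = 1 :> C).
    by have [a ha] := choice h0; exists a.
  by have [_ [a [_ a1 aP]]] := Gdelta_exposed (ge i); exists a.
exists (fun x => exists i, x = a i) => [_ [i ->]|]; first by case: (ha i).
apply/seteqP; split=> f [Bf hf]; split=> //; have [_ f1] := (real_dual_ballP tau f).1 Bf.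
  move=> _ [i ->]; apply/((ha i).2 f f1); apply: ((vP f f1).1 _ i); by rewrite -uv.
by rewrite uv; apply/(vP f f1) => i; apply/((ha i).2 f f1); apply: hf; exists i.
Qed.

Lemma compact_face u : compact_tripotent tau tp tp2 u -> weakstar_closed_faces tau (prime_face tau u).
Proof.
move=> /compact_exposed[_ [->|[A A1 ->]]]; last first.
  by split; [exact: exposed_face|exact: exposed_closed].
rewrite prime_face0; split; last exact: closed0.
split=> //; by move=> f g la; rewrite inE.
Qed.

Lemma compact_le u e : compact_tripotent tau tp tp2 u -> compact_tripotent tau tp tp2 e ->
  le u e <-> prime_face tau u `<=` prime_face tau e.
Proof.
move=> /compact_exposed[[ru tu] _] /compact_exposed[[re te] _]; split=> [ue f [Bf uf]|h].
  have [_ f1] := (real_dual_ballP tau f).1 Bf; split=> //.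
  by have [] := le_nstate H tu ue (conj f1 uf).
apply: (rstate_le (tau := tau1) H wc1) => // f [[f1 uf] tf].
by have [|_ ->] := h f; first by split=> //; apply/real_dual_ballP.
Qed.

Lemma compact_inj u e : compact_tripotent tau tp tp2 u -> compact_tripotent tau tp tp2 e ->
  prime_face tau u = prime_face tau e -> u = e.
Proof.
move=> cu ce E; have [[_ tu] _] := compact_exposed cu; have [[_ te] _] := compact_exposed ce.
by apply: (tle_anti H tu te); [apply/(compact_le cu ce); rewrite E|apply/(compact_le ce cu); rewrite E].
Qed.

Lemma prime_face_rstate u : prime_face tau u = rstate tau1 u.
Proof.
apply/seteqP; split=> f; first by move=> [/real_dual_ballP[tf f1] uf].
by move=> [[f1 uf] tf]; split=> //; apply/real_dual_ballP.
Qed.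

Lemma ball_proper F : weakstar_closed_proper_faces tau F -> exists2 f, B f & ~ F f.
Proof.
move=> [[[FB _ _] _ nB] _]; apply: contrapT => no; apply: nB; apply/seteqP; split=> // f Bf.
by apply: contrapT => nf; apply: no; exists f.
Qed.

Lemma proper_face_prime F : weakstar_closed_proper_faces tau F ->
  exists u, compact_tripotent tau tp tp2 u /\ F = prime_face tau u.
Proof.
move=> PF; have FR := proper_face_real PF; have F1 := proper_face_nm PF.
have hF := proper_face_compact PF; have face := proper_faceP PF.
have [[[FB _ _] _ _] _] := PF.
have [psi0 /real_dual_ballP[tpsi0 psi01] nF0] := ball_proper PF.
have exW := bidual_exposed H wc1 wc2 hF FR F1 face.
pose AW (w : W) := [/\ tau2 w = w, nm w <= 1 & forall f, F f -> w f = 1 :> C].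
have half0 : (0 : R) <= 2^-1 by rewrite invr_ge0.
have half2 : 2^-1%:C * (1 + 1) = 1 :> C.
  by rewrite -(rmorph1 (real_complex R)) -rmorphD -rmorphM; congr (_%:C); lra.
have midW w w' : AW w -> AW w' -> AW (2^-1%:C *: (w + w')).
  move=> [tw w1 wF] [tw' w1' wF']; split.
  - by rewrite tauZR sharpD tw tw'.
  - by rewrite nmZp //; have := nmD w w'; lra.
  - by move=> f Ff; rewrite dualcZ dualcD wF // wF'.
have neW : exists w, AW w by have [w [w1 w2 w3 _]] := exW psi0 tpsi0 psi01 nF0; exists w.
have [r [e [[dr mono re we] eP]]] :=
  support_net H wc1 wc2 neW (fun w (h : AW w) => let: And3 h1 _ _ := h in h1)
    (fun w (h : AW w) => let: And3 _ h2 _ := h in h2) midW.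
have [v [[[rv tv] _ _] vP]] := net_infimum (tau := tau1) H wc1 wc2 dr mono re.
have Fv : F = rstate tau1 v.
  apply/seteqP; split=> f.
    move=> Ff; have f1 : nm f <= 1 by rewrite F1.
    split; last exact: FR; split=> //; apply/(vP f f1); apply/(eP f f1) => w [_ _]; exact.
  move=> [[f1 vf] tf]; apply: contrapT => nf; have [w [w1 w2 w3]] := exW f tf f1 nf; apply.
  by have := (eP f f1).1 ((vP f f1).1 vf) w (And3 w1 w2 w3).
have exX := exact_element H wc1 tv rv; rewrite -Fv in exX; have {}exX := exX hF.
pose AX (w : W) := exists a : X, [/\ w = ev a, tau a = a, nm a <= 1 & forall f, F f -> f a = 1 :> C].
have midX w w' : AX w -> AX w' -> AX (2^-1%:C *: (w + w')).
  move=> [a [-> ta a1 aF]] [a' [-> ta' a1' aF']]; exists (2^-1%:C *: (a + a')); split.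
  - by apply: dualP => f; rewrite dualcZ dualcD /= linearZ_LR linearD.
  - by rewrite tauZR tauD ta ta'.
  - by rewrite nmZp //; have := nmD a a'; lra.
  - by move=> f Ff; rewrite dualZ dualD aF // aF'.
have neX : exists w, AX w.
  by have [a [a1 a2 a3 _]] := exX psi0 tpsi0 psi01 nF0; exists (ev a), a.
have AXR w : AX w -> tau2 w = w by move=> [a [-> ta _ _]]; exact: ev_real.
have AX1 w : AX w -> nm w <= 1 by move=> [a [-> _ a1 _]]; exact: le_trans (nm_ev a) a1.
have [r' [e' [[dr' mono' re' we'] eP']]] := support_net H wc1 wc2 neX AXR AX1 midX.
have [u [infu uP]] := net_infimum (tau := tau1) H wc1 wc2 dr' mono' re'.
exists u; split; last first.
  rewrite prime_face_rstate; apply/seteqP; split=> f.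
    move=> Ff; have f1 : nm f <= 1 by rewrite F1.
    split; last exact: FR; split=> //; apply/(uP f f1); apply/(eP' f f1) => w [a [-> _ _ aF]].
    exact: aF.
  move=> [[f1 uf] tf]; apply: contrapT => nf; have [a [a1 a2 a3]] := exX f tf f1 nf; apply.
  by apply: ((eP' f f1).1 ((uP f f1).1 uf) (ev a)); exists a.
right; exists {w | AX w}, r', e'; split=> // i; split; first exact: re'.
have [a [wE ta a1 aF]] := proj2_sig i; exists a; split=> //.
  (* The norm is exactly 1 because [F] contains a functional of norm 1 with value 1 at [a]. *)
  apply/nm1E/eqP; rewrite eq_le a1 /=; have [_ [f Ff] _] := PF.1.
  have := dual_le f a; rewrite aF // F1 // mul1r; by rewrite nm1.
by apply/supportP; rewrite -wE; exact: we'.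
Qed.

Lemma closed_face_cases F : weakstar_closed_faces tau F ->
  F = set0 \/ F = B \/ weakstar_closed_proper_faces tau F.
Proof.
move=> [fF clF]; have [|F0] := pselect (F = set0); first by left.
right; have [|nB] := pselect (F = B); [by left|right].
by split=> //; split=> //; apply/set0P/eqP.
Qed.

Lemma not_ball_prime (u : W) : ~ B `<=` prime_face tau u.
Proof.
have B0 : B 0.
  by apply/real_dual_ballP; split; [exact: tau0|rewrite nm0].
by move=> /(_ 0 B0)[_]; rewrite linear0 => /esym/eqP; rewrite oner_eq0.
Qed.

Lemma prime_face_isomorphism : order_isomorphism
    (compact_tripotents_top tau tp tp2) (weakstar_closed_faces tau)
    (tripotent_top_le tp2) (fun F G : set (dual X) => F `<=` G)
    (prime_face_top tau).
Proof.
split; last first.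
  move=> [u|] [e|] cu ce //=; first exact: compact_le.
  - by split=> // _ f [].
  - by split=> // /not_ball_prime.
  - by split=> // _ f.
split.
- move=> [u|] cu; first exact: compact_face.
  by have [] := ball_closed_face tau.
- move=> [u|] [e|]; rewrite !inE => cu ce //= E.
  + by rewrite (compact_inj cu ce E).
  + by case: (@not_ball_prime u); rewrite E.
  + by case: (@not_ball_prime e); rewrite -E.
- move=> F /closed_face_cases[->|[->|/proper_face_prime[u [cu ->]]]].
  + by exists (Some 0); [left|exact: prime_face0].
  + by exists None.
  + by exists (Some u).
Qed.

End Assembly.

Unset Implicit Arguments.

Theorem theorem3p7 (R : realType) (X : completeNormedModType R[i])
    (tp : X -> X -> X -> X) (Htp : is_jbstar_triple tp)
    (tau : conjugation X)
    (tp2 : bidual X -> bidual X -> bidual X -> bidual X)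
    (Htp2 : is_bidual_product tp tp2) :
  (forall F : set (dual X), weakstar_closed_proper_faces tau F ->
     exists! u : bidual X,
       compact_tripotent tau tp tp2 u /\ F = prime_face tau u) /\
  order_isomorphism
    (compact_tripotents_top tau tp tp2) (weakstar_closed_faces tau)
    (tripotent_top_le tp2) (fun F G : set (dual X) => F `<=` G)
    (prime_face_top tau).
Proof.
split; last exact: prime_face_isomorphism Htp2.
move=> F /(proper_face_prime Htp2)[u [cu FE]]; exists u; split=> // e [ce Fe].
by apply: (compact_inj Htp2 cu ce); rewrite -FE.
Qed.
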